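(* For every oriented connected closed $4$-dimensional manifold $N^4$ there exist an oriented closed $4$-dimensional hyperbolic manifold $M^4$ and a continuous mapping $M^4\to N^4$ of non-zero degree.
   Context: A closed manifold is called hyperbolic if it admits a Riemannian metric of constant negative sectional curvature. *)

(* Defs.v *)
From HB Require Import structures.
From mathcomp Require Import all_boot all_order all_algebra.
From mathcomp Require Import all_classical all_reals all_analysis.
From mathcomp Require Import freeg.
Set Implicit Arguments.
Unset Strict Implicit.
Unset Printing Implicit Defensive.
Import Order.TTheory GRing.Theory Num.Theory.
Import numFieldNormedType.Exports.
Local Open Scope classical_set_scope.
Local Open Scope ring_scope.

Definition std_simplex (R : realType) (n : nat) : set 'rV[R]_n.+1 :=
  [set x | (forall i, 0 <= x 0 i) /\ \sum_i x 0 i = 1].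
Arguments std_simplex : clear implicits.

Definition face_map (R : realType) (n : nat) (i : 'I_n.+2) (x : 'rV[R]_n.+1)
    : 'rV[R]_n.+2 :=
  \row_j (if unlift i j is Some k then x 0 k else 0).

Lemma face_map_simplex (R : realType) (n : nat) (i : 'I_n.+2)
    (x : std_simplex R n) :
  face_map i (set_val x) \in std_simplex R n.+1.
Proof.
apply/mem_set; have [x0 x1] := set_valP x; split.
  by move=> j; rewrite mxE; case: unliftP.
rewrite (bigD1_ord i) //= mxE unlift_none add0r -[RHS]x1.
by apply: eq_bigr => j _; rewrite mxE liftK.
Qed.

Definition face (R : realType) (n : nat) (i : 'I_n.+2) (x : std_simplex R n)
    : std_simplex R n.+1 :=
  SigSub (face_map_simplex i x).

Lemma continuous_face_map (R : realType) (n : nat) (i : 'I_n.+2) :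
  continuous (@face_map R n i).
Proof.
move=> x; have Fx : Filter (nbhs x) by exact: nbhs_filter.
apply/(@cvg_ballP R 'rV[R]_n.+2 _ _ Fx) => e e0; near=> y; split=> // a b.
have [_ xy] : ball x e y by near: y; exact: nbhsx_ballx.
by rewrite !mxE; case: unliftP => [k|] _; [exact: xy|exact: ballxx].
Unshelve. all: by end_near. Qed.

Lemma continuous_face (R : realType) (n : nat) (i : 'I_n.+2) :
  continuous (@face R n i).
Proof.
apply: continuous_comp_initial => x.
apply: (@continuous_comp _ _ _ (set_val : std_simplex R n -> _) (face_map i)).
  exact: initial_continuous.
exact: continuous_face_map.
Qed.

HB.instance Definition _ (R : realType) (n : nat) (i : 'I_n.+2) :=
  @isContinuous.Build _ _ (@face R n i) (@continuous_face R n i).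

Section Homology.
Variable R : realType.

Definition simplex (n : nat) (X : topologicalType) : choiceType :=
  continuousType (std_simplex R n) X.

Definition chain (n : nat) (X : topologicalType) : zmodType :=
  {freeg (simplex n X)}.

Definition boundary (n : nat) (X : topologicalType)
    : chain n X -> chain n.-1 X :=
  match n with
  | 0 => fun _ => 0
  | m.+1 => fglift (fun s : simplex m.+1 X =>
      \sum_(i < m.+2) (<< (-1) ^+ i *g (s \o @face R m i : simplex m X) >>
        : {freeg (simplex m X)}))
  end.

Definition pushforward (n : nat) (X Y : topologicalType)
    (f : continuousType X Y) : chain n X -> chain n Y :=
  fglift (fun s : simplex n X =>
    << (f \o s : simplex n Y) >> : {freeg (simplex n Y)}).

Definition chain_in (n : nat) (X : topologicalType) (A : set X)
    (c : chain n X) : Prop :=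
  forall s : simplex n X, s \in dom c -> range s `<=` A.

(* Relative cycles modulo [A] represent the classes of H_n(X, A; Z); two of
   them represent the same class when they are [homologous A].  For [A = set0]
   this is the absolute homology, as [chain_in set0 c] means [c = 0]. *)
Definition rel_cycle (n : nat) (X : topologicalType) (A : set X)
    (c : chain n X) : Prop :=
  chain_in A (boundary c).

Definition homologous (n : nat) (X : topologicalType) (A : set X)
    (c c' : chain n X) : Prop :=
  exists b : chain n.+1 X, chain_in A (c - c' - boundary b).

Definition homology_generator (n : nat) (X : topologicalType) (A : set X)
    (c : chain n X) : Prop :=
  rel_cycle A c /\
  forall c', rel_cycle A c' -> exists k : int, homologous A c' (c *~ k).

Record chart (n : nat) (M : topologicalType) : Type := Chart {
  chart_dom : set M;
  chart_cod : set 'rV[R]_n;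
  chart_fun : M -> 'rV[R]_n;
  chart_inv : 'rV[R]_n -> M;
  chart_dom_open : open chart_dom;
  chart_cod_open : open chart_cod;
  chart_funS : forall p, chart_dom p -> chart_cod (chart_fun p);
  chart_invS : forall x, chart_cod x -> chart_dom (chart_inv x);
  chart_funK : forall p, chart_dom p -> chart_inv (chart_fun p) = p;
  chart_invK : forall x, chart_cod x -> chart_fun (chart_inv x) = x;
  chart_fun_cts : forall p, chart_dom p -> {for p, continuous chart_fun};
  chart_inv_cts : forall x, chart_cod x -> {for x, continuous chart_inv} }.

Definition manifold (n : nat) (M : topologicalType) : Prop :=
  [/\ hausdorff_space M, @second_countable M &
      forall p : M, exists c : chart n M, chart_dom c p].

Definition closed_manifold (n : nat) (M : topologicalType) : Prop :=
  manifold n M /\ compact [set: M].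

(* [orient_at p] represents a generator of H_n(M, M \ p; Z), so two orientations
   may be equal mathematically without being equal as records. *)
Record orientation (n : nat) (M : topologicalType) : Type := Orientation {
  orient_at : M -> chain n M;
  orient_generator : forall p, homology_generator [set~ p] (orient_at p);
  orient_locally_consistent : forall p : M, exists (U : set M) (c : chain n M),
    [/\ nbhs p U, rel_cycle (~` U) c &
        forall q, U q -> homologous [set~ q] c (orient_at q)] }.

Definition fundamental_cycle (n : nat) (M : topologicalType)
    (o : orientation n M) (c : chain n M) : Prop :=
  boundary c = 0 /\ forall p, homologous [set~ p] c (orient_at o p).

Definition has_degree (n : nat) (M N : topologicalType) (oM : orientation n M)
    (oN : orientation n N) (f : continuousType M N) (d : int) : Prop :=
  exists cM cN,
    [/\ fundamental_cycle oM cM, fundamental_cycle oN cN &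
        homologous set0 (pushforward f cM) (cN *~ d)].

Definition partial (n : nat) (i : 'I_n) (f : 'rV[R]_n -> R) (x : 'rV[R]_n) : R :=
  'D_(delta_mx 0 i) f x.

Fixpoint continuously_differentiable (n k : nat) (U : set 'rV[R]_n)
    (f : 'rV[R]_n -> R) : Prop :=
  (forall x, U x -> {for x, continuous f}) /\
  (if k is k'.+1 then
     forall i : 'I_n, (forall x, U x -> derivable f x (delta_mx 0 i)) /\
                      continuously_differentiable k' U (partial i f)
   else True).

Definition smooth (n : nat) (U : set 'rV[R]_n) (f : 'rV[R]_n -> R) : Prop :=
  forall k, continuously_differentiable k U f.

Section Riemannian.
Variables (n : nat) (M : topologicalType).
Implicit Types c : chart n M.

Definition transition c c' (x : 'rV[R]_n) : 'rV[R]_n :=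
  chart_fun c' (chart_inv c x).

Definition transition_dom c c' : set 'rV[R]_n :=
  [set x | chart_cod c x /\ chart_dom c' (chart_inv c x)].

Record smooth_structure : Type := SmoothStructure {
  atlas : set (chart n M);
  atlas_cover : forall p : M, exists2 c, atlas c & chart_dom c p;
  atlas_smooth : forall c c', atlas c -> atlas c' ->
    forall j, smooth (transition_dom c c') (fun x => transition c c' x 0 j) }.

(* [metric c x] is the Gram matrix of the metric in the coordinates of [c];
   tangent vectors are row vectors, so that the differential of a transition
   map at [x] is [u |-> u *m 'J (transition c c') x]. *)
Record riemannian_metric (S : smooth_structure) : Type := RiemannianMetric {
  metric : chart n M -> 'rV[R]_n -> 'M[R]_n;
  metric_sym : forall c x, atlas S c -> chart_cod c x ->
    (metric c x)^T = metric c x;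
  metric_pos : forall c x (u : 'rV[R]_n), atlas S c -> chart_cod c x ->
    u != 0 -> 0 < (u *m metric c x *m u^T) 0 0;
  metric_smooth : forall c i j, atlas S c ->
    smooth (chart_cod c) (fun x => metric c x i j);
  metric_transition : forall c c' x, atlas S c -> atlas S c' ->
    transition_dom c c' x ->
    metric c x = 'J (transition c c') x *m metric c' (transition c c' x)
                   *m ('J (transition c c') x)^T }.

Section Curvature.
Variable g : 'rV[R]_n -> 'M[R]_n.

Definition christoffel (k i j : 'I_n) (x : 'rV[R]_n) : R :=
  2^-1 * \sum_l invmx (g x) k l *
    (partial i (fun y => g y j l) x + partial j (fun y => g y i l) x
     - partial l (fun y => g y i j) x).

(* The coefficient of e_l in R(e_i, e_j) e_k, where
   R(X, Y) Z = D_X D_Y Z - D_Y D_X Z - D_[X, Y] Z. *)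
Definition riemann (l i j k : 'I_n) (x : 'rV[R]_n) : R :=
  partial i (christoffel l j k) x - partial j (christoffel l i k) x
  + \sum_m (christoffel m j k x * christoffel l i m x
            - christoffel m i k x * christoffel l j m x).

Definition inner (x u v : 'rV[R]_n) : R := (u *m g x *m v^T) 0 0.

Definition curvature_operator (x u v w : 'rV[R]_n) : 'rV[R]_n :=
  \row_l \sum_i \sum_j \sum_k u 0 i * v 0 j * w 0 k * riemann l i j k x.

Definition sectional_curvature (x u v : 'rV[R]_n) : R :=
  inner x (curvature_operator x u v v) u /
  (inner x u u * inner x v v - inner x u v ^+ 2).

End Curvature.

Definition constant_sectional_curvature (S : smooth_structure)
    (g : riemannian_metric S) (K : R) : Prop :=
  forall c x (u v : 'rV[R]_n), atlas S c -> chart_cod c x ->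
    row_free (col_mx u v) -> sectional_curvature (metric g c) x u v = K.

End Riemannian.

Definition hyperbolic (n : nat) (M : topologicalType) : Prop :=
  exists (S : smooth_structure n M) (g : riemannian_metric S) (K : R),
    K < 0 /\ constant_sectional_curvature g K.

End Homology.

(* Main.v *)
(* Gaifullin's realisation of cycles, by copies of the right-angled 120-cell P
   in the Klein model.  The facets of P are coloured by proper nonempty subsets
   of {0,..,4} so that adjacent facets have comparable colours and exactly one
   complete flag of facets is coloured {0}, {0,1}, {0,1,2}, {0,1,2,3}.

   The barycentric subdivision of a fundamental cycle of N consists of signed
   singular simplices (chambers), matched in pairs of opposite sign along each
   face.  Copies of P are indexed by a chamber, a family of sign-reversing
   gluings of the chambers for all colours, and one bit for each facet; crossing
   a facet applies the gluing of its colour and conjugates the gluings of the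
   larger colours, so that the crossings of adjacent facets commute.  As the
   dihedral angles are right, the copies of P glued in this way form a closed
   hyperbolic manifold M.  Each copy is mapped to its chamber, with barycentric
   coordinate k the normalised product of the distances to the facets whose
   colour contains k; then facets of colour w go to the face where the
   coordinates in w vanish, so the maps agree on M.

   A fundamental cycle of M is the sum of the simplices spanned by the centres
   of the faces of the complete flags of all copies of P.  A straight-line
   homotopy inside the chambers replaces these centres by vertices.  Simplices
   that miss a vertex cancel in pairs of chambers, so the only surviving flag is
   the one above, and the image is, up to sign, the number of copies of P per
   chamber times the fundamental cycle of N.

   The same cancellation, in a chart at a vertex of P, shows that the cycle of M
   restricts there to the fan over a cross-polytope, a local
   generator by Mayer-Vietoris; along segments this spreads over each copy. *)
From HB Require Import structures.
Require Import Defs.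
From mathcomp Require Import all_boot all_order all_algebra.
From mathcomp Require Import all_classical all_reals all_analysis.
From mathcomp Require Import fingroup perm freeg ssrZ zify ring lra.
Set Implicit Arguments.
Unset Strict Implicit.
Unset Printing Implicit Defensive.
Import Order.TTheory GRing.Theory Num.Theory.
Import numFieldNormedType.Exports.
Local Open Scope classical_set_scope.
Local Open Scope ring_scope.

Local Notation lift := fintype.lift.

(** A closed topological four-manifold need not be triangulable, so only a singular fundamental
    cycle of N is available. Its simplices are matched face by face, with no control over how the
    matchings close up around a face of codimension two. This obstacle is why cells carry whole
    families of gluings: conjugation makes crossings commute where facets meet at right angles,
    although the gluings themselves do not commute. The colours are the names of the facets of the
    permutohedron, the polytope of Gaifullin's original construction; the uniqueness of the coloured
    flag excludes cancellation in the degree. The Klein model serves two geometries at once: P is an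
    affine convex polytope, so centres, segments and prisms are Euclidean, while reflections are
    projective and come from linear maps of Lorentz space. Orientations are handled algebraically:
    flag weights alternate, vanish unless the facets are pairwise adjacent, and sum to zero over the
    last facet. Together with the signs of the cells, these facts make the sum of flags a cycle and
    cancel all unwanted terms. *)

(** * Linear identities in abelian groups *)

Inductive zmod_expr :=
  ZVar of nat | ZAdd of zmod_expr & zmod_expr | ZOpp of zmod_expr | ZZero.

Fixpoint zmod_eval (V : zmodType) (env : seq V) (e : zmod_expr) : V :=
  match e with
  | ZVar n => nth 0 env n
  | ZAdd a b => zmod_eval env a + zmod_eval env b
  | ZOpp a => - zmod_eval env a
  | ZZero => 0
  end.

Fixpoint zmod_coef (e : zmod_expr) (n : nat) : int :=
  match e with
  | ZVar m => (m == n)%:R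
  | ZAdd a b => zmod_coef a n + zmod_coef b n
  | ZOpp a => - zmod_coef a n
  | ZZero => 0
  end.

Lemma zmod_evalE (V : zmodType) (env : seq V) e :
  zmod_eval env e = \sum_(i < size env) nth 0 env i *~ zmod_coef e i.
Proof.
elim: e => [m|a IHa b IHb|a IHa|] /=.
- have [mn|mn] := ltnP m (size env); last first.
    rewrite nth_default // big1 // => i _.
    by rewrite gtn_eqF ?mulr0z // (leq_trans (ltn_ord i)).
  rewrite (bigD1 (Ordinal mn)) //= eqxx mulr1z big1 ?addr0 // => i im.
  rewrite (_ : (m == i) = false) ?mulr0z //; apply/eqP => mi; case/eqP: im.
  exact/val_inj.
- by rewrite IHa IHb -big_split; apply: eq_bigr => i _; rewrite mulrzDr.
- by rewrite IHa -sumrN; apply: eq_bigr => i _; rewrite mulrNz.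
by rewrite big1 // => i _; rewrite mulr0z.
Qed.

Lemma zmod_decide (V : zmodType) (env : seq V) a b :
  all (fun i => zmod_coef a i == zmod_coef b i) (iota 0 (size env)) ->
  zmod_eval env a = zmod_eval env b.
Proof.
move=> /allP ab; rewrite !zmod_evalE; apply: eq_bigr => i _.
by rewrite (eqP (ab i _)) // mem_iota /=.
Qed.

(** Atoms are compared up to conversion, since equal chains may carry degrees such as [n.+1.-1] and
    [n] in their types; the inner [match goal] makes [unify] run while a term is being computed. *)
Ltac zmod_index x l :=
  match l with
  | ?y :: _ => let _ := match goal with _ => unify x y end in constr:(0%N)
  | _ :: ?l' => let n := zmod_index x l' in constr:(S n)
  end.

Ltac zmod_has x l :=
  match l with
  | ?y :: _ => let _ := match goal with _ => unify x y end in constr:(true)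
  | _ :: ?l' => zmod_has x l'
  | _ => constr:(false)
  end.

Ltac zmod_atoms e l :=
  lazymatch e with
  | (?a + ?b)%R => let l := zmod_atoms a l in zmod_atoms b l
  | (- ?a)%R => zmod_atoms a l
  | (0)%R => l
  | _ => let h := zmod_has e l in
         lazymatch h with true => l | false => constr:(e :: l) end
  end.

Ltac zmod_reify e l :=
  lazymatch e with
  | (?a + ?b)%R => let a := zmod_reify a l in let b := zmod_reify b l in
                   constr:(ZAdd a b)
  | (- ?a)%R => let a := zmod_reify a l in constr:(ZOpp a)
  | (0)%R => constr:(ZZero)
  | _ => let n := zmod_index e l in constr:(ZVar n)
  end.

(* Decides linear identities with unit coefficients in an abelian group. *)
Ltac zmod :=
  lazymatch goal with
  | |- @eq ?T ?a ?b =>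
    let l := zmod_atoms a (@nil T) in
    let l := zmod_atoms b l in
    let a' := zmod_reify a l in
    let b' := zmod_reify b l in
    exact (@zmod_decide _ l a' b' isT)
  end.

HB.instance Definition _ (A : nzRingType) (K : choiceType) (M : lmodType A)
    (f : K -> M) :=
  GRing.isZmodMorphism.Build _ _ (fglift f) (lift_is_additive f).

(** * Supports and homomorphisms of free abelian groups *)

Section FreeGroups.
Implicit Types (K L : choiceType).

Definition supported K (P : K -> Prop) (D : {freeg K}) : Prop :=
  forall x, x \in dom D -> P x.

Lemma supported_ind K (P : K -> Prop) (Q : {freeg K} -> Prop) :
  Q 0 -> (forall k x D, P x -> Q D -> Q (<< k *g x >> + D)) ->
  forall D, supported P D -> Q D.
Proof.
move=> Q0 QD D PD; rewrite -(freeg_sumE D); rewrite /supported in PD.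
elim: (dom D) PD => [|x s IH] PD; first by rewrite big_nil.
rewrite big_cons; apply: QD; first by apply: PD; rewrite inE eqxx.
by apply: IH => y ys; apply: PD; rewrite inE ys orbT.
Qed.

Lemma supported0 K (P : K -> Prop) : supported P 0.
Proof. by move=> x; rewrite dom0. Qed.

Lemma supportedD K (P : K -> Prop) D E :
  supported P D -> supported P E -> supported P (D + E).
Proof.
by move=> PD PE x /domD_subset; rewrite mem_cat => /orP[/PD|/PE].
Qed.

Lemma supportedN K (P : K -> Prop) D : supported P D -> supported P (- D).
Proof. by move=> PD x; rewrite domN => /PD. Qed.

Lemma supportedB K (P : K -> Prop) D E :
  supported P D -> supported P E -> supported P (D - E).
Proof. by move=> PD PE; apply: supportedD => //; apply: supportedN. Qed.

Lemma supportedMz K (P : K -> Prop) D (k : int) :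
  supported P D -> supported P (D *~ k).
Proof.
move=> PD; have PMn m : supported P (D *+ m).
  by elim: m => [|m IH]; [exact: supported0|rewrite mulrS; exact: supportedD].
case: k => m; first by rewrite -pmulrn; exact: (PMn m).
by rewrite NegzE mulrNz -pmulrn; apply: supportedN; exact: (PMn m.+1).
Qed.

Lemma freegZ K (D : {freeg K}) (k : int) : k *: D = D *~ k.
Proof. by rewrite -[k in LHS]intz scaler_int. Qed.

Lemma supportedU K (P : K -> Prop) (k : int) x :
  P x -> supported P << k *g x >>.
Proof.
move=> Px; have [->|k0] := eqVneq k 0; first by rewrite freegU0; apply: supported0.
by move=> y; rewrite domU// inE => /eqP->.
Qed.

Lemma supported_sum K (P : K -> Prop) I (r : seq I) (Q : pred I) F :
  (forall i, Q i -> supported P (F i)) -> supported P (\sum_(i <- r | Q i) F i).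
Proof.
by move=> PF; elim/big_ind: _ => //; [exact: supported0|exact: supportedD].
Qed.

Lemma supported_lift K L (P : K -> Prop) (Q : L -> Prop) (f : K -> {freeg L}) D :
  (forall x, P x -> supported Q (f x)) -> supported P D ->
  supported Q (fglift f D).
Proof.
move=> PQ; elim/supported_ind => [|k x E Px IH].
  by rewrite raddf0; apply: supported0.
rewrite raddfD /= liftU; apply: supportedD => //.
by rewrite freegZ; apply: supportedMz; apply: PQ.
Qed.

Lemma supported_ext K (V : zmodType) (P : K -> Prop)
    (F G : {additive {freeg K} -> V}) D :
  (forall x, P x -> F << x >> = G << x >>) -> supported P D -> F D = G D.
Proof.
move=> FG; elim/supported_ind => [|k x E Px IH]; first by rewrite !raddf0.
by rewrite !raddfD IH -[k]intz -freegU_mulz !raddfMz FG.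
Qed.

Lemma additive_ext K (V : zmodType) (F G : {additive {freeg K} -> V}) :
  (forall x, F << x >> = G << x >>) -> F =1 G.
Proof. by move=> FG D; apply: (@supported_ext _ _ (fun=> True)). Qed.

Lemma liftU1 K L (f : K -> {freeg L}) x : fglift f << x >> = f x.
Proof. by rewrite liftU scale1r. Qed.

Lemma freegU_sign K (i : nat) (x : K) :
  << (-1) ^+ i *g x >> = << x >> *~ (-1) ^+ i :> {freeg K}.
Proof. by rewrite freegU_mulz intz. Qed.

End FreeGroups.

Section AlternatingSum.
Implicit Types (V : zmodType).

(* The two faces [lift j \o lift i] and [lift i' \o lift j'] coincide exactly
   for the swap below, which changes the parity of [i + j]. *)
Lemma alternating_faces0 V n (a : ('I_n.+1 -> 'I_n.+3) -> V) :
  \sum_(j < n.+3) \sum_(i < n.+2) a (lift j \o lift i) *~ (-1) ^+ (i + j) = 0.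
Proof.
rewrite pair_big /=.
rewrite (bigID (fun p : 'I_n.+3 * 'I_n.+2 => (p.2 < p.1)%N)) /=.
pose h (p : 'I_n.+3 * 'I_n.+2) : 'I_n.+3 * 'I_n.+2 :=
  if (p.2 < p.1)%N then (inord p.2, inord p.1.-1)
  else (inord p.2.+1, inord p.1).
have hlt (j : 'I_n.+3) (i : 'I_n.+2) : (i < j)%N -> (h (j, i)).1 = i :> nat /\ (h (j, i)).2 = j.-1 :> nat.
  move=> ij; have jn := ltn_ord j; have i_n := ltn_ord i.
  by rewrite /h /= ij /= !inordK //; lia.
have hge (j : 'I_n.+3) (i : 'I_n.+2) : (j <= i)%N -> (h (j, i)).1 = i.+1 :> nat /\ (h (j, i)).2 = j :> nat.
  move=> ij; have jn := ltn_ord j; have i_n := ltn_ord i.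
  by rewrite /h /= ltnNge ij /= !inordK //; lia.
have pair_eq (p q : 'I_n.+3 * 'I_n.+2) : p.1 = q.1 :> nat -> p.2 = q.2 :> nat -> p = q.
  by case: p q => [? ?] [? ?] /= /val_inj -> /val_inj ->.
have hswap p : ((h p).2 < (h p).1)%N = ~~ (p.2 < p.1)%N.
  case: p => j i /=; case: (ltnP i j) => ij.
    by have [-> ->] := hlt _ _ ij; lia.
  by have [-> ->] := hge _ _ ij; rewrite ltnS ij.
have hK p : h (h p) = p.
  case: p => j i; case e : (h (j, i)) => [j' i'].
  case: (ltnP i j) => ij.
    have [] := hlt _ _ ij; rewrite e /= => e1 e2.
    have [|e3 e4] := hge j' i'; first by rewrite e1 e2; lia.
    by apply: pair_eq; rewrite ?e3 ?e4 /=; lia.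
  have [] := hge _ _ ij; rewrite e /= => e1 e2.
  have [|e3 e4] := hlt j' i'; first by rewrite e1 e2; lia.
  by apply: pair_eq; rewrite ?e3 ?e4 /=; lia.
rewrite addrC (reindex_onto h h) /=; last by move=> p _; rewrite hK.
rewrite (eq_bigl (fun p : 'I_n.+3 * 'I_n.+2 => (p.2 < p.1)%N)); last first.
  by move=> p; rewrite hswap negbK hK eqxx andbT.
apply/eqP; rewrite addr_eq0 -sumrN; apply/eqP; apply: eq_bigr => -[j i] ij.
have [h1 h2] := hlt _ _ ij; rewrite /= in ij *.
have j0 : (0 < j)%N by exact: leq_ltn_trans ij.
rewrite h1 h2; have -> : (j.-1 + i)%N = (i + j).-1 by rewrite addnC -!subn1 addnBA.
rewrite -[in RHS](@prednK (i + j)) ?addn_gt0 ?j0 ?orbT// exprS mulN1r mulrNz opprK.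
congr (a _ *~ _); apply/funext => k /=; apply/val_inj; rewrite /= /bump h1 h2.
by rewrite /=; do !(case: leqP => ? /=); lia.
Qed.

End AlternatingSum.

(** * Affine chains and subdivision *)

Section AffineChains.
Context {R : realType}.
Implicit Types (k m p n : nat).

Definition achain k m := {freeg 'M[R]_(k.+1, m)}.

Definition afaces k m (w : 'M[R]_(k.+2, m)) : achain k m :=
  \sum_(i < k.+2) << rowsub (lift i) w >> *~ (-1) ^+ i.

Definition abnd k m : achain k m -> achain k.-1 m :=
  match k with 0 => fun=> 0 | _.+1 => fglift (@afaces _ m) end.

Lemma abnd_is_additive k m : {morph @abnd k m : x y / x - y}.
Proof. by case: k => [|k] x y /=; rewrite ?subr0 ?raddfB. Qed.

HB.instance Definition _ k m :=
  GRing.isZmodMorphism.Build _ _ (@abnd k m) (@abnd_is_additive k m).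

Lemma abndU k m (w : 'M[R]_(k.+2, m)) : abnd (<< w >> : achain k.+1 m) = afaces w.
Proof. by rewrite /= liftU1. Qed.

Definition amul k m p (A : 'M[R]_(m, p)) : achain k m -> achain k p :=
  fglift (fun w => << w *m A >>).

HB.instance Definition _ k m p A := GRing.Additive.on (@amul k m p A).

Lemma amulU k m p (A : 'M[R]_(m, p)) w : amul A (<< w >> : achain k m) = << w *m A >>.
Proof. exact: liftU1. Qed.

Lemma amulM k m p q (A : 'M[R]_(m, p)) (B : 'M[R]_(p, q)) (D : achain k m) :
  amul B (amul A D) = amul (A *m B) D.
Proof.
by apply: (additive_ext (F := amul B \o amul A)) => w; rewrite /= !amulU mulmxA.
Qed.

Lemma abnd_amul k m p (A : 'M[R]_(m, p)) (D : achain k m) :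
  abnd (amul A D) = amul A (abnd D).
Proof.
case: k D => [|k] D; first by rewrite [RHS]raddf0.
apply: (additive_ext (F := @abnd k.+1 p \o amul A) (G := amul A \o @abnd k.+1 m)) => w.
rewrite /= amulU !liftU1 /afaces raddf_sum; apply: eq_bigr => i _.
by rewrite raddfMz /= amulU mul_rowsub_mx.
Qed.

Lemma abnd_abnd k m (D : achain k m) : abnd (abnd D) = 0.
Proof.
case: k D => [|[|k]] D //.
apply: (additive_ext (F := @abnd k.+1 m \o @abnd k.+2 m) (G := \0)) => w.
rewrite /= liftU1 /afaces raddf_sum -[RHS](@alternating_faces0 _ _
  (fun f => << rowsub f w >> : achain k m)).
apply: eq_bigr => j _; rewrite raddfMz /= liftU1 /afaces mulrz_suml.
by apply: eq_bigr => i _; rewrite -mulrzA -exprD rowsub_comp.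
Qed.

Definition conem k m (b : 'rV[R]_m) (w : 'M[R]_(k.+1, m)) : 'M[R]_(k.+2, m) :=
  col_mx b w.

Lemma conem0 k m (b : 'rV[R]_m) (w : 'M[R]_(k.+1, m)) j :
  conem b w ord0 j = b 0 j.
Proof.
by rewrite -(col_mxEu b w 0 j); congr (col_mx b w _ j); exact: ord_inj.
Qed.

Lemma conemS k m (b : 'rV[R]_m) (w : 'M[R]_(k.+1, m)) i j :
  conem b w (lift ord0 i) j = w i j.
Proof.
by rewrite -(col_mxEd b w i j); congr (col_mx b w _ j); exact: ord_inj.
Qed.

Definition acone k m (b : 'rV[R]_m) : achain k m -> achain k.+1 m :=
  fglift (fun w => << conem b w >>).

HB.instance Definition _ k m b := GRing.Additive.on (@acone k m b).

Lemma aconeU k m (b : 'rV[R]_m) (w : 'M[R]_(k.+1, m)) :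
  acone b << w >> = << conem b w >>.
Proof. exact: liftU1. Qed.

Lemma rowsub_lift0_cone k m (b : 'rV[R]_m) (w : 'M[R]_(k.+1, m)) :
  rowsub (lift ord0) (conem b w) = w.
Proof. by apply/matrixP => i j; rewrite mxE conemS. Qed.

Lemma rowsub_liftS_cone k m (b : 'rV[R]_m) (w : 'M[R]_(k.+2, m)) (i : 'I_k.+2) :
  rowsub (lift (lift ord0 i)) (conem b w) = conem b (rowsub (lift i) w).
Proof.
apply/matrixP => l j; rewrite mxE.
case: (unliftP (ord0 : 'I_k.+2) l) => [l'|] ->.
  apply/esym; apply: etrans (conemS b (rowsub (lift i) w) l' j) _.
  rewrite mxE; apply: etrans (esym (conemS b w _ j)) _; congr (conem _ _ _ _).
  by apply/val_inj; rewrite /= /bump /=; lia.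
apply/esym; apply: etrans (conem0 b (rowsub (lift i) w) j) _.
apply: etrans (esym (conem0 b w j)) _; congr (conem _ _ _ _).
exact/val_inj.
Qed.

Lemma abnd_cone k m b (D : achain k.+1 m) :
  abnd (acone b D) = D - acone b (abnd D).
Proof.
apply: (additive_ext (F := @abnd k.+2 m \o acone b)
  (G := idfun \- (acone b \o @abnd k.+1 m))) => w.
rewrite /= aconeU !liftU1 /afaces big_ord_recl rowsub_lift0_cone mulr1z; congr (_ + _).
rewrite /afaces raddf_sum -sumrN; apply: eq_bigr => i _.
rewrite lift0 exprS mulN1r mulrNz rowsub_liftS_cone; congr (- _).
by rewrite raddfMz /= aconeU.
Qed.

(** In degree 0 the boundary of a cone has the extra term [b] with multiplicity [deg D]: the
    augmentation takes the place of the missing boundary. *)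
Lemma abnd_cone0 m b (D : achain 0 m) : deg D = 0 -> abnd (acone b D) = D.
Proof.
suff -> : abnd (acone b D) = D - << (b : 'M[R]_(1, m)) >> *~ deg D.
  by move=> ->; rewrite subr0.
pose c (D : achain 0 m) : achain 0 m := << (b : 'M[R]_(1, m)) >> *~ deg D.
have cB : {morph c : x y / x - y} by move=> x y; rewrite /c raddfB mulrzBr.
pose c' : {additive achain 0 m -> achain 0 m} :=
  HB.pack c (GRing.isZmodMorphism.Build _ _ c cB).
apply: (additive_ext (F := @abnd 1 m \o @acone 0 m b) (G := idfun \- c')) => w.
rewrite /= aconeU !liftU1 /afaces !big_ord_recl big_ord0 rowsub_lift0_cone.
rewrite addr0 mulr1z /c degU mulr1z mulrN1z; congr (_ - << _ >>).
apply/matrixP => i j; rewrite mxE (ord1 i) -[RHS](conem0 b w).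
by congr (conem _ _ _ _); apply/val_inj.
Qed.

Definition rows_in k m (Q : set 'rV[R]_m) (w : 'M[R]_(k.+1, m)) : Prop :=
  forall i, Q (row i w).

Lemma rows_in_rowsub k l m (Q : set 'rV[R]_m) (w : 'M[R]_(k.+1, m))
  (f : 'I_l.+1 -> 'I_k.+1) : rows_in Q w -> rows_in Q (rowsub f w).
Proof. by move=> Qw i; rewrite row_rowsub; apply: Qw. Qed.

Lemma supported_abnd k m (Q : set 'rV[R]_m) (D : achain k m) :
  supported (rows_in Q) D -> supported (rows_in Q) (abnd D).
Proof.
case: k D => [|k] D; first by move=> _; apply: supported0.
apply: supported_lift => w Qw; apply: supported_sum => i _.
by apply: supportedMz; apply: supportedU; apply: rows_in_rowsub.
Qed.

Lemma supported_amul k m p (Q : set 'rV[R]_m) (Q' : set 'rV[R]_p)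
    (A : 'M[R]_(m, p)) (D : achain k m) :
  (forall x, Q x -> Q' (x *m A)) ->
  supported (rows_in Q) D -> supported (rows_in Q') (amul A D).
Proof.
move=> QQ'; apply: supported_lift => w Qw; apply: supportedU => i.
by rewrite row_mul; apply: QQ'; apply: Qw.
Qed.

Lemma supported_acone k m (Q : set 'rV[R]_m) b (D : achain k m) :
  Q b -> supported (rows_in Q) D -> supported (rows_in Q) (acone b D).
Proof.
move=> Qb; apply: supported_lift => w Qw; apply: supportedU => i.
case: (unliftP ord0 i) => [j|] ->.
  by rewrite (_ : row _ _ = row j w) //; apply/rowP => l; rewrite [LHS]mxE [RHS]mxE conemS.
by rewrite (_ : row _ _ = b) //; apply/rowP => l; rewrite [LHS]mxE conem0.
Qed.

End AffineChains.

(** * Acyclic models *)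

Section AcyclicModels.
Context {R : realType} (m : nat -> nat).
Local Notation achain := (@achain R).
Context (G : forall n, 'I_n.+2 -> 'M[R]_(m n, m n.+1)).

Definition codelta n k (D : achain k (m n)) : achain k (m n.+1) :=
  \sum_(i < n.+2) amul (G i) D *~ (-1) ^+ i.

Lemma codelta_is_additive n k : {morph @codelta n k : x y / x - y}.
Proof.
move=> x y; rewrite /codelta -sumrB; apply: eq_bigr => i _.
by rewrite raddfB mulrzBl.
Qed.

HB.instance Definition _ n k :=
  GRing.isZmodMorphism.Build _ _ (@codelta n k) (@codelta_is_additive n k).

Lemma abnd_codelta n k (D : achain k (m n)) : abnd (codelta D) = codelta (abnd D).
Proof.
by rewrite raddf_sum; apply: eq_bigr => i _; rewrite raddfMz /= abnd_amul.
Qed.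

(** The cosimplicial identities in the form that [alternating_faces0] consumes: the product depends
    on [i] and [j] only through the composite injection. *)
Definition cosimplicial := forall n, exists H : ('I_n.+1 -> 'I_n.+3) -> 'M[R]_(m n, m n.+2),
  forall i j, G i *m G j = H (lift j \o lift i).

Hypothesis GG : cosimplicial.

Lemma codelta_codelta n k (D : achain k (m n)) : codelta (codelta D) = 0.
Proof.
have [H HE] := GG n.
rewrite -[RHS](@alternating_faces0 _ _ (fun f => amul (H f) D)).
apply: eq_bigr => j _; rewrite raddf_sum mulrz_suml; apply: eq_bigr => i _.
by rewrite raddfMz /= amulM HE -mulrzA -exprD.
Qed.

Context (W : forall n, achain n (m n)) (b : forall n, 'rV[R]_(m n)).

(** Coning from [b n] contracts the model. The recursion solves [abnd (filling n.+1) + codelta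
    (filling n) = W n.+1], so each chain extends what is already fixed on the faces. It yields both
    the subdivision homotopy and the prism operator without explicit formulas. *)
Fixpoint filling n : achain n.+1 (m n) :=
  match n return achain n.+1 (m n) with
  | 0 => acone (b 0%N) (W 0%N)
  | n'.+1 => acone (b n'.+1) (W n'.+1 - codelta (filling n'))
  end.

Hypothesis W0 : deg (W 0%N) = 0.
Hypothesis WS : forall n, abnd (W n.+1) = codelta (W n).

Lemma abnd_filling0 : abnd (filling 0) = W 0%N.
Proof. exact: abnd_cone0. Qed.

Lemma fillingS n :
  filling n.+1 = acone (b n.+1) (W n.+1 - codelta (filling n)).
Proof. by []. Qed.

Lemma abnd_fillingS n : abnd (filling n.+1) = W n.+1 - codelta (filling n).
Proof.
elim: n => [|n IH]; rewrite fillingS abnd_cone abnd_is_additive WS abnd_codelta.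
  by rewrite abnd_filling0 subrr [acone _ _]raddf0 subr0.
by rewrite IH -codelta_is_additive subKr codelta_codelta [acone _ _]raddf0 subr0.
Qed.

Lemma supported_filling (Q : forall n, set 'rV[R]_(m n)) :
  (forall n (i : 'I_n.+2) x, Q n x -> Q n.+1 (x *m G i)) ->
  (forall n, Q n (b n)) -> (forall n, supported (rows_in (Q n)) (W n)) ->
  forall n, supported (rows_in (Q n)) (filling n).
Proof.
move=> QG Qb QW; elim=> [|n IH] /=; apply: supported_acone => //.
apply: supportedB => //; apply: supported_sum => i _; apply: supportedMz.
by apply: supported_amul IH => x; apply: QG.
Qed.

End AcyclicModels.

(** * Limits of matrices, sums and compositions *)

Section ContinuityTools.
Context {R : realType}.

Lemma cvg_mx (T : Type) (F : set_system T) {FF : Filter F} m n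
    (f : T -> 'M[R]_(m, n)) (l : 'M[R]_(m, n)) :
  (forall i j, f x i j @[x --> F] --> l i j) -> f x @[x --> F] --> l.
Proof.
move=> fl; apply/cvg_ballP => e e0.
have : \forall x \near F, forall ij : 'I_m * 'I_n, ball (l ij.1 ij.2) e (f x ij.1 ij.2).
  by apply: filter_forall => -[i j]; exact: (cvg_ballP _ _).1 (fl i j) e e0.
by apply: filterS => x xl; split => // i j; exact: (xl (i, j)).
Qed.

Lemma cvg_big_sum (T : Type) (F : set_system T) {FF : Filter F} (I : Type)
    (r : seq I) (P : pred I) (f : I -> T -> R) (l : I -> R) :
  (forall i, f i x @[x --> F] --> l i) ->
  \sum_(i <- r | P i) f i x @[x --> F] --> \sum_(i <- r | P i) l i.
Proof.
move=> fl; elim: r => [|i r IH].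
  by rewrite big_nil; under eq_fun do rewrite big_nil; exact: cvg_cst.
rewrite big_cons; under eq_fun do rewrite big_cons; case: ifP => // _.
by apply: cvgD.
Qed.

Lemma cvg_mulmxr (T : Type) (F : set_system T) {FF : Filter F} m n p
    (f : T -> 'M[R]_(m, n)) (l : 'M[R]_(m, n)) (w : 'M[R]_(n, p)) :
  f x @[x --> F] --> l -> f x *m w @[x --> F] --> l *m w.
Proof.
move=> fl; apply: cvg_mx => i j; rewrite mxE; under eq_fun do rewrite mxE.
apply: cvg_big_sum => k; apply: cvgM; last exact: cvg_cst.
exact: (cvg_comp _ _ fl (@coord_continuous _ _ _ i k l)).
Qed.

Lemma within_continuous_comp (S T : topologicalType) (X : topologicalType)
    (Q : set T) (g : T -> X) (u : S -> T) :
  {within Q, continuous g} -> continuous u -> (forall x, Q (u x)) ->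
  continuous (g \o u).
Proof.
move=> /subspace_continuousP gc uc Qu x B /gc /= => /(_ (Qu x)) gB.
have := uc x _ gB; rewrite !nbhs_simpl /=; apply: filterS => y /=; apply.
exact: Qu.
Qed.

End ContinuityTools.

(** * From affine chains to singular chains *)

Section Realization.
Context {R : realType}.
Implicit Types (X Y : topologicalType) (n k m : nat).

Lemma std_simplex_delta n (k : 'I_n.+1) : std_simplex R n (delta_mx 0 k).
Proof.
split=> [i|]; first by rewrite mxE ler0n.
rewrite (bigD1 k) //= big1 => [|i ik]; rewrite mxE !eqxx ?addr0 //=.
by rewrite (negPf ik).
Qed.

Lemma std_simplex_vertex n : delta_mx 0 0 \in std_simplex R n.
Proof. exact/mem_set/std_simplex_delta. Qed.

Definition simplex_vertex n : std_simplex R n := SigSub (std_simplex_vertex n).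

Lemma continuous_simplex_val n : continuous (set_val : std_simplex R n -> 'rV[R]_n.+1).
Proof. exact: initial_continuous. Qed.

(** The default is constant at a value of [f], so that the bound on the range holds without any
    proof of continuity. *)
Definition mksimplex n X (f : std_simplex R n -> X) : simplex R n X :=
  if pselect (continuous f) is left h then mkcts h
  else cst (f (simplex_vertex n)).

Lemma mksimplexE n X (f : std_simplex R n -> X) :
  continuous f -> mksimplex f = f :> (_ -> _).
Proof. by rewrite /mksimplex; case: pselect. Qed.

Lemma range_mksimplex n X (f : std_simplex R n -> X) :
  range (mksimplex f) `<=` range f.
Proof.
rewrite /mksimplex; case: pselect => [h|_] y [x _ <-] /=; first by exists x.
by exists (simplex_vertex n).
Qed.

Lemma eq_mksimplex n X (f g : std_simplex R n -> X) :
  f =1 g -> mksimplex f = mksimplex g.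
Proof. by move=> /funext ->. Qed.

Lemma simplex_eq n X (s t : simplex R n X) : s =1 t -> s = t.
Proof. by move=> st; apply/continuousEP. Qed.

Lemma mksimplex_id n X (s : simplex R n X) : mksimplex s = s.
Proof.
by apply: simplex_eq => x; rewrite mksimplexE //; exact: cts_fun.
Qed.

Definition convex_hull_closed m (Q : set 'rV[R]_m) : Prop :=
  forall n (x : 'rV[R]_n.+1) (w : 'M[R]_(n.+1, m)),
    std_simplex R n x -> rows_in Q w -> Q (x *m w).

Lemma mul_rows n m (x : 'rV[R]_n) (w : 'M[R]_(n, m)) :
  x *m w = \sum_i x 0 i *: row i w.
Proof.
apply/rowP => j; rewrite mxE summxE; apply: eq_bigr => i _.
by rewrite !mxE.
Qed.

Lemma convex_std_simplex n : convex_hull_closed (std_simplex R n).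
Proof.
move=> k x w [x0 x1] Qw; split=> [i|].
  rewrite mxE; apply: sumr_ge0 => j _; apply: mulr_ge0 => //.
  by have [/(_ i) + _] := Qw j; rewrite mxE.
under eq_bigr do rewrite mxE; rewrite exchange_big /= -[RHS]x1.
apply: eq_bigr => j _; rewrite -mulr_sumr.
have [_] := Qw j; under eq_bigr do rewrite mxE.
by move=> ->; rewrite mulr1.
Qed.

(** A total function on row vectors, so that affine maps can be composed with a singular simplex
    without carrying proofs of membership. *)
Definition simplex_ext n X (s : std_simplex R n -> X) (x : 'rV[R]_n.+1) : X :=
  s (insubd (simplex_vertex n) x).

Lemma simplex_extE n X (s : std_simplex R n -> X) (x : std_simplex R n) :
  simplex_ext s (set_val x) = s x.
Proof. by rewrite /simplex_ext; congr (s _); exact: valKd. Qed.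

Lemma simplex_val_insubd n (x : 'rV[R]_n.+1) : std_simplex R n x ->
  set_val (insubd (simplex_vertex n) x) = x.
Proof. by move=> Qx; apply: insubdK; apply/mem_set. Qed.

Lemma simplex_ext_continuous n X (s : simplex R n X) :
  {within std_simplex R n, continuous (simplex_ext s)}.
Proof.
apply/subspace_continuousP => x Qx B /= sB.
have sc : continuous s by exact: cts_fun.
have := sc (insubd (simplex_vertex n) x) B sB.
rewrite nbhs_simpl /= nbhsE => -[C [[D oD DC] Cx] CB].
have : \forall y \near x, D y.
  apply: open_nbhs_nbhs; split => //.
  by move: Cx; rewrite -DC /= simplex_val_insubd.
rewrite !nbhs_simpl /=; apply: filterS => y Dy Qy /=.
by apply: CB; rewrite -DC /= simplex_val_insubd.
Qed.

Definition realize n m X (g : 'rV[R]_m -> X) : achain n m -> chain R n X :=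
  fglift (fun w => << mksimplex (fun x : std_simplex R n => g (set_val x *m w)) >>
    : {freeg (simplex R n X)}).

HB.instance Definition _ n m X g := GRing.Additive.on (@realize n m X g).

Lemma realizeU n m X (g : 'rV[R]_m -> X) (w : 'M[R]_(n.+1, m)) :
  realize g << w >> = << mksimplex (fun x : std_simplex R n => g (set_val x *m w)) >>.
Proof. exact: liftU1. Qed.

Lemma boundary_is_additive n X : {morph @boundary R n X : x y / x - y}.
Proof. by case: n => [|n] x y /=; rewrite ?subr0 ?raddfB. Qed.

HB.instance Definition _ n X :=
  GRing.isZmodMorphism.Build _ _ (@boundary R n X) (@boundary_is_additive n X).

Lemma boundaryB n X (c d : chain R n X) : boundary (c - d) = boundary c - boundary d.
Proof. exact: boundary_is_additive. Qed.

Lemma boundaryD n X (c d : chain R n X) : boundary (c + d) = boundary c + boundary d.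
Proof. by rewrite [LHS]raddfD. Qed.

Lemma boundaryN n X (c : chain R n X) : boundary (- c) = - boundary c.
Proof. by rewrite [LHS]raddfN. Qed.

Lemma boundary0 n X : boundary (0 : chain R n X) = 0.
Proof. by rewrite [LHS]raddf0. Qed.

Lemma boundaryMz n X (c : chain R n X) (k : int) : boundary (c *~ k) = boundary c *~ k.
Proof. by rewrite [LHS]raddfMz. Qed.

Lemma boundaryU n X (s : simplex R n.+1 X) :
  boundary (<< s >> : chain R n.+1 X) =
  \sum_(i < n.+2) << (s \o @face R n i : simplex R n X) >> *~ (-1) ^+ i.
Proof.
by rewrite /= liftU1; apply: eq_bigr => i _; rewrite freegU_sign.
Qed.

Lemma face_mul n m (i : 'I_n.+2) (x : std_simplex R n) (w : 'M[R]_(n.+2, m)) :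
  set_val (face i x) *m w = set_val x *m rowsub (lift i) w.
Proof.
apply/rowP => j; rewrite !mxE (bigD1_ord i) //= mxE unlift_none mul0r add0r.
by apply: eq_bigr => l _; rewrite !mxE liftK.
Qed.

Lemma simplex_mulr_continuous n m (w : 'M[R]_(n.+1, m)) :
  continuous (fun x : std_simplex R n => set_val x *m w).
Proof.
move=> x; apply: (@cvg_mulmxr _ _ (nbhs x) _ _ _ _ (set_val : std_simplex R n -> _)).
exact: continuous_simplex_val.
Qed.

Lemma affine_simplex_continuous n m X (Q : set 'rV[R]_m) (g : 'rV[R]_m -> X)
    (w : 'M[R]_(n.+1, m)) :
  convex_hull_closed Q -> {within Q, continuous g} -> rows_in Q w ->
  continuous (fun x : std_simplex R n => g (set_val x *m w)).
Proof.
move=> cQ gQ Qw.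
apply: (within_continuous_comp (u := fun x : std_simplex R n => set_val x *m w) gQ).
  exact: simplex_mulr_continuous.
by move=> x; apply: cQ => //; exact: set_valP.
Qed.

Lemma boundary_realize n m X (Q : set 'rV[R]_m) (g : 'rV[R]_m -> X) (D : achain n m) :
  convex_hull_closed Q -> {within Q, continuous g} -> supported (rows_in Q) D ->
  boundary (realize g D) = realize g (abnd D).
Proof.
move=> cQ gQ; case: n D => [|n] D QD; first by rewrite [RHS]raddf0.
apply: (supported_ext (F := @boundary R n.+1 X \o realize g)
  (G := realize g \o @abnd R n.+1 m)) QD => w Qw.
change (boundary (realize g (<< w >> : achain n.+1 m)) = realize g (abnd (<< w >> : achain n.+1 m))).
rewrite realizeU boundaryU abndU /afaces raddf_sum.
apply: eq_bigr => i _; rewrite raddfMz /= realizeU; congr (<< _ >> *~ _).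
apply: simplex_eq => x /=; rewrite !mksimplexE ?face_mul //.
  exact (@affine_simplex_continuous _ _ _ Q g _ cQ gQ (rows_in_rowsub _ Qw)).
exact (@affine_simplex_continuous _ _ _ Q g _ cQ gQ Qw).
Qed.

Lemma realize_amul n m p X (g : 'rV[R]_p -> X) (A : 'M[R]_(m, p)) (D : achain n m) :
  realize g (amul A D) = realize (fun x => g (x *m A)) D.
Proof.
apply: (additive_ext (F := realize g \o amul A)) => w.
rewrite /= amulU !realizeU; congr << _ >>; apply: eq_mksimplex => x.
by rewrite mulmxA.
Qed.

Lemma eq_realize n m X (Q : set 'rV[R]_m) (g h : 'rV[R]_m -> X) (D : achain n m) :
  convex_hull_closed Q -> (forall x, Q x -> g x = h x) ->
  supported (rows_in Q) D -> realize g D = realize h D.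
Proof.
move=> cQ gh; apply: (supported_ext (F := realize g) (G := realize h)) => w Qw.
rewrite /= !realizeU; congr << _ >>; apply: eq_mksimplex => x.
by apply: gh; apply: cQ => //; exact: set_valP.
Qed.

Lemma realize_ext_id n X (s : simplex R n X) : realize (simplex_ext s) << 1%:M >> = << s >>.
Proof.
rewrite realizeU; congr << _ >>; rewrite -[RHS]mksimplex_id.
by apply: eq_mksimplex => x; rewrite mulmx1 simplex_extE.
Qed.

Lemma chain_in_realize n m X (A : set X) (Q : set 'rV[R]_m) (g : 'rV[R]_m -> X)
    (D : achain n m) :
  convex_hull_closed Q -> (forall x, Q x -> A (g x)) ->
  supported (rows_in Q) D -> chain_in A (realize g D).
Proof.
move=> cQ gA; apply: supported_lift => w Qw; apply: supportedU.
apply: subset_trans (@range_mksimplex _ _ _) _ => _ [x _ <-].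
by apply: gA; apply: cQ => //; exact: set_valP.
Qed.

(** A natural operation on singular chains is determined by its value on the identity of the model
    simplex; [th] is that value. Identities between operations thus become identities between affine
    chains. *)
Definition natop n k X (th : achain k n.+1) : chain R n X -> chain R k X :=
  fglift (fun s : simplex R n X =>
    realize (simplex_ext s) th : {freeg (simplex R k X)}).

HB.instance Definition _ n k X th := GRing.Additive.on (@natop n k X th).

Lemma natopU n k X (th : achain k n.+1) (s : simplex R n X) :
  natop th << s >> = realize (simplex_ext s) th.
Proof. exact: liftU1. Qed.

Lemma natop_id n X (c : chain R n X) : natop << 1%:M >> c = c.
Proof.
apply: (additive_ext (F := natop << 1%:M >>) (G := idfun)) => s.
by rewrite /= natopU realize_ext_id.
Qed.

Lemma natopB n k X (th th' : achain k n.+1) (c : chain R n X) :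
  natop (th - th') c = natop th c - natop th' c.
Proof.
apply: (additive_ext (F := natop (th - th')) (G := natop th \- natop th')) => s.
by rewrite /= !natopU raddfB.
Qed.

Lemma natop0 n k X (c : chain R n X) : natop (0 : achain k n.+1) c = 0.
Proof. by have := natopB 0 (0 : achain k n.+1) c; rewrite subr0 => ->; exact: subrr. Qed.

Lemma boundary_natop n k X (th : achain k n.+1) (c : chain R n X) :
  supported (rows_in (std_simplex R n)) th ->
  boundary (natop th c) = natop (abnd th) c.
Proof.
move=> Qth; apply: (additive_ext (F := @boundary R k X \o natop th)) => s.
rewrite /= !natopU (boundary_realize _ _ Qth) //.
  exact: convex_std_simplex.
exact: simplex_ext_continuous.
Qed.

Definition face_mx n (i : 'I_n.+2) : 'M[R]_(n.+1, n.+2) := rowsub (lift i) 1%:M.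

Lemma mul_face_mx n (i : 'I_n.+2) m (w : 'M[R]_(n.+2, m)) :
  face_mx i *m w = rowsub (lift i) w.
Proof. by rewrite mul_rowsub_mx mul1mx. Qed.

Lemma face_mapE n (i : 'I_n.+2) (x : 'rV[R]_n.+1) : face_map i x = x *m face_mx i.
Proof.
apply/rowP => j; rewrite !mxE; case: unliftP => [k|] ->.
  rewrite (bigD1 k) //= !mxE eqxx mulr1 big1 ?addr0 // => l lk.
  by rewrite !mxE (inj_eq lift_inj) (negPf lk) mulr0.
by rewrite big1 // => l _; rewrite !mxE eq_sym (negPf (neq_lift _ _)) mulr0.
Qed.

Lemma face_mx_simplex n (i : 'I_n.+2) x :
  std_simplex R n x -> std_simplex R n.+1 (x *m face_mx i).
Proof.
move=> Qx; have := face_map_simplex i (SigSub (mem_set Qx) : std_simplex R n).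
by rewrite face_mapE => /set_mem.
Qed.

Lemma cosimplicial_face_mx : cosimplicial (m := S) face_mx.
Proof.
move=> n; exists (fun f => rowsub f 1%:M) => i j.
by rewrite mul_rowsub_mx mul1mx -rowsub_comp.
Qed.

Lemma natop_boundary n k X (th : achain k n.+1) (c : chain R n.+1 X) :
  supported (rows_in (std_simplex R n)) th ->
  natop th (boundary c) = natop (codelta (m := S) face_mx th) c.
Proof.
move=> Qth.
apply: (additive_ext (F := natop th \o @boundary R n.+1 X) (G := natop _)) => s.
change (natop th (boundary (<< s >> : chain R n.+1 X)) =
  natop (codelta (m := S) face_mx th) (<< s >> : chain R n.+1 X)).
rewrite boundaryU natopU [LHS]raddf_sum [RHS]raddf_sum.
apply: eq_bigr => i _; rewrite [LHS]raddfMz [RHS]raddfMz /= natopU realize_amul.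
congr (_ *~ _); apply: eq_realize Qth; first exact: convex_std_simplex.
move=> x Qx; rewrite -[x](simplex_val_insubd Qx) simplex_extE /=.
rewrite -face_mapE; apply/esym.
exact: (simplex_extE s (face i (insubd (simplex_vertex n) x))).
Qed.

Lemma chain_in_natop n k X (A : set X) (th : achain k n.+1) (c : chain R n X) :
  chain_in A c -> chain_in A (natop th c).
Proof.
apply: supported_lift => s sA.
apply: (@chain_in_realize _ _ _ _ setT) => // x _; apply: sA.
by exists (insubd (simplex_vertex n) x).
Qed.

Lemma boundary_boundary n X (c : chain R n X) : boundary (boundary c) = 0.
Proof.
case: n c => [|n] c //; rewrite -[c]natop_id.
have Q1 k : supported (rows_in (std_simplex R k)) (<< 1%:M >> : achain k k.+1).
  by apply: supportedU => i; rewrite row1; apply: std_simplex_delta.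
by rewrite !boundary_natop ?abnd_abnd //; [exact: natop0|exact: supported_abnd].
Qed.

End Realization.

Lemma sum_sign_cancel (T : finType) (V : zmodType) (p : pred T) (t : T -> T)
    (F : T -> V) :
  involutive t -> (forall x, p (t x) = ~~ p x) -> (forall x, F (t x) = - F x) ->
  \sum_x F x = 0.
Proof.
move=> tK pt Ft; rewrite (bigID p) /= [X in _ + X](reindex_inj (inv_inj tK)) /=.
rewrite [X in _ + X](eq_bigl p); last by move=> x; rewrite pt negbK.
rewrite [X in _ + X](eq_bigr (fun x => - F x)) => [|x _]; last exact: Ft.
by rewrite sumrN subrr.
Qed.

(** * Barycentric subdivision *)

Section Subdivision.
Context {R : realType}.
Implicit Types (X : topologicalType) (n : nat).

(* The vertices of the simplex of the barycentric subdivision indexed by [s]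
   are the barycenters of the faces spanned by [s 0, .., s k]. *)
Definition bary n (s : 'S_n.+1) : 'M[R]_n.+1 :=
  \matrix_(k, l) (((s^-1)%g l <= k)%N%:R / k.+1%:R).

Lemma sum_bary_weights n (s : 'S_n.+1) (k : 'I_n.+1) (f : 'I_n.+1 -> R) :
  \sum_l bary s k l * f l = (\sum_(j < n.+1 | (j <= k)%N) f (s j)) / k.+1%:R.
Proof.
rewrite (reindex_inj (@perm_inj _ s)) /= mulr_suml [RHS]big_mkcond /=.
apply: eq_bigr => j _; rewrite mxE permK mulrC; case: leqP => _.
  by rewrite mulrA mulr1.
by rewrite mul0r mulr0.
Qed.

Lemma card_ord_le n (k : 'I_n.+1) : #|[pred j : 'I_n.+1 | (j <= k)%N]| = k.+1.
Proof.
rewrite -sum1_card -[RHS](card_ord k.+1) -[RHS]sum1_card.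
by rewrite (big_ord_widen n.+1 (fun=> 1%N)).
Qed.

Lemma bary_simplex n (s : 'S_n.+1) : rows_in (std_simplex R n) (bary s).
Proof.
move=> k; split=> [i|]; first by rewrite !mxE mulr_ge0 ?invr_ge0 ?ler0n.
under eq_bigr do rewrite mxE -[bary _ _ _]mulr1.
by rewrite (sum_bary_weights s k (fun=> 1)) sumr_const card_ord_le mulfV ?pnatr_eq0.
Qed.

Definition sdch n : achain (R := R) n n.+1 :=
  \sum_(s : 'S_n.+1) << bary s >> *~ (-1) ^+ s.

Lemma sdch_simplex n : supported (rows_in (std_simplex R n)) (sdch n).
Proof.
apply: supported_sum => s _; apply: supportedMz; apply: supportedU.
exact: bary_simplex.
Qed.

Lemma sdch0 : sdch 0 = << 1%:M >>.
Proof.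
rewrite /sdch (bigD1 1%g) //= big1 => [|s]; last first.
  by case/eqP; apply/permP => i; rewrite [RHS]ord1 [LHS]ord1.
rewrite addr0 odd_perm1 mulr1z; congr << _ >>; apply/matrixP => i j.
by rewrite !mxE (ord1 (((1 : 'S_1)^-1)%g j)) (ord1 i) (ord1 j) /= divr1.
Qed.

(* Dropping the barycenter of an intermediate face leaves two choices for that
   face, which contribute with opposite signs. *)
Lemma bary_inner_face n (s : 'S_n.+2) (i : 'I_n.+1) :
  rowsub (lift (widen_ord (leqnSn _) i))
    (bary (tperm (widen_ord (leqnSn _) i) (lift ord0 i) * s)%g) =
  rowsub (lift (widen_ord (leqnSn _) i)) (bary s).
Proof.
apply/matrixP => k l; rewrite !mxE; congr ((nat_of_bool _)%:R / _).
rewrite invMg tpermV permM; set y := (s^-1)%g l.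
have ki : (lift (widen_ord (leqnSn n.+1) i) k : nat) != i.
  by rewrite eq_sym neq_bump.
move: (lift _ _ : nat) ki => k' ki.
by case: tpermP => [->|->|//]; rewrite lift0 /=; lia.
Qed.

(** The permutation puts [j] last. Without the barycenter of the whole simplex, the remaining
    vertices form a simplex of the subdivision of the face opposite [j]. *)
Lemma bary_outer_face n (s : 'S_n.+1) (j : 'I_n.+2) :
  rowsub (lift ord_max) (bary (lift_perm ord_max j s)) = bary s *m face_mx j.
Proof.
apply/matrixP => k l; rewrite !mxE lift_permV.
rewrite (_ : nat_of_ord (lift ord_max k) = k); last by rewrite /= /bump leqNgt ltn_ord.
case: (unliftP j l) => [l'|] ->.
  rewrite lift_perm_lift (bigD1 l') //= big1 => [|m ml]; last first.
    by rewrite !mxE (inj_eq lift_inj) (negPf ml) mulr0.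
  rewrite !mxE eqxx mulr1 addr0; congr (_%:R / _).
  by rewrite /= /bump [(n.+1 <= _)%N]leqNgt ltn_ord.
rewrite lift_perm_id big1 /= => [|m _].
  by rewrite leqNgt ltn_ord mul0r.
by rewrite !mxE eq_sym (negPf (neq_lift _ _)) mulr0.
Qed.

Lemma lift_perm_bij n :
  bijective (fun p : 'I_n.+1 * 'S_n => lift_perm ord_max p.1 p.2).
Proof.
apply: inj_card_bij => [[j s] [j' s'] /= e|].
  have jj : j = j' by rewrite -(lift_perm_id ord_max j s) e lift_perm_id.
  rewrite -jj in e *; congr pair; apply/permP => k; apply: (@lift_inj _ j).
  by rewrite -(lift_perm_lift ord_max) e lift_perm_lift.
by rewrite card_prod card_ord !card_Sn factS.
Qed.

(** Faces that drop an intermediate barycenter cancel under a transposition; those that drop the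
    last barycenter are regrouped, by the vertex added last, into the subdivisions of the faces. *)
Lemma abnd_sdch n : abnd (sdch n.+1) = codelta (m := S) face_mx (sdch n).
Proof.
rewrite raddf_sum.
under eq_bigr do rewrite raddfMz /= liftU1 /afaces mulrz_suml.
rewrite exchange_big /= big_ord_recr /= big1 ?add0r => [|i _]; last first.
  apply: (sum_sign_cancel (p := fun s : 'S_n.+2 => odd_perm s)
    (t := fun s => (tperm (widen_ord (leqnSn _) i) (lift ord0 i) * s)%g)) => s.
  - by rewrite mulgA tperm2 mul1g.
  - rewrite odd_permM odd_tperm; case: eqP => // /(congr1 val) /=.
    by rewrite /bump /=; lia.
  rewrite bary_inner_face odd_permM odd_tperm.
  have -> : widen_ord (leqnSn n.+1) i != lift ord0 i.
    by apply/eqP => /(congr1 val) /=; rewrite /bump /=; lia.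
  by rewrite addTb signrN mulrNz.
rewrite (reindex _ (onW_bij _ (@lift_perm_bij n.+1))) /=.
rewrite -(pair_big predT predT (fun j s => << rowsub (lift ord_max)
   (bary (lift_perm ord_max j s)) >> *~ (-1) ^+ n.+1 *~ (-1) ^+ lift_perm ord_max j s)) /=.
apply: eq_bigr => j _; rewrite raddf_sum mulrz_suml; apply: eq_bigr => s _.
rewrite raddfMz /= amulU bary_outer_face -!mulrzA odd_lift_perm /=; congr (_ *~ _).
rewrite -[(-1) ^+ n.+1]signr_odd -[(-1) ^+ j]signr_odd -!signr_addb /=.
congr ((-1) ^+ (nat_of_bool _)).
by case: (odd n) (odd j) (odd_perm s) => [] [] [].
Qed.

Definition sd n X : chain R n X -> chain R n X := natop (sdch n).

HB.instance Definition _ n X := GRing.Additive.on (@sd n X).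

Lemma chain_in_sd n X (A : set X) (c : chain R n X) :
  chain_in A c -> chain_in A (sd c).
Proof. exact: chain_in_natop. Qed.

Lemma boundary_sd n X (c : chain R n.+1 X) : boundary (sd c) = sd (boundary c).
Proof.
rewrite /sd boundary_natop ?abnd_sdch -?natop_boundary //; exact: sdch_simplex.
Qed.

Lemma one_simplex n : supported (rows_in (std_simplex R n)) (<< 1%:M >> : achain n n.+1).
Proof. by apply: supportedU => i; rewrite row1; apply: std_simplex_delta. Qed.

Definition sdhch n : achain (R := R) n.+1 n.+1 :=
  filling (m := S) face_mx (fun k => << 1%:M >> - sdch k)
    (fun k => delta_mx 0 0) n.

Lemma sdhch_simplex n : supported (rows_in (std_simplex R n)) (sdhch n).
Proof.
apply: (supported_filling (Q := std_simplex R)) => [k i x|k|k].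
- exact: face_mx_simplex.
- exact: std_simplex_delta.
- by apply: supportedB; [exact: one_simplex|exact: sdch_simplex].
Qed.

Definition sdh n X : chain R n X -> chain R n.+1 X := natop (sdhch n).

HB.instance Definition _ n X := GRing.Additive.on (@sdh n X).

Lemma chain_in_sdh n X (A : set X) (c : chain R n X) :
  chain_in A c -> chain_in A (sdh c).
Proof. exact: chain_in_natop. Qed.

Lemma sdh_target0 : deg ((<< 1%:M >> : achain (R := R) 0 1) - sdch 0) = 0.
Proof. by rewrite sdch0 subrr raddf0. Qed.

Lemma abnd_one n :
  abnd (<< 1%:M >> : achain n.+1 n.+2) =
  codelta (R := R) (m := S) face_mx (<< 1%:M >> : achain n n.+1).
Proof.
by rewrite abndU; apply: eq_bigr => i _; rewrite amulU mul1mx.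
Qed.

Lemma boundary_sdhS n X (c : chain R n.+1 X) :
  boundary (sdh c) = c - sd c - sdh (boundary c).
Proof.
rewrite /sdh boundary_natop; last exact: sdhch_simplex.
rewrite /sdhch abnd_fillingS ?natopB ?natop_id ?natop_boundary //.
- exact: sdhch_simplex.
- exact: cosimplicial_face_mx.
- exact: sdh_target0.
- by move=> k; rewrite abnd_is_additive codelta_is_additive abnd_one abnd_sdch.
Qed.

End Subdivision.

Section IteratedSubdivision.
Context {R : realType}.
Implicit Types (X : topologicalType) (n : nat).

Definition sdk k n X (c : chain R n X) : chain R n X := iter k (@sd R n X) c.

Definition sdhk k n X (c : chain R n X) : chain R n.+1 X :=
  \sum_(i < k) sdh (sdk i c).

Lemma sdkB k n X : {morph @sdk k n X : x y / x - y}.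
Proof. by move=> x y; elim: k => //= k ->; rewrite raddfB. Qed.

HB.instance Definition _ k n X :=
  GRing.isZmodMorphism.Build _ _ (@sdk k n X) (@sdkB k n X).

Lemma chain_in_sdk k n X (A : set X) (c : chain R n X) :
  chain_in A c -> chain_in A (sdk k c).
Proof. by move=> Ac; elim: k => //= k; apply: chain_in_sd. Qed.

Lemma chain_in_sdhk k n X (A : set X) (c : chain R n X) :
  chain_in A c -> chain_in A (sdhk k c).
Proof.
move=> Ac; apply: supported_sum => i _.
by apply: chain_in_sdh; apply: chain_in_sdk.
Qed.

Lemma sdkS k n X (c : chain R n X) : sdk k.+1 c = sd (sdk k c).
Proof. by []. Qed.

Lemma sdhk0 n X (c : chain R n X) : sdhk 0 c = 0.
Proof. by rewrite /sdhk big_ord0. Qed.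

Lemma sdhkS k n X (c : chain R n X) : sdhk k.+1 c = sdhk k c + sdh (sdk k c).
Proof. by rewrite /sdhk big_ord_recr. Qed.

Lemma boundary_sdk k n X (c : chain R n.+1 X) :
  boundary (sdk k c) = sdk k (boundary c).
Proof. by elim: k => // k IH; rewrite !sdkS boundary_sd IH. Qed.

Lemma boundary_sdhkS k n X (c : chain R n.+1 X) :
  boundary (sdhk k c) = c - sdk k c - sdhk k (boundary c).
Proof.
elim: k => [|k IH]; first by rewrite !sdhk0 boundary0 subrr subr0.
rewrite !sdhkS boundaryD IH boundary_sdhS boundary_sdk sdkS.
by rewrite addrACA -opprD; congr (_ - _); rewrite addrA subrK.
Qed.

End IteratedSubdivision.

(** * Small simplices *)

Section Mesh.
Context {R : realType}.
Implicit Types (X : topologicalType) (n k m : nat).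

Definition mesh_le k m (r : R) (w : 'M[R]_(k.+1, m)) : Prop :=
  forall i j, `|row i w - row j w| <= r.

Lemma convex_comb_sub n m (x : 'rV[R]_n.+1) (w : 'M[R]_(n.+1, m)) y :
  std_simplex R n x -> x *m w - y = \sum_i x 0 i *: (row i w - y).
Proof.
move=> [_ x1]; under eq_bigr do rewrite scalerBr.
by rewrite sumrB -scaler_suml x1 scale1r mul_rows.
Qed.

Lemma convex_comb_dist n m (x : 'rV[R]_n.+1) (w : 'M[R]_(n.+1, m)) y r :
  std_simplex R n x -> (forall i, x 0 i != 0 -> `|row i w - y| <= r) ->
  `|x *m w - y| <= r.
Proof.
move=> Qx wr; rewrite convex_comb_sub //; apply: le_trans (ler_norm_sum _ _ _) _.
have [x0 x1] := Qx; rewrite -[leRHS]mul1r -x1 mulr_suml; apply: ler_sum => i _.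
rewrite normrZ ger0_norm //; have [->|xi] := eqVneq (x 0 i) 0; first by rewrite !mul0r.
by rewrite ler_wpM2l // wr.
Qed.

(** Convexity reduces the distance of two barycenters to that of a vertex of the smaller face from
    the barycenter of the larger one. In the latter average that vertex itself contributes 0, which
    leaves the weight [1 - 1 / (l + 1)], at most [n / (n + 1)]. *)
Lemma bary_mesh n m (s : 'S_n.+1) (w : 'M[R]_(n.+1, m)) d :
  mesh_le d w -> mesh_le (n%:R / n.+1%:R * d) (bary s *m w).
Proof.
move=> wd; have d0 : 0 <= d by apply: le_trans (wd 0 0).
have main (k l : 'I_n.+1) : (k <= l)%N ->
    `|row k (bary s *m w) - row l (bary s *m w)| <= n%:R / n.+1%:R * d.
  move=> kl; rewrite (row_mul k); apply: convex_comb_dist; first exact: bary_simplex.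
  move=> i; rewrite !mxE; case: leqP => ik; last by rewrite mul0r eqxx.
  move=> _; rewrite -normrN opprB row_mul convex_comb_sub; last exact: bary_simplex.
  apply: le_trans (ler_norm_sum _ _ _) _; have [b0 b1] := @bary_simplex R _ s l.
  rewrite (bigD1 i) //= subrr scaler0 normr0 add0r.
  apply: (@le_trans _ _ ((\sum_(j < n.+1 | j != i) row l (bary s) 0 j) * d)).
    rewrite mulr_suml; apply: ler_sum => j _; rewrite normrZ ger0_norm //.
    by rewrite ler_wpM2l.
  rewrite ler_wpM2r //; move: b1; rewrite (bigD1 i) //= !mxE (leq_trans ik kl).
  rewrite mulr1n mul1r => b1.
  have -> : \sum_(j < n.+1 | j != i) row l (bary s) 0 j = 1 - l.+1%:R^-1 :> R.
    by apply/eqP; rewrite eq_sym subr_eq addrC b1.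
  rewrite -[X in X - _](@mulfV _ (n.+1%:R : R)) ?pnatr_eq0 //.
  have -> : n%:R / n.+1%:R = n.+1%:R / n.+1%:R - n.+1%:R^-1 :> R.
    by rewrite -[n.+1]addn1 natrD mulrDl mul1r addrK.
  by rewrite lerD2l lerN2 lef_pV2 ?posrE ?ltr0n // ler_nat.
move=> k l; case: (leqP k l) => kl; first exact: main.
by rewrite distrC; apply: main; exact: ltnW.
Qed.

Definition small_piece n X (s : simplex R n X) (r : R) (t : simplex R n X) : Prop :=
  exists w : 'M[R]_n.+1, [/\ rows_in (std_simplex R n) w, mesh_le r w &
    t = mksimplex (fun x : std_simplex R n => simplex_ext s (set_val x *m w))].

Lemma small_piece_sd n X (s : simplex R n X) r c :
  supported (small_piece s r) c ->
  supported (small_piece s (n%:R / n.+1%:R * r)) (sd c).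
Proof.
apply: supported_lift => t [w [Qw wr ->]]; rewrite raddf_sum.
apply: supported_sum => p _; rewrite raddfMz /=; apply: supportedMz.
rewrite realizeU; apply: supportedU; exists (bary p *m w); split.
- by move=> i; rewrite row_mul; apply: convex_std_simplex => //; exact: bary_simplex.
- exact: bary_mesh.
apply: eq_mksimplex => x.
have Qx : std_simplex R n (set_val x *m bary p).
  by apply: convex_std_simplex; [exact: set_valP|exact: bary_simplex].
rewrite -[set_val x *m bary p](simplex_val_insubd Qx) simplex_extE mksimplexE.
  by rewrite simplex_val_insubd // mulmxA.
exact (@affine_simplex_continuous _ _ _ _ _ _ _ (@convex_std_simplex _ n)
  (@simplex_ext_continuous _ _ _ s) Qw).
Qed.

(** A crude bound on the diameter of the undivided simplex; only its finiteness matters, because it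
    is multiplied by powers of [n / (n + 1)]. *)
Definition vertex_spread n : R :=
  \sum_i \sum_j `|row i (1%:M : 'M[R]_n.+1) - row j 1%:M|.

Lemma small_piece_sdk k n X (s : simplex R n X) :
  supported (small_piece s ((n%:R / n.+1%:R) ^+ k * vertex_spread n)) (sdk k << s >>).
Proof.
elim: k => [|k IH]; last by rewrite sdkS exprS -mulrA; apply: small_piece_sd.
rewrite expr0 mul1r; apply: supportedU; exists 1%:M; split.
- by move=> i; rewrite row1; exact: std_simplex_delta.
- move=> i j; rewrite /vertex_spread (bigD1 i) //= (bigD1 j) //= -addrA lerDl addr_ge0 //.
    by apply: sumr_ge0.
  by apply: sumr_ge0 => i' _; apply: sumr_ge0.
rewrite -[LHS]mksimplex_id; apply: eq_mksimplex => x.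
by rewrite mulmx1 simplex_extE.
Qed.

Lemma rV_norm_le m (x : 'rV[R]_m) r :
  0 <= r -> (forall i, `|x 0 i| <= r) -> `|x| <= r.
Proof.
move=> r0 xr; have -> : `|x| = mx_norm x by [].
rewrite mx_normrE; apply: bigmax_le => // -[i j] _ /=.
by rewrite (ord1 i).
Qed.

Lemma rV_norm_coord m (x : 'rV[R]_m) i : `|x 0 i| <= `|x|.
Proof.
have -> : `|x| = mx_norm x by [].
by rewrite mx_normrE; apply: (le_bigmax _ (fun ij => `|x ij.1 ij.2|) (0, i)).
Qed.

Lemma std_simplex_compact n : compact (std_simplex R n).
Proof.
apply: bounded_closed_compact.
  exists 1; split; first exact: num_real.
  move=> r r1 x [x0 x1]; apply: (le_trans _ (ltW r1)).
  apply: rV_norm_le => // j.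
  by rewrite ger0_norm // -x1 (bigD1 j) //= lerDl; apply: sumr_ge0.
have -> : std_simplex R n = (\bigcap_i [set x : 'rV[R]_n.+1 | 0 <= x 0 i]) `&`
    [set x | \sum_i x 0 i = 1].
  by apply/seteqP; split=> x [x0 x1]; split => // i; [move=> _; exact: x0|exact: x0].
apply: closedI.
  apply: closed_bigI => i _; apply: (closed_comp _ (@closed_ge _ 0)) => x _.
  exact: coord_continuous.
apply: (closed_comp (f := fun x : 'rV[R]_n.+1 => \sum_i x 0 i) _ (@closed_eq _ 1)) => x _.
by apply: (@cvg_big_sum _ _ (nbhs x)) => i; exact: coord_continuous.
Qed.

(** The radius is drawn from the filter of small positive numbers, along which compactness makes the
    local estimates uniform. *)
Lemma lebesgue_number2 n X (s : simplex R n X) (A B : set X) :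
  open A -> open B -> range s `<=` A `|` B ->
  exists2 e : R, 0 < e & forall x, std_simplex R n x ->
    (forall y, std_simplex R n y -> `|x - y| < e -> A (simplex_ext s y)) \/
    (forall y, std_simplex R n y -> `|x - y| < e -> B (simplex_ext s y)).
Proof.
move=> oA oB sAB.
have /compact_near_coveringP nc := @std_simplex_compact n.
pose P (e : R) x := (forall y, std_simplex R n y -> `|x - y| < e -> A (simplex_ext s y)) \/
    (forall y, std_simplex R n y -> `|x - y| < e -> B (simplex_ext s y)).
have : \forall e \near 0^'+, std_simplex R n `<=` P e.
  apply: nc => x Qx.
  have sub C : open C -> C (simplex_ext s x) -> \forall x' \near x & e \near 0^'+,
     forall y, std_simplex R n y -> `|x' - y| < e -> C (simplex_ext s y).
    move=> oC Cx.
    have /subspace_continuousP/(_ x Qx) sc := @simplex_ext_continuous _ _ _ s.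
    have /sc : nbhs (simplex_ext s x) C by exact: open_nbhs_nbhs.
    rewrite nbhs_simpl /= => /nbhs_normP [r /= r0 rC].
    have r2 : 0 < r / 2 by rewrite divr_gt0.
    near=> x' e => /= y Qy xy; apply: rC => //=.
    rewrite -[x](subrK x') -addrA; apply: le_lt_trans (ler_normD _ _) _.
    rewrite [ltRHS]splitr; apply: ltrD.
      near: x'; exact: (@cvgr_dist_lt _ _ _ (nbhs x) _ id x (@cvg_id _ _) _ r2).
    by apply: lt_trans xy _; near: e; exact: nbhs_right_lt.
  have : (A `|` B) (simplex_ext s x).
    by apply: sAB; exists (insubd (simplex_vertex n) x).
  case=> [/(sub _ oA)|/(sub _ oB)]; apply: filterS => -[x' e] /= H; [left|right]; exact: H.
move=> /(filterI (nbhs_right_gt 0)) /filter_ex [e [/= e0 eP]]; by exists e.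
Unshelve. all: by end_near. Qed.

Lemma sdk_split_simplex n X (s : simplex R n X) (A B : set X) :
  open A -> open B -> range s `<=` A `|` B ->
  exists k a b, [/\ sdk k << s >> = a + b, chain_in A a & chain_in B b].
Proof.
move=> oA oB sAB; have [e e0 eP] := lebesgue_number2 oA oB sAB.
pose q : R := n%:R / n.+1%:R.
have q0 : 0 <= q by rewrite divr_ge0.
have q1 : `|q| < 1 by rewrite ger0_norm // ltr_pdivrMr ?ltr0n // mul1r ltr_nat.
have [k kP] : exists k, q ^+ k * vertex_spread n < e.
  have cv : q ^+ k * vertex_spread n @[k --> \oo] --> (0 : R).
    by rewrite -(mul0r (vertex_spread n)); apply: cvgM; [exact: cvg_expr|exact: cvg_cst].
  have : \forall k \near \oo, `|0 - q ^+ k * vertex_spread n| < e by exact: cvgr_dist_lt.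
  move=> [k _ kP]; exists k.
  by have := kP k (leqnn k); rewrite sub0r normrN; apply: le_lt_trans; exact: ler_norm.
exists k; have := @small_piece_sdk k n X s; rewrite -/q.
elim/supported_ind => [|z t D [w [Qw wr ->]] [a [b [-> aA bB]]]].
  by exists 0, 0; split; [rewrite addr0|exact: supported0|exact: supported0].
have piece C : (forall y, std_simplex R n y -> `|row 0 w - y| < e -> C (simplex_ext s y)) ->
    chain_in C << z *g mksimplex (fun x : std_simplex R n => simplex_ext s (set_val x *m w)) >>.
  move=> wC; apply: supportedU; apply: subset_trans (@range_mksimplex _ _ _ _) _.
  move=> _ [x _ <-]; have Qx := set_valP x; apply: wC.
    exact: convex_std_simplex.
  rewrite distrC; apply: le_lt_trans kP; exact: convex_comb_dist.
have [/piece wA|/piece wB] := eP _ (Qw 0).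
  by exists (<< z *g mksimplex (fun x : std_simplex R n => simplex_ext s (set_val x *m w)) >> + a), b;
    split; [rewrite addrA|apply: supportedD|].
by exists a, (<< z *g mksimplex (fun x : std_simplex R n => simplex_ext s (set_val x *m w)) >> + b);
  split; [rewrite addrCA|exact: aA|apply: supportedD].
Qed.

Lemma sdk_add k l n X (c : chain R n X) : sdk (k + l) c = sdk k (sdk l c).
Proof. exact: iterD. Qed.

Lemma sdk_split n X (c : chain R n X) (A B : set X) :
  open A -> open B -> chain_in (A `|` B) c ->
  exists k a b, [/\ sdk k c = a + b, chain_in A a & chain_in B b].
Proof.
move=> oA oB; elim/supported_ind => [|z s D sAB [k [a [b [kD aA bB]]]]].
  exists 0, 0, 0; split; first by rewrite addr0.
    exact: supported0.
  exact: supported0.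
have [l [a' [b' [kl aA' bB']]]] := sdk_split_simplex oA oB sAB.
(* The two parts need different numbers of subdivisions. Further subdivision keeps a chain inside
   the same set, so the sum of both numbers works for either part. *)
exists (l + k)%N, (sdk k a' *~ z + sdk l a), (sdk k b' *~ z + sdk l b); split.
- have -> : << z *g s >> = << s >> *~ z by rewrite freegU_mulz intz.
  rewrite [LHS]raddfD /= [X in X + _]raddfMz /= {1}addnC !sdk_add kl kD.
  by rewrite !raddfD /= mulrzDl addrACA.
- by apply: supportedD; [apply: supportedMz|]; apply: chain_in_sdk.
by apply: supportedD; [apply: supportedMz|]; apply: chain_in_sdk.
Qed.

End Mesh.

(** * Relative homology *)

Section RelativeHomology.
Context {R : realType}.
Implicit Types (X Y Z : topologicalType) (n k : nat).

(** Vanishing of a relative class. [homologous A c c'] unfolds to [null A (c - c')], so all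
    computations are carried out with [null]. *)
Definition null n X (A : set X) (c : chain R n X) : Prop :=
  exists b : chain R n.+1 X, chain_in A (c - boundary b).

Lemma chain_in_boundary n X (A : set X) (c : chain R n X) :
  chain_in A c -> chain_in A (boundary c).
Proof.
case: n c => [|n] c; first by move=> _; exact: supported0.
apply: supported_lift => s sA; apply: supported_sum => i _; apply: supportedU.
by apply: subset_trans sA => _ [x _ <-] /=; exists (face i x).
Qed.

(* The following two variants avoid the index [n.+1.-1]. *)
Lemma chain_in_boundaryS n X (A : set X) (c : chain R n.+1 X) :
  chain_in A c -> chain_in A (boundary c : chain R n X).
Proof. exact: chain_in_boundary. Qed.

Lemma boundary_boundaryS n X (c : chain R n.+1 X) :
  boundary (boundary c : chain R n X) = 0.
Proof. exact (@boundary_boundary R n.+1 X c). Qed.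

Lemma chain_in_set0 n X (c : chain R n X) : chain_in set0 c -> c = 0.
Proof.
move=> c0; apply/eqP; rewrite -dom_eq0; case e : (dom c) => [//|s l].
have := c0 s; rewrite e inE eqxx => /(_ isT) s0.
by have := s0 (s (simplex_vertex n)); case; exists (simplex_vertex n).
Qed.

Lemma chain_in_setI n X (A B : set X) (c : chain R n X) :
  chain_in A c -> chain_in B c -> chain_in (A `&` B) c.
Proof. by move=> cA cB s sc x xs; split; [exact: cA xs|exact: cB xs]. Qed.

Lemma chain_in_sub n X (A B : set X) (c : chain R n X) :
  A `<=` B -> chain_in A c -> chain_in B c.
Proof. by move=> AB cA s sc; apply: subset_trans AB; exact: cA. Qed.

Lemma chain_inT n X (c : chain R n X) : chain_in setT c.
Proof. by []. Qed.

Lemma chain_inD n X (A : set X) (c d : chain R n X) :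
  chain_in A c -> chain_in A d -> chain_in A (c + d).
Proof. exact: supportedD. Qed.

Lemma chain_inB n X (A : set X) (c d : chain R n X) :
  chain_in A c -> chain_in A d -> chain_in A (c - d).
Proof. exact: supportedB. Qed.

Lemma chain_inN n X (A : set X) (c : chain R n X) :
  chain_in A c -> chain_in A (- c).
Proof. exact: supportedN. Qed.

Lemma chain_inMz n X (A : set X) (c : chain R n X) (k : int) :
  chain_in A c -> chain_in A (c *~ k).
Proof. exact: supportedMz. Qed.

Lemma null_in n X (A : set X) (c : chain R n X) : chain_in A c -> null A c.
Proof. by move=> cA; exists 0; rewrite boundary0 subr0. Qed.

Lemma null_boundary n X (A : set X) (b : chain R n.+1 X) : null A (boundary b).
Proof. by exists b; rewrite subrr; exact: supported0. Qed.

Lemma null_sub n X (A B : set X) (c : chain R n X) :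
  A `<=` B -> null A c -> null B c.
Proof. by move=> AB [b bA]; exists b; apply: chain_in_sub bA. Qed.

Lemma nullD n X (A : set X) (c d : chain R n X) : null A c -> null A d -> null A (c + d).
Proof.
move=> [b bA] [e eA]; exists (b + e); rewrite boundaryD opprD addrACA.
exact: chain_inD.
Qed.

Lemma nullN n X (A : set X) (c : chain R n X) : null A c -> null A (- c).
Proof.
by move=> [b bA]; exists (- b); rewrite boundaryN -opprD; exact: chain_inN.
Qed.

Lemma nullB n X (A : set X) (c d : chain R n X) : null A c -> null A d -> null A (c - d).
Proof. by move=> cA dA; apply: nullD => //; apply: nullN. Qed.

Lemma nullMz n X (A : set X) (c : chain R n X) (k : int) : null A c -> null A (c *~ k).
Proof.
by move=> [b bA]; exists (b *~ k); rewrite boundaryMz -mulrzBl; exact: chain_inMz.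
Qed.

Lemma rel_cycle_in n X (A : set X) (c : chain R n X) : chain_in A c -> rel_cycle A c.
Proof. exact: chain_in_boundary. Qed.

Lemma rel_cycle_boundary n X (A : set X) (b : chain R n.+1 X) : rel_cycle A (boundary b).
Proof. by rewrite /rel_cycle boundary_boundary; exact: supported0. Qed.

Lemma rel_cycleD n X (A : set X) (c d : chain R n X) :
  rel_cycle A c -> rel_cycle A d -> rel_cycle A (c + d).
Proof. by rewrite /rel_cycle boundaryD; exact: chain_inD. Qed.

Lemma rel_cycleB n X (A : set X) (c d : chain R n X) :
  rel_cycle A c -> rel_cycle A d -> rel_cycle A (c - d).
Proof. by rewrite /rel_cycle boundaryB; exact: chain_inB. Qed.

Lemma rel_cycleMz n X (A : set X) (c : chain R n X) (k : int) :
  rel_cycle A c -> rel_cycle A (c *~ k).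
Proof. by rewrite /rel_cycle boundaryMz; exact: chain_inMz. Qed.

Lemma rel_cycle_sub n X (A B : set X) (c : chain R n X) :
  A `<=` B -> rel_cycle A c -> rel_cycle B c.
Proof. exact: chain_in_sub. Qed.

Lemma null_rel_cycle n X (A : set X) (c : chain R n X) : null A c -> rel_cycle A c.
Proof.
move=> [b bA]; rewrite -(subrK (boundary b) c).
by apply: rel_cycleD; [exact: rel_cycle_in|exact: rel_cycle_boundary].
Qed.

Lemma null_sdk j n X (A : set X) (c : chain R n.+1 X) :
  rel_cycle A c -> null A (c - sdk j c).
Proof.
move=> cA; exists (sdhk j c); rewrite boundary_sdhkS opprB addrC subrK.
exact: chain_in_sdhk.
Qed.

(** * Mayer-Vietoris and excision for relative cycles *)

Section MayerVietoris.
Context {X : topologicalType} {A B : set X}.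
Hypotheses (oA : open A) (oB : open B).

(** As the homology relative to [A] and relative to [B] vanishes in degree [k.+1], the connecting
    map from the pair with [A] union [B] to the pair with the intersection is injective. It sends
    [z] to [a0], so [z] generates as soon as [a0] does. *)
Lemma mayer_vietoris_generator k (z a0 b0 : _) :
  (forall c : chain R k.+1 X, rel_cycle A c -> null A c) ->
  (forall c : chain R k.+1 X, rel_cycle B c -> null B c) ->
  boundary (z : chain R k.+1 X) = a0 + b0 -> chain_in A a0 -> chain_in B b0 ->
  (forall a : chain R k X, rel_cycle (A `&` B) a ->
     exists m : int, null (A `&` B) (a - a0 *~ m)) ->
  forall c : chain R k.+1 X, rel_cycle (A `|` B) c ->
    exists m : int, null (A `|` B) (c - z *~ m).
Proof.
move=> HA HB zab aA bB G c cAB.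
have [j [a [b [dab Aa Bb]]]] := sdk_split oA oB cAB.
have dc : boundary (sdk j c) = a + b by rewrite boundary_sdk.
have [|m [b' eAB]] := G a.
  apply: chain_in_setI; first exact: chain_in_boundary.
  have -> : a = boundary (sdk j c) - b by rewrite dc addrK.
  apply: rel_cycleB; first exact: rel_cycle_boundary.
  exact: chain_in_boundary.
exists m; set e := a - _ - _ in eAB.
have eA : chain_in A e by apply: chain_in_sub eAB => x [].
have eB : chain_in B e by apply: chain_in_sub eAB => x [].
have db' : boundary b' = a - a0 *~ m - e by rewrite /e subKr.
(* The difference splits into a subdivision error, a cycle relative to [B], and the chain [b'],
   which is a cycle relative to [A]; each of the three is null. *)
have -> : c - z *~ m = (c - sdk j c) + ((sdk j c - z *~ m - b') + b').
  by zmod.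
apply: nullD; first exact: null_sdk.
apply: nullD.
  apply: (null_sub (A := B)); first by move=> x; right.
  apply: HB; rewrite /rel_cycle !boundaryB dc boundaryMz zab db'.
  rewrite (_ : _ - _ = e + (b - b0 *~ m)); last first.
    by rewrite mulrzDl; zmod.
  by apply: chain_inD => //; apply: chain_inB => //; apply: chain_inMz.
apply: (null_sub (A := A)); first by move=> x; left.
apply: HA; rewrite /rel_cycle db'.
by apply: chain_inB => //; apply: chain_inB => //; apply: chain_inMz.
Qed.

(** Exactness at the intersection: two chains bounding [c], one modulo [A] and one modulo [B],
    differ by a cycle relative to the union, which is null by hypothesis, and can then be adjusted
    to a common bounding chain. *)
Lemma mayer_vietoris_inter n (c : chain R n.+1 X) :
  (forall d : chain R n.+2 X, rel_cycle (A `|` B) d -> null (A `|` B) d) ->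
  null A c -> null B c -> rel_cycle (A `&` B) c -> null (A `&` B) c.
Proof.
move=> V [d1 d1A] [d2 d2B] cAB.
have [|w fAB] := V (d1 - d2).
  rewrite /rel_cycle boundaryB.
  rewrite (_ : _ - _ = (c - boundary d2) - (c - boundary d1)); last first.
    by zmod.
  by apply: chain_inB; [apply: chain_in_sub d2B|apply: chain_in_sub d1A] => x;
    [right|left].
set f := d1 - d2 - _ in fAB.
have [j [fa [fb [fE Afa Bfb]]]] := sdk_split oA oB fAB.
have fE' : sdk j d1 - fa = sdk j d2 + boundary (sdk j w) + fb.
  have := fE; rewrite /f !sdkB -boundary_sdk => e.
  by rewrite -[fb](addKr fa) -e; zmod.
rewrite -[c](subrK (sdk j c)); apply: nullD; first exact: null_sdk.
exists (sdk j d1 - fa); apply: chain_in_setI.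
  rewrite boundaryB boundary_sdk (_ : _ - _ = sdk j (c - boundary d1) + boundary fa); last first.
    by rewrite sdkB; zmod.
  by apply: chain_inD; [exact: chain_in_sdk|exact: chain_in_boundaryS].
rewrite fE' !boundaryD boundary_boundaryS addr0 boundary_sdk.
rewrite (_ : _ - _ = sdk j (c - boundary d2) - boundary fb); last by rewrite sdkB; zmod.
by apply: chain_inB; [exact: chain_in_sdk|exact: chain_in_boundaryS].
Qed.

(** Exactness at the direct sum. The error term is split between [A] and [B], and each half is moved
    to the side where it is invisible. *)
Lemma mayer_vietoris_glue n (c1 c2 : chain R n.+1 X) :
  rel_cycle A c1 -> rel_cycle B c2 -> null (A `|` B) (c1 - c2) ->
  exists c, [/\ rel_cycle (A `&` B) c, null A (c - c1) & null B (c - c2)].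
Proof.
move=> c1A c2B [d fAB]; set f := c1 - c2 - _ in fAB.
have [j [fa [fb [fE Afa Bfb]]]] := sdk_split oA oB fAB.
have fE' : sdk j c1 - boundary (sdk j d) - fa = sdk j c2 + fb.
  have := fE; rewrite /f !sdkB -boundary_sdk => e.
  by rewrite -[fb](addKr fa) -e; zmod.
exists (sdk j c1 - boundary (sdk j d) - fa); split.
- apply: chain_in_setI.
    apply: rel_cycleB; last exact: rel_cycle_in.
    apply: rel_cycleB; last exact: rel_cycle_boundary.
    by rewrite /rel_cycle boundary_sdk; exact: chain_in_sdk.
  rewrite fE'; apply: rel_cycleD; last exact: rel_cycle_in.
  by rewrite /rel_cycle boundary_sdk; exact: chain_in_sdk.
- rewrite (_ : _ - c1 = - (c1 - sdk j c1) - boundary (sdk j d) - fa); last first.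
    by zmod.
  apply: nullB; last exact: null_in.
  by apply: nullB; [apply/nullN/null_sdk|exact: null_boundary].
rewrite fE' (_ : _ - c2 = - (c2 - sdk j c2) + fb); last by zmod.
by apply: nullD; [apply/nullN/null_sdk|exact: null_in].
Qed.

(** The surjective half of excision: after subdivision the part inside [B] is discarded. *)
Lemma excision_split n (c : chain R n.+1 X) :
  chain_in (A `|` B) c -> rel_cycle B c ->
  exists a, [/\ chain_in A a, rel_cycle B a & null B (c - a)].
Proof.
move=> cAB cB; have [j [a [b [cE Aa Bb]]]] := sdk_split oA oB cAB.
have aE : a = sdk j c - b by rewrite cE addrK.
exists a; split => //.
  rewrite aE; apply: rel_cycleB; last exact: rel_cycle_in.
  by rewrite /rel_cycle boundary_sdk; exact: chain_in_sdk.
rewrite aE (_ : _ - _ = (c - sdk j c) + b); last by zmod.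
by apply: nullD; [exact: null_sdk|exact: null_in].
Qed.

(** The injective half of excision at chain level. Both the bounding chain and the remainder stay
    inside [A], which allows them to be moved along a map that is continuous on [A] only. *)
Lemma excision_null n (a : chain R n.+1 X) :
  A `|` B = setT -> chain_in A a -> null B a ->
  exists2 d : chain R n.+2 X, chain_in A d & chain_in (A `&` B) (a - boundary d).
Proof.
move=> AB Aa [b eB].
have bAB : chain_in (A `|` B) b by rewrite AB; exact: chain_inT.
have [j [b1 [b2 [bE Ab Bb]]]] := sdk_split oA oB bAB.
have daB : chain_in B (boundary a) by apply: null_rel_cycle; exists b.
exists (b1 + sdhk j a).
  by apply: chain_inD => //; exact: chain_in_sdhk.
have E : a - boundary (b1 + sdhk j a) = sdk j a - boundary b1 + sdhk j (boundary a).
  by rewrite boundaryD boundary_sdhkS; zmod.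
rewrite E; apply: chain_in_setI.
  apply: chain_inD; last by apply: chain_in_sdhk; exact (chain_in_boundary Aa).
  by apply: chain_inB; [exact: chain_in_sdk|exact (chain_in_boundary Ab)].
apply: chain_inD; last by apply: chain_in_sdhk; exact daB.
have -> : b1 = sdk j b - b2 by rewrite bE addrK.
rewrite boundaryB boundary_sdk (_ : _ - _ = sdk j (a - boundary b) + boundary b2).
  by apply: chain_inD; [exact: chain_in_sdk|exact: chain_in_boundaryS].
by rewrite sdkB; zmod.
Qed.

End MayerVietoris.

Section Push.
Context {X Y : topologicalType}.

(** Charts are total functions that are continuous only on their domains, so [f] is a bare function
    here and continuity is demanded on the support of the chain. *)
Definition push n (f : X -> Y) : chain R n X -> chain R n Y :=
  fglift (fun s : simplex R n X =>
    << mksimplex (f \o s) >> : {freeg (simplex R n Y)}).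

HB.instance Definition _ n f := GRing.Additive.on (@push n f).

Lemma pushU n f (s : simplex R n X) : push f << s >> = << mksimplex (f \o s) >>.
Proof. exact: liftU1. Qed.

Lemma local_comp_continuous n (U : set X) (f : X -> Y) (s : simplex R n X) :
  (forall x, U x -> {for x, continuous f}) -> range s `<=` U -> continuous (f \o s).
Proof.
move=> fU sU x; apply: continuous_comp; first exact: cts_fun.
by apply: fU; apply: sU; exists x.
Qed.

Lemma boundary_push n (U : set X) f (c : chain R n X) :
  (forall x, U x -> {for x, continuous f}) -> chain_in U c ->
  boundary (push f c) = push f (boundary c).
Proof.
case: n c => [|n] c fU Uc; first by rewrite [RHS]raddf0.
apply: (supported_ext (F := @boundary R n.+1 Y \o @push _ f)
  (G := @push _ f \o @boundary R n.+1 X)) Uc => s sU.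
change (boundary (push f (<< s >> : chain R n.+1 X)) =
  push f (boundary (<< s >> : chain R n.+1 X))).
rewrite pushU !boundaryU [RHS]raddf_sum; apply: eq_bigr => i _.
rewrite [RHS]raddfMz /= pushU; congr (<< _ >> *~ _).
apply: simplex_eq => x /=; rewrite !mksimplexE //.
  have siU : range (s \o face i) `<=` U.
    by apply: subset_trans sU => _ [y _ <-]; exists (face i y).
  exact (@local_comp_continuous _ U f (s \o face i : simplex R n X) fU siU).
exact (@local_comp_continuous _ U f s fU sU).
Qed.

Lemma chain_in_push n (U : set X) (V : set Y) f (c : chain R n X) :
  (forall x, U x -> V (f x)) -> chain_in U c -> chain_in V (push f c).
Proof.
move=> fUV; apply: supported_lift => s sU; apply: supportedU.
apply: subset_trans (@range_mksimplex _ _ _ _) _ => _ [x _ <-] /=.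
by apply: fUV; apply: sU; exists x.
Qed.

Lemma eq_push n (U : set X) f g (c : chain R n X) :
  (forall x, U x -> f x = g x) -> chain_in U c -> push f c = push g c.
Proof.
move=> fg; apply: (supported_ext (F := push f) (G := push g)) => s sU.
rewrite /= !pushU; congr << _ >>; apply: eq_mksimplex => x /=.
by apply: fg; apply: sU; exists x.
Qed.

End Push.

Lemma push_id n X (U : set X) (f : X -> X) (c : chain R n X) :
  (forall x, U x -> f x = x) -> chain_in U c -> push f c = c.
Proof.
move=> fid cU; rewrite (eq_push (g := idfun) _ cU); last by move=> x /fid.
apply: (additive_ext (F := push idfun) (G := idfun)) => s.
by rewrite /= pushU; congr << _ >>; rewrite -[RHS]mksimplex_id.
Qed.

Lemma push_push n X Y Z (U : set X) (f : X -> Y) (g : Y -> Z) (c : chain R n X) :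
  (forall x, U x -> {for x, continuous f}) -> chain_in U c ->
  push g (push f c) = push (g \o f) c.
Proof.
move=> fU; apply: (supported_ext (F := push g \o push f) (G := push (g \o f))) => s sU.
rewrite /= !pushU; congr << _ >>; apply: eq_mksimplex => x /=.
by rewrite mksimplexE //; exact: local_comp_continuous fU sU.
Qed.

Lemma pushforwardE n X Y (f : continuousType X Y) (c : chain R n X) :
  Defs.pushforward f c = push f c.
Proof.
apply: (additive_ext (F := fglift _) (G := push f)) => s.
by rewrite /= pushU liftU1; congr << _ >>; rewrite -[LHS]mksimplex_id.
Qed.

Lemma null_push n X Y (U A : set X) (B : set Y) (f : X -> Y) (c : chain R n X) :
  (forall x, U x -> {for x, continuous f}) ->
  (forall x, U x -> A x -> B (f x)) -> chain_in U c ->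
  (exists2 d : chain R n.+1 X, chain_in U d & chain_in (U `&` A) (c - boundary d)) ->
  null B (push f c).
Proof.
move=> fU fAB cU [d dU cdA]; exists (push f d).
rewrite (boundary_push fU dU) -raddfB.
by apply: chain_in_push cdA => x [Ux Ax]; exact: fAB.
Qed.

End RelativeHomology.

(** * Homotopy invariance *)

Section Prism.
Context {R : realType}.
Implicit Types (X Y : topologicalType) (n : nat).

Lemma row_lsub k m p (w : 'M[R]_(k, m + p)) i : row i (lsubmx w) = lsubmx (row i w).
Proof. by apply/rowP => j; rewrite !mxE. Qed.

Lemma row_rsub k m p (w : 'M[R]_(k, m + p)) i : row i (rsubmx w) = rsubmx (row i w).
Proof. by apply/rowP => j; rewrite !mxE. Qed.

Definition prism_set n : set 'rV[R]_(n.+1 + 1) :=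
  [set y | std_simplex R n (lsubmx y) /\ 0 <= rsubmx y 0 0 <= 1].

Lemma convex_prism_set n : convex_hull_closed (prism_set (n := n)).
Proof.
move=> k x w Qx Qw; split.
  rewrite -mulmx_lsub; apply: convex_std_simplex => // i.
  by rewrite row_lsub; have [] := Qw i.
have [x0 x1] := Qx; rewrite -mulmx_rsub mxE.
have w01 i : 0 <= rsubmx w i 0 <= 1.
  by have [_] := Qw i; rewrite -row_rsub mxE.
rewrite sumr_ge0 => [/=|i _]; last by rewrite mulr_ge0 //; case/andP: (w01 i).
rewrite -x1; apply: ler_sum => i _; rewrite -[leRHS]mulr1 ler_wpM2l //.
by case/andP: (w01 i).
Qed.

Definition prism_face n (i : 'I_n.+2) : 'M[R]_(n.+1 + 1, n.+2 + 1) :=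
  block_mx (face_mx i) 0 0 1%:M.

Lemma mul_prism_face n (i : 'I_n.+2) k (y : 'M[R]_(k, n.+1 + 1)) :
  y *m prism_face i = row_mx (lsubmx y *m face_mx i) (rsubmx y).
Proof.
by rewrite -{1}[y]hsubmxK mul_row_block !mulmx0 mulmx1 addr0 add0r.
Qed.

Lemma cosimplicial_prism_face :
  cosimplicial (m := fun n => (n.+1 + 1)%N) prism_face.
Proof.
move=> n; have [H HE] := @cosimplicial_face_mx R n.
exists (fun f => block_mx (H f) 0 0 1%:M) => i j.
by rewrite mulmx_block !mulmx0 !mul0mx HE !addr0 add0r mulmx1.
Qed.

Definition prism_level n (a : R) : achain n (n.+1 + 1) :=
  << row_mx 1%:M (const_mx a) >>.

Lemma abnd_prism_level n a : abnd (prism_level n.+1 a) =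
  codelta (m := fun n => (n.+1 + 1)%N) prism_face (prism_level n a).
Proof.
rewrite /prism_level abndU; apply: eq_bigr => i _; rewrite amulU; congr (<< _ >> *~ _).
rewrite mul_prism_face row_mxKl row_mxKr mul1mx.
apply/matrixP => k l; rewrite mxE; case: (split_ordP l) => j ->.
  by rewrite !row_mxEl !mxE.
by rewrite !row_mxEr !mxE.
Qed.

(** The triangulation of the prism is never written down: acyclic models fill the difference of top
    and bottom by cones from the first vertex of the bottom. *)
Definition prism n : achain n.+1 (n.+1 + 1) :=
  filling (m := fun n => (n.+1 + 1)%N) prism_face
    (fun n => prism_level n 1 - prism_level n 0)
    (fun n => row_mx (delta_mx 0 0) 0) n.

Lemma prism_target0 : deg (prism_level 0 1 - prism_level 0 0) = 0.
Proof. by rewrite raddfB /= /prism_level !degU subrr. Qed.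

Lemma prism_targetS n :
  abnd (prism_level n.+1 1 - prism_level n.+1 0) =
  codelta (m := fun n => (n.+1 + 1)%N) prism_face (prism_level n 1 - prism_level n 0).
Proof. by rewrite abnd_is_additive codelta_is_additive !abnd_prism_level. Qed.

Lemma prism_level_in n a : 0 <= a <= 1 -> supported (rows_in (prism_set (n := n))) (prism_level n a).
Proof.
move=> a01; apply: supportedU => i; split.
  by rewrite -row_lsub row_mxKl row1; exact: std_simplex_delta.
by rewrite -row_rsub row_mxKr !mxE.
Qed.

Lemma prism_in n : supported (rows_in (prism_set (n := n))) (prism n).
Proof.
apply: (supported_filling (Q := prism_set)) => [k i x [Qx x01]|k|k].
- rewrite mul_prism_face; split; first by rewrite row_mxKl; exact: face_mx_simplex.
  by rewrite row_mxKr.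
- split; first by rewrite row_mxKl; exact: std_simplex_delta.
  by rewrite row_mxKr mxE lexx ler01.
by apply: supportedB; apply: prism_level_in; rewrite ?lexx ?ler01.
Qed.

Definition prism_chain n X (h : 'rV[R]_n.+1 -> R -> X) : chain R n.+1 X :=
  realize (fun y : 'rV[R]_(n.+1 + 1) => h (lsubmx y) (rsubmx y 0 0)) (prism n).

Definition prism_continuous n X (h : 'rV[R]_n.+1 -> R -> X) : Prop :=
  {within prism_set (n := n),
    continuous (fun y : 'rV[R]_(n.+1 + 1) => h (lsubmx y) (rsubmx y 0 0))}.

Definition level_simplex n X (h : 'rV[R]_n.+1 -> R -> X) (a : R) : simplex R n X :=
  mksimplex (fun x : std_simplex R n => h (set_val x) a).

Lemma realize_prism_level n X (h : 'rV[R]_n.+1 -> R -> X) a :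
  realize (fun y : 'rV[R]_(n.+1 + 1) => h (lsubmx y) (rsubmx y 0 0)) (prism_level n a) =
  << level_simplex h a >>.
Proof.
rewrite /prism_level realizeU; congr << _ >>; apply: eq_mksimplex => x.
rewrite mul_mx_row row_mxKl row_mxKr mulmx1; congr (h _ _).
rewrite mxE; have [_ x1] := set_valP x; rewrite -[RHS]mul1r -x1 mulr_suml.
by apply: eq_bigr => i _; rewrite mxE.
Qed.

Lemma boundary_prism_chain0 X (h : 'rV[R]_1 -> R -> X) : prism_continuous h ->
  boundary (prism_chain h) = << level_simplex h 1 >> - << level_simplex h 0 >>.
Proof.
move=> hc; rewrite /prism_chain (boundary_realize (@convex_prism_set 0) hc (@prism_in 0)).
by rewrite (abnd_filling0 _ _ prism_target0) raddfB /= !realize_prism_level.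
Qed.

Lemma boundary_prism_chainS n X (h : 'rV[R]_n.+2 -> R -> X) : prism_continuous h ->
  boundary (prism_chain h) = << level_simplex h 1 >> - << level_simplex h 0 >> -
    \sum_(i < n.+2) prism_chain (fun x t => h (x *m face_mx i) t) *~ (-1) ^+ i.
Proof.
move=> hc; rewrite /prism_chain (boundary_realize (@convex_prism_set n.+1) hc (@prism_in n.+1)).
rewrite abnd_fillingS; last exact: prism_targetS; last exact: prism_target0; last first.
  exact: cosimplicial_prism_face.
rewrite [LHS]raddfB [X in X - _]raddfB /= !realize_prism_level; congr (_ - _).
rewrite [LHS]raddf_sum; apply: eq_bigr => i _; rewrite [LHS]raddfMz /= realize_amul.
congr (_ *~ _); apply: (additive_ext (F := realize _) (G := realize _)) => w.
rewrite /= !realizeU; congr << _ >>; apply: eq_mksimplex => x.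
by rewrite mul_prism_face row_mxKl row_mxKr.
Qed.

Lemma eq_prism_chain n X (h h' : 'rV[R]_n.+1 -> R -> X) :
  (forall x t, std_simplex R n x -> 0 <= t <= 1 -> h x t = h' x t) ->
  prism_chain h = prism_chain h'.
Proof.
move=> hh; apply: (eq_realize (@convex_prism_set n) _ (@prism_in n)) => y [Qy y01].
exact: hh.
Qed.

Lemma chain_in_prism_chain n X (A : set X) (h : 'rV[R]_n.+1 -> R -> X) :
  (forall x t, std_simplex R n x -> 0 <= t <= 1 -> A (h x t)) ->
  chain_in A (prism_chain h).
Proof.
move=> hA; apply: (chain_in_realize (@convex_prism_set n) _ (@prism_in n)) => y [Qy y01].
exact: hA.
Qed.

Lemma prism_lsub_cvg n (y : 'rV[R]_(n.+1 + 1)) : prism_set y ->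
  lsubmx y' @[y' --> within (prism_set (n := n)) (nbhs y)] -->
  within (std_simplex R n) (nbhs (lsubmx y)).
Proof.
move=> Qy P; rewrite /within /= => PQ.
have lc : lsubmx y' @[y' --> y] --> lsubmx y.
  apply: (@cvg_mx _ _ (nbhs y)) => i j; rewrite mxE; under eq_fun do rewrite mxE.
  exact: coord_continuous.
have := lc _ PQ; rewrite !nbhs_simpl /=; apply: filterS => y' /= H [Q' _].
exact: H.
Qed.

Lemma prism_rsub_cvg n (y : 'rV[R]_(n.+1 + 1)) :
  rsubmx y' 0 0 @[y' --> within (prism_set (n := n)) (nbhs y)] --> rsubmx y 0 0.
Proof.
apply: cvg_within_filter; rewrite mxE; under eq_fun do rewrite mxE.
exact: coord_continuous.
Qed.

Lemma prism_continuous_comp n X Y (h : X -> R -> Y) (u : 'rV[R]_n.+1 -> X) :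
  continuous (fun p : X * R => h p.1 p.2) ->
  {within std_simplex R n, continuous u} ->
  prism_continuous (fun x t => h (u x) t).
Proof.
move=> hc /subspace_continuousP uc; apply/subspace_continuousP => y Qy.
have := Qy => -[Qly _].
have l := cvg_comp _ _ (prism_lsub_cvg Qy) (uc _ Qly).
exact: (cvg_comp _ _ (cvg_pair l (@prism_rsub_cvg n y)) (hc (u (lsubmx y), rsubmx y 0 0))).
Qed.

Section Homotopy.
Context {X Y : topologicalType} (h : X -> R -> Y).
Hypothesis hc : continuous (fun p : X * R => h p.1 p.2).

Definition homotopy_op n : chain R n X -> chain R n.+1 Y :=
  fglift (fun s : simplex R n X =>
    prism_chain (fun x t => h (simplex_ext s x) t) : {freeg (simplex R n.+1 Y)}).

HB.instance Definition _ n := GRing.Additive.on (@homotopy_op n).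

Lemma homotopy_opU n (s : simplex R n X) :
  homotopy_op << s >> = prism_chain (fun x t => h (simplex_ext s x) t).
Proof. exact: liftU1. Qed.

Lemma chain_in_homotopy_op n (A : set X) (B : set Y) (c : chain R n X) :
  (forall x t, A x -> 0 <= t <= 1 -> B (h x t)) -> chain_in A c ->
  chain_in B (homotopy_op c).
Proof.
move=> hAB; apply: supported_lift => s sA; apply: chain_in_prism_chain => x t Qx t01.
by apply: hAB => //; apply: sA; exists (insubd (simplex_vertex n) x).
Qed.

Lemma level_simplex_ext n (s : simplex R n X) a :
  level_simplex (fun x t => h (simplex_ext s x) t) a = mksimplex (h^~ a \o s).
Proof. by apply: eq_mksimplex => x /=; rewrite simplex_extE. Qed.

Lemma boundary_homotopy_op0 (c : chain R 0 X) :
  boundary (homotopy_op c) = push (h^~ 1) c - push (h^~ 0) c.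
Proof.
apply: (additive_ext (F := @boundary R 1 Y \o @homotopy_op 0)
  (G := push (h^~ 1) \- push (h^~ 0))) => s.
rewrite /GRing.sub_fun /comp /= homotopy_opU !pushU -!level_simplex_ext.
rewrite -boundary_prism_chain0 //.
by apply: prism_continuous_comp => //; exact: simplex_ext_continuous.
Qed.

Lemma boundary_homotopy_opS n (c : chain R n.+1 X) :
  boundary (homotopy_op c) =
  push (h^~ 1) c - push (h^~ 0) c - homotopy_op (boundary c).
Proof.
apply: (additive_ext (F := @boundary R n.+2 Y \o @homotopy_op n.+1)
  (G := (push (h^~ 1) \- push (h^~ 0)) \- (@homotopy_op n \o @boundary R n.+1 X))) => s.
change (boundary (homotopy_op (<< s >> : chain R n.+1 X)) =
  push (h^~ 1) (<< s >> : chain R n.+1 X) - push (h^~ 0) (<< s >> : chain R n.+1 X)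
  - homotopy_op (boundary (<< s >> : chain R n.+1 X))).
rewrite homotopy_opU !pushU boundaryU boundary_prism_chainS; last first.
  by apply: prism_continuous_comp => //; exact: simplex_ext_continuous.
rewrite !level_simplex_ext; congr (_ - _); rewrite [RHS]raddf_sum.
apply: eq_bigr => i _; rewrite [RHS]raddfMz /= homotopy_opU; congr (_ *~ _).
apply: eq_prism_chain => x t Qx t01; congr (h _ _).
rewrite -[x](simplex_val_insubd Qx) simplex_extE /= -face_mapE.
exact: (simplex_extE s (face i (insubd (simplex_vertex n) x))).
Qed.

Lemma homotopy_null n (A : set X) (B : set Y) (c : chain R n X) :
  (forall x t, A x -> 0 <= t <= 1 -> B (h x t)) -> rel_cycle A c ->
  null B (push (h^~ 1) c - push (h^~ 0) c).
Proof.
move=> hAB cA; exists (homotopy_op c); case: n c cA => [|n] c cA.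
  by rewrite boundary_homotopy_op0 subrr; exact: supported0.
rewrite boundary_homotopy_opS opprB addrC subrK.
exact: chain_in_homotopy_op cA.
Qed.

End Homotopy.

End Prism.

Section CompactSupport.
Context {R : realType}.
Implicit Types (X : topologicalType) (n : nat).

Lemma simplex_range_compact n X (s : simplex R n X) : compact (range s).
Proof.
have -> : range s = simplex_ext s @` std_simplex R n.
  apply/seteqP; split=> _ [x _ <-].
    by exists (set_val x); [exact: set_valP|rewrite simplex_extE].
  by exists (insubd (simplex_vertex n) x).
by apply: continuous_compact (@std_simplex_compact R n); exact: simplex_ext_continuous.
Qed.

Lemma chain_compact_support n X (A : set X) (c : chain R n X) :
  chain_in A c -> exists D, [/\ compact D, D `<=` A & chain_in D c].
Proof.
elim/supported_ind => [|k s c' sA [D [Dc DA cD]]].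
  by exists set0; split; [exact: compact0|exact: sub0set|exact: supported0].
exists (range s `|` D); split.
- by apply: compactU => //; exact: simplex_range_compact.
- by move=> x [/sA|/DA].
apply: chain_inD; first by apply: supportedU => x; left.
by apply: chain_in_sub cD => x; right.
Qed.

Lemma finite_subcover (X : topologicalType) (K : set X) (V : X -> set X) :
  compact K -> (forall x, K x -> nbhs x (V x)) ->
  exists2 s : seq X, (forall x, x \in s -> K x) &
    (forall y, K y -> exists2 x, x \in s & V x y).
Proof.
move=> /compact_near_coveringP nc KV.
(* The filter of all sufficiently large finite families of points of [K]; for such families near
   covering is the existence of a finite subcover. *)
pose F : set_system (seq X) := [set P | exists2 s0 : seq X, (forall x, x \in s0 -> K x) &
  forall s : seq X, (forall x, x \in s -> K x) -> {subset s0 <= s} -> P s].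
have FF : Filter F.
  split; first by exists [::].
  - move=> P Q [s0 s0K sP] [s1 s1K sQ]; exists (s0 ++ s1).
      by move=> x; rewrite mem_cat => /orP[/s0K|/s1K].
    move=> s sK ss; split; [apply: sP|apply: sQ] => // x xs; apply: ss;
      by rewrite mem_cat xs ?orbT.
  by move=> P Q PQ [s0 s0K sP]; exists s0 => // s sK ss; apply: PQ; apply: sP.
have [|s sK] := nc (seq X) F (fun s y => exists2 x, x \in s & V x y) FF.
  move=> x Kx; exists (V x, [set s : seq X | x \in s]).
    split; first exact: KV.
    exists [:: x]; first by move=> y; rewrite inE => /eqP ->.
    by move=> s _ ss; apply: ss; rewrite inE.
  by move=> [y s] /= [Vy xs]; exists x.
by move=> /(_ s sK (fun x xs => xs)) H; exists s.
Qed.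

End CompactSupport.

(** * Euclidean space relative to the complement of a closed set *)

Section EuclideanHomology.
Context {R : realType} {m : nat}.
Local Notation E := 'rV[R]_m.
Implicit Types (n k d p : nat) (K : set E).

Definition star_about (q : E) (K : set E) : Prop :=
  forall x t, K x -> 0 <= t <= 1 -> K (q + t *: (x - q)).

Definition convex_set2 (K : set E) : Prop := forall q, K q -> star_about q K.

Lemma compact_bound K (q : E) : compact K ->
  exists2 M : R, 0 < M & forall x, K x -> `|x - q| <= M.
Proof.
move=> /compact_bounded [M [_ MK]].
exists (`|M| + 1 + `|q|) => [|x Kx].
  by rewrite -addrA ltr_wpDl // ltr_pwDl.
apply: le_trans (ler_normB _ _) _; rewrite lerD2r.
by apply: (MK (`|M| + 1)) => //; rewrite ltr_pwDr // ler_norm.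
Qed.

Lemma chain_bound n (q : E) (c : chain R n E) :
  exists2 M : R, 0 < M & chain_in [set x | `|x - q| <= M] c.
Proof.
have [D [Dc _ cD]] := chain_compact_support (@chain_inT R n _ c).
have [M M0 MD] := compact_bound q Dc.
by exists M => //; apply: chain_in_sub cD.
Qed.

Lemma nbhs_norm_sub (q : E) (r : R) (A : set E) :
  0 < r -> (forall x, `|q - x| < r -> A x) -> nbhs q A.
Proof.
move=> r0 qA; apply: filterS (@nbhsx_ballx _ 'rV[R]_m q r r0) => x.
by rewrite mx_norm_ball => /qA.
Qed.

Lemma chain_avoid n (q : E) (c : chain R n E) : chain_in [set~ q] c ->
  exists2 r : R, 0 < r & chain_in [set x | r < `|x - q|] c.
Proof.
move=> /chain_compact_support [D [Dc Dq cD]].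
have oD : open (~` D).
  by apply: closed_openC; apply: compact_closed => //; exact: norm_hausdorff.
have : nbhs q (~` D) by apply: open_nbhs_nbhs; split => // Dqq; exact: (Dq q Dqq).
move=> /nbhs_normP [r /= r0 rD]; exists (r / 2); first by rewrite divr_gt0.
apply: chain_in_sub cD => x Dx /=; rewrite ltNge; apply/negP => xr.
apply: (rD x) => //=; rewrite distrC; apply: le_lt_trans xr _.
by rewrite ltr_pdivrMr // ltr_pMr // ltr1n.
Qed.

Lemma cont_linear_homotopy (u v w : E) (a b : R) :
  continuous (fun p : E * R => u + (a + p.2 * b) *: (p.1 - v) + p.2 *: w).
Proof.
move=> p; apply: cvgD.
  apply: cvgD; first exact: cvg_cst.
  apply: cvgZ; last by apply: cvgB; [exact: cvg_fst|exact: cvg_cst].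
  by apply: cvgD; [exact: cvg_cst|apply: cvgM; [exact: cvg_snd|exact: cvg_cst]].
by apply: cvgZ; [exact: cvg_snd|exact: cvg_cst].
Qed.

(** Translation along [v] preserves the complement of [K] and finally pushes every bounded set into
    it. As chains have bounded support, the relative homology vanishes. *)
Lemma null_translate n K (v : E) (c : chain R n E) :
  (forall x t, ~ K x -> 0 <= t -> ~ K (x + t *: v)) ->
  (forall M, exists2 L, 0 <= L & forall x, `|x| <= M -> ~ K (x + L *: v)) ->
  rel_cycle (~` K) c -> null (~` K) c.
Proof.
move=> Kv KM cK; have [M _ cM] := chain_bound 0 c.
have [L L0 KL] := KM M.
pose h (x : E) (t : R) : E := 0 + (1 + t * 0) *: (x - 0) + t *: (L *: v).
have hE x t : h x t = x + (t * L) *: v.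
  by rewrite /h mulr0 addr0 scale1r add0r subr0 scalerA.
have hc := @cont_linear_homotopy 0 0 (L *: v) 1 0.
have := @homotopy_null R E E h hc n (~` K) (~` K) c _ cK.
rewrite (@push_id _ _ _ setT (h^~ 0)) //; last by move=> x _; rewrite /= hE mul0r scale0r addr0.
move=> H; rewrite -[c](subKr (push (h^~ 1) c)); apply: nullB.
  apply: null_in; apply: chain_in_push cM => x /=; rewrite subr0 => xM.
  by rewrite hE mul1r; exact: KL.
apply: H => x t Kx /andP[t0 _]; rewrite hE; apply: Kv => //.
exact: mulr_ge0.
Qed.

(** Affine subspaces of codimension [p] interpolate between the whole space and a point. Two
    opposite half planes of [plane q p] have it as union and [plane q p.+1] as intersection, so
    Mayer-Vietoris raises the codimension by one. *)
Definition plane (q : E) p : set E := [set x | forall i : 'I_m, (i < p)%N -> x 0 i = q 0 i].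

Definition half_plane (q : E) p (hp : (p < m)%N) (e : R) : set E :=
  [set x | plane q p x /\ 0 <= e * (x 0 (Ordinal hp) - q 0 (Ordinal hp))].

Lemma closed_coord_eq (i : 'I_m) (a : R) : closed [set x : E | x 0 i = a].
Proof.
apply: (closed_comp (f := fun x : E => x 0 i) _ (@closed_eq _ a)) => x _.
exact: coord_continuous.
Qed.

Lemma cvg_coordB (i : 'I_m) (e a : R) (x : E) :
  e * (y 0 i - a) @[y --> x] --> e * (x 0 i - a).
Proof.
apply: cvgM; first exact: cvg_cst.
by apply: cvgB; [exact: coord_continuous|exact: cvg_cst].
Qed.

Lemma closed_half_plane q p hp e : closed (@half_plane q p hp e).
Proof.
have -> : half_plane q hp e = plane q p `&`
   [set x | 0 <= e * (x 0 (Ordinal hp) - q 0 (Ordinal hp))] by [].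
apply: closedI.
  have -> : plane q p = \bigcap_(i in [set i : 'I_m | (i < p)%N]) [set x | x 0 i = q 0 i].
    by apply/seteqP; split=> x xq i; [exact: xq|exact: xq].
  by apply: closed_bigI => i _; exact: closed_coord_eq.
apply: (closed_comp (f := fun x : E => e * (x 0 (Ordinal hp) - q 0 (Ordinal hp)))
  _ (@closed_ge _ 0)) => x _.
exact: cvg_coordB.
Qed.

Lemma half_plane_null n q p hp e (c : chain R n E) : e != 0 ->
  rel_cycle (~` @half_plane q p hp e) c -> null (~` @half_plane q p hp e) c.
Proof.
move=> e0; pose j := Ordinal hp.
have vj : (delta_mx 0 j : E) 0 j = 1 by rewrite mxE !eqxx.
have vi (i : 'I_m) : (i < p)%N -> (delta_mx 0 j : E) 0 i = 0.
  move=> ip; rewrite mxE /= (_ : (i == j) = false) //.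
  by apply/eqP => ij; rewrite ij /= ltnn in ip.
have e2 : 0 < e * e by rewrite -expr2 exprn_even_gt0.
have shift (x : E) t i : (x + t *: (- e *: delta_mx 0 j)) 0 i = x 0 i - t * e * (delta_mx 0 j : E) 0 i.
  by rewrite !mxE mulNr mulrN mulrA.
apply: (@null_translate _ _ (- e *: delta_mx 0 j)) => [x t Kx t0 [xp xj]|M].
  apply: Kx; split => [i ip|].
    by rewrite -(xp i ip) shift vi // mulr0 subr0.
  apply: le_trans xj _; rewrite shift vj mulr1 addrAC -/j mulrBr lerBlDr lerDl.
  by rewrite mulrCA mulr_ge0 // ltW.
(* The shift is long enough to carry the coordinate of every point of norm at most [M] past that of
   [q]; the summand 1 makes the inequality strict. *)
exists ((`|e| * (`|M| + `|q|) + 1) / (e * e)).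
  by rewrite divr_ge0 ?ltW // ltr_wpDl // mulr_ge0 // addr_ge0.
move=> x xM [_]; rewrite shift vj mulr1 addrAC -/j mulrBr.
set L := _ / _; have -> : e * (L * e) = `|e| * (`|M| + `|q|) + 1.
  by rewrite mulrCA /L divfK // gt_eqF.
rewrite subr_ge0 leNgt => /negP; apply.
apply: (@le_lt_trans _ _ (`|e| * (`|M| + `|q|))); last by rewrite ltrDl.
apply: le_trans (ler_norm _) _; rewrite normrM ler_wpM2l //.
apply: le_trans (ler_normB _ _) _; apply: lerD; last exact: rV_norm_coord.
by apply: le_trans (rV_norm_coord x j) (le_trans xM (ler_norm M)).
Qed.

Lemma half_planeU q p hp :
  ~` @half_plane q p hp 1 `|` ~` @half_plane q p hp (-1) = ~` plane q p.+1.
Proof.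
rewrite -setCI; congr (~` _); apply/seteqP; split=> x /=.
  move=> [[xp xj] [_ xj']] i; rewrite ltnS leq_eqVlt => /orP[/eqP ip|]; last exact: xp.
  move: xj xj'; rewrite mul1r mulN1r oppr_ge0 => xj xj'.
  have -> : i = Ordinal hp by exact/val_inj.
  by apply/eqP; rewrite -subr_eq0 eq_le xj xj'.
move=> xp; have xq : plane q p x by move=> i ip; apply: xp; exact: ltnW.
by rewrite /half_plane /= (xp (Ordinal hp) (ltnSn p)) subrr !mulr0 lexx.
Qed.

Lemma half_planeI q p hp :
  ~` @half_plane q p hp 1 `&` ~` @half_plane q p hp (-1) = ~` plane q p.
Proof.
rewrite -setCU; congr (~` _); apply/seteqP; split=> x /=; first by case=> -[].
move=> xp; rewrite /half_plane /= mul1r mulN1r oppr_ge0.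
by case: (lerP 0 (x 0 (Ordinal hp) - q 0 (Ordinal hp))) => [h|/ltW h]; [left|right].
Qed.

Lemma plane_generator_step q p (hp : (p < m)%N) k (z a0 b0 : _) :
  boundary (z : chain R k.+1 E) = a0 + b0 ->
  chain_in (~` @half_plane q p hp 1) a0 -> chain_in (~` @half_plane q p hp (-1)) b0 ->
  (forall a : chain R k E, rel_cycle (~` plane q p) a ->
     exists j : int, null (~` plane q p) (a - a0 *~ j)) ->
  forall c : chain R k.+1 E, rel_cycle (~` plane q p.+1) c ->
    exists j : int, null (~` plane q p.+1) (c - z *~ j).
Proof.
rewrite -(half_planeU q hp) -(half_planeI q hp) => zab a0A b0B G.
have N1 : (1 : R) != 0 by exact: oner_neq0.
have N2 : (-1 : R) != 0 by rewrite oppr_eq0 oner_neq0.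
apply: (mayer_vietoris_generator _ _ _ _ zab a0A b0B G) => [||c|c].
- exact/closed_openC/closed_half_plane.
- exact/closed_openC/closed_half_plane.
- exact: half_plane_null.
exact: half_plane_null.
Qed.

Definition const_simplex n (y : E) : simplex R n E := cst y.

Lemma sum_signs n : \sum_(i < n) (-1 : int) ^+ i = (odd n)%:R.
Proof.
elim: n => [|n IH]; first by rewrite big_ord0.
by rewrite big_ord_recr /= IH -signr_odd; case: (odd n).
Qed.

Lemma boundary_const n y :
  boundary (<< const_simplex n.+1 y >> : chain R n.+1 E) =
  << const_simplex n y >> *~ (odd n)%:R.
Proof.
rewrite boundaryU -[odd n]negbK -[~~ odd n]/(odd n.+1) -[~~ odd n.+1]/(odd n.+2).
rewrite -sum_signs mulrz_sumr; apply: eq_bigr => i _; congr (<< _ >> *~ _).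
exact: simplex_eq.
Qed.

Lemma homologous_const n (c : chain R n E) (y : E) : rel_cycle set0 c ->
  exists j : int, null set0 (c - << const_simplex n y >> *~ j).
Proof.
move=> c0; pose h (x : E) (t : R) : E := y + (1 + t * (-1)) *: (x - y) + t *: 0.
have hc := @cont_linear_homotopy y y 0 1 (-1).
have H := @homotopy_null R E E h hc n set0 set0 c (fun x t => False_ind _) c0.
rewrite (@push_id _ _ _ setT (h^~ 0)) // in H; last first.
  by move=> x _; rewrite /h mul0r addr0 scale1r scale0r addr0 addrC subrK.
have [j cj] : exists j : int, push (h^~ 1) c = << const_simplex n y >> *~ j.
  elim/freeg_ind_dom0: (c) => [|k s D _ _ [j IH]].
    by exists 0; rewrite raddf0 mulr0z.
  exists (k + j); rewrite raddfD /= IH mulrzDr; congr (_ + _).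
  rewrite -[k]intz -freegU_mulz [push _ _]raddfMz /= pushU intz.
  congr (<< _ >> *~ _); apply: simplex_eq => x.
  have hE z : h z 1 = y by rewrite /h mul1r subrr scale0r addr0 scaler0 addr0.
  by rewrite mksimplexE /=; [rewrite hE|rewrite (_ : _ \o _ = cst y); [exact: cst_continuous|
    apply/funext => z /=; rewrite hE]].
exists j; rewrite -cj -opprB; exact: nullN.
Qed.

Lemma plane_null q d p (c : chain R d E) : (p <= m)%N -> (p < d)%N ->
  rel_cycle (~` plane q p) c -> null (~` plane q p) c.
Proof.
elim: p d c => [|p IH] [//|d] c pm pd.
  have -> : ~` plane q 0 = set0 by apply/seteqP; split=> x //; apply.
  move=> c0; have [j cj] := homologous_const q c0.
  rewrite -[c](subrK (<< const_simplex d.+1 q >> *~ j)); apply: nullD => //.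
  (* Homology of a point: the constant simplex of dimension [d.+1] bounds when [d.+1] is odd, and is
     not a cycle when [d.+1] is even, which forces the multiplicity to be 0. *)
  case od : (odd d); last first.
    rewrite (_ : _ *~ j = boundary (<< const_simplex d.+2 q >> *~ j)).
      exact: null_boundary.
    by rewrite boundaryMz boundary_const /= od mulr1z.
  suff -> : j = 0 by rewrite mulr0z; apply: null_in; exact: supported0.
  have : rel_cycle set0 (<< const_simplex d.+1 q >> *~ j : chain R d.+1 E).
    rewrite -[_ *~ j](subKr c) ; apply: rel_cycleB => //; exact: null_rel_cycle.
  rewrite /rel_cycle boundaryMz boundary_const od mulr1z => /chain_in_set0 /eqP.
  by rewrite freegU_mulz intz freegU_eq0 => /eqP.
(* Vanishing is the case of the generator 0 in the induction step. *)
move=> cp; have [|||a ap|j] := @plane_generator_step q p pm d 0 0 0 _ _ _ _ c cp.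
- by rewrite boundary0 addr0.
- exact: supported0.
- exact: supported0.
- by exists 0; rewrite mul0rz subr0; apply: IH => //; exact: ltnW.
by rewrite mul0rz subr0.
Qed.

Lemma plane_full q : plane q m = [set q].
Proof.
apply/seteqP; split=> x /= xq; last by rewrite xq.
by apply/rowP => i; apply: xq.
Qed.

Lemma point_null q d (c : chain R d E) : (m < d)%N ->
  rel_cycle [set~ q] c -> null [set~ q] c.
Proof. by move=> md; rewrite -(plane_full q); exact: plane_null. Qed.

Definition dilate (q : E) (L : R) (x : E) : E := q + L *: (x - q).

Lemma scale_continuous (q : E) (L : R) : continuous (dilate q L).
Proof.
move=> x; apply: (@cvg_mx _ _ (nbhs x)) => i j; rewrite !mxE.
under eq_fun do rewrite !mxE; apply: cvgD; first exact: cvg_cst.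
apply: cvgM; first exact: cvg_cst.
by apply: cvgD; [exact: coord_continuous|exact: cvg_cst].
Qed.

Lemma scale_null n K q (c : chain R n E) (L : R) :
  star_about q K -> 1 <= L -> rel_cycle (~` K) c ->
  null (~` K) (push (dilate q L) c - c).
Proof.
move=> Kq L1 cK; pose h (x : E) (t : R) : E := q + (1 + t * (L - 1)) *: (x - q) + t *: 0.
have hc := @cont_linear_homotopy q q 0 1 (L - 1).
have := @homotopy_null R E E h hc n (~` K) (~` K) c _ cK.
rewrite (@push_id _ _ _ setT (h^~ 0)) //; last first.
  by move=> x _; rewrite /h mul0r addr0 scale1r scale0r addr0 addrC subrK.
rewrite (@eq_push _ _ _ _ setT (h^~ 1) (dilate q L)) //; last first.
  by move=> x _; rewrite /h /dilate mul1r scaler0 addr0 [1 + _]addrC subrK.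
apply=> x t Kx /andP[t0 t1] Kh; apply: Kx; move: Kh; rewrite /h scaler0 addr0 => Kh.
have l1 : 1 <= 1 + t * (L - 1) by rewrite lerDl mulr_ge0 // subr_ge0.
have l0 : 0 < 1 + t * (L - 1) by exact: lt_le_trans l1.
have := Kq _ (1 + t * (L - 1))^-1 Kh; rewrite addrAC subrr add0r scalerA.
rewrite mulVf ?gt_eqF // scale1r [q + _]addrC subrK; apply.
by rewrite invr_ge0 (ltW l0) invf_le1.
Qed.

Lemma scale_away K q r : compact K -> 0 < r ->
  exists2 L : R, 1 <= L & forall x, r < `|x - q| -> ~ K (dilate q L x).
Proof.
move=> Kc r0; have [M M0 MK] := compact_bound q Kc.
exists (1 + M / r) => [|x xr /MK].
  by rewrite lerDl divr_ge0 // ltW.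
have L0 : 0 < 1 + M / r by rewrite ltr_wpDr // divr_ge0 // ltW.
rewrite /dilate addrAC subrr add0r normrZ gtr0_norm // leNgt => /negP; apply.
apply: (@lt_trans _ _ ((1 + M / r) * r)); last by rewrite ltr_pM2l.
by rewrite mulrDl divfK ?gt_eqF // mul1r ltrDr.
Qed.

(** A chain that is null off [q] is already null off a small ball around [q]. The dilation about
    [q], homotopic to the identity off the star-shaped [K], expands the outside of this ball beyond
    [K]. *)
Lemma star_null n K q (c : chain R n E) : compact K -> star_about q K ->
  rel_cycle (~` K) c -> null [set~ q] c -> null (~` K) c.
Proof.
move=> Kc Kq cK [b /chain_avoid [r r0 er]].
have [L L1 LK] := scale_away q Kc r0.
rewrite -[c](subKr (push (dilate q L) c)).
apply: nullB; last exact: scale_null.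
exists (push (dilate q L) b).
rewrite (@boundary_push _ _ _ _ setT); [|by move=> x _; exact: scale_continuous|exact: chain_inT].
by rewrite -raddfB; apply: chain_in_push er.
Qed.

(** The same dilation gives surjectivity: it moves the boundary of a cycle relative to the
    complement of [q] off all of [K]. *)
Lemma star_lift n K q (c : chain R n.+1 E) : compact K -> star_about q K -> K q ->
  rel_cycle [set~ q] c ->
  exists2 c', rel_cycle (~` K) c' & null [set~ q] (c' - c).
Proof.
move=> Kc Kq Kqq cq; have [r r0 er] := chain_avoid cq.
have [L L1 LK] := scale_away q Kc r0.
exists (push (dilate q L) c).
  rewrite /rel_cycle (@boundary_push _ _ _ _ setT) //; last by move=> x _; exact: scale_continuous.
  exact: chain_in_push er.
apply: scale_null => //; move=> x t -> _; by rewrite subrr scaler0 addr0.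
Qed.

Lemma convex_compact_null d K (c : chain R d E) : compact K -> convex_set2 K ->
  (m < d)%N -> rel_cycle (~` K) c -> null (~` K) c.
Proof.
move=> Kc Kx md cK; have [->|/set0P [q Kq]] := eqVneq K set0.
  by rewrite setC0; apply: null_in; exact: chain_inT.
apply: (star_null Kc (Kx q Kq)) => //; apply: point_null => //.
by apply: rel_cycle_sub cK => x Kx' xq; apply: Kx'; rewrite xq.
Qed.

Definition union_all (Ks : seq (set E)) : set E := [set x | exists2 K, K \in Ks & K x].

Lemma union_all_cons K Ks : union_all (K :: Ks) = K `|` union_all Ks.
Proof.
apply/seteqP; split=> x /=.
  by move=> [K']; rewrite inE => /orP[/eqP ->|K's] K'x; [left|right; exists K'].
case=> [Kx|[K' K's K'x]]; first by exists K; rewrite ?inE ?eqxx.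
by exists K'; rewrite // inE K's orbT.
Qed.

Definition all_convex_compact (Ks : seq (set E)) : Prop :=
  forall K, K \in Ks -> compact K /\ convex_set2 K.

Lemma union_all_compact Ks : all_convex_compact Ks -> compact (union_all Ks).
Proof.
elim: Ks => [|K Ks IH] KsP.
  have -> : union_all [::] = set0 by apply/seteqP; split=> x // [].
  exact: compact0.
rewrite union_all_cons; apply: compactU.
  by have [] := KsP K; rewrite ?inE ?eqxx.
by apply: IH => K' K's; apply: KsP; rewrite inE K's orbT.
Qed.

Lemma compact_openC (K : set E) : compact K -> open (~` K).
Proof.
by move=> Kc; apply: closed_openC; apply: compact_closed => //; exact: norm_hausdorff.
Qed.

Lemma union_all_setI K Ks : K `&` union_all Ks = union_all [seq K `&` K' | K' <- Ks].
Proof.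
apply/seteqP; split=> x /=.
  by move=> [Kx [K' K's K'x]]; exists (K `&` K') => //; exact: map_f.
by move=> [_ /mapP [K' K's ->] [Kx K'x]]; split => //; exists K'.
Qed.

Lemma all_convex_compact_setI K Ks : all_convex_compact (K :: Ks) ->
  all_convex_compact [seq K `&` K' | K' <- Ks].
Proof.
move=> KsP _ /mapP [K' K's ->].
have [Kc Kx] : compact K /\ convex_set2 K by apply: KsP; rewrite inE eqxx.
have [K'c K'x] : compact K' /\ convex_set2 K' by apply: KsP; rewrite inE K's orbT.
split; first by apply: compact_closedI => //; apply: compact_closed => //; exact: norm_hausdorff.
by move=> q [Kq K'q] x t [xK xK'] t01; split; [exact: Kx|exact: K'x].
Qed.

(** Induction on the number of pieces: the intersection of one piece with the union of the others is
    a union of fewer compact convex sets, and it is used one degree higher, which is still above the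
    dimension. *)
Lemma union_all_null Ks d (c : chain R d.+1 E) : all_convex_compact Ks ->
  (m < d.+1)%N -> rel_cycle (~` union_all Ks) c -> null (~` union_all Ks) c.
Proof.
have [l] := ubnP (size Ks); elim: l Ks d c => // l IH [|K Ks] d c /= ls KsP md.
  have -> : union_all [::] = set0 by apply/seteqP; split=> x // [].
  by move=> _; rewrite setC0; apply: null_in; exact: chain_inT.
rewrite union_all_cons setCU => cK.
have [Kc Kx] : compact K /\ convex_set2 K by apply: KsP; rewrite inE eqxx.
have KsP' : all_convex_compact Ks by move=> K' K's; apply: KsP; rewrite inE K's orbT.
apply: mayer_vietoris_inter => //.
- exact: compact_openC.
- exact/compact_openC/union_all_compact.
- move=> d'; rewrite -setCI union_all_setI; apply: IH; first by rewrite size_map.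
    exact: all_convex_compact_setI.
  exact: ltnW.
- by apply: convex_compact_null => //; apply: rel_cycle_sub cK => x [].
by apply: IH => //; apply: rel_cycle_sub cK => x [].
Qed.

(** In the top degree a class is detected on the pieces, because the homology one degree higher,
    relative to the complement of the intersection, vanishes. *)
Lemma union_all_local_null Ks d (c : chain R d.+1 E) : all_convex_compact Ks ->
  m = d.+1 -> (forall K, K \in Ks -> null (~` K) c) -> null (~` union_all Ks) c.
Proof.
move=> + md; elim: Ks => [|K Ks IH] KsP cK.
  have -> : union_all [::] = set0 by apply/seteqP; split=> x // [].
  by rewrite setC0; apply: null_in; exact: chain_inT.
rewrite union_all_cons setCU.
have [Kc Kx] : compact K /\ convex_set2 K by apply: KsP; rewrite inE eqxx.
have KsP' : all_convex_compact Ks by move=> K' K's; apply: KsP; rewrite inE K's orbT.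
have cK1 : null (~` K) c by apply: cK; rewrite inE eqxx.
have cK2 : null (~` union_all Ks) c.
  by apply: IH => // K' K's; apply: cK; rewrite inE K's orbT.
apply: mayer_vietoris_inter => //.
- exact: compact_openC.
- exact/compact_openC/union_all_compact.
- move=> d'; rewrite -setCI union_all_setI; apply: union_all_null; last by rewrite md.
  exact: all_convex_compact_setI.
by apply: chain_in_setI; exact: null_rel_cycle.
Qed.

Lemma norm_closed_ball_compact (q : E) r : compact [set x | `|x - q| <= r].
Proof.
apply: bounded_closed_compact.
  exists (`|r| + `|q|); split; first exact: num_real.
  move=> M rM x /= xr; apply: le_trans (ltW rM).
  rewrite -[x](subrK q); apply: le_trans (ler_normD _ _) _; rewrite lerD2r.
  exact: le_trans xr (ler_norm _).
have [r0|r0] := ltP r 0.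
  have -> : [set x | `|x - q| <= r] = set0; last exact: closed0.
  apply/seteqP; split=> x //= xr; have := le_lt_trans xr r0.
  by rewrite ltNge normr_ge0.
have -> : [set x | `|x - q| <= r] = \bigcap_(ib in [set: 'I_m * bool])
   [set x : E | 0 <= (-1) ^+ ib.2 * (x 0 ib.1 - (q 0 ib.1 - (-1) ^+ ib.2 * r))].
  have absE (t a : R) : `|t - a| <= r <->
      (0 <= 1 * (t - (a - 1 * r))) /\ (0 <= -1 * (t - (a - -1 * r))).
    rewrite ler_norml !mul1r !mulN1r opprK; split; first by move=> /andP[]; lra.
    by move=> [? ?]; apply/andP; split; lra.
  apply/seteqP; split=> x /= xr.
    move=> [i b] _ /=; have := le_trans (rV_norm_coord (x - q) i) xr.
    by rewrite !mxE => /absE [h1 h2]; case: b => /=; rewrite ?expr1 ?expr0.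
  apply: rV_norm_le => // i; rewrite !mxE; apply/absE.
  by split; [have := xr (i, false) I|have := xr (i, true) I].
apply: closed_bigI => -[i b] _.
apply: (closed_comp (f := fun x : E => (-1) ^+ b * (x 0 i - (q 0 i - (-1) ^+ b * r)))
  _ (@closed_ge _ 0)) => x _.
exact: cvg_coordB.
Qed.

Lemma norm_closed_ball_convex (q : E) r : convex_set2 [set x | `|x - q| <= r].
Proof.
move=> y /= yr x t xr /andP[t0 t1] /=.
have -> : y + t *: (x - y) - q = (1 - t) *: (y - q) + t *: (x - q).
  rewrite scalerBl scale1r !scalerBr; zmod.
apply: le_trans (ler_normD _ _) _; rewrite !normrZ ger0_norm ?subr_ge0 // ger0_norm //.
have -> : r = (1 - t) * r + t * r by rewrite -mulrDl subrK mul1r.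
by apply: lerD; apply: ler_wpM2l; rewrite ?subr_ge0.
Qed.

(** A bounding chain modulo the complement of a point leaves an error of compact support, hence
    works on a closed ball around the point. Finitely many such balls cover [K], and balls are
    convex. *)
Lemma compact_local_null K d (c : chain R d.+1 E) : m = d.+1 -> compact K ->
  (forall q, K q -> null [set~ q] c) -> null (~` K) c.
Proof.
move=> md Kc cK.
have ballP q : K q -> exists2 r : R, 0 < r & null (~` [set x | `|x - q| <= r]) c.
  move=> /cK [b /chain_avoid [r r0 er]]; exists r => //; exists b.
  by apply: chain_in_sub er => x /= xr; apply/negP; rewrite -ltNge.
pose rad q : R := if pselect (K q) is left Kq then projT1 (cid2 (ballP q Kq)) else 1.
have radP q : K q -> 0 < rad q /\ null (~` [set x | `|x - q| <= rad q]) c.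
  by move=> Kq; rewrite /rad; case: pselect => // Kq'; case: cid2.
have [|s sK sV] := finite_subcover (V := fun q => [set x | `|x - q| <= rad q]) Kc.
  move=> q Kq; have [r0 _] := radP q Kq; apply: (nbhs_norm_sub r0) => x /=.
  by rewrite distrC => /ltW.
apply: (null_sub (A := ~` union_all [seq [set x | `|x - q| <= rad q] | q <- s])).
  move=> x nx Kx; apply: nx; have [q qs qx] := sV x Kx.
  by exists [set x | `|x - q| <= rad q] => //; apply: map_f.
apply: union_all_local_null => // _ /mapP [q qs ->].
  by split; [exact: norm_closed_ball_compact|exact: norm_closed_ball_convex].
by have [] := radP q (sK q qs).
Qed.

End EuclideanHomology.

(** * Local homology of a manifold through charts *)

Section Charts.
Context {R : realType} {M : topologicalType} {d : nat}.
Hypothesis M_hausdorff : hausdorff_space M.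
Local Notation E := 'rV[R]_d.+1.
Variable c : chart R d.+1 M.
Local Notation phi := (chart_fun c).
Local Notation psi := (chart_inv c).

Lemma compact_openCM (K : set M) : compact K -> open (~` K).
Proof. by move=> Kc; apply: closed_openC; apply: compact_closed. Qed.

Lemma pointwise_continuous_within (T U : topologicalType) (A : set T) (f : T -> U) :
  (forall x, A x -> {for x, continuous f}) -> {within A, continuous f}.
Proof.
by move=> fA; apply/subspace_continuousP => x Ax; apply: cvg_within_filter; exact: fA.
Qed.

Lemma chart_inv_compact (K : set E) : K `<=` chart_cod c -> compact K -> compact (psi @` K).
Proof.
move=> Kc; apply: continuous_compact; apply: pointwise_continuous_within => x /Kc.
exact: chart_inv_cts.
Qed.

Lemma chart_fun_compact (K : set M) : K `<=` chart_dom c -> compact K -> compact (phi @` K).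
Proof.
move=> Kc; apply: continuous_compact; apply: pointwise_continuous_within => x /Kc.
exact: chart_fun_cts.
Qed.

Lemma chart_push_in n (a : chain R n M) :
  chain_in (chart_dom c) a -> chain_in (chart_cod c) (push phi a).
Proof. by apply: chain_in_push => x; exact: chart_funS. Qed.

Lemma chart_pushK n (a : chain R n M) :
  chain_in (chart_dom c) a -> push psi (push phi a) = a.
Proof.
move=> ca; rewrite (push_push _ _ ca); last exact: chart_fun_cts.
by apply: (push_id _ ca) => x; exact: chart_funK.
Qed.

(** The given bounding chain may leave the domain, where [phi] need not be continuous; excision
    first confines it to the chart. *)
Lemma chart_push_null n (K : set M) (a : chain R n.+1 M) :
  compact K -> K `<=` chart_dom c -> chain_in (chart_dom c) a ->
  null (~` K) a -> null (~` (phi @` K)) (push phi a).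
Proof.
move=> Kc Kd ca aK.
have AB : chart_dom c `|` ~` K = setT.
  apply/seteqP; split=> x // _; case: (pselect (K x)) => [/Kd|]; by [left|right].
have H := excision_null (@chart_dom_open _ _ _ c) (compact_openCM Kc) AB ca aK.
apply: (@null_push _ _ _ _ (chart_dom c) (~` K) (~` (phi @` K)) phi a _ _ ca H).
  exact: chart_fun_cts.
move=> x dx Kx [y Ky e]; apply: Kx.
by rewrite -(chart_funK dx) -e (chart_funK (Kd _ Ky)).
Qed.

Lemma chart_pull_null n (K : set E) (a : chain R n.+1 E) :
  compact K -> K `<=` chart_cod c -> chain_in (chart_cod c) a ->
  null (~` K) a -> null (~` (psi @` K)) (push psi a).
Proof.
move=> Kc Kd ca aK.
have AB : chart_cod c `|` ~` K = setT.
  apply/seteqP; split=> x // _; case: (pselect (K x)) => [/Kd|]; by [left|right].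
have H := excision_null (@chart_cod_open _ _ _ c) (compact_openC Kc) AB ca aK.
apply: (@null_push _ _ _ _ (chart_cod c) (~` K) (~` (psi @` K)) psi a _ _ ca H).
  exact: chart_inv_cts.
move=> x dx Kx [y Ky e]; apply: Kx.
by rewrite -(chart_invK dx) -e (chart_invK (Kd _ Ky)).
Qed.

Lemma chart_excise (K : set M) (z : chain R d.+1 M) :
  compact K -> K `<=` chart_dom c -> rel_cycle (~` K) z ->
  exists a, [/\ chain_in (chart_dom c) a, rel_cycle (~` K) a & null (~` K) (z - a)].
Proof.
move=> Kc Kd zK; apply: excision_split zK.
- exact: chart_dom_open.
- exact: compact_openCM.
move=> s _ x _; case: (pselect (K x)) => [/Kd|]; by [left|right].
Qed.

Lemma chart_funI (K : set M) : K `<=` chart_dom c -> psi @` (phi @` K) = K.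
Proof.
move=> Kd; apply/seteqP; split=> x.
  by move=> [_ [y Ky <-] <-]; rewrite chart_funK //; exact: Kd.
by move=> Kx; exists (phi x); [exists x|rewrite chart_funK //; exact: Kd].
Qed.

Lemma chart_invI (K : set E) : K `<=` chart_cod c -> phi @` (psi @` K) = K.
Proof.
move=> Kd; apply/seteqP; split=> x.
  by move=> [_ [y Ky <-] <-]; rewrite chart_invK //; exact: Kd.
by move=> Kx; exists (psi x); [exists x|rewrite chart_invK //; exact: Kd].
Qed.

Lemma chart_local_null (K : set M) (z : chain R d.+1 M) :
  compact K -> K `<=` chart_dom c -> rel_cycle (~` K) z ->
  (forall q, K q -> null [set~ q] z) -> null (~` K) z.
Proof.
move=> Kc Kd zK zq; have [a [ca aK za]] := chart_excise Kc Kd zK.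
rewrite -[z](subrK a); apply: nullD => //.
rewrite -(chart_pushK ca) -{1}(chart_funI Kd); apply: chart_pull_null.
- exact: chart_fun_compact.
- by move=> _ [x Kx <-]; apply: chart_funS; exact: Kd.
- exact: chart_push_in.
apply: compact_local_null => //; first exact: chart_fun_compact.
move=> _ [q Kq <-]; have dq := Kd _ Kq.
rewrite -[set1 _](image_set1 phi q); apply: chart_push_null => //.
- exact: compact_set1.
- by move=> x ->.
rewrite -[a](subKr z); apply: nullB; first exact: zq.
by apply: null_sub za => x Kx xq; apply: Kx; rewrite xq.
Qed.

Lemma chart_star_null (K : set E) (p : E) (z : chain R d.+1 M) :
  compact K -> K `<=` chart_cod c -> star_about p K -> K p ->
  rel_cycle (~` (psi @` K)) z -> null [set~ psi p] z -> null (~` (psi @` K)) z.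
Proof.
move=> Kc Kd Kp Kpp zK zp.
have Kd' : psi @` K `<=` chart_dom c by move=> _ [x Kx <-]; apply: chart_invS; exact: Kd.
have [a [ca aK za]] := chart_excise (chart_inv_compact Kd Kc) Kd' zK.
rewrite -[z](subrK a); apply: nullD => //.
rewrite -(chart_pushK ca); apply: chart_pull_null => //; first exact: chart_push_in.
apply: (star_null Kc Kp).
  rewrite /rel_cycle (boundary_push _ ca); last exact: chart_fun_cts.
  rewrite -{1}(chart_invI Kd).
  have caK : chain_in (chart_dom c `&` ~` (psi @` K)) (boundary a).
    by apply: chain_in_setI; [exact: chain_in_boundary|exact: aK].
  apply: chain_in_push caK => x [dx Kx] [y Ky e]; apply: Kx.
  by rewrite -(chart_funK dx) -e (chart_funK (Kd' _ Ky)).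
have -> : [set~ p] = ~` (phi @` [set psi p]).
  by rewrite image_set1 chart_invK //; exact: Kd.
apply: chart_push_null => //; first exact: compact_set1.
  by move=> x ->; apply: chart_invS; exact: Kd.
rewrite -[a](subKr z); apply: nullB => //.
by apply: null_sub za => x Kx xp; apply: Kx; rewrite xp; exists p.
Qed.

Definition local_generator (Z : chain R d.+1 M) (p : M) : Prop :=
  homology_generator [set~ p] Z.

(** Inside a chart, restriction from the complement of a compact convex [K] to the complement of any
    of its points is an isomorphism. Since [Z] is a global cycle, its class relative to [K]
    restricts to both points. *)
Lemma local_generator_transport (K : set E) (p q : E) (Z : chain R d.+1 M) :
  compact K -> K `<=` chart_cod c -> convex_set2 K -> K p -> K q ->
  boundary Z = 0 -> local_generator Z (psi p) -> local_generator Z (psi q).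
Proof.
move=> Kc Kd Kx Kp Kq Z0 [_ Zp]; split.
  by rewrite /rel_cycle Z0; exact: supported0.
move=> c' c'q.
have dq : chart_dom c (psi q) by apply: chart_invS; exact: Kd.
have q1 : [set psi q] `<=` chart_dom c by move=> x ->.
have [c1 [cc1 c1q c'c1]] := chart_excise (@compact_set1 _ (psi q)) q1 c'q.
have eq : rel_cycle [set~ q] (push phi c1).
  rewrite /rel_cycle (boundary_push _ cc1); last exact: chart_fun_cts.
  have c1I : chain_in (chart_dom c `&` [set~ psi q]) (boundary c1).
    by apply: chain_in_setI; [exact: chain_in_boundary|exact: c1q].
  apply: chain_in_push c1I => x [dx xq] /= xe; apply: xq.
  by rewrite /= -xe chart_funK.
(* The class at [q] is enlarged to one relative to [K], where it can be compared with [Z] at [p];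
   the relation found there is then restricted back to [q]. *)
have [c2 c2K c2q] := star_lift Kc (Kx q Kq) Kq eq.
have [|x [xc xK c2x]] := excision_split (@chart_cod_open _ _ _ c) (compact_openC Kc) _ c2K.
  move=> s _ y _; case: (pselect (K y)) => [/Kd|]; by [left|right].
have xq : null [set~ q] (x - push phi c1).
  rewrite (_ : _ - _ = (c2 - push phi c1) - (c2 - x)); last by zmod.
  by apply: nullB => //; apply: null_sub c2x => y Ky yq; apply: Ky; rewrite yq.
have yK : rel_cycle (~` (psi @` K)) (push psi x).
  rewrite /rel_cycle (boundary_push _ xc); last exact: chart_inv_cts.
  have xI : chain_in (chart_cod c `&` ~` K) (boundary x).
    by apply: chain_in_setI; [exact: chain_in_boundary|exact: xK].
  apply: chain_in_push xI => y [dy Ky] [z Kz e]; apply: Ky.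
  by rewrite -(chart_invK dy) -e (chart_invK (Kd _ Kz)).
have [|k yk] := Zp (push psi x).
  by apply: rel_cycle_sub yK => y Ky yp; apply: Ky; rewrite yp; exists p.
exists k.
have uK : null (~` (psi @` K)) (push psi x - Z *~ k).
  apply: (chart_star_null Kc Kd (Kx p Kp) Kp) => //.
  apply: rel_cycleB => //; apply: rel_cycleMz.
  by rewrite /rel_cycle Z0; exact: supported0.
have yc1 : null [set~ psi q] (push psi x - c1).
  rewrite -{1}(chart_pushK cc1) -[_ - _]raddfB -(image_set1 psi q).
  apply: chart_pull_null => //; first exact: compact_set1.
    by move=> y ->; exact: Kd.
  by apply: chain_inB => //; exact: chart_push_in.
suff : null [set~ psi q] (c' - Z *~ k) by [].
rewrite (_ : _ - _ = (c' - c1) - (push psi x - c1) + (push psi x - Z *~ k)); last by zmod.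
apply: nullD; first exact: nullB.
by apply: null_sub uK => y Ky yq; apply: Ky; rewrite yq; exists q.
Qed.

End Charts.

(** * Existence of the fundamental cycle *)

Section FundamentalClass.
Context {R : realType} {M : topologicalType} {d : nat}.
Variable oM : orientation R d.+1 M.
Hypothesis M_closed : closed_manifold R d.+1 M.

Let M_hausdorff : hausdorff_space M. Proof. by have [[]] := M_closed. Qed.

Definition oriented_over (K : set M) (c : chain R d.+1 M) : Prop :=
  rel_cycle (~` K) c /\ forall q, K q -> null [set~ q] (c - orient_at oM q).

Lemma compact_neighborhood (p : M) : exists K : set M, [/\ nbhs p K, compact K,
  (exists c : chart R d.+1 M, K `<=` chart_dom c) & exists c, oriented_over K c].
Proof.
have [[_ _ chM] _] := M_closed; have [c dp] := chM p.
have [U [z [nU zU zq]]] := orient_locally_consistent oM p.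
have nW : nbhs (chart_fun c p) (chart_cod c `&` (chart_inv c @^-1` U)).
  apply: filterI; first by apply: open_nbhs_nbhs; split;
    [exact: chart_cod_open|exact: chart_funS].
  have nU' : nbhs (chart_inv c (chart_fun c p)) U by rewrite chart_funK.
  exact: (chart_inv_cts (chart_funS dp) nU').
have [r /= r0 rW] : exists2 r : R, 0 < r & forall x, `|x - chart_fun c p| <= r ->
     (chart_cod c `&` (chart_inv c @^-1` U)) x.
  move: nW; rewrite -nbhs_ballE => -[r /= r0 rW]; exists (r / 2); first exact: divr_gt0.
  move=> x xr; apply: rW; rewrite mx_norm_ball /ball_ /= distrC.
  by apply: le_lt_trans xr _; rewrite ltr_pdivrMr // ltr_pMr // ltr1n.
pose B := [set x | `|x - chart_fun c p| <= r].
have Bc : B `<=` chart_cod c by move=> x /rW [].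
have Kd : chart_inv c @` B `<=` chart_dom c.
  by move=> _ [x Bx <-]; apply: chart_invS; exact: Bc.
have KU : chart_inv c @` B `<=` U by move=> _ [x /rW [_ Ux] <-].
exists (chart_inv c @` B); split.
- have nB : nbhs (chart_fun c p) B.
    by apply: (nbhs_norm_sub r0) => x /=; rewrite distrC => /ltW.
  have := chart_fun_cts dp nB; rewrite nbhs_simpl /= => H.
  have dc : nbhs p (chart_dom c) by apply: open_nbhs_nbhs; split => //; exact: chart_dom_open.
  apply: filterS (filterI H dc) => x [Bx dx]; exists (chart_fun c x) => //.
  exact: chart_funK.
- by apply: chart_inv_compact Bc _; exact: norm_closed_ball_compact.
- by exists c.
exists z; split; first by apply: rel_cycle_sub zU => x Ux Kx; apply: Ux; exact: KU.
by move=> q /KU /zq.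
Qed.

(** The intersection of the new piece with the old union lies in one chart, where agreement at every
    point implies agreement relative to the whole intersection. This is the hypothesis of
    Mayer-Vietoris gluing. *)
Lemma oriented_over_union (s : seq M) (V : M -> set M) :
  (forall p, [/\ compact (V p), (exists c : chart R d.+1 M, V p `<=` chart_dom c) &
     exists c, oriented_over (V p) c]) ->
  compact [set x | exists2 p, p \in s & V p x] /\
  exists c, oriented_over [set x | exists2 p, p \in s & V p x] c.
Proof.
move=> VP; elim: s => [|p s [Kc [c2 [c2K c2q]]]].
  have -> : [set x | exists2 p, p \in [::] & V p x] = set0.
    by apply/seteqP; split=> x //= [].
  split; first exact: compact0.
  by exists 0; split => //; rewrite /rel_cycle boundary0; exact: supported0.
have [Vc [ch Vd] [c1 [c1K c1q]]] := VP p.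
set K := [set x | exists2 p, p \in s & V p x] in Kc c2K c2q *.
have -> : [set x | exists2 q, q \in p :: s & V q x] = V p `|` K.
  apply/seteqP; split=> x /=.
    by move=> [q]; rewrite inE => /orP[/eqP ->|qs] Vqx; [left|right; exists q].
  by case=> [Vx|[q qs Vqx]]; [exists p|exists q] => //; rewrite inE ?eqxx ?qs ?orbT.
split; first exact: compactU.
have oV := compact_openCM M_hausdorff Vc; have oK := compact_openCM M_hausdorff Kc.
have [|c [cAB cA cB]] := mayer_vietoris_glue oV oK c1K c2K.
  rewrite -setCI; apply: (chart_local_null M_hausdorff (c := ch)).
  - by apply: compact_closedI => //; exact: compact_closed.
  - by move=> x [/Vd].
  - apply: rel_cycleB; [apply: rel_cycle_sub c1K|apply: rel_cycle_sub c2K] => x Vx [] //.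
  move=> q [Vq Kq]; rewrite (_ : _ - _ = (c1 - orient_at oM q) - (c2 - orient_at oM q)).
    by apply: nullB; [exact: c1q|exact: c2q].
  by zmod.
exists c; split; first by rewrite setCU.
move=> q [Vq|Kq].
  rewrite (_ : _ - _ = (c - c1) + (c1 - orient_at oM q)); last by zmod.
  apply: nullD; last exact: c1q.
  by apply: null_sub cA => x Vx xq; apply: Vx; rewrite xq.
rewrite (_ : _ - _ = (c - c2) + (c2 - orient_at oM q)); last by zmod.
apply: nullD; last exact: c2q.
by apply: null_sub cB => x Vx xq; apply: Vx; rewrite xq.
Qed.

Theorem fundamental_cycle_exists : exists c, fundamental_cycle oM c.
Proof.
pose V p := projT1 (cid (compact_neighborhood p)).
have VP p : [/\ nbhs p (V p), compact (V p),
  (exists c : chart R d.+1 M, V p `<=` chart_dom c) & exists c, oriented_over (V p) c].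
  by rewrite /V; case: cid.
have [|s _ sV] := finite_subcover (V := V) (proj2 M_closed).
  by move=> p _; have [] := VP p.
have [|_ [c [cK cq]]] := @oriented_over_union s V.
  by move=> p; have [] := VP p.
have KT : [set x | exists2 p, p \in s & V p x] = setT.
  by apply/seteqP; split=> x // _; apply: sV.
(* Over the whole manifold the complement is empty, so the relative cycle is an absolute one. *)
rewrite KT in cK cq; exists c; split; last by move=> p; exact: cq.
by apply: chain_in_set0; move: cK; rewrite /rel_cycle setCT.
Qed.

End FundamentalClass.

(** * Cross-polytopes *)

Section CrossPolytope.
Context {R : realType} {m : nat}.

Definition unit_row (p : nat) : 'rV[R]_m := \row_j (j == p :> nat)%:R.

(** The fan from [y] over the boundary of the cross-polytope on [k] consecutive axes starting at
    [p], written as an iterated join of the pairs of opposite unit vectors; [y] is the last vertex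
    of every simplex. *)
Fixpoint cross k (p : nat) (y : 'rV[R]_m) : achain (R := R) k m :=
  if k is k'.+1 then
    acone (unit_row p) (cross k' p.+1 y) - acone (- unit_row p) (cross k' p.+1 y)
  else << y >>.

Lemma crossS k p y : cross k.+1 p y =
  acone (unit_row p) (cross k p.+1 y) - acone (- unit_row p) (cross k p.+1 y).
Proof. by []. Qed.

Lemma abnd_cross k p (y : 'rV[R]_m) : abnd (cross k.+1 p y) =
  (cross k p (unit_row (p + k)) - cross k p (- unit_row (p + k))) *~ (-1) ^+ k.+1.
Proof.
elim: k p => [|k IH] p.
  rewrite /= addn0 raddfB /= !aconeU !liftU1 /afaces !big_ord_recl !big_ord0.
  rewrite !rowsub_lift0_cone !addr0 expr0 mulr1z /= /bump /= addn0 expr1.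
  have E (a b : 'rV[R]_m) : rowsub (lift (lift ord0 ord0)) (conem a (b : 'M[R]_(1, m))) = a.
    apply/matrixP => i j; rewrite mxE (ord1 i) -[RHS](conem0 a (b : 'M[R]_(1, m))).
    by congr (conem _ _ _ _); apply/val_inj.
  by rewrite !E !mulrN1z !opprB addrC addrA subrK.
rewrite crossS abnd_is_additive !abnd_cone IH addSnnS !crossS.
rewrite (raddfMz (acone (unit_row p))) (raddfMz (acone (- unit_row p))).
rewrite [(-1) ^+ k.+2]exprS mulN1r mulrNz.
move: (cross k p.+1 (unit_row _)) (cross k p.+1 (- _)) ((-1) ^+ k.+1) => A B s.
rewrite (raddfB (acone (unit_row p))) (raddfB (acone (- unit_row p))) /=.
have -> (a b c d : achain (R := R) k.+1 m) : a - b - (c - d) = (a - c) - (b - d) by zmod.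
by rewrite !mulrzBl; zmod.
Qed.

Definition cross_simplex k p (y : 'rV[R]_m) (w : 'M[R]_(k.+1, m)) : Prop :=
  row ord_max w = y /\
  forall i : 'I_k.+1, (i < k)%N -> exists s : bool, row i w = (-1) ^+ s *: unit_row (p + i).

Lemma conem_row0 k (b : 'rV[R]_m) (w : 'M[R]_(k.+1, m)) : row ord0 (conem b w) = b.
Proof. by apply/rowP => j; rewrite mxE conem0. Qed.

Lemma conem_rowS k (b : 'rV[R]_m) (w : 'M[R]_(k.+1, m)) (i : 'I_k.+1) :
  row (lift ord0 i) (conem b w) = row i w.
Proof. by apply/rowP => j; rewrite mxE [RHS]mxE; exact: conemS. Qed.

Lemma supported_cross k p (y : 'rV[R]_m) : supported (cross_simplex p y) (cross k p y).
Proof.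
elim: k p => [|k IH] p /=.
  by apply: supportedU; split=> [|//]; apply/rowP => j; rewrite mxE ord1.
have H (b : bool) : supported (cross_simplex p y)
    (acone ((-1) ^+ b *: unit_row p) (cross k p.+1 y)).
  apply: supported_lift (IH p.+1) => w [wy wi]; apply: supportedU; split.
    by rewrite (_ : ord_max = lift ord0 ord_max) ?conem_rowS //; exact/val_inj.
  move=> i; case: (unliftP ord0 i) => [j|] -> ij.
    by rewrite conem_rowS lift0 -addSnnS; exact: wi.
  by exists b; rewrite conem_row0 addn0.
apply: supportedB; first by have := H false; rewrite expr0 scale1r.
by have := H true; rewrite expr1 scaleN1r.
Qed.

Lemma cross_simplex_mul k (y : 'rV[R]_m) (w : 'M[R]_(k.+1, m)) (x : 'rV[R]_k.+1)
    (hk : (k <= m)%N) (i : 'I_k) :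
  cross_simplex 0 y w -> exists s : bool,
  (x *m w) 0 (widen_ord hk i) =
    (-1) ^+ s * x 0 (widen_ord (leqnSn k) i) + x 0 ord_max * y 0 (widen_ord hk i).
Proof.
move=> [wy wi]; have [s ws] := wi (widen_ord (leqnSn k) i) (ltn_ord i).
exists s; rewrite mul_rows summxE big_ord_recr /= wy.
congr (_ + _); last by rewrite mxE.
rewrite (bigD1 i) //= ws big1 ?addr0 => [|j ji]; first by rewrite !mxE eqxx mulr1 mulrC.
have [s' ->] := wi (widen_ord (leqnSn k) j) (ltn_ord j).
by rewrite !mxE /= add0n (inj_eq val_inj) eq_sym (negPf ji) !mulr0.
Qed.

(** A point of the fan whose first [k] coordinates vanish has weight 0 on every unit vector, hence
    is [y] itself. *)
Lemma cross_chain_avoid k (hk : (k < m)%N) (e : R) (y : 'rV[R]_m) :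
  (forall i : 'I_m, (i < k)%N -> y 0 i = 0) -> e * y 0 (Ordinal hk) < 0 ->
  chain_in (~` @half_plane R m 0 k hk e) (realize id (cross k 0 y)).
Proof.
move=> y0 ey; have hk' := ltnW hk.
move: (@supported_cross k 0 y); apply: supported_lift => w cw.
apply: supportedU; apply: subset_trans (@range_mksimplex _ _ _ _) _ => _ [x _ <-] [xp xe].
have [_ x1] := set_valP x; have [wy _] := cw.
have x0 (i : 'I_k) : set_val x 0 (widen_ord (leqnSn k) i) = 0.
  have [s ws] := cross_simplex_mul (set_val x) hk' i cw.
  have := xp (widen_ord hk' i) (ltn_ord i); rewrite /= ws mxE y0 //= mulr0 addr0.
  by move/eqP; rewrite mulf_eq0 signr_eq0 => /eqP.
have xm : set_val x 0 ord_max = 1.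
  by rewrite -x1 big_ord_recr /= big1 ?add0r // => i _; exact: x0.
move: xe; rewrite /= mul_rows summxE big_ord_recr /= big1 => [|i _]; last first.
  by rewrite x0 scale0r mxE.
by rewrite add0r wy xm scale1r mxE subr0 leNgt ey.
Qed.

Lemma boundary_realize_id (X := 'rV[R]_m : topologicalType) k (D : achain k m) :
  boundary (realize id D : chain R k X) = realize id (abnd D).
Proof.
by apply: (@boundary_realize R _ _ _ setT) => //; apply: continuous_subspaceT => x; exact: cvg_id.
Qed.
(** By induction on [k]: the boundary of a fan consists of the fans of one dimension less from two
    opposite unit vectors, which avoid opposite half planes. The connecting map therefore sends the
    fan to a generator, up to sign. *)
Lemma cross_generates k (km : (k <= m)%N) (y : 'rV[R]_m) (c : chain R k 'rV[R]_m) :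
  rel_cycle (~` plane 0 k) c ->
  exists j : int, null (~` plane 0 k) (c - realize id (cross k 0 y) *~ j).
Proof.
elim: k km y c => [|k IH] km y c.
  have -> : ~` plane (0 : 'rV[R]_m) 0 = set0 by apply/seteqP; split=> x //; apply.
  move=> c0; have [j cj] := homologous_const y c0; exists j.
  rewrite (_ : realize _ _ = << const_simplex 0 y >>) // realizeU.
  congr << _ >>; rewrite -[RHS]mksimplex_id; apply: eq_mksimplex => x.
  have [_] := set_valP x; rewrite big_ord1 => x1; apply/rowP => i.
  by rewrite mxE big_ord1 x1 mul1r.
pose D := (-1) ^+ k.+1 : int.
pose a0 := realize id (cross k 0 (- unit_row k)) *~ - D : chain R k 'rV[R]_m.
pose b0 := realize id (cross k 0 (unit_row k)) *~ D : chain R k 'rV[R]_m.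
have uk i : (i < k)%N -> forall j : 'I_m, (j < k)%N -> unit_row k 0 j = 0 :> R.
  by move=> _ j jk; rewrite mxE ltn_eqF.
apply: (@plane_generator_step R m 0 k km k _ a0 b0).
- rewrite boundary_realize_id abnd_cross !add0n [LHS]raddfMz /= raddfB /=.
  by rewrite /a0 /b0 mulrNz -mulNrz addrC -mulrzDl /=.
- apply: supportedMz; apply: cross_chain_avoid => [i ik|].
    by rewrite mxE (uk i) ?oppr0.
  by rewrite !mxE eqxx mul1r oppr_lt0 ltr01.
- apply: supportedMz; apply: cross_chain_avoid => [i ik|]; first by rewrite (uk i).
  by rewrite !mxE eqxx mulr1 oppr_lt0 ltr01.
move=> a /(IH (ltnW km) (- unit_row k)) [j aj]; exists (- D * j).
rewrite /a0 -mulrzA mulrA mulrNN -expr2 sqrr_sign mul1r //.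
Qed.

End CrossPolytope.

(** * The 120-cell *)

Section GoldenIntegers.

(* [(p, q)] stands for [p + q phi], where [phi ^+ 2 = phi + 1]. *)
Definition golden := (BinNums.Z * BinNums.Z)%type.

Definition gzero : golden := (0, 0).
Definition gadd (x y : golden) : golden := (x.1 + y.1, x.2 + y.2).
Definition gopp (x : golden) : golden := (- x.1, - x.2).
Definition gmul (x y : golden) : golden :=
  (x.1 * y.1 + x.2 * y.2, x.1 * y.2 + x.2 * y.1 + x.2 * y.2).

Definition gdot (u v : seq golden) : golden :=
  foldr (fun p a => gadd (gmul p.1 p.2) a) gzero (zip u v).

Fixpoint gdet (n : nat) (rows : seq (seq golden)) : golden :=
  if n is n'.+1 then
    if rows is r :: rows' then
      foldr (fun k a => gadd (gmul (if odd k then gopp (nth gzero r k) else nth gzero r k)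
        (gdet n' [seq take k x ++ drop k.+1 x | x <- rows'])) a) gzero (iota 0 n)
    else gzero
  else (1, 0).

Definition golden_code (k : nat) : golden :=
  nth gzero [:: (0, 0); (2, 0); (-2, 0); (1, 0); (-1, 0); (0, 1); (0, -1); (-1, 1); (1, -1)] k.

(* Twice the unit vectors of the 600-cell; the digits refer to [golden_code]. *)
Definition normal_codes : seq (seq nat) := [::
  [:: 1; 0; 0; 0]; [:: 2; 0; 0; 0]; [:: 0; 1; 0; 0]; [:: 0; 2; 0; 0]; [:: 0; 0; 1; 0];
  [:: 0; 0; 2; 0]; [:: 0; 0; 0; 1]; [:: 0; 0; 0; 2]; [:: 3; 3; 3; 3]; [:: 3; 3; 3; 4];
  [:: 3; 3; 4; 3]; [:: 3; 3; 4; 4]; [:: 3; 4; 3; 3]; [:: 3; 4; 3; 4]; [:: 3; 4; 4; 3];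
  [:: 3; 4; 4; 4]; [:: 4; 3; 3; 3]; [:: 4; 3; 3; 4]; [:: 4; 3; 4; 3]; [:: 4; 3; 4; 4];
  [:: 4; 4; 3; 3]; [:: 4; 4; 3; 4]; [:: 4; 4; 4; 3]; [:: 4; 4; 4; 4]; [:: 5; 3; 7; 0];
  [:: 5; 3; 8; 0]; [:: 5; 4; 7; 0]; [:: 5; 4; 8; 0]; [:: 6; 3; 7; 0]; [:: 6; 3; 8; 0];
  [:: 6; 4; 7; 0]; [:: 6; 4; 8; 0]; [:: 5; 0; 3; 7]; [:: 5; 0; 3; 8]; [:: 5; 0; 4; 7];
  [:: 5; 0; 4; 8]; [:: 6; 0; 3; 7]; [:: 6; 0; 3; 8]; [:: 6; 0; 4; 7]; [:: 6; 0; 4; 8];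
  [:: 5; 7; 0; 3]; [:: 5; 8; 0; 3]; [:: 5; 7; 0; 4]; [:: 5; 8; 0; 4]; [:: 6; 7; 0; 3];
  [:: 6; 8; 0; 3]; [:: 6; 7; 0; 4]; [:: 6; 8; 0; 4]; [:: 3; 5; 0; 7]; [:: 3; 5; 0; 8];
  [:: 4; 5; 0; 7]; [:: 4; 5; 0; 8]; [:: 3; 6; 0; 7]; [:: 3; 6; 0; 8]; [:: 4; 6; 0; 7];
  [:: 4; 6; 0; 8]; [:: 7; 5; 3; 0]; [:: 8; 5; 3; 0]; [:: 7; 5; 4; 0]; [:: 8; 5; 4; 0];
  [:: 7; 6; 3; 0]; [:: 8; 6; 3; 0]; [:: 7; 6; 4; 0]; [:: 8; 6; 4; 0]; [:: 0; 5; 7; 3];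
  [:: 0; 5; 8; 3]; [:: 0; 5; 7; 4]; [:: 0; 5; 8; 4]; [:: 0; 6; 7; 3]; [:: 0; 6; 8; 3];
  [:: 0; 6; 7; 4]; [:: 0; 6; 8; 4]; [:: 3; 7; 5; 0]; [:: 3; 8; 5; 0]; [:: 4; 7; 5; 0];
  [:: 4; 8; 5; 0]; [:: 3; 7; 6; 0]; [:: 3; 8; 6; 0]; [:: 4; 7; 6; 0]; [:: 4; 8; 6; 0];
  [:: 0; 3; 5; 7]; [:: 0; 3; 5; 8]; [:: 0; 4; 5; 7]; [:: 0; 4; 5; 8]; [:: 0; 3; 6; 7];
  [:: 0; 3; 6; 8]; [:: 0; 4; 6; 7]; [:: 0; 4; 6; 8]; [:: 7; 0; 5; 3]; [:: 8; 0; 5; 3];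
  [:: 7; 0; 5; 4]; [:: 8; 0; 5; 4]; [:: 7; 0; 6; 3]; [:: 8; 0; 6; 3]; [:: 7; 0; 6; 4];
  [:: 8; 0; 6; 4]; [:: 3; 0; 7; 5]; [:: 3; 0; 8; 5]; [:: 4; 0; 7; 5]; [:: 4; 0; 8; 5];
  [:: 3; 0; 7; 6]; [:: 3; 0; 8; 6]; [:: 4; 0; 7; 6]; [:: 4; 0; 8; 6]; [:: 7; 3; 0; 5];
  [:: 8; 3; 0; 5]; [:: 7; 4; 0; 5]; [:: 8; 4; 0; 5]; [:: 7; 3; 0; 6]; [:: 8; 3; 0; 6];
  [:: 7; 4; 0; 6]; [:: 8; 4; 0; 6]; [:: 0; 7; 3; 5]; [:: 0; 8; 3; 5]; [:: 0; 7; 4; 5];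
  [:: 0; 8; 4; 5]; [:: 0; 7; 3; 6]; [:: 0; 8; 3; 6]; [:: 0; 7; 4; 6]; [:: 0; 8; 4; 6]].

(* Found by a computer search. *)
Definition facet_colours : seq (seq nat) := [::
  [:: 3; 4]; [:: 0; 1; 2]; [:: 1; 2]; [:: 0; 3; 4]; [:: 2]; [:: 1]; [:: 3]; [:: 4];
  [:: 2; 3]; [:: 2; 4]; [:: 1; 3]; [:: 1; 4]; [:: 3]; [:: 4]; [:: 3]; [:: 4]; [:: 2];
  [:: 2]; [:: 1]; [:: 1]; [:: 0; 2; 3]; [:: 0; 2; 4]; [:: 0; 1; 3]; [:: 0; 1; 4];
  [:: 1; 2; 3; 4]; [:: 1; 2; 3; 4]; [:: 3; 4]; [:: 3; 4]; [:: 0; 1; 2]; [:: 0; 1; 2];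
  [:: 0]; [:: 0]; [:: 2; 3; 4]; [:: 2; 3; 4]; [:: 1; 3; 4]; [:: 1; 3; 4]; [:: 0; 2];
  [:: 0; 2]; [:: 0; 1]; [:: 0; 1]; [:: 3]; [:: 3]; [:: 4]; [:: 4]; [:: 0; 1; 2; 3];
  [:: 0]; [:: 0; 1; 2; 4]; [:: 0]; [:: 1; 2; 3; 4]; [:: 1; 2; 3; 4]; [:: 1; 2];
  [:: 1; 2]; [:: 0; 3; 4]; [:: 0; 3; 4]; [:: 0]; [:: 0]; [:: 2]; [:: 2]; [:: 1]; [:: 1];
  [:: 0; 2; 3; 4]; [:: 0]; [:: 0; 1; 3; 4]; [:: 0]; [:: 1; 2; 3]; [:: 1; 2; 3];
  [:: 1; 2; 4]; [:: 1; 2; 4]; [:: 0; 3]; [:: 0; 3]; [:: 0; 4]; [:: 0; 4]; [:: 2; 3; 4];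
  [:: 0; 2; 3; 4]; [:: 2]; [:: 0; 2]; [:: 1; 3; 4]; [:: 0; 1; 3; 4]; [:: 1]; [:: 0; 1];
  [:: 2]; [:: 2]; [:: 0; 2; 3; 4]; [:: 0; 2; 3; 4]; [:: 1]; [:: 1]; [:: 0; 1; 3; 4];
  [:: 0; 1; 3; 4]; [:: 2; 3]; [:: 0; 2; 3]; [:: 2; 4]; [:: 0; 2; 4]; [:: 1; 3];
  [:: 0; 1; 3]; [:: 1; 4]; [:: 0; 1; 4]; [:: 3]; [:: 3]; [:: 0; 1; 2; 3];
  [:: 0; 1; 2; 3]; [:: 4]; [:: 4]; [:: 0; 1; 2; 4]; [:: 0; 1; 2; 4]; [:: 1; 2; 3];
  [:: 0; 1; 2; 3]; [:: 3]; [:: 0; 3]; [:: 1; 2; 4]; [:: 0; 1; 2; 4]; [:: 4]; [:: 0; 4];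
  [:: 2; 3]; [:: 0; 2; 3]; [:: 1; 3]; [:: 0; 1; 3]; [:: 2; 4]; [:: 0; 2; 4]; [:: 1; 4];
  [:: 0; 1; 4]].

Definition normals2 : seq (seq golden) :=
  Eval vm_compute in [seq [seq golden_code k | k <- v] | v <- normal_codes].

Definition normal2 (i : nat) : seq golden := nth [::] normals2 i.

Definition facets := iota 0 120.

(** Adjacent doubled normals have product [2 phi]: the unit normals make an angle of 36 degrees, the
    edge angle of the 600-cell. *)
Definition neighbour_table : seq (seq nat) := Eval vm_compute in
  [seq [seq j <- facets | gdot (normal2 i) (normal2 j) == (0, 2)] | i <- facets].

Definition neighbours (i : nat) : seq nat := nth [::] neighbour_table i.

Definition gadj (i j : nat) : bool := j \in neighbours i.

(** The Gram determinant of four pairwise adjacent doubled normals is the square of [4 (phi - 1)],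
    so one comparison decides the sign of their determinant. *)
Definition gsign (rows : seq nat) : int :=
  if gdet 4 [seq normal2 m | m <- rows] == (-4, 4) then 1 else -1.

(* The signs of the determinants of the cliques of four normals. *)
Definition orient_table := Eval vm_compute in
  [seq [seq (j, [seq (k, [seq (l, gsign [:: i; j; k; l]) | l <- neighbours i &
      gadj j l && gadj k l]) | k <- neighbours i & gadj j k]) | j <- neighbours i] |
    i <- facets].

Definition assoc (T : Type) (d : T) (s : seq (nat * T)) (i : nat) : T :=
  foldr (fun p a => if p.1 == i then p.2 else a) d s.

Definition table_sign (i j k l : nat) : int :=
  assoc 0 (assoc [::] (assoc [::] (nth [::] orient_table i) j) k) l.

Definition gorient (i j k l : nat) : int :=
  if [&& gadj i j, gadj i k, gadj i l, gadj j k, gadj j l & gadj k l] then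
    table_sign i j k l
  else 0.

Definition colours (i : nat) : seq nat := nth [::] facet_colours i.

Lemma gdot_values : all (fun i => all (fun j => if i == j then gdot (normal2 i) (normal2 j) == (4, 0)
  else if gadj i j then gdot (normal2 i) (normal2 j) == (0, 2)
  else gdot (normal2 i) (normal2 j) \in [:: (2, 0); (-2, 2); (0, 0); (2, -2); (-2, 0); (0, -2); (-4, 0)]) facets) facets.
Proof. by vm_cast_no_check (erefl true). Qed.

Lemma gadj_sym : all (fun i => all (fun j => gadj i j == gadj j i) facets) facets.
Proof. by vm_cast_no_check (erefl true). Qed.

Lemma gadj_irr_check : all (fun i => ~~ gadj i i) facets.
Proof. by vm_cast_no_check (erefl true). Qed.

Lemma colours_comparable : all (fun i => all (fun j => gadj i j ==>
  (all (mem (colours j)) (colours i) || all (mem (colours i)) (colours j))) facets) facets.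
Proof. by vm_cast_no_check (erefl true). Qed.

Lemma colours_proper : all (fun i => has (mem (iota 0 5)) (colours i) &&
  ~~ all (mem (colours i)) (iota 0 5)) facets.
Proof. by vm_cast_no_check (erefl true). Qed.

(** The two properties that make the flags of the simplicial 600-cell a cycle: the weight alternates
    under exchange of neighbours in a flag, and the completions of a triangle have total weight 0.
    Only cliques are visited, which keeps the computation small. *)
Lemma gorient_check : all (fun i => all (fun j => let J := seq.filter (gadj j) (neighbours i) in
  all (fun k => let K := seq.filter (gadj k) J in
    (foldr (fun l a => table_sign i j k l + a) 0 K == 0) &&
    all (fun l => let o := table_sign i j k l in [&& table_sign j i k l == - o,
      table_sign i k j l == - o & table_sign i j l k == - o]) K) J) (neighbours i)) facets.
Proof. by vm_cast_no_check (erefl true). Qed.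

End GoldenIntegers.

Section Dot.
Context {R : realType} {n : nat}.
Implicit Types u v w x : 'rV[R]_n.

Definition dot u v : R := (u *m v^T) 0 0.

Lemma dotE u v : dot u v = \sum_i u 0 i * v 0 i.
Proof. by rewrite /dot mxE; apply: eq_bigr => i _; rewrite mxE. Qed.

Lemma dotC u v : dot u v = dot v u.
Proof. by rewrite !dotE; apply: eq_bigr => i _; rewrite mulrC. Qed.

Lemma dotDl u v w : dot (u + v) w = dot u w + dot v w.
Proof. by rewrite /dot mulmxDl mxE. Qed.

Lemma dotZl a u w : dot (a *: u) w = a * dot u w.
Proof. by rewrite /dot -scalemxAl mxE. Qed.

Lemma dotDr u v w : dot w (u + v) = dot w u + dot w v.
Proof. by rewrite dotC dotDl !(dotC w). Qed.

Lemma dotZr a u w : dot w (a *: u) = a * dot w u.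
Proof. by rewrite dotC dotZl (dotC w). Qed.

Lemma dot0l w : dot 0 w = 0.
Proof. by rewrite /dot mul0mx mxE. Qed.

Lemma dot0r w : dot w 0 = 0.
Proof. by rewrite dotC dot0l. Qed.

Lemma dotNl u w : dot (- u) w = - dot u w.
Proof. by rewrite -scaleN1r dotZl mulN1r. Qed.

Lemma dotNr u w : dot w (- u) = - dot w u.
Proof. by rewrite dotC dotNl dotC. Qed.

Lemma dotBl u v w : dot (u - v) w = dot u w - dot v w.
Proof. by rewrite dotDl dotNl. Qed.

Lemma dotBr u v w : dot w (u - v) = dot w u - dot w v.
Proof. by rewrite dotDr dotNr. Qed.

Lemma dot_suml (I : Type) (r : seq I) (P : pred I) (F : I -> 'rV[R]_n) w :
  dot (\sum_(i <- r | P i) F i) w = \sum_(i <- r | P i) dot (F i) w.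
Proof. by elim/big_rec2: _ => [|i a u _ <-]; rewrite ?dot0l ?dotDl. Qed.

Lemma dot_sumr (I : Type) (r : seq I) (P : pred I) (F : I -> 'rV[R]_n) w :
  dot w (\sum_(i <- r | P i) F i) = \sum_(i <- r | P i) dot w (F i).
Proof. by rewrite dotC dot_suml; apply: eq_bigr => i _; rewrite dotC. Qed.

Lemma dot_ge0 u : 0 <= dot u u.
Proof. by rewrite dotE; apply: sumr_ge0 => i _; rewrite -expr2 sqr_ge0. Qed.

Lemma dot_eq0 u : (dot u u == 0) = (u == 0).
Proof.
apply/eqP/eqP => [|->]; last by rewrite dot0l.
rewrite dotE => /eqP; rewrite psumr_eq0 => [/allP u0|i _]; last by rewrite -expr2 sqr_ge0.
apply/rowP => i; have := u0 i (mem_index_enum i).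
by rewrite /= mulf_eq0 orbb mxE => /eqP.
Qed.

Lemma dot_coord u i : u 0 i ^+ 2 <= dot u u.
Proof.
rewrite dotE (bigD1 i) //= -expr2 lerDl; apply: sumr_ge0 => j _.
by rewrite -expr2 sqr_ge0.
Qed.

Lemma dot_cvg (T : Type) (F : set_system T) {FF : Filter F} (f : T -> 'rV[R]_n) u v :
  f x @[x --> F] --> u -> dot v (f x) @[x --> F] --> dot v u.
Proof.
move=> fu; rewrite dotE; under eq_fun do rewrite dotE.
apply: cvg_big_sum => i; apply: cvgM; first exact: cvg_cst.
exact: (cvg_comp _ _ fu (@coord_continuous _ _ _ 0 i u)).
Qed.

Lemma dot_mulmx k (x : 'rV[R]_k) (w : 'M[R]_(k, n)) v :
  dot v (x *m w) = \sum_i x 0 i * dot v (row i w).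
Proof.
by rewrite mul_rows dot_sumr; apply: eq_bigr => i _; rewrite dotZr.
Qed.

End Dot.

(* In the Klein model of hyperbolic space the facet [F] lies on the hyperplane
   [dot (normal F) x = height], the polar of the Lorentz vector
   [(normal F, height)]; adjacent facets are orthogonal exactly when
   [dot (normal F) (normal F') = height ^+ 2]. *)
Record polytope (R : realType) (n : nat) := Polytope {
  facet : finType;
  normal : facet -> 'rV[R]_n;
  height : R;
  adjacent : rel facet;
  height_gt0 : 0 < height;
  height_lt1 : height ^+ 2 < 1;
  adjacent_sym : symmetric adjacent;
  adjacent_irr : irreflexive adjacent;
  normal_unit : forall F, dot (normal F) (normal F) = 1;
  normal_adjacent : forall F F', adjacent F F' ->
    dot (normal F) (normal F') = height ^+ 2;
  normal_apart : forall F F', F != F' -> ~~ adjacent F F' ->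
    1 + dot (normal F) (normal F') < 2 * height ^+ 2;
  polytope_inside : forall x, (forall F, dot (normal F) x <= height) -> dot x x < 1 }.

(** * The 120-cell as a right-angled polytope *)

Section GoldenEvaluation.
Context {R : realType}.

Definition phi : R := (1 + Num.sqrt 5) / 2.

Lemma phi_sqr : phi ^+ 2 = phi + 1.
Proof.
rewrite /phi expr_div_n sqrrD sqr_sqrtr ?ler0n // !expr1n mul1r.
by field.
Qed.

Lemma phi_gt0 : 0 < phi.
Proof. by rewrite divr_gt0 // ltr_pwDl // sqrtr_ge0. Qed.

Lemma phi_lb : 1618 < phi * 1000.
Proof. have := phi_sqr; have := phi_gt0 => ? ?; nra. Qed.

Lemma phi_ub : phi * 100 < 162.
Proof. have := phi_sqr; have := phi_gt0 => ? ?; nra. Qed.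

Definition geval (x : golden) : R := (int_of_Z x.1)%:~R + (int_of_Z x.2)%:~R * phi.

Lemma gevalE p q (a b : int) : int_of_Z p = a -> int_of_Z q = b ->
  geval (p, q) = a%:~R + b%:~R * phi.
Proof. by move=> <- <-. Qed.

Lemma gevalD x y : geval (gadd x y) = geval x + geval y.
Proof. rewrite /geval /= !rmorphD /=; ring. Qed.

Lemma gevalN x : geval (gopp x) = - geval x.
Proof. rewrite /geval /= !rmorphN /=; ring. Qed.

Lemma gevalM x y : geval (gmul x y) = geval x * geval y.
Proof.
rewrite /geval /= !rmorphD !rmorphM /=.
transitivity ((int_of_Z x.1)%:~R * (int_of_Z y.1)%:~R +
  ((int_of_Z x.1)%:~R * (int_of_Z y.2)%:~R + (int_of_Z x.2)%:~R * (int_of_Z y.1)%:~R) * phi +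
  (int_of_Z x.2)%:~R * (int_of_Z y.2)%:~R * phi ^+ 2 : R); last by ring.
rewrite phi_sqr; ring.
Qed.

Lemma geval0 : geval gzero = 0.
Proof. by rewrite /geval /= mul0r addr0. Qed.

Lemma gdotE (u v : seq golden) : size u = size v ->
  geval (gdot u v) = \sum_(k < size u) geval (nth gzero u k) * geval (nth gzero v k).
Proof.
elim: u v => [|a u IH] [|b v] //=; first by rewrite big_ord0 geval0.
by move=> [/IH uv]; rewrite big_ord_recl /= /gdot /= gevalD gevalM -uv.
Qed.

Definition normal120 (i : 'I_120) : 'rV[R]_4 :=
  \row_(k < 4) (geval (nth gzero (normal2 i) k) / 2).

Lemma facet_mem (i : 'I_120) : (i : nat) \in facets.
Proof. by rewrite mem_iota ltn_ord. Qed.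

Lemma size_normals2 : all (fun v => size v == 4%N) normals2 && (size normals2 == 120%N).
Proof. by vm_cast_no_check (erefl true). Qed.

Lemma size_normal2 (i : 'I_120) : size (normal2 i) = 4%N.
Proof.
have /andP[/allP H /eqP s] := size_normals2; apply/eqP/H/mem_nth.
by rewrite s ltn_ord.
Qed.

Lemma dot_normal120 i j :
  dot (normal120 i) (normal120 j) = geval (gdot (normal2 i) (normal2 j)) / 4.
Proof.
rewrite gdotE ?size_normal2 // dotE mulr_suml; apply: eq_bigr => k _.
by rewrite !mxE; field.
Qed.

(** Forced by the right angles: [height ^+ 2] must equal the product [phi / 2] of adjacent unit
    normals. *)
Definition height120 : R := Num.sqrt (phi / 2).

Lemma height120_sqr : height120 ^+ 2 = phi / 2.
Proof. by rewrite sqr_sqrtr // divr_ge0 // ltW // phi_gt0. Qed.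

Lemma height120_gt0 : 0 < height120.
Proof. by rewrite sqrtr_gt0 divr_gt0 // phi_gt0. Qed.

Lemma height120_ub : height120 * 2 <= 18 / 10.
Proof.
have := height120_sqr; have := height120_gt0; have := phi_ub => ? ? ?; nra.
Qed.

Lemma facets_allP (P : nat -> nat -> bool) :
  all (fun i => all (P i) facets) facets -> forall i j : 'I_120, P i j.
Proof. by move=> /allP H i j; have /allP := H _ (facet_mem i); apply; exact: facet_mem. Qed.

Lemma dot_normal120_unit i : dot (normal120 i) (normal120 i) = 1.
Proof.
have := facets_allP gdot_values i i; rewrite eqxx dot_normal120 => /eqP ->.
by rewrite (@gevalE _ _ 4 0) //; field.
Qed.

Lemma dot_normal120_adjacent (i j : 'I_120) : i != j -> gadj i j ->
  dot (normal120 i) (normal120 j) = height120 ^+ 2.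
Proof.
move=> ij aij; have := facets_allP gdot_values i j.
rewrite (negPf (ij : (i : nat) != j)) aij dot_normal120 height120_sqr => /eqP ->.
by rewrite (@gevalE _ _ 0 2) //; field.
Qed.

Lemma dot_normal120_apart (i j : 'I_120) : i != j -> ~~ gadj i j ->
  1 + dot (normal120 i) (normal120 j) < 2 * height120 ^+ 2.
Proof.
move=> ij aij; have := facets_allP gdot_values i j.
rewrite (negPf (ij : (i : nat) != j)) (negPf aij) dot_normal120 height120_sqr !inE.
have := phi_lb; have := phi_ub => ? ?.
move=> /or4P[||| /or4P[]] /eqP ->.
- by rewrite (@gevalE _ _ 2 0) //; lra.
- by rewrite (@gevalE _ _ (-2) 2) //; lra.
- by rewrite (@gevalE _ _ 0 0) //; lra.
- by rewrite (@gevalE _ _ 2 (-2)) //; lra.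
- by rewrite (@gevalE _ _ (-2) 0) //; lra.
- by rewrite (@gevalE _ _ 0 (-2)) //; lra.
- by rewrite (@gevalE _ _ (-4) 0) //; lra.
Qed.

(* Up to even permutations of the coordinates there are two cases, according to
   the order of the two smallest coordinates. *)
Lemma sorted_inside_even (a b c d : R) : 0 <= d -> d <= c -> c <= b -> b <= a ->
  10 * a <= 9 -> 809 * a + 500 * b + 309 * c <= 900 -> 10 * (a + b + c + d) <= 18 ->
  a ^+ 2 + b ^+ 2 + c ^+ 2 + d ^+ 2 < 1.
Proof. by move=> *; nra. Qed.

Lemma sorted_inside_odd (a b c d : R) : 0 <= d -> d <= c -> c <= b -> b <= a ->
  10 * a <= 9 -> 809 * a + 309 * b + 500 * c <= 900 -> 809 * a + 500 * b + 309 * d <= 900 ->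
  809 * b + 500 * a + 309 * c <= 900 -> 10 * (a + b + c + d) <= 18 -> a ^+ 2 + b ^+ 2 + c ^+ 2 + d ^+ 2 < 1.
Proof. by move=> *; nra. Qed.

(** The facet inequality [phi * a + b + (phi - 1) * c <= 18 / 10] with [phi] lowered to 1.618 and
    denominators cleared, so that only rational coefficients reach [nra]. *)
Definition even_bound (a b c d : R) : Prop := 809 * a + 500 * b + 309 * c <= 900.

Definition golden_bounds (a b c d : R) : Prop :=
  [/\ [/\ 0 <= a, 0 <= b, 0 <= c & 0 <= d],
      [/\ 10 * a <= 9, 10 * b <= 9, 10 * c <= 9 & 10 * d <= 9],
      10 * (a + b + c + d) <= 18 &
      [/\ [/\ even_bound a b c d, even_bound a c d b & even_bound a d b c],
          [/\ even_bound b a d c, even_bound b d c a & even_bound b c a d],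
          [/\ even_bound c d a b, even_bound c a b d & even_bound c b d a] &
          [/\ even_bound d c b a, even_bound d b a c & even_bound d a c b]]].

(** This 3-cycle and the double transposition below generate the even permutations, under which the
    normals with entries [phi], 1 and [phi - 1] are stable. *)
Lemma golden_bounds_rot a b c d : golden_bounds a b c d -> golden_bounds a c d b.
Proof. by rewrite /golden_bounds => -[[? ? ? ?] [? ? ? ?] ? [[? ? ?] [? ? ?] [? ? ?] [? ? ?]]]; do !split => //; lra. Qed.

Lemma golden_bounds_swap a b c d : golden_bounds a b c d -> golden_bounds b a d c.
Proof. by rewrite /golden_bounds => -[[? ? ? ?] [? ? ? ?] ? [[? ? ?] [? ? ?] [? ? ?] [? ? ?]]]; do !split => //; lra. Qed.

Lemma golden_inside_sorted a b c d : golden_bounds a b c d -> b <= a -> c <= b -> d <= b ->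
  a ^+ 2 + b ^+ 2 + c ^+ 2 + d ^+ 2 < 1.
Proof.
rewrite /golden_bounds /even_bound.
move=> [[? ? ? ?] [? _ _ _] s18 [[H1 _ H3] [H4 _ _] _ _]] ab bc bd.
have [cd|/ltW dc] := leP d c; first by apply: sorted_inside_even.
rewrite addrAC; apply: sorted_inside_odd => //.
all: clear -H1 H3 H4 s18; lra.
Qed.

Lemma golden_inside_max a b c d : golden_bounds a b c d -> b <= a -> c <= a -> d <= a ->
  a ^+ 2 + b ^+ 2 + c ^+ 2 + d ^+ 2 < 1.
Proof.
move=> G ab ac ad; have G1 := golden_bounds_rot G; have G2 := golden_bounds_rot G1.
have [cb|/ltW bc] := leP c b.
  have [db|/ltW bd] := leP d b; first exact: golden_inside_sorted.
  have := golden_inside_sorted G2 ad bd (le_trans cb bd); lra.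
have [dc|/ltW cd] := leP d c.
  have := golden_inside_sorted G1 ac dc bc; lra.
have := golden_inside_sorted G2 ad (le_trans bc cd) cd; lra.
Qed.

Lemma golden_inside a b c d : golden_bounds a b c d ->
  a ^+ 2 + b ^+ 2 + c ^+ 2 + d ^+ 2 < 1.
Proof.
wlog : a b c d / c <= a /\ d <= a /\ b <= a.
  move=> W G; have G1 := golden_bounds_swap G.
  have G2 := golden_bounds_swap (golden_bounds_rot G).
  have G3 := golden_bounds_swap (golden_bounds_rot (golden_bounds_rot G)).
  have [ab|/ltW ba] := leP b a; have [cd|/ltW dc] := leP d c.
  - have [ac|/ltW ca] := leP c a; first by apply: W => //; lra.
    by have := W _ _ _ _ (conj _ (conj _ _)) G2; lra.
  - have [ad|/ltW da] := leP d a; first by apply: W => //; lra.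
    by have := W _ _ _ _ (conj _ (conj _ _)) G3; lra.
  - have [bc|/ltW cb] := leP c b.
      by have := W _ _ _ _ (conj _ (conj _ _)) G1; lra.
    by have := W _ _ _ _ (conj _ (conj _ _)) G2; lra.
  have [bd|/ltW db] := leP d b.
    by have := W _ _ _ _ (conj _ (conj _ _)) G1; lra.
  by have := W _ _ _ _ (conj _ (conj _ _)) G3; lra.
by move=> [ca [da ba]] G; exact: golden_inside_max.
Qed.

Definition gflip (b : seq bool) (v : seq golden) : seq golden :=
  [seq if p.1 then gopp p.2 else p.2 | p <- zip b v].

Definition golden_patterns : seq (seq golden) := Eval vm_compute in
  [seq [seq golden_code k | k <- v] | v <- [:: [:: 1; 0; 0; 0]; [:: 0; 1; 0; 0];
    [:: 0; 0; 1; 0]; [:: 0; 0; 0; 1]; [:: 3; 3; 3; 3];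
    [:: 5; 3; 7; 0]; [:: 5; 0; 3; 7]; [:: 5; 7; 0; 3];
    [:: 3; 5; 0; 7]; [:: 7; 5; 3; 0]; [:: 0; 5; 7; 3];
    [:: 3; 7; 5; 0]; [:: 0; 3; 5; 7]; [:: 7; 0; 5; 3];
    [:: 3; 0; 7; 5]; [:: 7; 3; 0; 5]; [:: 0; 7; 3; 5]]%N].

Lemma golden_patterns_mem : all (fun v => all (fun b1 => all (fun b2 => all (fun b3 => all
  (fun b4 => gflip [:: b1; b2; b3; b4] v \in normals2) [:: false; true]) [:: false; true])
  [:: false; true]) [:: false; true]) golden_patterns.
Proof. by vm_cast_no_check (erefl true). Qed.

(** The normals are stable under changes of sign, so some facet has the entries of [v] with the
    signs of [x]; its inequality is one between absolute values. The factor 2 comes from the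
    doubling of the normals. *)
Lemma golden_pattern_le (x : 'rV[R]_4) (v : seq golden) :
  (forall i, dot (normal120 i) x <= height120) -> v \in golden_patterns ->
  \sum_(k < 4) geval (nth gzero v k) * `|x 0 k| <= height120 * 2.
Proof.
move=> xP vP; pose b k := x 0 k < 0.
pose s := [:: b 0; b 1; b 2%:R; b 3%:R].
have bm c : c \in [:: false; true] by case: c.
have /allP /(_ _ vP) := golden_patterns_mem.
move=> /allP /(_ _ (bm (b 0))) /allP /(_ _ (bm (b 1))) /allP /(_ _ (bm (b 2%:R))).
move=> /allP /(_ _ (bm (b 3%:R))) sm.
have /andP[_ /eqP sz] := size_normals2.
have im : (index (gflip s v) normals2 < 120)%N by rewrite -sz index_mem.
move: (nth_index [::] sm) => E.
suff H : \sum_(i < 4) normal120 (Ordinal im) 0 i * x 0 i =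
    (\sum_(k < 4) geval (nth gzero v k) * `|x 0 k|) / 2.
  by have := xP (Ordinal im); rewrite dotE H ler_pdivrMr.
rewrite mulr_suml.
have sv : size v = 4%N.
  by move: vP; rewrite !inE => vP; repeat case/orP: vP => [/eqP -> //|vP]; rewrite (eqP vP).
apply: eq_bigr => k _; rewrite mxE /normal2 /= E /gflip.
rewrite (nth_map (false, gzero)) ?size_zip ?sv ?ltn_ord // nth_zip ?sv //=.
have -> : nth false s k = b k.
  by case: k => -[|[|[|[|]]]] //= ?; congr b; exact/val_inj.
rewrite /b; case: ltrP => [xk|xk].
  by rewrite gevalN ltr0_norm //; ring.
by rewrite ger0_norm //; ring.
Qed.

Lemma even_bound_phi (a b c d s : R) : 0 <= a -> 0 <= c ->
  s <= 18 / 10 -> s = phi * a + b + (phi - 1) * c -> even_bound a b c d.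
Proof. by move=> a0 c0 + sE; rewrite sE /even_bound; have := phi_lb => ? ?; nra. Qed.

Lemma golden_bounds_patterns (a b c d : R) : 0 <= a -> 0 <= b -> 0 <= c -> 0 <= d ->
  (forall c0 c1 c2 c3, [:: c0; c1; c2; c3] \in golden_patterns ->
    geval c0 * a + geval c1 * b + geval c2 * c + geval c3 * d <= 18 / 10) ->
  golden_bounds a b c d.
Proof.
move=> a0 b0 c0 d0 P.
have [E2 E1 E0] : [/\ geval (2, 0) = 2, geval (1, 0) = 1 & geval (0, 0) = 0].
  by split; [rewrite (@gevalE _ _ 2 0)|rewrite (@gevalE _ _ 1 0)|rewrite (@gevalE _ _ 0 0)] => //; ring.
have [Ep Eq] : geval (0, 1) = phi /\ geval (-1, 1) = phi - 1.
  by split; [rewrite (@gevalE _ _ 0 1)|rewrite (@gevalE _ _ (-1) 1)] => //; ring.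
split; [by []| | |].
- by split; [have := P (2, 0) (0, 0) (0, 0) (0, 0) erefl|
    have := P (0, 0) (2, 0) (0, 0) (0, 0) erefl|
    have := P (0, 0) (0, 0) (2, 0) (0, 0) erefl|
    have := P (0, 0) (0, 0) (0, 0) (2, 0) erefl]; rewrite E2 E0; lra.
- by have := P (1, 0) (1, 0) (1, 0) (1, 0) erefl; rewrite E1; lra.
split; split.
- by apply: (even_bound_phi _ _ _ (P (0, 1) (1, 0) (-1, 1) (0, 0) erefl)) => //; rewrite Ep Eq E1 E0; ring.
- by apply: (even_bound_phi _ _ _ (P (0, 1) (0, 0) (1, 0) (-1, 1) erefl)) => //; rewrite Ep Eq E1 E0; ring.
- by apply: (even_bound_phi _ _ _ (P (0, 1) (-1, 1) (0, 0) (1, 0) erefl)) => //; rewrite Ep Eq E1 E0; ring.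
- by apply: (even_bound_phi _ _ _ (P (1, 0) (0, 1) (0, 0) (-1, 1) erefl)) => //; rewrite Ep Eq E1 E0; ring.
- by apply: (even_bound_phi _ _ _ (P (0, 0) (0, 1) (-1, 1) (1, 0) erefl)) => //; rewrite Ep Eq E1 E0; ring.
- by apply: (even_bound_phi _ _ _ (P (-1, 1) (0, 1) (1, 0) (0, 0) erefl)) => //; rewrite Ep Eq E1 E0; ring.
- by apply: (even_bound_phi _ _ _ (P (-1, 1) (0, 0) (0, 1) (1, 0) erefl)) => //; rewrite Ep Eq E1 E0; ring.
- by apply: (even_bound_phi _ _ _ (P (1, 0) (-1, 1) (0, 1) (0, 0) erefl)) => //; rewrite Ep Eq E1 E0; ring.
- by apply: (even_bound_phi _ _ _ (P (0, 0) (1, 0) (0, 1) (-1, 1) erefl)) => //; rewrite Ep Eq E1 E0; ring.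
- by apply: (even_bound_phi _ _ _ (P (0, 0) (-1, 1) (1, 0) (0, 1) erefl)) => //; rewrite Ep Eq E1 E0; ring.
- by apply: (even_bound_phi _ _ _ (P (-1, 1) (1, 0) (0, 0) (0, 1) erefl)) => //; rewrite Ep Eq E1 E0; ring.
- by apply: (even_bound_phi _ _ _ (P (1, 0) (0, 0) (-1, 1) (0, 1) erefl)) => //; rewrite Ep Eq E1 E0; ring.
Qed.

Lemma inside120 (x : 'rV[R]_4) : (forall i, dot (normal120 i) x <= height120) -> dot x x < 1.
Proof.
move=> xP; have H v := golden_pattern_le xP (v := v).
rewrite dotE !big_ord_recl big_ord0 addr0 !addrA -!expr2.
rewrite -!(real_normK (num_real (x 0 _))).
apply/golden_inside/golden_bounds_patterns => // c0 c1 c2 c3.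
move=> /H; rewrite !big_ord_recl big_ord0 addr0 !addrA => /le_trans; apply.
exact: height120_ub.
Qed.

Lemma gadj_symmetric : symmetric (fun i j : 'I_120 => gadj i j).
Proof. by move=> i j; apply/eqP; exact: (facets_allP gadj_sym). Qed.

Lemma gadj_irreflexive : irreflexive (fun i j : 'I_120 => gadj i j).
Proof.
by move=> i; have /allP /(_ _ (facet_mem i)) := gadj_irr_check => /negbTE.
Qed.

Definition polytope120 : polytope R 4.
Proof.
refine (@Polytope R 4 'I_120 normal120 height120 (fun i j => gadj i j) _ _ _ _ _ _ _ _).
- exact: height120_gt0.
- by rewrite height120_sqr; have := phi_ub; lra.
- exact: gadj_symmetric.
- exact: gadj_irreflexive.
- exact: dot_normal120_unit.
- move=> i j ij; apply: dot_normal120_adjacent => //.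
  by apply: contraTneq ij => ->; rewrite (gadj_irreflexive j).
- exact: dot_normal120_apart.
exact: inside120.
Defined.

End GoldenEvaluation.

(** * Hyperbolic reflections *)

Section Lorentz.
Context {R : realType} {n : nat}.
Local Notation E := 'rV[R]_n.
Local Notation L := 'rV[R]_(n + 1).
Implicit Types (x y : E) (X Y Z : L).

Definition last X : R := rsubmx X 0 0.

Definition lform X Y : R := dot (lsubmx X) (lsubmx Y) - last X * last Y.

Definition hom x : L := row_mx x 1%:M.

Definition proj X : E := (last X)^-1 *: lsubmx X.

Lemma lastD X Y : last (X + Y) = last X + last Y.
Proof. by rewrite /last raddfD mxE. Qed.

Lemma lastZ a X : last (a *: X) = a * last X.
Proof. by rewrite /last linearZ mxE. Qed.

Lemma last0 : last 0 = 0. Proof. by rewrite /last raddf0 mxE. Qed.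

Lemma last_sum (I : Type) (r : seq I) (P : pred I) (F : I -> L) :
  last (\sum_(i <- r | P i) F i) = \sum_(i <- r | P i) last (F i).
Proof. by elim/big_rec2: _ => [|i a u _ <-]; rewrite ?last0 ?lastD. Qed.

Lemma last_hom x : last (hom x) = 1.
Proof. by rewrite /last row_mxKr mxE eqxx. Qed.

Lemma lformC X Y : lform X Y = lform Y X.
Proof. by rewrite /lform dotC mulrC. Qed.

Lemma lformDl X Y Z : lform (X + Y) Z = lform X Z + lform Y Z.
Proof. by rewrite /lform raddfD dotDl lastD; ring. Qed.

Lemma lformZl a X Z : lform (a *: X) Z = a * lform X Z.
Proof. by rewrite /lform linearZ /= dotZl lastZ; ring. Qed.

Lemma lform0l Z : lform 0 Z = 0.
Proof. by rewrite -[0](scale0r (0 : L)) lformZl mul0r. Qed.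

Lemma lform_suml (I : Type) (r : seq I) (P : pred I) (F : I -> L) Z :
  lform (\sum_(i <- r | P i) F i) Z = \sum_(i <- r | P i) lform (F i) Z.
Proof. by elim/big_rec2: _ => [|i a u _ <-]; rewrite ?lform0l ?lformDl. Qed.

Lemma lform_hom x : lform (hom x) (hom x) = dot x x - 1.
Proof. by rewrite /lform /hom row_mxKl last_hom mulr1. Qed.

Lemma proj_hom x : proj (hom x) = x.
Proof. by rewrite /proj last_hom invr1 scale1r row_mxKl. Qed.

Lemma hom_proj X : last X != 0 -> hom (proj X) = (last X)^-1 *: X.
Proof.
move=> X0; rewrite -[X in RHS](hsubmxK X) [in RHS]scale_row_mx hsubmxK /hom /proj.
congr row_mx; apply/matrixP => i j; rewrite (ord1 i) (ord1 j) [RHS]mxE -/(last X).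
by rewrite mulVf // mxE eqxx.
Qed.

Lemma projZ a X : a != 0 -> proj (a *: X) = proj X.
Proof.
move=> a0; rewrite /proj lastZ linearZ /= scalerA.
by rewrite invfM [a^-1 * _]mulrC mulfVK.
Qed.

Lemma last_continuous : continuous last.
Proof.
have -> : last = (fun X : L => X 0 (rshift n 0)) by apply/funext => X; rewrite /last mxE.
exact: coord_continuous.
Qed.

Lemma lsubmx_continuous : continuous (lsubmx : L -> E).
Proof.
move=> X; apply: (@cvg_mx _ _ (nbhs X)) => i j; rewrite mxE; under eq_fun do rewrite mxE.
exact: coord_continuous.
Qed.

Lemma proj_cvg (T : Type) (F : set_system T) {FF : Filter F} (f : T -> L) X :
  last X != 0 -> f t @[t --> F] --> X -> proj (f t) @[t --> F] --> proj X.
Proof.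
move=> X0 fX; rewrite /proj; apply: (@cvg_mx _ _ F) => i j; rewrite mxE.
under eq_fun do rewrite mxE.
apply: cvgM; first by apply: cvgV => //; exact: (cvg_comp _ _ fX (@last_continuous X)).
apply: (cvg_comp f (fun Y : L => lsubmx Y i j) fX).
exact: (cvg_comp (lsubmx : L -> E) _ (@lsubmx_continuous X) (@coord_continuous _ _ _ i j _)).
Qed.

Lemma hom_continuous : continuous hom.
Proof.
move=> x; apply: (@cvg_mx _ _ (nbhs x)) => i j; rewrite /hom.
case: (split_ordP j) => k ->.
  rewrite row_mxEl; under eq_fun do rewrite row_mxEl; exact: coord_continuous.
rewrite row_mxEr; under eq_fun do rewrite row_mxEr; exact: cvg_cst.
Qed.

Definition lorentz (g : L -> L) : Prop :=
  linear g /\ forall X Y, lform (g X) (g Y) = lform X Y.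

Lemma lorentz_comp g h : lorentz g -> lorentz h -> lorentz (g \o h).
Proof.
move=> [gl gf] [hl hf]; split=> [a X Y|X Y] /=; first by rewrite hl gl.
by rewrite gf hf.
Qed.

End Lorentz.

Section Reflections.
Context {R : realType} {n : nat}.
Variable P : polytope R n.
Local Notation E := 'rV[R]_n.
Local Notation L := 'rV[R]_(n + 1).
Local Notation F := (facet P).
Local Notation h := (height P).
Implicit Types (x : E) (X Y : L) (i j : F) (S T : {set F}).

Definition pole i : L := row_mx (normal i) h%:M.

Definition kappa : R := 1 - h ^+ 2.

Lemma kappa_gt0 : 0 < kappa.
Proof. by rewrite subr_gt0 height_lt1. Qed.

Definition ht i X : R := - lform X (pole i).

Definition fht i x : R := h - dot (normal i) x.

Definition clique T : Prop := {in T &, forall i j, i != j -> adjacent i j}.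

Lemma cliqueS S T : S \subset T -> clique T -> clique S.
Proof. by move=> /fintype.subsetP ST cT i j /ST iT /ST jT; exact: cT. Qed.

Lemma htD i X Y : ht i (X + Y) = ht i X + ht i Y.
Proof. by rewrite /ht lformDl opprD. Qed.

Lemma htZ i a X : ht i (a *: X) = a * ht i X.
Proof. by rewrite /ht lformZl mulrN. Qed.

Lemma ht_sum (I : Type) (r : seq I) (Q : pred I) (G : I -> L) i :
  ht i (\sum_(k <- r | Q k) G k) = \sum_(k <- r | Q k) ht i (G k).
Proof. by rewrite /ht lform_suml sumrN. Qed.

Lemma ht_hom i x : ht i (hom x) = fht i x.
Proof.
rewrite /ht /lform /hom /pole !row_mxKl last_hom mul1r /last row_mxKr !mxE eqxx.
by rewrite mulr1n opprB dotC.
Qed.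

Lemma ht_pole i : ht i (pole i) = - kappa.
Proof.
rewrite /ht /lform /pole row_mxKl /last row_mxKr !mxE eqxx mulr1n normal_unit.
by rewrite -expr2.
Qed.

Lemma ht_pole_adjacent i j : adjacent i j -> ht i (pole j) = 0.
Proof.
move=> ij; rewrite /ht /lform /pole !row_mxKl /last !row_mxKr !mxE eqxx mulr1n.
by rewrite normal_adjacent 1?adjacent_sym // -expr2 subrr oppr0.
Qed.

(** The common form of reflections and foldings, which differ only in the coefficients [c]. The
    factor is [2 / kappa] because [kappa] is the Lorentz square of every pole. *)
Definition push_poles (c : F -> R) X : L := X + (2 / kappa) *: \sum_i c i *: pole i.

Lemma ht_push_poles T (c : F -> R) X i : clique (i |: T) ->
  (forall j, j \notin T -> c j = 0) ->
  ht i (push_poles c X) = ht i X - 2 * c i.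
Proof.
move=> cT cc; rewrite /push_poles htD htZ ht_sum; congr (_ + _).
rewrite (bigD1 i) //= htZ ht_pole big1 ?addr0 => [|j ji].
  by field; rewrite gt_eqF // kappa_gt0.
rewrite htZ; have [jT|/cc ->] := boolP (j \in T); last by rewrite mul0r.
by rewrite ht_pole_adjacent ?mulr0 //; apply: cT; rewrite ?setU11 ?setU1r // eq_sym.
Qed.

Lemma last_push_poles (c : F -> R) X :
  last (push_poles c X) = last X + 2 / kappa * (h * \sum_i c i).
Proof.
rewrite /push_poles lastD lastZ last_sum; congr (_ + _ * _); rewrite mulr_sumr.
apply: eq_bigr => i _; rewrite lastZ mulrC; congr (_ * _).
by rewrite /last /pole row_mxKr mxE eqxx.
Qed.

(** The poles of a clique are mutually orthogonal, so for a clique this is the product of commuting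
    reflections in the facets of [S], with no order to choose. *)
Definition reflect_in S X : L := push_poles (fun i => ht i X *+ (i \in S)) X.

Lemma ht_reflect S X i : clique (i |: S) ->
  ht i (reflect_in S X) = (if i \in S then - ht i X else ht i X).
Proof.
move=> cS; rewrite (ht_push_poles (T := S)) // => [|j /negbTE ->]; last by rewrite mulr0n.
by case: ifP => _; rewrite ?mulr1n ?mulr0n; ring.
Qed.

Lemma reflect_linear S : linear (reflect_in S).
Proof.
suff H a (X Y : L) : reflect_in S (a *: X + Y) = a *: reflect_in S X + reflect_in S Y by exact: H.
rewrite /reflect_in /push_poles.
have -> : \sum_i ht i (a *: X + Y) *+ (i \in S) *: pole i =
  a *: (\sum_i ht i X *+ (i \in S) *: pole i) + \sum_i ht i Y *+ (i \in S) *: pole i.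
  rewrite scaler_sumr -big_split /=; apply: eq_bigr => i _.
  by rewrite htD htZ scalerA -scalerDl mulrnDl mulrnAr.
move: (\sum_i _) (\sum_i _) => U V.
by apply/rowP => k; rewrite !mxE; ring.
Qed.

Lemma ht_zero i : ht i 0 = 0.
Proof. by rewrite /ht lform0l oppr0. Qed.

Lemma reflectZ S a X : reflect_in S (a *: X) = a *: reflect_in S X.
Proof.
have := reflect_linear S a X 0; rewrite addr0 => ->.
rewrite [reflect_in S 0](_ : _ = 0) ?addr0 //.
rewrite /reflect_in /push_poles add0r big1 ?scaler0 // => i _.
by rewrite ht_zero mul0rn scale0r.
Qed.

Lemma eq_reflect S S' X : (forall i, ht i X != 0 -> (i \in S) = (i \in S')) ->
  reflect_in S X = reflect_in S' X.
Proof.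
move=> SS'; rewrite /reflect_in /push_poles; congr (_ + _ *: _); apply: eq_bigr => i _.
have [->|/SS' ->] := eqVneq (ht i X) 0; by rewrite ?mul0rn.
Qed.

Lemma reflect_reflect S S' X : clique (S :|: S') ->
  reflect_in S (reflect_in S' X) = reflect_in ((S :\: S') :|: (S' :\: S)) X.
Proof.
move=> cS; rewrite {1}/reflect_in /push_poles.
rewrite [reflect_in S' X]/reflect_in {2}/push_poles -addrA -scalerDr -big_split /=.
rewrite /reflect_in /push_poles; congr (_ + _ *: _); apply: eq_bigr => i _.
rewrite -scalerDl; congr (_ *: _).
rewrite !inE; have [iS|iS] := boolP (i \in S); rewrite /= ?mulr0n ?addr0 ?andbF ?andbT //.
have cS' : clique (i |: S').
  by apply: cliqueS cS; apply: finset.setSU; rewrite finset.sub1set.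
rewrite -/(push_poles _ X) -/(reflect_in S' X) (ht_reflect _ cS') orbF.
by case: (i \in S') => /=; rewrite ?mulr0n ?mulr1n ?subrr ?add0r.
Qed.

Lemma reflectK S X : clique S -> reflect_in S (reflect_in S X) = X.
Proof.
move=> cS; rewrite reflect_reflect ?finset.setUid // finset.setDv.
rewrite /reflect_in /push_poles big1 ?scaler0 ?addr0 // => i _.
by rewrite inE mulr0n scale0r.
Qed.

Lemma reflect_lform S X Y : clique S ->
  lform (reflect_in S X) (reflect_in S Y) = lform X Y.
Proof.
move=> cS; set X' := reflect_in S X.
have E1 Z Z' : lform (reflect_in S Z) Z' =
    lform Z Z' - 2 / kappa * \sum_(i in S) ht i Z * ht i Z'.
  rewrite /reflect_in /push_poles lformDl lformZl lform_suml; congr (_ + _).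
  rewrite -mulrN -sumrN [in RHS]big_mkcond /=; congr (_ * _); apply: eq_bigr => i _.
  rewrite lformZl /ht [lform (pole i) _]lformC.
  by case: (i \in S); rewrite ?mulr1n ?mulr0n ?mul0r //; ring.
rewrite lformC E1 lformC /X' E1.
have -> : \sum_(i in S) ht i Y * ht i (reflect_in S X) = - \sum_(i in S) ht i X * ht i Y.
  rewrite -sumrN; apply: eq_bigr => i iS; rewrite ht_reflect ?iS; first by ring.
  by apply: cliqueS cS; rewrite finset.subUset finset.sub1set iS fintype.subxx.
by ring.
Qed.

Lemma lorentz_reflect S : clique S -> lorentz (reflect_in S).
Proof. by move=> cS; split=> [|X Y]; [exact: reflect_linear|exact: reflect_lform]. Qed.

Lemma ht_continuous i : continuous (ht i).
Proof.
move=> X; have A : dot (lsubmx Y) (lsubmx (pole i)) @[Y --> X] --> dot (lsubmx X) (lsubmx (pole i)).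
  rewrite dotC; under eq_fun do rewrite dotC.
  exact: dot_cvg (@lsubmx_continuous _ _ X).
have B : last Y * last (pole i) @[Y --> X] --> last X * last (pole i).
  exact: (cvgM (@last_continuous _ _ X) (cvg_cst _)).
exact: (cvgN (cvgB A B)).
Qed.

Lemma push_poles_cvg (T : Type) (G : set_system T) {FG : Filter G}
    (c : F -> T -> R) (d : F -> R) (f : T -> L) X :
  (forall i, c i t @[t --> G] --> d i) -> f t @[t --> G] --> X ->
  push_poles (c^~ t) (f t) @[t --> G] --> push_poles d X.
Proof.
move=> cd fX; apply: cvgD => //; apply: cvgZr.
apply: (@cvg_mx _ _ G) => k l; rewrite summxE; under eq_fun do rewrite summxE.
apply: cvg_big_sum => i; rewrite mxE; under eq_fun do rewrite mxE.
by apply: cvgM => //; exact: cvg_cst.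
Qed.

Lemma reflect_continuous S : continuous (reflect_in S).
Proof.
move=> X; apply: (@push_poles_cvg _ (nbhs X) _ (fun i Y => ht i Y *+ (i \in S))) => [i|].
  by case: (i \in S) => /=; [exact: ht_continuous|exact: cvg_cst].
exact: cvg_id.
Qed.

Definition body : set E := [set x | forall i, 0 <= fht i x].

Definition facets_at x : {set F} := [set i | fht i x == 0].

Lemma bodyE x : body x <-> forall i, dot (normal i) x <= h.
Proof. by split=> xP i; have := xP i; rewrite /fht subr_ge0. Qed.

Lemma body_inside x : body x -> dot x x < 1.
Proof. by move/bodyE; exact: polytope_inside. Qed.

(** The common point of two facet hyperplanes nearest to the origin has squared norm
    [2 h^2 / (1 + dot)], which exceeds 1 for facets that are not adjacent; so such facets cannot
    meet inside the ball. The square of the vector below expresses this minimality. *)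
Lemma body_clique x : body x -> clique (facets_at x).
Proof.
move=> Bx i j; rewrite !inE /fht => /eqP xi /eqP xj ij; apply: contraT => aij.
have := body_inside Bx; have := normal_apart ij aij.
have h0 := height_gt0 P; move/eqP: xi; rewrite subr_eq0 eq_sym => /eqP xi.
move/eqP: xj; rewrite subr_eq0 eq_sym => /eqP xj.
have := dot_ge0 (normal i + normal j - (2 * h) *: x).
have -> : dot (normal i + normal j - (2 * h) *: x) (normal i + normal j - (2 * h) *: x) =
    2 + 2 * dot (normal i) (normal j) + 4 * h ^+ 2 * dot x x - 8 * h ^+ 2.
  rewrite !(dotBl, dotBr, dotDl, dotDr, dotNl, dotNr, dotZl, dotZr, normal_unit).
  rewrite ?[dot x (normal i)]dotC ?[dot x (normal j)]dotC ?[dot (normal j) (normal i)]dotC.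
  by rewrite xi xj; ring.
move: (dot (normal i) (normal j)) (dot x x) => a b.
nra.
Qed.

Lemma fht_convex k (x : 'rV[R]_k.+1) (w : 'M[R]_(k.+1, n)) i : std_simplex R k x ->
  fht i (x *m w) = \sum_j x 0 j * fht i (row j w).
Proof.
move=> [_ x1]; rewrite /fht dot_mulmx -[h in LHS]mul1r -x1 mulr_suml -sumrB.
by apply: eq_bigr => j _; rewrite mulrBr.
Qed.

Lemma body_convex : convex_hull_closed body.
Proof.
move=> k x w xs wB i; rewrite fht_convex //; apply: sumr_ge0 => j _.
by apply: mulr_ge0; [have [] := xs|exact: wB].
Qed.

Lemma fht_continuous i : continuous (fht i).
Proof.
move=> x; have A : dot (normal i) y @[y --> x] --> dot (normal i) x by exact: (@dot_cvg _ _ _ (nbhs x) _ id x (normal i) (@cvg_id _ _)).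
exact: (cvgB (cvg_cst h) A).
Qed.

Lemma body_closed : closed body.
Proof.
have -> : body = \bigcap_(i in [set: F]) (fht i @^-1` [set y | 0 <= y]).
  by apply/seteqP; split=> x Bx i; [move=> _|]; exact: Bx.
apply: closed_bigI => i _.
apply: (closed_comp (f := fht i) _ (@closed_ge _ 0)) => x _; exact: (@fht_continuous i x).
Qed.

Lemma body_compact : compact body.
Proof.
apply: (subclosed_compact body_closed (@norm_closed_ball_compact _ _ 0 1)) => x Bx /=.
rewrite subr0; apply: rV_norm_le => // i.
have := le_lt_trans (dot_coord x i) (body_inside Bx).
by rewrite -(real_normK (num_real _)); have := normr_ge0 (x 0 i) => ? ?; nra.
Qed.

Lemma body0 : body 0.
Proof. by move=> i; rewrite /fht dot0r subr0 ltW // height_gt0. Qed.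

End Reflections.

(** * Gluing copies of a polytope *)

Section Pasting.
Context {X Y : topologicalType} {I : finType}.

(** The pasting lemma for a finite closed family that need only cover a neighbourhood of [x0];
    members not containing [x0] are avoided nearby. *)
Lemma cvg_paste (A : I -> set X) (f : X -> Y) (x0 : X) :
  (forall i, closed (A i)) -> (\forall x \near x0, exists i, A i x) ->
  (forall i, A i x0 -> forall B, nbhs (f x0) B -> \forall x \near x0, A i x -> B (f x)) ->
  {for x0, continuous f}.
Proof.
move=> Ac Acov fA B fB.
have : \forall x \near x0, forall i, A i x -> B (f x).
  apply: filter_forall => i; case: (pselect (A i x0)) => [/fA|nA]; first exact.
  have : open_nbhs x0 (~` A i) by split=> //; exact: closed_openC.
  by move/open_nbhs_nbhs; apply: filterS => x nx /nx.
by move=> H; apply: filterS (filterI H Acov) => x [Hx [i Ai]]; exact: Hx Ai.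
Qed.

End Pasting.

Lemma cvg_big_prod {R : realType} (T : Type) (F : set_system T) {FF : Filter F} (I : Type)
    (r : seq I) (P : pred I) (f : I -> T -> R) (l : I -> R) :
  (forall i, f i x @[x --> F] --> l i) ->
  \prod_(i <- r | P i) f i x @[x --> F] --> \prod_(i <- r | P i) l i.
Proof.
move=> fl; elim: r => [|i r IH].
  by rewrite big_nil; under eq_fun do rewrite big_nil; exact: cvg_cst.
rewrite big_cons; under eq_fun do rewrite big_cons; case: ifP => // _.
by apply: cvgM.
Qed.

Lemma cvg_subtype (X : topologicalType) (A : set X) (T : Type) (F : set_system T)
    {FF : Filter F} (f : T -> A) (p : A) :
  set_val (f t) @[t --> F] --> set_val p -> f t @[t --> F] --> p.
Proof.
move=> fp B; rewrite nbhsE => -[C [[D oD DC] Cp] CB].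
have : \forall t \near F, D (set_val (f t)).
  by apply: fp; apply: open_nbhs_nbhs; split=> //; rewrite -DC in Cp.
by apply: filterS => t Dt; apply: CB; rewrite -DC.
Qed.

Lemma hausdorff_subtype (X : topologicalType) (A : set X) :
  hausdorff_space X -> hausdorff_space (A : topologicalType).
Proof.
rewrite !open_hausdorff => hX p q pq.
have [|[U V] /= [Up Vq] [oU oV UV]] := hX (set_val p) (set_val q).
  by apply: contra pq => /eqP e; apply/eqP/val_inj.
exists (set_val @^-1` U, set_val @^-1` V); split=> /=.
- by apply/mem_set; exact: set_mem Up.
- by apply/mem_set; exact: set_mem Vq.
- by exists U.
- by exists V.
by rewrite -preimage_setI (eqP UV) preimage_set0.
Qed.

(* The cells of a manifold glued from copies of a polytope: [flip i v] is the
   cell on the other side of the facet [i] of [v].  The walls crossed on the way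
   from [v] to another cell are read off the bits [side i]. *)
Record mirrors (R : realType) (n : nat) (P : polytope R n) := Mirrors {
  cell : finType;
  flip : facet P -> cell -> cell;
  side : facet P -> cell -> bool;
  sgn : cell -> bool;
  flipK : forall i, involutive (flip i);
  flip_comm : forall i j v, adjacent i j -> flip i (flip j v) = flip j (flip i v);
  side_flip : forall i j v, side j (flip i v) = side j v (+) (i == j);
  sgn_flip : forall i v, sgn (flip i v) = ~~ sgn v }.

Section Flips.
Context {R : realType} {n : nat} {P : polytope R n}.
Variable V : mirrors P.
Local Notation F := (facet P).
Local Notation cell := (cell V).
Local Notation flip := (@flip _ _ _ V).
Implicit Types (S T : {set F}) (v w : cell) (i j : F).

Definition flips S v : cell := foldr flip v (enum S).

Definition diff v w : {set F} := [set i | side i v != side i w].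

(** The crossed walls are recovered from the bits, which makes the relation decidable and leaves at
    most one set of crossings between two cells. *)
Definition near T v w : bool := (diff v w \subset T) && (w == flips (diff v w) v).

Lemma side_foldr l i v : side i (foldr flip v l) = side i v (+) odd (count_mem i l).
Proof.
elim: l => [|j l IH] /=; first by rewrite addbF.
by rewrite side_flip IH oddD oddb [RHS]addbCA addbC.
Qed.

Lemma side_flips S i v : side i (flips S v) = side i v (+) (i \in S).
Proof.
rewrite side_foldr count_uniq_mem ?enum_uniq // mem_enum.
by case: (i \in S).
Qed.

Lemma diff_flips S v : diff v (flips S v) = S.
Proof.
by apply/finset.setP => i; rewrite inE side_flips; case: (side i v); case: (i \in S).
Qed.

Lemma in_diff_trans v w u i : (i \in diff v u) = (i \in diff v w) (+) (i \in diff w u).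
Proof. by rewrite !inE; case: (side i v); case: (side i w); case: (side i u). Qed.

Lemma diffC v w : diff v w = diff w v.
Proof. by apply/finset.setP => i; rewrite !inE eq_sym. Qed.

Lemma nearP T v w : reflect (exists2 S : {set F}, S \subset T & w = flips S v) (near T v w).
Proof.
apply: (iffP andP) => [[dT /eqP ->]|[S ST ->]]; first by exists (diff v w).
by rewrite diff_flips.
Qed.

Lemma near_sub T T' v w : T \subset T' -> near T v w -> near T' v w.
Proof. by move=> TT' /nearP[S ST ->]; apply/nearP; exists S => //; exact: fintype.subset_trans TT'. Qed.

Lemma flips0 v : flips finset.set0 v = v.
Proof. by rewrite /flips enum_set0. Qed.

Lemma near_refl T v : near T v v.
Proof. by apply/nearP; exists finset.set0; rewrite ?finset.sub0set ?flips0. Qed.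

Section InClique.
Variable T : {set F}.
Hypothesis cT : clique T.

Lemma foldr_mid a i b v : i \in T -> {subset a <= T} ->
  foldr flip v (a ++ i :: b) = flip i (foldr flip v (a ++ b)).
Proof.
move=> iT; elim: a => [//|j a IH] aT /=.
rewrite IH => [|k ka]; last by apply: aT; rewrite inE ka orbT.
have [->//|ij] := eqVneq i j.
by apply/esym/flip_comm/cT => //; apply: aT; rewrite inE eqxx.
Qed.

Lemma foldr_perm l l' v : {subset l <= T} -> perm_eq l l' -> foldr flip v l = foldr flip v l'.
Proof.
elim: l l' => [|i l IH] l' lT pl; first by move: pl; rewrite perm_sym => /perm_nilP ->.
have il' : i \in l' by rewrite -(perm_mem pl) inE eqxx.
have iT : i \in T by apply: lT; rewrite inE eqxx.
case/splitPr: il' pl => a b pl.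
have pl' : perm_eq l (a ++ b).
  by rewrite -(perm_cons i) (perm_trans pl) // perm_catC /= perm_cons perm_catC.
have lT' : {subset l <= T} by move=> j jl; apply: lT; rewrite inE jl orbT.
rewrite foldr_mid //= ?(IH _ lT' pl') // => j ja.
by apply: lT'; rewrite (perm_mem pl') mem_cat ja.
Qed.

Lemma flip_flips i S v : i \in T -> S \subset T ->
  flip i (flips S v) = flips (if i \in S then S :\ i else i |: S) v.
Proof.
move=> iT /fintype.subsetP ST; have sub (S' : {set F}) : {subset enum S' <= S'}.
  by move=> j; rewrite mem_enum.
have E S' : i \notin S' -> {subset S' <= T} -> flip i (flips S' v) = flips (i |: S') v.
  move=> iS' S'T; rewrite -[LHS]/(foldr flip v (i :: enum S')); apply: foldr_perm.
    by move=> j; rewrite inE mem_enum => /orP[/eqP -> //|/S'T].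
  rewrite uniq_perm ?enum_uniq //= ?mem_enum ?iS' ?enum_uniq //.
  by move=> j; rewrite !inE !mem_enum !inE.
have [iS|iS] := boolP (i \in S); last exact: E.
rewrite -{1}(finset.setD1K iS) -E ?flipK //; first by rewrite !inE eqxx.
by move=> j; rewrite !inE => /andP[_ /ST].
Qed.

Lemma near_trans v w u : near T v w -> near T w u -> near T v u.
Proof.
move=> /nearP[S ST ->] /nearP[S' S'T ->]; rewrite /flips.
have : {subset enum S' <= T} by move=> j; rewrite mem_enum; exact: (fintype.subsetP S'T).
elim: (enum S') => [|i l IH] lT /=; first by apply/nearP; exists S.
have [C CT ->] := nearP _ _ _ (IH (fun j jl => lT j (mem_behead (s := i :: l) jl))).
have iT : i \in T by apply: lT; rewrite inE eqxx.
rewrite flip_flips //; apply/nearP; exists (if i \in C then C :\ i else i |: C) => //.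
case: ifP => _; last by rewrite finset.subUset finset.sub1set iT.
by apply: fintype.subset_trans CT; exact: finset.subsetDl.
Qed.

Lemma near_sym v w : near T v w -> near T w v.
Proof.
move=> /nearP[S ST ->]; have sT : {subset enum S <= T}.
  by move=> j; rewrite mem_enum; exact: (fintype.subsetP ST).
apply: (@near_trans _ (foldr flip (flips S v) (rev (enum S)))); last first.
  suff -> : foldr flip (flips S v) (rev (enum S)) = v by exact: near_refl.
  rewrite /flips; elim: (enum S) => [//|i l IH] /=.
  by rewrite rev_cons foldr_rcons flipK.
apply/nearP; exists S => //; apply: foldr_perm; last by rewrite perm_rev.
by move=> j; rewrite mem_rev; exact: sT.
Qed.

End InClique.
End Flips.

(** * The glued space *)

Section Manifold.
Context {R : realType} {n : nat} {P : polytope R n}.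
Variable V : mirrors P.
Local Notation E := 'rV[R]_n.
Local Notation F := (facet P).
Local Notation I := ({set F} * cell V)%type.
Implicit Types (S T : {set F}) (v w : cell V) (i j : F) (x : E).

(* The glued space is realised as a subset of a Euclidean space: the coordinate
   of index [(T, w)] is a bump function supported on the copies of the polytope
   obtained from [w] by crossing facets in [T]. *)
Definition bump_fun (T : {set F}) w x v : R :=
  if `[< clique T >] && near T w v then \prod_(i | i \notin T) fht i x else 0.

Definition embed x v : E * 'rV[R]_#|{: I}| :=
  (x, \row_k bump_fun (enum_val k).1 (enum_val k).2 x v).

(** The coordinate indexed by the facets through [x] and by [v] is nonzero on the cells near [v], so
    it separates the others. Conversely a coordinate vanishes at [x] unless its set [T] contains all
    facets through [x], and then near cells give the same value. *)
Lemma embed_eq x v w : body P x -> (embed x v = embed x w) <-> near (facets_at P x) v w.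
Proof.
move=> Bx; have cx := body_clique Bx; split=> [[] /rowP /(_ (enum_rank (facets_at P x, v)))|vw].
  rewrite !mxE enum_rankK /= /bump_fun near_refl (asboolT cx) /=.
  case: ifP => // _ /eqP; rewrite prodf_seq_eq0 => /hasP[i _] /=.
  by rewrite inE => /andP[/negbTE ->].
congr pair; apply/rowP => k; rewrite !mxE /bump_fun; case: (enum_val k) => T u /=.
case: (pselect (clique T)) => [cT|/asboolF -> //].
case: (boolP (facets_at P x \subset T)) => [xT|/fintype.subsetPn [i ix iT]]; last first.
  by rewrite (bigD1 i) //=; move: ix; rewrite inE => /eqP ->; rewrite mul0r !if_same.
rewrite (asboolT cT) /=; congr (if _ then _ else _).
have vw' := near_sub xT vw; have wv' := near_sym cT vw'.
by apply/idP/idP => h; [exact: near_trans h vw'|exact: near_trans h wv'].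
Qed.

Definition glued_set : set (E * 'rV[R]_#|{: I}|) :=
  [set p | exists x v, body P x /\ p = embed x v].

Definition glued : topologicalType := glued_set.

Lemma glued_base v : embed 0 v \in glued_set.
Proof. by apply/mem_set; exists 0, v; split=> //; exact: body0. Qed.

Definition glue x v : glued := insubd (SigSub (glued_base v) : glued_set) (embed x v).

Lemma glueE x v : body P x -> set_val (glue x v : glued_set) = embed x v.
Proof. by move=> Bx; apply: insubdK; apply/mem_set; exists x, v. Qed.

Lemma gluedP (p : glued) : exists x v, body P x /\ p = glue x v.
Proof.
have [x [v [Bx px]]] := set_valP (p : glued_set); exists x, v; split=> //.
by apply: val_inj; exact: etrans px (esym (glueE v Bx)).
Qed.

Lemma glue_eq x v w : body P x -> (glue x v = glue x w) <-> near (facets_at P x) v w.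
Proof.
move=> Bx; rewrite -embed_eq //; split=> [e|e].
  by rewrite -!glueE // e.
by apply: val_inj; rewrite /= -!set_valE !glueE.
Qed.

Definition pos (p : glued) : E := (set_val (p : glued_set)).1.

Lemma pos_glue x v : body P x -> pos (glue x v) = x.
Proof. by move=> Bx; rewrite /pos glueE. Qed.

(** A chosen cell: a point on a wall lies in several, so its label is meaningful only up to [near]
    over the facets through the point. *)
Definition lbl (p : glued) : cell V := projT1 (cid (projT2 (cid (gluedP p)))).

Lemma glue_lbl p : body P (pos p) /\ glue (pos p) (lbl p) = p.
Proof.
rewrite /lbl; case: cid => x /= [w wP]; case: cid => /= v [Bx pE].
by rewrite {1 2}pE pos_glue.
Qed.

Lemma near_lbl x v : body P x -> near (facets_at P x) v (lbl (glue x v)).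
Proof.
move=> Bx; apply/(glue_eq _ _ Bx); have [_] := glue_lbl (glue x v).
by rewrite pos_glue // => ->.
Qed.

Lemma pos_continuous : continuous pos.
Proof.
move=> p; apply: (cvg_comp (set_val : glued_set -> _) fst).
  exact: initial_continuous.
exact: cvg_fst.
Qed.

Definition bumps (p : glued) := (set_val (p : glued_set)).2.

Lemma bumps_continuous : continuous bumps.
Proof.
move=> p; apply: (cvg_comp (set_val : glued_set -> _) snd).
  exact: initial_continuous.
exact: cvg_snd.
Qed.

Lemma glue_continuous v : {within body P, continuous (glue^~ v)}.
Proof.
apply/subspace_continuousP => x Bx; apply: cvg_subtype; rewrite glueE //.
have H : embed y v @[y --> within (body P) (nbhs x)] --> embed x v.
  apply: cvg_within_filter.
  have H2 : (embed y v).2 @[y --> x] --> (embed x v).2.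
    apply: (@cvg_mx _ _ (nbhs x)) => k l; rewrite mxE; under eq_fun do rewrite mxE.
    rewrite /bump_fun; case: ifP => _; last exact: cvg_cst.
    by apply: (@cvg_big_prod _ _ (nbhs x)) => i; exact: fht_continuous.
  exact: (cvg_pair (@cvg_id _ (nbhs x)) H2).
apply: cvg_trans H; apply: near_eq_cvg; rewrite /near_simpl.
by rewrite near_withinE; apply: nearW => y By; rewrite glueE.
Qed.

Lemma glued_hausdorff : hausdorff_space glued.
Proof. by apply: hausdorff_subtype; exact: norm_hausdorff. Qed.

Definition layer v : set glued := (glue^~ v) @` body P.

Lemma layer_compact v : compact (layer v).
Proof. by apply: continuous_compact (@body_compact _ _ P); exact: glue_continuous. Qed.

Lemma layer_closed v : closed (layer v).
Proof. by apply: (compact_closed glued_hausdorff); exact: layer_compact. Qed.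

Lemma glued_compact : compact [set: glued].
Proof.
have H (s : seq (cell V)) : compact [set p | exists2 v, v \in s & layer v p].
  elim: s => [|v s IH].
    have -> : [set p | exists2 v, v \in [::] & layer v p] = set0.
      by apply/seteqP; split=> p //= [].
    exact: compact0.
  rewrite (_ : [set p | exists2 u, u \in v :: s & layer u p] = layer v `|` [set p | exists2 v, v \in s & layer v p]).
    by apply: compactU => //; exact: layer_compact.
  apply/seteqP; split=> p /= => [[u]|[vp|[u us up]]].
  - by rewrite inE => /orP[/eqP ->|us up]; [left|right; exists u].
  - by exists v; rewrite ?inE ?eqxx.
  by exists u => //; rewrite inE us orbT.
suff -> : setT = [set p | exists2 v, v \in enum (cell V) & layer v p] by exact: H.
apply/seteqP; split=> p // _; have [x [v [Bx ->]]] := gluedP p.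
by exists v; [rewrite mem_enum|exists x].
Qed.

Lemma glued_second_countable (v0 : cell V) : @second_countable glued.
Proof.
pose G : pseudoPMetricType R := HB.pack (glued_set : Type) (PseudoMetric.on (glued_set : Type))
  (isPointed.Build (glued_set : Type) (glue 0 v0)).
exact: (@compact_second_countable R G glued_compact).
Qed.

End Manifold.

Lemma cvg_positive {R : realType} (X : topologicalType) (f : X -> R) (x : X) :
  {for x, continuous f} -> 0 < f x -> \forall y \near x, 0 < f y.
Proof.
move=> fx fx0; have H : nbhs (f x) [set y : R | 0 < y].
  by apply: open_nbhs_nbhs; split=> //; exact: open_gt.
exact: (fx _ H).
Qed.

(** * Charts by folding and unfolding *)

Section Charts.
Context {R : realType} {n : nat} {P : polytope R n}.
Variable V : mirrors P.
Local Notation E := 'rV[R]_n.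
Local Notation L := 'rV[R]_(n + 1).
Local Notation F := (facet P).
Local Notation M := (glued V).
Implicit Types (S T : {set F}) (v w : cell V) (i j : F) (x z : E) (X : L).

Definition negatives T X : {set F} := [set i in T | ht i X < 0].

Definition fold_in T X : L := push_poles (fun i => Num.min (ht i X) 0 *+ (i \in T)) X.

Lemma foldE T X : fold_in T X = reflect_in (negatives T X) X.
Proof.
rewrite /fold_in /reflect_in /push_poles; congr (_ + _ *: _); apply: eq_bigr => i _.
rewrite inE; case: (i \in T) => //=; rewrite minElt; case: ifP => _; by rewrite ?mulr0n ?mul0rn.
Qed.

Lemma min0E (a : R) : Num.min a 0 = (a - `|a|) / 2.
Proof.
rewrite minElt; case: ltrP => h; first by rewrite ltr0_norm //; field.
by rewrite ger0_norm // subrr mul0r.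
Qed.

Lemma fold_continuous T : continuous (fold_in T).
Proof.
move=> X; apply: (@push_poles_cvg _ _ P _ (nbhs X) _ (fun i Y => Num.min (ht i Y) 0 *+ (i \in T)) _ id).
  move=> i; case: (i \in T) => /=; last exact: cvg_cst.
  rewrite mulr1n min0E; under eq_fun do rewrite mulr1n min0E.
  have H := @ht_continuous _ _ P i X.
  exact: (cvgMr_tmp (cvgB H (cvg_norm H))).
exact: cvg_id.
Qed.

Lemma hom_fold_continuous T : continuous (fun z => fold_in T (hom z)).
Proof.
move=> z; exact: (cvg_comp _ _ (@hom_continuous _ _ z) (@fold_continuous T (hom z))).
Qed.

Section OneChart.
Variables (T : {set F}) (w : cell V).
Hypothesis cT : clique T.

Definition star : set M :=
  [set p | near T w (lbl p) /\ forall i, i \notin T -> 0 < fht i (pos p)].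

Lemma facets_at_sub x : body P x -> (forall i, i \notin T -> 0 < fht i x) ->
  facets_at P x \subset T.
Proof.
move=> Bx xT; apply/fintype.subsetP => i; rewrite inE => /eqP xi.
by apply: contraT => /xT; rewrite xi ltxx.
Qed.

Lemma star_glue x v : body P x ->
  star (glue x v) <-> near T w v /\ forall i, i \notin T -> 0 < fht i x.
Proof.
move=> Bx; rewrite /star /= pos_glue //; have nl := near_lbl v Bx.
split=> -[wv xT]; split=> //.
  apply: (near_trans cT wv); apply: (near_sym cT).
  by apply: near_sub nl; exact: facets_at_sub.
by apply: (near_trans cT wv); apply: near_sub nl; exact: facets_at_sub.
Qed.

(** The star is the set where the coordinate of index [(T, w)] of the embedding is positive; the
    bump functions were chosen for this. *)
Lemma star_open : open star.
Proof.
pose k : 'I_#|{: {set F} * cell V}| := enum_rank (T, w).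
pose g (p : M) : R := bumps p 0 k.
have gc : continuous g.
  move=> p; exact: (cvg_comp _ _ (@bumps_continuous _ _ _ V p) (@coord_continuous R 1 _ 0 k _)).
have -> : star = g @^-1` [set y | 0 < y].
  apply/seteqP; split=> p; have [Bp pE] := glue_lbl p; rewrite -pE.
    move=> /(star_glue _ Bp) [wp pT]; rewrite /= /g /bumps glueE //= mxE enum_rankK /bump_fun /=.
    by rewrite (asboolT cT) wp; apply: prodr_gt0 => i; exact: pT.
  rewrite /= /g /bumps glueE //= mxE enum_rankK /bump_fun /= (asboolT cT) /=.
  case: ifP => [wp p0|]; last by rewrite ltxx.
  apply/star_glue => //; split=> // i iT; rewrite lt_neqAle eq_sym Bp andbT.
  by apply: contraTneq p0 => p0; rewrite (bigD1 i) //= p0 mul0r ltxx.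
apply: open_comp; last exact: open_gt.
by move=> p _; exact: gc.
Qed.

(** The developing map: the copy containing the point is reflected across the walls that separate it
    from [w]. *)
Definition unfold_pt (p : M) : E := proj (reflect_in (diff w (lbl p)) (hom (pos p))).

Definition fold_pt z : M :=
  glue (proj (fold_in T (hom z))) (flips (negatives T (hom z)) w).

Definition star_image : set E :=
  [set z | 0 < last (fold_in T (hom z)) /\
    forall i, i \notin T -> 0 < ht i (fold_in T (hom z))].

(** Independence of the chosen label: two possible labels differ only in facets through [x], and
    reflection in such a facet fixes [hom x]. *)
Lemma unfold_glue x v : body P x -> star (glue x v) ->
  unfold_pt (glue x v) = proj (reflect_in (diff w v) (hom x)).
Proof.
move=> Bx _; rewrite /unfold_pt pos_glue //; congr proj.
apply: eq_reflect => i; rewrite ht_hom => xi; rewrite (in_diff_trans _ v).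
have /andP[/fintype.subsetP /(_ i)] := near_lbl v Bx.
rewrite [i \in facets_at _ _]inE (negPf xi); case: (i \in diff v _) => [/(_ isT)|] //.
by rewrite addbF.
Qed.

Lemma clique_negatives X : clique (negatives T X).
Proof.
by apply: cliqueS cT; apply/fintype.subsetP => i; rewrite inE => /andP[].
Qed.

Lemma ht_fold X i : i \in T -> ht i (fold_in T X) = `|ht i X|.
Proof.
move=> iT; rewrite foldE ht_reflect; last first.
  apply: cliqueS cT; rewrite finset.subUset finset.sub1set iT.
  by apply/fintype.subsetP => j; rewrite inE => /andP[].
by rewrite inE iT /=; case: ltrP => h; [rewrite ltr0_norm|rewrite ger0_norm].
Qed.

Lemma fht_proj X i : last X != 0 -> fht i (proj X) = (last X)^-1 * ht i X :> R.
Proof. by move=> X0; rewrite -ht_hom hom_proj // htZ. Qed.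

Lemma star_image_body z : star_image z -> body P (proj (fold_in T (hom z))) /\
  forall i, i \notin T -> 0 < fht i (proj (fold_in T (hom z))).
Proof.
move=> [z0 zT]; have H i : i \notin T -> 0 < fht i (proj (fold_in T (hom z))).
  by move=> iT; rewrite fht_proj ?gt_eqF // mulr_gt0 ?invr_gt0 //; exact: zT.
split=> // i; have [iT|/H/ltW //] := boolP (i \in T).
by rewrite fht_proj ?gt_eqF // ht_fold // mulr_ge0 ?invr_ge0 // ltW.
Qed.

Lemma fold_pt_star z : star_image z -> star (fold_pt z).
Proof.
move=> /star_image_body [Bz zT]; apply/star_glue => //; split=> //.
apply/nearP; exists (negatives T (hom z)) => //.
by apply/fintype.subsetP => i; rewrite inE => /andP[].
Qed.

Lemma fold_ptK z : star_image z -> unfold_pt (fold_pt z) = z.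
Proof.
move=> zi; have [Bz _] := star_image_body zi; have [z0 _] := zi.
rewrite unfold_glue //; last exact: fold_pt_star.
rewrite diff_flips hom_proj ?gt_eqF // reflectZ projZ ?invr_eq0 ?gt_eqF //.
rewrite foldE reflectK ?proj_hom //; exact: clique_negatives.
Qed.

(** Reflection adds nonnegative multiples of poles to a point of the body, and every pole has the
    positive last coordinate [h]; the projection is thus defined. *)
Lemma last_reflect_body S x : body P x -> 0 < last (reflect_in S (hom x)).
Proof.
move=> Bx; rewrite last_push_poles last_hom; apply: ltr_wpDr => //.
apply: mulr_ge0; first by rewrite divr_ge0 // ltW // kappa_gt0.
apply: mulr_ge0; first by rewrite ltW // height_gt0.
apply: sumr_ge0 => i _; rewrite ht_hom; exact/mulrn_wge0.
Qed.

(** Reflection changes the signs of precisely the heights over crossed walls, so away from the walls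
    the signs at the unfolded point recover the cell, and folding undoes the reflection. *)
Lemma unfold_negatives x v : body P x -> star (glue x v) ->
  let z := unfold_pt (glue x v) in
  fold_in T (hom z) = (last (reflect_in (diff w v) (hom x)))^-1 *: hom x /\
  forall i, fht i x != 0 -> (i \in negatives T (hom z)) = (i \in diff w v).
Proof.
move=> Bx sx z; have := sx; rewrite star_glue // => -[/andP[dT /eqP vE] xT].
have l0 := last_reflect_body (diff w v) Bx; set l := last _ in l0 *.
have zE : hom z = l^-1 *: reflect_in (diff w v) (hom x).
  by rewrite /z unfold_glue // hom_proj // gt_eqF.
have cD : clique (diff w v) by exact: cliqueS cT.
have N i : fht i x != 0 -> (i \in negatives T (hom z)) = (i \in diff w v).
  move=> xi; rewrite inE zE htZ; have [iT|iT] /= := boolP (i \in T); last first.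
    by apply/esym/negbTE; apply: contra iT; exact: (fintype.subsetP dT).
  rewrite pmulr_rlt0 ?invr_gt0 // ht_reflect; last first.
    by apply: cliqueS cT; rewrite finset.subUset finset.sub1set iT.
  have xi0 : 0 < fht i x by rewrite lt_neqAle eq_sym xi Bx.
  by rewrite ht_hom; case: ifP => _; rewrite ?oppr_lt0 // ltNge ltW.
split=> //; rewrite foldE (@eq_reflect _ _ _ _ (diff w v)) => [|i]; last first.
  move=> h; apply: N; move: h; rewrite zE htZ mulf_eq0 negb_or => /andP[_].
  apply: contra => /eqP xi.
  have [iT|iT] := boolP (i \in T).
    rewrite ht_reflect ?ht_hom ?xi ?oppr0 ?if_same //.
    by apply: cliqueS cT; rewrite finset.subUset finset.sub1set iT.
  by have := xT i iT; rewrite xi ltxx.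
by rewrite zE reflectZ reflectK.
Qed.

Lemma unfold_image p : star p -> star_image (unfold_pt p).
Proof.
have [x [v [Bx ->]]] := gluedP p => sx; have [fE _] := unfold_negatives Bx sx.
have := sx; rewrite star_glue // => -[_ xT].
have l0 : 0 < (last (reflect_in (diff w v) (hom x)))^-1.
  by rewrite invr_gt0; exact: last_reflect_body.
split=> [|i iT]; rewrite fE ?lastZ ?last_hom ?mulr1 // htZ ht_hom.
by apply: mulr_gt0 => //; exact: xT.
Qed.

Lemma unfold_ptK p : star p -> fold_pt (unfold_pt p) = p.
Proof.
have [x [v [Bx ->]]] := gluedP p => sx; have [fE N] := unfold_negatives Bx sx.
have l0 : (last (reflect_in (diff w v) (hom x)))^-1 != 0.
  by rewrite invr_eq0 gt_eqF //; exact: last_reflect_body.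
have := sx; rewrite star_glue // => -[/andP[dT /eqP vE] xT].
rewrite /fold_pt fE projZ // proj_hom; apply/glue_eq => //; set S := negatives _ _ in N *.
have cS : S \subset T by apply/fintype.subsetP => i; rewrite inE => /andP[].
have : near T (flips S w) v.
  apply: (near_trans cT (w := w)); last by apply/nearP; exists (diff w v).
  by apply: (near_sym cT); apply/nearP; exists S.
move=> /andP[_ vE']; rewrite /near vE' andbT; apply/fintype.subsetP => i.
rewrite (in_diff_trans _ w) diffC diff_flips; apply: contraTT.
by rewrite inE => /N ->; rewrite addbb.
Qed.

Lemma star_image_open : open star_image.
Proof.
rewrite openE => z [z0 zT]; rewrite /interior.
have A : \forall y \near z, 0 < last (fold_in T (hom y)).
  apply: (@cvg_positive _ _ (fun y => last (fold_in T (hom y)))) => //.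
  exact: (cvg_comp _ _ (@hom_fold_continuous T z) (@last_continuous _ _ _)).
have B : \forall y \near z, forall i, i \notin T -> 0 < ht i (fold_in T (hom y)).
  apply: (@filter_forall _ _ _ (nbhs z)) => i; case: (boolP (i \in T)) => iT; first by near=> y.
  have H : \forall y \near z, 0 < ht i (fold_in T (hom y)).
    apply: (@cvg_positive _ _ (fun y => ht i (fold_in T (hom y)))); last exact: zT.
    exact: (cvg_comp _ _ (@hom_fold_continuous T z) (@ht_continuous _ _ _ i _)).
  by apply: filterS H.
by apply: filterS (filterI A B) => y [].
Unshelve. all: by end_near. Qed.

Lemma unfold_continuous p : star p -> {for p, continuous unfold_pt}.
Proof.
move=> sp; apply: (@cvg_paste _ _ (cell V) (@layer _ _ _ V)) => [v||].
- exact: layer_closed.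
- near=> q; have [x [v [Bx ->]]] := gluedP q; exists v.
  by exists x.
move=> v [x Bx pE] B; rewrite -pE => nB.
have sx : star (glue x v) by rewrite pE.
rewrite unfold_glue // in nB.
pose g (q : M) := proj (reflect_in (diff w v) (hom (pos q))).
have gc : g q @[q --> p] --> g p.
  have l0 : last (reflect_in (diff w v) (hom (pos p))) != 0.
    by rewrite -pE pos_glue //; apply: lt0r_neq0; exact: last_reflect_body.
  have hc := cvg_comp _ _ (@pos_continuous _ _ _ V p) (@hom_continuous _ _ (pos p)).
  have rc : reflect_in (diff w v) (hom (pos q)) @[q --> p] -->
      reflect_in (diff w v) (hom (pos p)).
    exact: (cvg_comp _ _ hc (@reflect_continuous _ _ P (diff w v) (hom (pos p)))).
  exact: (proj_cvg l0 rc).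
have gp : g p = proj (reflect_in (diff w v) (hom x)) by rewrite /g -pE pos_glue.
have H : \forall q \near p, B (g q) by apply: gc; rewrite gp.
have S : \forall q \near p, star q by apply: open_nbhs_nbhs; split=> //; exact: star_open.
rewrite pE; apply: filterS (filterI H S) => q [Bq sq] [y By qE].
by move: Bq sq; rewrite -qE => + sq; rewrite unfold_glue // /g pos_glue.
Unshelve. all: by end_near. Qed.

(** Closed regions, one for each [S] inside [T], on which folding is the fixed reflection in [S]
    followed by the inclusion of one fixed cell; [fold_pt] is shown continuous by pasting over
    them. *)
Definition sign_region S : set E :=
  [set z | (forall i, i \in S -> ht i (hom z) <= 0) /\
           (forall i, i \in T :\: S -> 0 <= ht i (hom z))].

Lemma sign_region_closed S : closed (sign_region S).
Proof.
have hc i : continuous (fun z => ht i (hom z)) by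
  move=> z; exact: (cvg_comp _ _ (@hom_continuous _ _ z) (@ht_continuous _ _ _ i _)).
have -> : sign_region S =
    (\bigcap_(i in [set i | i \in S]) [set z | ht i (hom z) <= 0]) `&`
    (\bigcap_(i in [set i | i \in T :\: S]) [set z | 0 <= ht i (hom z)]) by [].
apply: closedI; apply: closed_bigI => i _.
  by apply: (closed_comp (f := fun z => ht i (hom z)) _ (@closed_le _ 0)) => z _; exact: hc.
by apply: (closed_comp (f := fun z => ht i (hom z)) _ (@closed_ge _ 0)) => z _; exact: hc.
Qed.

Lemma sign_region_negatives S z : S \subset T -> sign_region S z ->
  forall i, ht i (hom z) != 0 -> (i \in negatives T (hom z)) = (i \in S).
Proof.
move=> ST [zS zT] i z0; rewrite inE; have [iS|iS] := boolP (i \in S).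
  by rewrite (fintype.subsetP ST _ iS) lt_neqAle z0 zS.
by have [iT|//] := boolP (i \in T); rewrite /= ltNge zT // inE iS.
Qed.

Lemma fold_pt_region S z : S \subset T -> sign_region S z -> star_image z ->
  last (reflect_in S (hom z)) != 0 /\ body P (proj (reflect_in S (hom z))) /\
  fold_pt z = glue (proj (reflect_in S (hom z))) (flips S w).
Proof.
move=> ST zS zi; have [Bz _] := star_image_body zi; have [z0 _] := zi.
have N := sign_region_negatives ST zS.
have E : fold_in T (hom z) = reflect_in S (hom z) by rewrite foldE; exact: eq_reflect.
rewrite /fold_pt -E; split; [by rewrite gt_eqF|split=> //].
apply/glue_eq => //; set S' := negatives _ _ in N *.
have S'T : S' \subset T by apply/fintype.subsetP => i; rewrite inE => /andP[].
have : near T (flips S' w) (flips S w).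
  apply: (near_trans cT (w := w)); last by apply/nearP; exists S.
  by apply: (near_sym cT); apply/nearP; exists S'.
move=> /andP[_ vE]; rewrite /near vE andbT; apply/fintype.subsetP => i.
rewrite (in_diff_trans _ w) diffC !diff_flips => h.
have zi0 : ht i (hom z) = 0 by apply/eqP; apply: contraTT h => /N ->; rewrite addbb.
have iT : i \in T.
  by case: (boolP (i \in S')) h => [/(fintype.subsetP S'T)|_ /(fintype.subsetP ST)].
rewrite inE fht_proj; last by rewrite gt_eqF.
by rewrite ht_fold // zi0 normr0 mulr0.
Qed.

Lemma fold_continuous_at z : star_image z -> {for z, continuous fold_pt}.
Proof.
move=> zi; pose A (S : {set F}) := if S \subset T then sign_region S else set0.
apply: (@cvg_paste _ _ {set F} A) => [S||].
- by rewrite /A; case: ifP => _; [exact: sign_region_closed|exact: closed0].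
- near=> y; exists (negatives T (hom y)); rewrite /A.
  have -> : negatives T (hom y) \subset T.
    by apply/fintype.subsetP => i; rewrite inE => /andP[].
  split=> i; rewrite !inE; first by move=> /andP[_ /ltW].
  by case: (i \in T); rewrite //= andbT -leNgt.
move=> S; rewrite /A; case: ifP => // ST zS B.
have [l0 [Bz ->]] := fold_pt_region ST zS zi.
move=> nB; have /subspace_continuousP gc := @glue_continuous _ _ _ V (flips S w).
have /= := gc _ Bz _ nB.
rewrite nbhs_simpl /= /within /= => H.
have pc : proj (reflect_in S (hom y)) @[y --> z] --> proj (reflect_in S (hom z)).
  have rc : reflect_in S (hom y) @[y --> z] --> reflect_in S (hom z).
    exact: (cvg_comp _ _ (@hom_continuous _ _ z) (@reflect_continuous _ _ P S (hom z))).
  exact: (proj_cvg l0 rc).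
have H' : \forall y \near z, body P (proj (reflect_in S (hom y))) ->
  B (glue (proj (reflect_in S (hom y))) (flips S w)) by exact: pc _ H.
have N : \forall y \near z, star_image y by apply: open_nbhs_nbhs; split=> //; exact: star_image_open.
apply: filterS (filterI H' N) => y [/= Hy yi] yS.
have [_ [By ->]] := fold_pt_region ST yS yi.
exact: Hy.
Unshelve. all: by end_near. Qed.

Definition star_chart : chart R n M :=
  Chart star_open star_image_open unfold_image fold_pt_star unfold_ptK fold_ptK
    unfold_continuous fold_continuous_at.

End OneChart.

Lemma glued_manifold (v0 : cell V) : closed_manifold R n M.
Proof.
split; last exact: glued_compact.
split; [exact: glued_hausdorff|exact: glued_second_countable|move=> p].
have [Bp pE] := glue_lbl p.
exists (star_chart (lbl p) (body_clique Bp)); split; first exact: near_refl.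
by move=> i; rewrite inE lt_neqAle eq_sym Bp andbT.
Qed.

End Charts.

Lemma near_eq_differentiable {R : realType} (V W : normedModType R) (f g : V -> W) (x : V) :
  (\forall y \near x, f y = g y) -> differentiable g x -> differentiable f x.
Proof.
move=> fg dg; have fgx : f x = g x by exact: nbhs_singleton fg.
have H : f \o shift x = cst (f x) + 'd g x +o_ 0 id.
  have /eqaddoP Hg := diff_locally dg; apply/eqaddoP => e e0.
  have fg0 : \forall h \near (0 : V), f (h + x) = g (h + x).
    have : h + x @[h --> (0 : V)] --> 0 + x by exact: (cvgD (@cvg_id _ (nbhs 0)) (cvg_cst x)).
    by rewrite add0r => shx; exact: (shx _ fg).
  by apply: filterS2 fg0 (Hg e e0) => h /= e1; rewrite /= !fctE /= e1 fgx.
have dc : continuous ('d g x) by move: dg => /diff_locallyP [].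
by apply/diff_locallyP; rewrite (diff_unique dc H).
Qed.

(** * Smoothness and derivatives of rational functions *)

Section RationalFunctions.
Context {R : realType} {n : nat}.
Local Notation E := 'rV[R]_n.

(** Expressions closed under a formal derivative: smoothness of every order follows by one
    induction, and partial derivatives are obtained by computation. *)
Inductive rexp :=
  | Const of R
  | Coord of 'I_n
  | Add of rexp & rexp
  | Mul of rexp & rexp
  | Inv of rexp.

Fixpoint reval (e : rexp) (x : E) : R :=
  match e with
  | Const a => a
  | Coord i => x 0 i
  | Add e1 e2 => reval e1 x + reval e2 x
  | Mul e1 e2 => reval e1 x * reval e2 x
  | Inv e1 => (reval e1 x)^-1
  end.

Fixpoint rdef (e : rexp) (x : E) : Prop :=
  match e with
  | Const _ | Coord _ => True
  | Add e1 e2 | Mul e1 e2 => rdef e1 x /\ rdef e2 x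
  | Inv e1 => rdef e1 x /\ reval e1 x != 0
  end.

Fixpoint rder (u : E) (e : rexp) : rexp :=
  match e with
  | Const _ => Const 0
  | Coord i => Const (u 0 i)
  | Add e1 e2 => Add (rder u e1) (rder u e2)
  | Mul e1 e2 => Add (Mul (rder u e1) e2) (Mul e1 (rder u e2))
  | Inv e1 => Mul (Const (-1)) (Mul (Mul (Inv e1) (Inv e1)) (rder u e1))
  end.

Lemma rdef_der u e x : rdef e x -> rdef (rder u e) x.
Proof. by elim: e => //= [e1 H1 e2 H2 []|e1 H1 e2 H2 []|e1 H1 []] *; do !split; auto. Qed.

Lemma reval_differentiable e x : rdef e x -> differentiable (reval e) x.
Proof.
elim: e => [a|i|e1 H1 e2 H2|e1 H1 e2 H2|e1 H1] /= => [_|_|[d1 d2]|[d1 d2]|[d1 x0]].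
- exact: differentiable_cst.
- exact: differentiable_coord.
- exact: (differentiableD (H1 d1) (H2 d2)).
- exact: (differentiableM (H1 d1) (H2 d2)).
exact: (differentiableV (H1 d1) x0).
Qed.

Lemma derive_coord i u (x : E) : 'D_u (fun y : E => y 0 i : R) x = u 0 i.
Proof.
rewrite deriveE; last exact: differentiable_coord.
have @f : {linear E -> R}.
  by exists (fun N : E => N 0 i); do 2![eexists]; do ?[constructor];
     rewrite ?mxE// => ? *; rewrite ?mxE//; move=> ?; rewrite !mxE.
by rewrite (_ : (fun y : E => y 0 i) = f) // diff_lin //; exact: coord_continuous.
Qed.

Lemma reval_derive u e x : rdef e x -> 'D_u (reval e) x = reval (rder u e) x.
Proof.
elim: e => [a|i|e1 H1 e2 H2|e1 H1 e2 H2|e1 H1] /= => [_|_|[d1 d2]|[d1 d2]|[d1 x0]].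
- exact: derive_cst.
- exact: derive_coord.
- by rewrite -H1 // -H2 // -deriveD //; apply: diff_derivable; exact: reval_differentiable.
- rewrite -H1 // -H2 // (deriveM (f := reval e1) (g := reval e2)) /=.
  + by rewrite /GRing.scale /=; ring.
  + by apply: diff_derivable; exact: reval_differentiable.
  by apply: diff_derivable; exact: reval_differentiable.
rewrite (deriveV (f := reval e1)) // ?H1 //; last first.
  by apply: diff_derivable; exact: reval_differentiable.
by rewrite /GRing.scale /= -exprVn expr2; ring.
Qed.

Lemma partial_reval (U : set E) (f : E -> R) e i x : open U -> U x ->
  (forall y, U y -> f y = reval e y) -> rdef e x ->
  partial i f x = reval (rder (delta_mx 0 i) e) x.
Proof.
move=> Uo Ux fe ex; rewrite /partial -reval_derive //.
have [i0|u0] := eqVneq (delta_mx 0 i : E) 0; first by rewrite i0 !derive0.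
by apply: near_eq_derive => //; apply: filterS (open_nbhs_nbhs (conj Uo Ux)).
Qed.

Lemma smooth_reval (U : set E) (f : E -> R) e : open U ->
  (forall x, U x -> f x = reval e x) -> (forall x, U x -> rdef e x) -> smooth U f.
Proof.
move=> Uo fe Ue k; elim: k f e fe Ue => [|k IH] f e fe Ue /=.
  split=> // x Ux; apply: differentiable_continuous.
  apply: (@near_eq_differentiable _ _ _ _ (reval e)); last by apply: reval_differentiable; exact: Ue.
  by apply: filterS (open_nbhs_nbhs (conj Uo Ux)).
have Uf x : U x -> \forall y \near x, f y = reval e y.
  by move=> Ux; apply: filterS (open_nbhs_nbhs (conj Uo Ux)).
have df x : U x -> differentiable f x.
  move=> Ux; apply: near_eq_differentiable (Uf x Ux) _; apply: reval_differentiable; exact: Ue.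
split=> [x Ux|i]; first exact/differentiable_continuous/df.
split=> [x Ux|]; first exact/diff_derivable/df.
apply: (IH _ (rder (delta_mx 0 i) e)) => x Ux; last by apply: rdef_der; exact: Ue.
by rewrite (partial_reval _ Uo Ux fe) //; exact: Ue.
Qed.

Definition rsum (F : 'I_n -> rexp) : rexp := foldr (fun i e => Add (F i) e) (Const 0) (enum 'I_n).

Lemma reval_rsum F x : reval (rsum F) x = \sum_i reval (F i) x.
Proof.
rewrite /rsum -big_enum; elim: (enum _) => [|i l IH]; first by rewrite big_nil.
by rewrite big_cons /= IH.
Qed.

Lemma rdef_rsum F x : (forall i, rdef (F i) x) -> rdef (rsum F) x.
Proof. by move=> H; rewrite /rsum; elim: (enum _) => //= i l IH; split. Qed.

Lemma rder_rsum u F : rder u (rsum F) = rsum (fun i => rder u (F i)).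
Proof. by rewrite /rsum; elim: (enum _) => //= i l ->. Qed.

Definition affine_exp (a : E) (b : R) : rexp :=
  Add (rsum (fun i => Mul (Const (a 0 i)) (Coord i))) (Const b).

Lemma reval_affine a b x : reval (affine_exp a b) x = dot a x + b.
Proof. by rewrite /= reval_rsum dotE. Qed.

Lemma rdef_affine a b x : rdef (affine_exp a b) x.
Proof. by split=> //; exact: rdef_rsum. Qed.

Lemma reval_der_affine u a b x : reval (rder u (affine_exp a b)) x = dot a u.
Proof.
rewrite /= rder_rsum reval_rsum addr0 dotE.
by apply: eq_bigr => i _ /=; rewrite mul0r add0r.
Qed.

End RationalFunctions.

(** * Curvature of the Klein metric *)

Section Klein.
Context {R : realType} {n : nat}.
Local Notation E := 'rV[R]_n.
Implicit Types (x u v w : E).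

Definition ball_set : set E := [set x | dot x x < 1].

Lemma ball_set_open : open ball_set.
Proof.
have H : continuous (fun x : E => dot x x).
  move=> x; have E1 y : dot y y = \sum_i y 0 i * y 0 i := dotE y y.
  rewrite /continuous_at E1; under eq_fun do rewrite E1.
  apply: (@cvg_big_sum _ _ (nbhs x)) => i; apply: cvgM; exact: coord_continuous.
apply: (open_comp (f := fun x : E => dot x x) (D := [set y | y < 1])); last exact: open_lt.
by move=> x _; exact: H.
Qed.

(** The Beltrami-Klein metric of the unit ball, normalised to curvature -1. *)
Definition klein x : 'M[R]_n :=
  \matrix_(i, j) ((i == j)%:R / (1 - dot x x) + x 0 i * x 0 j / (1 - dot x x) ^+ 2).

Definition klein_form x u v : R :=
  dot u v / (1 - dot x x) + dot u x * dot v x / (1 - dot x x) ^+ 2.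

Lemma kleinE x : klein x =
  (1 - dot x x)^-1 *: 1%:M + (1 - dot x x) ^- 2 *: (x^T *m x).
Proof.
apply/matrixP => i j; rewrite !mxE big_ord1 !mxE mulrC; congr (_ + _).
by rewrite mulrC.
Qed.

Lemma klein_formE x u v : (u *m klein x *m v^T) 0 0 = klein_form x u v.
Proof.
rewrite kleinE mulmxDr mulmxDl mxE -!scalemxAr -!scalemxAl mulmx1 mxE -/(dot u v).
have -> : u *m (x^T *m x) *m v^T = (u *m x^T) *m (x *m v^T) by rewrite !mulmxA.
rewrite mxE [in X in _ + _ * X]mxE big_ord1 -/(dot u x) -/(dot x v) (dotC x v).
by rewrite /klein_form; ring.
Qed.

Lemma klein_symmetric x : (klein x)^T = klein x.
Proof. by apply/matrixP => i j; rewrite !mxE eq_sym (mulrC (x 0 j)). Qed.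

Lemma klein_form_gt0 x u : ball_set x -> u != 0 -> 0 < klein_form x u u.
Proof.
rewrite /ball_set /= -subr_gt0 => q0 u0; apply: ltr_wpDr.
  by rewrite divr_ge0 // -?expr2 sqr_ge0.
by rewrite divr_gt0 // lt_neqAle eq_sym dot_eq0 u0 dot_ge0.
Qed.

Definition qexp : rexp := Add (Const 1) (Mul (Const (-1)) (rsum (fun i => Mul (Coord i) (Coord i)))) : @rexp R n.

(** Abstracting the expression [q] keeps [1 - dot x x] an atom, so that [field] is not confronted
    with the sum inside it. *)
Definition klein_exp_of (q : rexp) i j : @rexp R n := Add (Mul (Const (i == j)%:R) (Inv q))
  (Mul (Mul (Coord i) (Coord j)) (Mul (Inv q) (Inv q))).

Definition klein_exp := klein_exp_of qexp.

Lemma reval_q x : reval qexp x = 1 - dot x x.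
Proof. by rewrite /= reval_rsum dotE mulN1r. Qed.

Lemma rdef_q x : rdef qexp x.
Proof. by do !split => //; exact: rdef_rsum. Qed.

Lemma reval_der_q k x : reval (rder (delta_mx 0 k) qexp) x = - 2 * x 0 k.
Proof.
rewrite /= mul0r !add0r mulN1r rder_rsum reval_rsum (bigD1 k) //= big1.
  by rewrite !mxE !eqxx /=; ring.
by move=> i ik; rewrite !mxE (negPf ik) andbF /= mulr0 mul0r addr0.
Qed.

Lemma q_neq0 x : ball_set x -> 1 - dot x x != 0.
Proof. by rewrite /ball_set /= -subr_gt0 => q0; rewrite gt_eqF. Qed.

Lemma rdef_Inv_q x : ball_set x -> rdef (Inv qexp) x.
Proof. by move=> Bx; split; [exact: rdef_q|rewrite reval_q q_neq0]. Qed.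

Lemma reval_klein i j x : reval (klein_exp i j) x = klein x i j.
Proof.
have E (q : rexp) : reval (klein_exp_of q i j) x =
    (i == j)%:R / reval q x + x 0 i * x 0 j / reval q x ^+ 2.
  by rewrite /= -exprVn expr2; ring.
by rewrite /klein_exp E reval_q mxE.
Qed.

Lemma rdef_klein i j x : ball_set x -> rdef (klein_exp i j) x.
Proof. by move=> Bx; have H := rdef_Inv_q Bx; do !split => //; case: H. Qed.

Lemma klein_smooth (U : set E) i j : open U -> U `<=` ball_set ->
  smooth U (fun x => klein x i j).
Proof.
move=> Uo UB; apply: (smooth_reval (e := klein_exp i j)) => // x Ux.
  by rewrite reval_klein.
by apply: rdef_klein; exact: UB.
Qed.

Lemma partial_klein k i j x : ball_set x ->
  partial k (fun y => klein y i j) x =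
  (2 * x 0 k * (i == j)%:R + (i == k)%:R * x 0 j + (j == k)%:R * x 0 i) / (1 - dot x x) ^+ 2 +
  4 * x 0 k * x 0 i * x 0 j / (1 - dot x x) ^+ 3.
Proof.
move=> Bx; rewrite (partial_reval (e := klein_exp i j) _ ball_set_open Bx) => [|y _|].
- have E (q : rexp) u : reval q x != 0 -> reval (rder u (klein_exp_of q i j)) x =
      - (i == j)%:R * reval (rder u q) x / reval q x ^+ 2 +
      (u 0 i * x 0 j + u 0 j * x 0 i) / reval q x ^+ 2 -
      2 * x 0 i * x 0 j * reval (rder u q) x / reval q x ^+ 3.
    by move=> /= q0; field.
  rewrite /klein_exp E reval_q ?q_neq0 // reval_der_q !mxE /=.
  by have := q_neq0 Bx; move: (1 - dot x x) => q q0; field.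
- by rewrite reval_klein.
exact: rdef_klein.
Qed.

Lemma sum_delta_l (i : 'I_n) (f : 'I_n -> R) : \sum_j (i == j)%:R * f j = f i.
Proof.
rewrite (bigD1 i) //= eqxx mul1r big1 ?addr0 // => j ji.
by rewrite eq_sym (negPf ji) mul0r.
Qed.

Lemma klein_unit x : ball_set x -> klein x \in unitmx.
Proof.
move=> Bx; rewrite -row_free_unit; apply: inj_row_free => u u0.
apply/eqP; apply: contraT => /(klein_form_gt0 Bx).
by rewrite -klein_formE u0 mul0mx mxE ltxx.
Qed.

(* Lowering the index [k] turns the claim into an identity between the partial
   derivatives of [klein]. *)
Lemma klein_christoffel k i j x : ball_set x -> christoffel klein k i j x =
  ((k == i)%:R * x 0 j + (k == j)%:R * x 0 i) / (1 - dot x x).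
Proof.
move=> Bx; rewrite /christoffel; have q0 := q_neq0 Bx.
have S l : partial i (fun y => klein y j l) x + partial j (fun y => klein y i l) x -
    partial l (fun y => klein y i j) x =
    2 * ((x 0 j * klein x l i + x 0 i * klein x l j) / (1 - dot x x)).
  rewrite !partial_klein // !mxE (eq_sym l i) (eq_sym l j) (eq_sym j i).
  by move: (1 - dot x x) q0 => q q0; field.
under eq_bigr => l _ do rewrite S mulrCA.
rewrite -mulr_sumr mulrA mulVf ?pnatr_eq0 // mul1r.
have D l : \sum_m invmx (klein x) k m * klein x m l = (k == l)%:R.
  by have := congr1 (fun A : 'M[R]_n => A k l) (mulVmx (klein_unit Bx)); rewrite !mxE.
rewrite -!D !mulr_suml -big_split /= mulr_suml; apply: eq_bigr => l _; ring.
Qed.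

Definition christoffel_exp k i j : @rexp R n :=
  Mul (Add (Mul (Const (k == i)%:R) (Coord j)) (Mul (Const (k == j)%:R) (Coord i))) (Inv qexp).

Lemma partial_christoffel m k i j x : ball_set x -> partial m (christoffel klein k i j) x =
  ((k == i)%:R * (j == m)%:R + (k == j)%:R * (i == m)%:R) / (1 - dot x x) +
  2 * x 0 m * ((k == i)%:R * x 0 j + (k == j)%:R * x 0 i) / (1 - dot x x) ^+ 2.
Proof.
move=> Bx; rewrite (partial_reval (e := christoffel_exp k i j) _ ball_set_open Bx) => [|y By|].
- have E (q : rexp) u e : reval q x != 0 -> reval (rder u (Mul e (Inv q))) x =
      reval (rder u e) x / reval q x - reval e x * reval (rder u q) x / reval q x ^+ 2.
    by move=> /= q0; field.
  rewrite /christoffel_exp E reval_q ?q_neq0 // reval_der_q /= !mxE /=.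
  by have := q_neq0 Bx; move: (1 - dot x x) => q q0; field.
- have E (q e : rexp) : reval (Mul e (Inv q)) y = reval e y / reval q y by [].
  by rewrite klein_christoffel // /christoffel_exp E reval_q.
by split; [do !split|exact: rdef_Inv_q].
Qed.

(** The shape of the curvature tensor of a space of constant curvature -1; the products of
    Christoffel symbols collapse because each symbol is a sum of two terms with a Kronecker
    delta. *)
Lemma klein_riemann l i j k x : ball_set x -> riemann klein l i j k x =
  (l == j)%:R * klein x i k - (l == i)%:R * klein x j k.
Proof.
move=> Bx; rewrite /riemann !partial_christoffel //.
have -> : \sum_m (christoffel klein m j k x * christoffel klein l i m x -
    christoffel klein m i k x * christoffel klein l j m x) =
  ((l == i)%:R * x 0 j - (l == j)%:R * x 0 i) * x 0 k / (1 - dot x x) ^+ 2.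
  under eq_bigr => m _ do rewrite !klein_christoffel // ![m == _]eq_sym ![l == m]eq_sym.
  transitivity (\sum_m ((j == m)%:R * (((l == i)%:R * x 0 m + (m == l)%:R * x 0 i) * x 0 k / (1 - dot x x) ^+ 2)
    + (k == m)%:R * (((l == i)%:R * x 0 m + (m == l)%:R * x 0 i) * x 0 j / (1 - dot x x) ^+ 2)
    - (i == m)%:R * (((l == j)%:R * x 0 m + (m == l)%:R * x 0 j) * x 0 k / (1 - dot x x) ^+ 2)
    - (k == m)%:R * (((l == j)%:R * x 0 m + (m == l)%:R * x 0 j) * x 0 i / (1 - dot x x) ^+ 2))).
    by apply: eq_bigr => m _; have := q_neq0 Bx; move: (1 - dot x x) => q q0; field.
  rewrite !sumrB big_split /= !sum_delta_l (eq_sym j l) (eq_sym k l) (eq_sym i l).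
  by have := q_neq0 Bx; move: (1 - dot x x) => q q0; field.
rewrite !mxE (eq_sym k i) (eq_sym k j) (eq_sym j i).
by have := q_neq0 Bx; move: (1 - dot x x) => q q0; field.
Qed.

Lemma klein_curvature_operator x u v w : ball_set x ->
  curvature_operator klein x u v w = klein_form x u w *: v - klein_form x v w *: u.
Proof.
move=> Bx; apply/rowP => l; rewrite !mxE.
have form a b : klein_form x a b = \sum_i a 0 i * (\sum_k b 0 k * klein x i k).
  rewrite -klein_formE mxE; under eq_bigr do rewrite !mxE mulr_suml.
  rewrite exchange_big /=; apply: eq_bigr => i _; rewrite mulr_sumr.
  by apply: eq_bigr => k _; ring.
transitivity (\sum_i \sum_j \sum_k (u 0 i * v 0 j * w 0 k *
   ((l == j)%:R * klein x i k - (l == i)%:R * klein x j k))).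
  by do 3!(apply: eq_bigr => ? _); rewrite klein_riemann.
transitivity (\sum_i \sum_j ((l == j)%:R * (v 0 j * (u 0 i * \sum_k w 0 k * klein x i k)) -
   (l == i)%:R * (u 0 i * (v 0 j * \sum_k w 0 k * klein x j k)))).
  apply: eq_bigr => i _; apply: eq_bigr => j _.
  rewrite !mulr_sumr -sumrB; apply: eq_bigr => k _; ring.
under eq_bigr do rewrite sumrB sum_delta_l -mulr_sumr -mulr_sumr -form.
by rewrite sumrB sum_delta_l -mulr_sumr -form; ring.
Qed.

Lemma klein_curvature x u v : ball_set x -> row_free (col_mx u v) ->
  sectional_curvature klein x u v = -1.
Proof.
move=> Bx uv; rewrite /sectional_curvature /inner !klein_formE klein_curvature_operator //.
have lin a b c d : klein_form x (a *: b - c *: d) u =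
    a * klein_form x b u - c * klein_form x d u.
  by rewrite /klein_form !(dotBl, dotZl); ring.
rewrite lin; set a := klein_form x u u; set b := klein_form x u v; set c := klein_form x v v.
have -> : klein_form x v u = b by rewrite /b /klein_form (dotC v u) (mulrC (dot v x)).
suff D : a * c - b ^+ 2 != 0.
  by apply: (mulIf D); rewrite divfK // mulN1r; ring.
apply/eqP => D0.
have free a' b' : a' *: u + b' *: v = 0 -> a' = 0 /\ b' = 0.
  move=> e; have [B uvB] := row_freeP uv.
  have : row_mx a'%:M b'%:M *m col_mx u v = 0 by rewrite mul_row_col !mul_scalar_mx.
  move/(congr1 (mulmx^~ B)); rewrite -mulmxA uvB mulmx1 mul0mx => /eqP.
  rewrite row_mx_eq0 => /andP[/eqP /matrixP /(_ 0 0) + /eqP /matrixP /(_ 0 0)].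
  by rewrite !mxE.
have v0 : v != 0.
  apply/eqP => v0; have := free 0 1; rewrite v0 scale0r scaler0 addr0 => /(_ erefl) [_].
  by move/eqP; rewrite oner_eq0.
have c0 : 0 < c := klein_form_gt0 Bx v0.
(* The vector is [c] times the component of [u] orthogonal to [v]. Its square is [c] times the Gram
   determinant, which is therefore positive unless [u] and [v] are dependent. *)
have [w0|w0] := eqVneq (c *: u - b *: v) 0.
  by have [c00 _] := free c (- b) (etrans (congr1 (+%R (c *: u)) (scaleNr _ _)) w0); rewrite c00 ltxx in c0.
have := klein_form_gt0 Bx w0.
have -> : klein_form x (c *: u - b *: v) (c *: u - b *: v) = c * (a * c - b ^+ 2).
  rewrite /a /b /c /klein_form !(dotBl, dotBr, dotZl, dotZr) (dotC v u); ring.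
by rewrite D0 mulr0 ltxx.
Qed.

End Klein.

(** * Lorentz maps as isometries of the Klein metric *)

Section ProjectiveMaps.
Context {R : realType} {n : nat}.
Local Notation E := 'rV[R]_n.
Local Notation L := 'rV[R]_(n + 1).
Variable g : L -> L.
Hypothesis g_lorentz : lorentz g.
Implicit Types (u v z : E).

Definition tangent_lift u : L := row_mx u 0.

Definition linear_coef k : E := \row_i (g (tangent_lift (delta_mx 0 i))) 0 k.

Definition constant_coef k : R := (g (hom 0)) 0 k.

Lemma g_sum (I : Type) (r : seq I) (a : I -> R) (f : I -> L) :
  g (\sum_(i <- r) a i *: f i) = \sum_(i <- r) a i *: g (f i).
Proof.
have [gl _] := g_lorentz; elim: r => [|i r IH]; last by rewrite !big_cons gl IH.
rewrite !big_nil; have := gl (-1) 0 0.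
by rewrite scaler0 addr0 scaleN1r addNr.
Qed.

Lemma g_tangent u k : (g (tangent_lift u)) 0 k = dot (linear_coef k) u.
Proof.
have -> : tangent_lift u = \sum_i u 0 i *: tangent_lift (delta_mx 0 i).
  have E1 i : u 0 i *: tangent_lift (delta_mx 0 i) = tangent_lift (u 0 i *: delta_mx 0 i).
    by rewrite /tangent_lift scale_row_mx scaler0.
  under eq_bigr do rewrite E1; rewrite [in LHS](row_sum_delta u).
  rewrite /tangent_lift; elim/big_rec2: _ => [|i a b _ <-]; first exact: row_mx0.
  by rewrite add_row_mx addr0.
rewrite g_sum summxE dotE; apply: eq_bigr => i _.
by rewrite !mxE mulrC.
Qed.

Lemma hom_tangent z : hom z = 1 *: tangent_lift z + hom 0.
Proof. by rewrite scale1r /hom /tangent_lift add_row_mx addr0 add0r. Qed.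

Lemma g_hom z k : (g (hom z)) 0 k = dot (linear_coef k) z + constant_coef k.
Proof.
have [gl _] := g_lorentz.
by rewrite hom_tangent gl scale1r mxE g_tangent.
Qed.

Lemma lastE (X : L) : last X = X 0 (rshift n 0).
Proof. by rewrite /last mxE. Qed.

Definition coord_exp k : rexp := affine_exp (linear_coef k) (constant_coef k).

Definition proj_exp j : rexp := Mul (coord_exp (lshift 1 j)) (Inv (coord_exp (rshift n 0))).

Lemma reval_coord_exp z k : reval (coord_exp k) z = (g (hom z)) 0 k.
Proof. by rewrite reval_affine g_hom. Qed.

Lemma reval_proj_exp z j : reval (proj_exp j) z = proj (g (hom z)) 0 j.
Proof.
have -> : reval (proj_exp j) z =
  reval (coord_exp (lshift 1 j)) z / reval (coord_exp (rshift n 0)) z by [].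
by rewrite !reval_coord_exp -lastE /proj !mxE mulrC.
Qed.

Lemma rdef_proj_exp z j : last (g (hom z)) != 0 -> rdef (proj_exp j) z.
Proof.
by move=> l0; do 2!(split; first exact: rdef_affine); rewrite reval_coord_exp -lastE.
Qed.

Definition proj_derivative z u : E :=
  (last (g (hom z)))^-1 *: lsubmx (g (tangent_lift u)) -
  (last (g (tangent_lift u)) / last (g (hom z)) ^+ 2) *: lsubmx (g (hom z)).

Lemma reval_der_proj_exp z u j : last (g (hom z)) != 0 ->
  reval (rder u (proj_exp j)) z = proj_derivative z u 0 j.
Proof.
move=> l0; have E1 (a b : rexp) : reval b z != 0 -> reval (rder u (Mul a (Inv b))) z =
    (reval b z)^-1 * reval (rder u a) z - reval (rder u b) z / reval b z ^+ 2 * reval a z.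
  by move=> /= b0; field.
rewrite /proj_exp E1 ?reval_coord_exp -?lastE // !reval_der_affine -!g_tangent -!lastE.
by rewrite !mxE.
Qed.

Lemma derive_rowE (e : 'I_n -> rexp) z u : (forall j, rdef (e j) z) ->
  differentiable (fun y : E => \row_j reval (e j) y) z /\
  'D_u (fun y : E => \row_j reval (e j) y : E) z = \row_j reval (rder u (e j)) z.
Proof.
move=> ez; have dj j : differentiable (fun y : E => reval (e j) y *: (delta_mx 0 j : E)) z.
  by apply: differentiableZl; exact: reval_differentiable.
have E1 : (fun y : E => \row_j reval (e j) y) =
    \sum_j (fun y : E => reval (e j) y *: (delta_mx 0 j : E)).
  apply/funext => y; rewrite fct_sumE [LHS]row_sum_delta.
  by apply: eq_bigr => j _; rewrite mxE.
split; first by rewrite E1; exact: differentiable_sum.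
rewrite E1 derive_sum; last by move=> j; exact: diff_derivable.
rewrite [RHS]row_sum_delta; apply: eq_bigr => j _; rewrite mxE deriveE //.
rewrite diffZl; last exact: reval_differentiable.
by rewrite -deriveE ?reval_derive //; exact: reval_differentiable.
Qed.

Lemma lform_tangent u v : lform (tangent_lift u) (tangent_lift v) = dot u v.
Proof.
by rewrite /lform /tangent_lift !row_mxKl /last !row_mxKr !mxE mul0r subr0.
Qed.

Lemma lform_tangent_hom u z : lform (tangent_lift u) (hom z) = dot u z.
Proof.
by rewrite /lform /tangent_lift /hom !row_mxKl /last !row_mxKr !mxE mul0r subr0.
Qed.

(** Euclidean products of the spatial parts of [g X] and [g Y] are Lorentz products, which [g]
    preserves, plus products of last coordinates. In the Klein form of the projections these last
    coordinates cancel. *)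
Lemma proj_isometry z u v : ball_set z -> last (g (hom z)) != 0 ->
  klein_form (proj (g (hom z))) (proj_derivative z u) (proj_derivative z v) = klein_form z u v.
Proof.
move=> Bz l0; have q0 := q_neq0 Bz; have [_ gf] := g_lorentz.
have E X Y : dot (lsubmx (g X)) (lsubmx (g Y)) = lform X Y + last (g X) * last (g Y).
  by rewrite -gf /lform subrK.
have := E (hom z) (hom z); rewrite lform_hom.
have := E (tangent_lift u) (hom z); rewrite lform_tangent_hom.
have := E (tangent_lift v) (hom z); rewrite lform_tangent_hom.
have := E (tangent_lift u) (tangent_lift v); rewrite lform_tangent.
rewrite /proj_derivative /proj /klein_form => e1 e2 e3 e4.
rewrite !(dotBl, dotBr, dotZl, dotZr) (dotC (lsubmx (g (hom z))) (lsubmx (g (tangent_lift v)))).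
rewrite e1 e2 e3 e4; move: (last (g (hom z))) l0 => l l0.
rewrite (_ : 1 - l^-1 * (l^-1 * (dot z z - 1 + l * l)) = (1 - dot z z) / l ^+ 2); last by field.
rewrite (_ : dot z z - 1 = - (1 - dot z z)); last by ring.
by move: (1 - dot z z) q0 => q q0; field; rewrite q0.
Qed.

Lemma klein_jacobian (t : E -> E) z : (\forall y \near z, t y = proj (g (hom y))) ->
  ball_set z -> last (g (hom z)) != 0 ->
  klein z = 'J t z *m klein (t z) *m ('J t z)^T.
Proof.
move=> tE Bz l0; pose G y : E := \row_j reval (proj_exp j) y.
have GE y : G y = proj (g (hom y)).
  by apply/rowP => j; rewrite mxE reval_proj_exp.
have H u := @derive_rowE proj_exp z u (fun j => rdef_proj_exp j l0).
have dG : differentiable G z := (H 0).1.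
have tG : \forall y \near z, t y = G y by apply: filterS tE => y ->; rewrite GE.
have dt : differentiable t z by exact: near_eq_differentiable tG dG.
have Dt u : u *m 'J t z = proj_derivative z u.
  rewrite -deriveEjacobian //; have -> : 'D_u t z = 'D_u G z.
    by have [->|u0] := eqVneq u 0; [rewrite !derive0|exact: near_eq_derive].
  rewrite (H u).2; apply/rowP => j; rewrite mxE; exact: reval_der_proj_exp.
have tz : t z = proj (g (hom z)) by exact: nbhs_singleton tE.
have E1 (A B : 'M[R]_n) : (forall u v, (u *m A *m v^T) 0 0 = (u *m B *m v^T) 0 0) -> A = B.
  move=> AB; apply/matrixP => i j; have := AB (delta_mx 0 i) (delta_mx 0 j).
  by rewrite -!rowE trmx_delta -!colE !mxE.
apply: E1 => u v; rewrite klein_formE -[RHS]/(((u *m _) *m v^T) 0 0) !mulmxA.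
rewrite -mulmxA -trmx_mul Dt (Dt v) klein_formE tz.
by rewrite proj_isometry.
Qed.

End ProjectiveMaps.

(** * Transition maps between the charts *)

Section HyperbolicManifold.
Context {R : realType} {n : nat} {P : polytope R n}.
Variable V : mirrors P.
Local Notation E := 'rV[R]_n.
Local Notation L := 'rV[R]_(n + 1).
Local Notation F := (facet P).
Local Notation M := (glued V).
Implicit Types (S T : {set F}) (v w : cell V) (i j : F) (x z : E).

(** The sets reflected by folding and by unfolding vary with the point, but their symmetric
    difference is always [diff w w']. This formula depends on the latter alone, so a transition is a
    single projective map on its whole domain. *)
Definition crossing T T' (D : {set F}) (X : L) : L :=
  reflect_in (D :\: T) (reflect_in (D :&: T :&: T') (reflect_in (D :\: T') X)).

(** Facets outside [T'] can occur only in [S], and those outside [T] only in [S']. The others lie in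
    both cliques, where reflections commute and those common to [S] and [S'] cancel. *)
Lemma crossingE T T' S S' (X : L) : clique T -> clique T' -> S \subset T -> S' \subset T' ->
  reflect_in S' (reflect_in S X) = crossing T T' ((S :\: S') :|: (S' :\: S)) X.
Proof.
move=> cT cT' /fintype.subsetP ST /fintype.subsetP ST'; set D := _ :|: _; rewrite /crossing.
have subT (A : {set F}) : {subset A <= T} -> clique A.
  by move=> AT; apply: cliqueS cT; apply/fintype.subsetP.
have subT' (A : {set F}) : {subset A <= T'} -> clique A.
  by move=> AT; apply: cliqueS cT'; apply/fintype.subsetP.
have H i : [/\ (i \in S) ==> (i \in T), (i \in S') ==> (i \in T')
    & (i \in D) = (i \in S) (+) (i \in S')].
  split; [exact/implyP/ST|exact/implyP/ST'|].
  by rewrite !inE; case: (i \in S); case: (i \in S').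
have E1 Y : reflect_in S' Y = reflect_in (D :\: T) (reflect_in (S' :&: T) Y).
  rewrite reflect_reflect.
    apply: eq_reflect => i _; rewrite !inE; have [] := H i; rewrite !inE.
    by case: (i \in S); case: (i \in S'); case: (i \in T); case: (i \in T').
  apply: subT' => i; rewrite !inE; have [] := H i; rewrite !inE.
  by case: (i \in S); case: (i \in S'); case: (i \in T); case: (i \in T').
have E2 : reflect_in S X = reflect_in (S :&: T') (reflect_in (D :\: T') X).
  rewrite reflect_reflect.
    apply: eq_reflect => i _; rewrite !inE; have [] := H i; rewrite !inE.
    by case: (i \in S); case: (i \in S'); case: (i \in T); case: (i \in T').
  apply: subT => i; rewrite !inE; have [] := H i; rewrite !inE.
  by case: (i \in S); case: (i \in S'); case: (i \in T); case: (i \in T').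
rewrite E1 E2; congr (reflect_in _ _); rewrite reflect_reflect.
  apply: eq_reflect => i _; rewrite !inE; have [] := H i; rewrite !inE.
  by case: (i \in S); case: (i \in S'); case: (i \in T); case: (i \in T').
apply: subT => i; rewrite !inE; have [] := H i; rewrite !inE.
by case: (i \in S); case: (i \in S'); case: (i \in T); case: (i \in T').
Qed.

Variables (T T' : {set F}) (w w' : cell V) (cT : clique T) (cT' : clique T').
Local Notation c := (star_chart w cT).
Local Notation c' := (star_chart w' cT').
Local Notation D := (diff w w').

Lemma transition_crossing z : transition_dom c c' z ->
  Defs.transition c c' z = proj (crossing T T' D (hom z)) /\ last (crossing T T' D (hom z)) != 0.
Proof.
move=> [zi /= zs]; have [Bz _] := star_image_body cT zi; have [l0 _] := zi.
rewrite /Defs.transition /=; rewrite /fold_pt in zs *.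
set x := proj _ in Bz zs *; set S := negatives T (hom z) in zs *; set v := flips S w in zs *.
rewrite (unfold_glue Bz zs); set S' := diff w' v.
have ST : S \subset T by apply/fintype.subsetP => i; rewrite inE => /andP[].
have ST' : S' \subset T'.
  by have := zs; rewrite (star_glue w' cT' v Bz) => -[/andP[]].
have DE : (S :\: S') :|: (S' :\: S) = D.
  apply/finset.setP => i; rewrite !inE /v side_flips.
  have -> : (i \in T) && (ht i (hom z) < 0) = (i \in S) by rewrite [RHS]inE.
  by case: (i \in S); case: (side i w); case: (side i w').
have xE : hom x = (last (fold_in T (hom z)))^-1 *: reflect_in S (hom z).
  by rewrite /x hom_proj ?gt_eqF // foldE.
have E1 : reflect_in S' (hom x) = (last (fold_in T (hom z)))^-1 *: crossing T T' D (hom z).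
  by rewrite xE reflectZ (crossingE _ cT cT' ST ST') DE.
split; first by rewrite E1 projZ // invr_eq0 gt_eqF.
have := last_reflect_body S' Bz; rewrite E1 lastZ => /lt0r_neq0.
by rewrite mulf_eq0 negb_or => /andP[].
Qed.

Lemma transition_dom_open : open (transition_dom c c').
Proof.
rewrite openE => z [zi zs]; rewrite /interior.
have A : \forall y \near z, star_image T y.
  by apply: open_nbhs_nbhs; split=> //; exact: star_image_open.
have B : nbhs (fold_pt T w z) (star T' w').
  by apply: open_nbhs_nbhs; split=> //; exact: star_open.
by apply: filterS (filterI A (fold_continuous_at cT zi B)) => y [].
Qed.

Lemma lorentz_crossing (z : E) : transition_dom c c' z -> lorentz (crossing T T' D).
Proof.
move=> [zi /= zs]; have [Bz _] := star_image_body cT zi.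
set S := negatives T (hom z); set S' := diff w' (flips S w).
have ST : S \subset T by apply/fintype.subsetP => i; rewrite inE => /andP[].
have ST' : S' \subset T'.
  by have := zs; rewrite /fold_pt (star_glue w' cT' _ Bz) => -[/andP[]].
have DE : (S :\: S') :|: (S' :\: S) = D.
  apply/finset.setP => i; rewrite !inE side_flips -/(i \in S); have -> : (i \in T) && (ht i (hom z) < 0) = (i \in S) by rewrite [RHS]inE.
  by case: (i \in S); case: (side i w); case: (side i w').
have E1 : crossing T T' D = reflect_in S' \o reflect_in S.
  by apply/funext => X; rewrite /= (crossingE _ cT cT' ST ST') DE.
by rewrite E1; apply: lorentz_comp; apply: lorentz_reflect; apply: cliqueS; eauto.
Qed.

Lemma transition_smooth (j : 'I_n) : smooth (transition_dom c c') (fun z => Defs.transition c c' z 0 j).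
Proof.
have [[z0 z0d]|empty] := pselect (exists z, transition_dom c c' z); last first.
  apply: (smooth_reval (e := Const 0) transition_dom_open) => z zd; exfalso;
    by apply: empty; exists z.
have lg := lorentz_crossing z0d.
apply: (smooth_reval (e := proj_exp (crossing T T' D) j) transition_dom_open) => z zd.
  by rewrite reval_proj_exp //; have [-> _] := transition_crossing zd.
by apply: rdef_proj_exp => //; have [] := transition_crossing zd.
Qed.

(** Folding is a reflection at each point, hence preserves the Lorentz square, whose sign
    distinguishes the inside of the ball; the folded point lies in the body. *)
Lemma star_image_ball : star_image T `<=` @ball_set R n.
Proof.
move=> z zi; have [Bz _] := star_image_body cT zi; have [l0 _] := zi.
have lg : lorentz (@reflect_in _ _ P (negatives T (hom z))).
  by apply: lorentz_reflect; exact: clique_negatives.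
have zE : lform (hom z) (hom z) =
    last (fold_in T (hom z)) ^+ 2 * lform (hom (proj (fold_in T (hom z))))
      (hom (proj (fold_in T (hom z)))).
  rewrite hom_proj ?gt_eqF // lformZl [lform (fold_in T _) _]lformC lformZl.
  rewrite -[LHS](proj2 lg) -foldE; move: (lform _ _) l0 => a; move: (last _) => l l0.
  by field; rewrite gt_eqF.
rewrite /ball_set /= -subr_lt0 -lform_hom zE pmulr_rlt0 ?exprn_gt0 // lform_hom subr_lt0.
exact: body_inside Bz.
Qed.

Lemma transition_metric z : transition_dom c c' z ->
  klein z = 'J (Defs.transition c c') z *m klein (Defs.transition c c' z) *m ('J (Defs.transition c c') z)^T.
Proof.
move=> zd; have [zi _] := zd; have [_ l0] := transition_crossing zd.
apply: (klein_jacobian (lorentz_crossing zd)) => //; last exact: star_image_ball.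
have : \forall y \near z, transition_dom c c' y.
  by apply: open_nbhs_nbhs; split=> //; exact: transition_dom_open.
by apply: filterS => y /transition_crossing [].
Qed.

End HyperbolicManifold.

Section HyperbolicStructure.
Context {R : realType} {n : nat} {P : polytope R n}.
Variable V : mirrors P.
Local Notation M := (glued V).

Definition star_atlas : set (chart R n M) :=
  [set c | exists T w (cT : clique T), c = star_chart w cT].

Definition glued_smooth_structure : smooth_structure R n M.
Proof.
refine (@SmoothStructure R n M star_atlas _ _).
- move=> p; have [Bp pE] := glue_lbl p.
  exists (star_chart (lbl p) (body_clique Bp)); first by do 3!eexists.
  by split=> [|i]; [exact: near_refl|rewrite inE lt_neqAle eq_sym Bp andbT].
by move=> c c' [T [w [cT ->]]] [T' [w' [cT' ->]]] j; exact: transition_smooth.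
Defined.

Definition glued_metric : riemannian_metric glued_smooth_structure.
Proof.
refine (@RiemannianMetric R n M glued_smooth_structure (fun _ => klein) _ _ _ _).
- by move=> c x _ _; exact: klein_symmetric.
- move=> c x u [T [w [cT ->]]] xc u0; rewrite klein_formE.
  by apply: klein_form_gt0 => //; exact: star_image_ball xc.
- move=> c i j [T [w [cT ->]]]; apply: klein_smooth; last exact: star_image_ball.
  exact: star_image_open.
by move=> c c' x [T [w [cT ->]]] [T' [w' [cT' ->]]]; exact: transition_metric.
Defined.

Lemma glued_hyperbolic : hyperbolic R n M.
Proof.
exists glued_smooth_structure, glued_metric, (-1); split; first by rewrite oppr_lt0 ltr01.
move=> c x u v [T [w [cT ->]]] xc uv; apply: klein_curvature => //.
exact: star_image_ball xc.
Qed.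

End HyperbolicStructure.

(** * Chambers of a cycle *)

Section SignedSums.
Context {T : choiceType}.

(** Multiplicities are unrolled into repeated terms, so that single simplices can be matched. *)
Lemma freeg_signed_sum (D : {freeg T}) : exists l : seq (bool * T),
  D = \sum_(p <- l) << p.2 >> *~ (-1) ^+ p.1.
Proof.
elim/freeg_ind_dom0: D => [|k x D _ _ [l ->]]; first by exists [::]; rewrite big_nil.
have E m (a : bool * T) : \sum_(p <- nseq m a) << p.2 >> *~ (-1) ^+ p.1 =
    << a.2 >> *~ (-1) ^+ a.1 *+ m :> {freeg T} by rewrite big_nseq iter_addr_0.
exists (nseq (absz k) ((k : int) < 0, x) ++ l); rewrite big_cat /= E; congr (_ + _).
by rewrite pmulrn -mulrzA abszE -[(-1) ^+ _ * _]intEsign freegU_mulz intz.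
Qed.

Variables (I : finType) (x : I -> T) (e : I -> bool).
Hypothesis sum0 : \sum_i << x i >> *~ (-1) ^+ e i = 0 :> {freeg T}.

Let fibre i b : {set I} := [set k | (x k == x i) && (e k == b)].

Lemma card_fibre i : #|fibre i (e i)| = #|fibre i (~~ e i)|.
Proof.
have := congr1 (coeff (x i)) sum0; rewrite raddf_sum raddf0 /=.
have E k : coeff (x i) (<< x k >> *~ (-1) ^+ e k) =
    (if e k then - (x k == x i)%:R else (x k == x i)%:R : int).
  by rewrite raddfMz /= coeffU mul1r; case: (e k); rewrite ?expr1 ?mulrN1z ?expr0 ?mulr1z.
under eq_bigr do rewrite E.
have -> : \sum_k (if e k then - (x k == x i)%:R else (x k == x i)%:R : int) =
   (#|fibre i false| : int) - (#|fibre i true| : int).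
  have C b : (#|fibre i b| : int) = \sum_(k | e k == b) (x k == x i)%:R.
    rewrite -[LHS]natz -sum1_card natr_sum big_mkcond [RHS]big_mkcond /=; apply: eq_bigr => k _.
    by rewrite inE andbC; case: (e k == b) => //=; case: (x k == x i).
  rewrite !C (bigID e) /= addrC; congr (_ + _).
    by rewrite [RHS](eq_bigl (fun k => ~~ e k)) => [|k]; [apply: eq_bigr => k /negbTE ->|case: (e k)].
  rewrite -sumrN [RHS](eq_bigl e) => [|k]; last by case: (e k).
  by apply: eq_bigr => k ->.
by move/eqP; rewrite subr_eq0 => /eqP [H]; case: (e i) => /=; rewrite H.
Qed.

(** The coefficient of each generator vanishes, so it occurs equally often with either sign;
    occurrences are matched by their position in the two enumerations. *)
Lemma sign_matching : exists mu : I -> I,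
  [/\ involutive mu, forall i, x (mu i) = x i & forall i, e (mu i) = ~~ e i].
Proof.
pose mu i := nth i (enum (fibre i (~~ e i))) (index i (enum (fibre i (e i)))).
have iin i : i \in enum (fibre i (e i)) by rewrite mem_enum inE !eqxx.
have sz i : (index i (enum (fibre i (e i))) < size (enum (fibre i (~~ e i))))%N.
  by rewrite -cardE -card_fibre cardE index_mem.
have muP i : x (mu i) = x i /\ e (mu i) = ~~ e i.
  have := mem_nth i (sz i); rewrite -/(mu i) mem_enum inE.
  by move=> /andP[/eqP -> /eqP ->].
have fib i b : fibre (mu i) b = fibre i b by rewrite /fibre (muP i).1.
exists mu; split=> [i|i|i]; [|exact: (muP i).1|exact: (muP i).2].
rewrite {1}/mu (muP i).2 negbK !fib {2}/mu index_uniq ?enum_uniq //.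
by rewrite (set_nth_default i) ?nth_index // -cardE card_fibre cardE.
Qed.

End SignedSums.

(** A cycle as combinatorial data: signed singular simplices with one sign-reversing involution for
    each face. Involutions for different faces are not assumed to commute. *)
Record chambers (R : realType) (n : nat) (N : topologicalType) := Chambers {
  chamber : finType;
  csgn : chamber -> bool;
  cmap : chamber -> simplex R n N;
  cadj : 'I_n.+1 -> chamber -> chamber;
  cadjK : forall j, involutive (cadj j);
  csgn_cadj : forall j c, csgn (cadj j c) = ~~ csgn c;
  cmap_cadj : forall j c (x : std_simplex R n), set_val x 0 j = 0 ->
    cmap (cadj j c) x = cmap c x }.

Section ChambersOfCycle.
Context {R : realType} {n : nat} {N : topologicalType}.
Variables (K : nat) (s : 'I_K -> simplex R n.+1 N) (eps : 'I_K -> bool).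
Variable mu : 'I_K * 'I_n.+2 -> 'I_K * 'I_n.+2.
Hypothesis muK : involutive mu.
Hypothesis mu_face : forall p,
  s (mu p).1 \o @face R n (mu p).2 =1 s p.1 \o @face R n p.2.
Hypothesis mu_sign : forall p, eps (mu p).1 (+) odd (mu p).2 = ~~ (eps p.1 (+) odd p.2).

Lemma mul_rowsub_lift m k (x : 'rV[R]_k.+2) (w : 'M[R]_(k.+2, m)) (j : 'I_k.+2) :
  x 0 j = 0 -> x *m w = colsub (lift j) x *m rowsub (lift j) w.
Proof.
move=> x0; apply/rowP => l; rewrite !mxE (bigD1_ord j) //= x0 mul0r add0r.
by apply: eq_bigr => i _; rewrite !mxE.
Qed.

Lemma colsub_lift_simplex k (x : 'rV[R]_k.+2) (j : 'I_k.+2) :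
  std_simplex R k.+1 x -> x 0 j = 0 -> std_simplex R k (colsub (lift j) x).
Proof.
move=> [x0 x1] xj; split=> [i|]; first by rewrite mxE.
by rewrite -x1 (bigD1_ord j) //= xj add0r; apply: eq_bigr => i _; rewrite mxE.
Qed.

Definition flag_simplex (i : 'I_K) (t : 'S_n.+2) : simplex R n.+1 N :=
  mksimplex (fun x => simplex_ext (s i) (set_val x *m bary t)).

Lemma flag_simplexE i t x : flag_simplex i t x = simplex_ext (s i) (set_val x *m bary t).
Proof.
rewrite /flag_simplex mksimplexE //.
apply: (affine_simplex_continuous (Q := std_simplex R n.+1)).
- exact: convex_std_simplex.
- exact: simplex_ext_continuous.
exact: bary_simplex.
Qed.

Lemma simplex_ext_face (i : 'I_K) (j : 'I_n.+2) (y : 'rV[R]_n.+1) : std_simplex R n y ->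
  simplex_ext (s i) (y *m face_mx j) =
  (s i \o @face R n j) (insubd (simplex_vertex n) y).
Proof.
move=> yS; rewrite -[in LHS](simplex_val_insubd yS) -face_mapE.
exact: (simplex_extE (s i) (face j (insubd (simplex_vertex n) y))).
Qed.

Variable unlift : 'S_n.+2 -> 'I_n.+2 * 'S_n.+1.
Hypothesis unliftK : forall t, lift_perm ord_max (unlift t).1 (unlift t).2 = t.
Hypothesis liftK : forall j t, unlift (lift_perm ord_max j t) = (j, t).

(** Vertex [j] of a flag simplex is the barycenter of a face of dimension [j]. For [j] below the top
    the other choice of that face is taken; for the top vertex the facet is crossed to its partner
    under [mu]. Numbering vertices by dimension makes the matchings respect the order of
    vertices. *)
Definition flag_adj (j : 'I_n.+2) (c : 'I_K * 'S_n.+2) : 'I_K * 'S_n.+2 :=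
  if @fintype.unlift n.+2 ord_max j is Some k then
    (c.1, (tperm (widen_ord (leqnSn _) k) (lift ord0 k) * c.2)%g)
  else let p := mu (c.1, (unlift c.2).1) in (p.1, lift_perm ord_max p.2 (unlift c.2).2).

Definition flag_sign (c : 'I_K * 'S_n.+2) : bool := eps c.1 (+) c.2.

Lemma flag_adjK j : involutive (flag_adj j).
Proof.
move=> [i t]; rewrite /flag_adj; case: fintype.unliftP => [k|] jE /=.
  by rewrite mulgA tperm2 mul1g.
rewrite liftK /= -surjective_pairing muK /=; congr pair; exact: unliftK.
Qed.

Lemma flag_sign_adj j c : flag_sign (flag_adj j c) = ~~ flag_sign c.
Proof.
case: c => i t; rewrite /flag_adj /flag_sign; case: fintype.unliftP => [k|] jE /=.
  rewrite odd_permM odd_tperm (_ : _ != _); last first.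
    by apply/eqP => /(congr1 val) /= /eqP; rewrite /bump /= add1n ltn_eqF.
  by case: (eps i); case: (odd_perm t).
have -> : odd_perm t = ~~ odd n (+) odd (unlift t).1 (+) (unlift t).2.
  by rewrite -{1}(unliftK t) odd_lift_perm.
have := mu_sign (i, (unlift t).1); rewrite odd_lift_perm /=.
case: (mu _) => i' j' /=.
case: (eps i') => /=; case: (odd j') => /=; case: (eps i) => /=; case: (odd (unlift t).1) => /= //;
  by case: (odd n) => /=; case: (odd_perm (unlift t).2).
Qed.

Lemma flag_map_adj j c (x : std_simplex R n.+1) : set_val x 0 j = 0 ->
  flag_simplex (flag_adj j c).1 (flag_adj j c).2 x = flag_simplex c.1 c.2 x.
Proof.
case: c => i t x0; rewrite !flag_simplexE /flag_adj; case: fintype.unliftP => [k|] jE /=.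
  have jk : j = widen_ord (leqnSn _) k.
    by rewrite jE; apply/val_inj; rewrite /= /bump leqNgt ltn_ord.
  rewrite jk in x0 *; congr (simplex_ext _ _).
  by rewrite !(mul_rowsub_lift _ x0) bary_inner_face.
have xS : std_simplex R n (colsub (lift ord_max) (set_val x)).
  by apply: colsub_lift_simplex; [exact: set_valP|rewrite -jE].
rewrite jE in x0; rewrite !(mul_rowsub_lift _ x0) bary_outer_face mulmxA.
rewrite -[in RHS](unliftK t) bary_outer_face mulmxA.
have yS : std_simplex R n (colsub (lift ord_max) (set_val x) *m bary (unlift t).2).
  by apply: convex_std_simplex => //; exact: bary_simplex.
rewrite !simplex_ext_face //; exact: mu_face (i, (unlift t).1) _.
Qed.

Definition flag_chambers : chambers R n.+1 N :=
  Chambers (cmap := fun c => flag_simplex c.1 c.2) flag_adjK flag_sign_adj flag_map_adj.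

Lemma sum_flag_chambers :
  \sum_(c : chamber flag_chambers) << cmap c >> *~ (-1) ^+ csgn c =
  sd (\sum_i << s i >> *~ (-1) ^+ eps i) :> chain R n.+1 N.
Proof.
rewrite [RHS]raddf_sum.
rewrite -(pair_bigA _ (fun i t => << flag_simplex i t >> *~ (-1) ^+ flag_sign (i, t))) /=.
apply: eq_bigr => i _; rewrite [RHS]raddfMz /= /sd natopU /sdch raddf_sum mulrz_suml.
apply: eq_bigr => t _; rewrite [in RHS]raddfMz /= realizeU -mulrzA; congr (_ *~ _).
by rewrite /flag_sign /= signr_addb mulrC.
Qed.

End ChambersOfCycle.

Theorem cycle_chambers (R : realType) (n : nat) (N : topologicalType) (z : chain R n.+1 N) :
  boundary z = 0 -> exists X : chambers R n.+1 N,
  null set0 (\sum_(c : chamber X) << cmap c >> *~ (-1) ^+ csgn c - z).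
Proof.
move=> dz; have [l zE] := freeg_signed_sum z.
pose K := size l; pose p0 (i : 'I_K) := tnth (in_tuple l) i.
have {}zE : z = \sum_i << (p0 i).2 >> *~ (-1) ^+ (p0 i).1.
  by rewrite zE (big_tnth _ _ l).
have [|mu [muK mux mue]] := @sign_matching _ ('I_K * 'I_n.+2)%type
    (fun p => ((p0 p.1).2 \o @face R n p.2 : simplex R n N))
    (fun p => (p0 p.1).1 (+) odd p.2).
  rewrite -[RHS]dz zE [RHS]raddf_sum /=.
  rewrite -(pair_bigA _ (fun i j => << ((p0 i).2 \o @face R n j : simplex R n N) >> *~
    (-1) ^+ ((p0 i).1 (+) odd j))) /=.
  apply: eq_bigr => i _; rewrite [RHS]raddfMz /=.
  change (\sum_j << ((p0 i).2 \o @face R n j : simplex R n N) >> *~ (-1) ^+ ((p0 i).1 (+) odd j) =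
    boundary (<< (p0 i).2 >> : chain R n.+1 N) *~ (-1) ^+ (p0 i).1).
  rewrite boundaryU mulrz_suml; apply: eq_bigr => j _.
  by rewrite -mulrzA signr_addb signr_odd mulrC.
have [un liK unK] := @lift_perm_bij n.+1.
have H p : (p0 (mu p).1).2 \o @face R n (mu p).2 =1 (p0 p.1).2 \o @face R n p.2.
  by move=> x; have := mux p => /continuousEP /(_ x).
exists (@flag_chambers R n N K (fun i => (p0 i).2) (fun i => (p0 i).1) mu muK H mue un unK
  (fun j t => liK (j, t))).
rewrite sum_flag_chambers -zE -[sd z]/(sdk 1 z) -opprB; apply/nullN/null_sdk.
by rewrite /rel_cycle dz; exact: supported0.
Qed.

(** * Coloured cells and the map to the given manifold *)

Section ColouredCells.
Context {R : realType} {n m : nat} {P : polytope R n} {N : topologicalType}.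
Variable X : chambers R m N.
Variable colour : facet P -> {set 'I_m.+1}.
Hypothesis colour_neq0 : forall i, colour i != finset.set0.
Hypothesis colour_comparable : forall i j, adjacent i j ->
  (colour i \subset colour j) || (colour j \subset colour i).

Local Notation C := (chamber X).
Local Notation F := (facet P).
Local Notation J := {set 'I_m.+1}.
Implicit Types (w u t : J) (i j : F) (c : C).

(* The cells carry their gluing involutions with them: crossing a facet conjugates
   the involutions of the larger colours, which makes the crossings of adjacent
   facets commute. *)
Definition wall_family (Phi : {ffun J -> {ffun C -> C}}) : bool :=
  `[< forall w, w != finset.set0 -> [/\ involutive (Phi w),
        (forall c, csgn (Phi w c) = ~~ csgn c) &
        forall c (x : std_simplex R m), (forall k, k \in w -> set_val x 0 k = 0) ->
          cmap (Phi w c) x = cmap c x] >].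

Definition walls := {Phi : {ffun J -> {ffun C -> C}} | wall_family Phi}.

(** For any [k] in [w], points whose coordinates in [w] vanish lie on face [k], so the adjacency
    across this single face serves as a gluing for [w]. *)
Lemma walls_exist : exists Phi, wall_family Phi.
Proof.
exists [ffun w : J => [ffun c => if [pick k | k \in w] is Some k then cadj k c else c]].
apply/asboolP => w w0; have [k0 k0w] : exists k0, k0 \in w by exact/set0Pn.
have E c : [ffun w : J => [ffun c => if [pick k | k \in w] is Some k then cadj k c else c]] w c =
   (if [pick k | k \in w] is Some k then cadj k c else c) by rewrite !ffunE.
split=> [c|c|c x xw]; rewrite !E; case: pickP => [k kw|/(_ k0)]; rewrite ?k0w //.
- exact: cadjK.
- exact: csgn_cadj.
by apply: cmap_cadj; exact: xw.
Qed.

Definition twist w (Phi : {ffun J -> {ffun C -> C}}) : {ffun J -> {ffun C -> C}} :=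
  [ffun u : J => [ffun c : C => if w \subset u then Phi w (Phi u (Phi w c)) else Phi u c]].

Lemma twistE w Phi u c : twist w Phi u c =
  if w \subset u then Phi w (Phi u (Phi w c)) else Phi u c.
Proof. by rewrite !ffunE. Qed.

Lemma wall_family_twist w Phi : w != finset.set0 -> wall_family Phi ->
  wall_family (twist w Phi).
Proof.
move=> w0 /asboolP G; apply/asboolP => u u0; have [wK ws wm] := G w w0.
have [uK us um] := G u u0; have [wu|wu] := boolP (w \subset u); last first.
  by split=> [c|c|c x xu]; rewrite !twistE ?(negPf wu) ?uK ?us // um.
split=> [c|c|c x xu]; rewrite !twistE wu ?twistE ?wu.
- by rewrite wK uK wK.
- by rewrite ws us ws negbK.
have xw k : k \in w -> set_val x 0 k = 0 by move=> kw; apply: xu; exact: (fintype.subsetP wu).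
by rewrite wm // um // wm.
Qed.

Definition twist_walls w (Phi : walls) : walls := insubd Phi (twist w (val Phi)).

Lemma val_twist_walls w Phi : w != finset.set0 -> val (twist_walls w Phi) = twist w (val Phi).
Proof. by move=> w0; rewrite val_insubd wall_family_twist //; exact: valP. Qed.

Lemma wallK w (Phi : walls) : w != finset.set0 -> involutive (val Phi w).
Proof. by move=> w0; have /asboolP /(_ w w0) [] := valP Phi. Qed.

Definition coloured_cell : finType := (C * walls * {ffun F -> bool})%type.

Definition coloured_flip i (v : coloured_cell) : coloured_cell :=
  (val v.1.2 (colour i) v.1.1, twist_walls (colour i) v.1.2,
   [ffun j => v.2 j (+) (i == j)]).

Lemma twistK w (Phi : {ffun J -> {ffun C -> C}}) : involutive (Phi w) -> twist w (twist w Phi) = Phi.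
Proof.
move=> wK; apply/ffunP => u; apply/ffunP => c; rewrite !twistE fintype.subxx.
by have [wu|//] := boolP (w \subset u); rewrite !wK.
Qed.

Lemma coloured_flipK i : involutive (coloured_flip i).
Proof.
move=> [[c Phi] b]; rewrite /coloured_flip /=; have w0 := colour_neq0 i.
have wK := wallK Phi w0; congr (_, _, _).
- by rewrite val_twist_walls // twistE fintype.subxx !wK.
- by apply: val_inj; rewrite !val_twist_walls // twistK.
by apply/(@ffunP _ (fun=> bool)) => j; rewrite !ffunE -addbA addbb addbF.
Qed.

(** Both orders of crossing end at [Phi w (Phi u c)]: crossing [w] first conjugates the gluing of
    [u] by [Phi w], and the inner conjugation cancels the step already made. *)
Lemma twist_comm w u (Phi : {ffun J -> {ffun C -> C}}) : w \subset u -> involutive (Phi w) -> involutive (Phi u) ->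
  (forall c, twist u Phi w (Phi u c) = twist w Phi u (Phi w c)) /\
  twist w (twist u Phi) = twist u (twist w Phi).
Proof.
move=> wu wK uK; have [uw|uw] := boolP (u \subset w).
  by have -> : u = w by apply/eqP; rewrite finset.eqEsubset uw wu.
split=> [c|]; first by rewrite !twistE (negPf uw) wu wK.
apply/ffunP => t; apply/ffunP => c; rewrite !twistE (negPf uw) wu.
case: (boolP (u \subset t)) => ut; first by rewrite (fintype.subset_trans wu ut) !wK.
by [].
Qed.

Lemma coloured_flip_comm i j v : adjacent i j ->
  coloured_flip i (coloured_flip j v) = coloured_flip j (coloured_flip i v).
Proof.
wlog ij : i j / colour i \subset colour j => [W aij|_].
  by case/orP: (colour_comparable aij) => h; [|apply/esym]; apply: W => //; rewrite adjacent_sym.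
case: v => [[c Phi] b]; rewrite /coloured_flip /=.
have [iK jK] := (wallK Phi (colour_neq0 i), wallK Phi (colour_neq0 j)).
have [E1 E2] := twist_comm ij iK jK.
congr (_, _, _); first by rewrite !val_twist_walls.
  by apply: val_inj; rewrite !val_twist_walls.
by apply/(@ffunP _ (fun=> bool)) => k; rewrite !ffunE addbAC.
Qed.

Definition coloured_mirrors : mirrors P.
Proof.
refine (@Mirrors R n P coloured_cell coloured_flip (fun i v => v.2 i)
  (fun v => csgn v.1.1) coloured_flipK coloured_flip_comm _ _).
- by move=> i j v; rewrite ffunE.
move=> i [[c Phi] b] /=; have /asboolP /(_ _ (colour_neq0 i)) [_ -> //] := valP Phi.
Defined.

Definition chamber_of (v : cell coloured_mirrors) : C := v.1.1.

Lemma cmap_flip i v (x : std_simplex R m) : (forall k, k \in colour i -> set_val x 0 k = 0) ->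
  cmap (chamber_of (flip i v)) x = cmap (chamber_of v) x.
Proof.
by case: v => [[c Phi] b] /=; have /asboolP /(_ _ (colour_neq0 i)) [_ _] := valP Phi; apply.
Qed.

Definition multiplicity : nat := #|{: walls * {ffun F -> bool}}|.

Lemma multiplicity_gt0 : (0 < multiplicity)%N.
Proof.
rewrite /multiplicity card_prod muln_gt0 card_ffun card_bool expn_gt0 /= andbT.
by have [Phi G] := walls_exist; apply/card_gt0P; exists (Sub Phi G : walls).
Qed.

Lemma sum_chamber_of (W : zmodType) (G : C -> W) :
  \sum_(v : cell coloured_mirrors) G (chamber_of v) = (\sum_c G c) *+ multiplicity.
Proof.
rewrite -(pair_bigA _ (fun cp (b : {ffun F -> bool}) => G cp.1)) /=.
under eq_bigr do rewrite sumr_const.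
rewrite -(pair_bigA _ (fun c (Phi : walls) => G c *+ #|{: {ffun F -> bool}}|)) /=.
under eq_bigr do rewrite sumr_const -mulrnA.
by rewrite sumrMnl /multiplicity card_prod mulnC.
Qed.

Lemma near_cmap (S : {set F}) (v v' : cell coloured_mirrors) (y : 'rV[R]_m.+1) : near S v v' -> std_simplex R m y ->
  (forall i, i \in S -> forall k, k \in colour i -> y 0 k = 0) ->
  simplex_ext (cmap (chamber_of v)) y = simplex_ext (cmap (chamber_of v')) y.
Proof.
move=> /nearP[A AS ->] ys y0; rewrite /flips.
have : {subset enum A <= S} by move=> j; rewrite mem_enum; exact: (fintype.subsetP AS).
elim: (enum A) => [//|i l IH] lS /=.
rewrite IH => [|j jl]; last by apply: lS; rewrite inE jl orbT.
apply/esym/cmap_flip => k ki; rewrite simplex_val_insubd //.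
by apply: (y0 i) => //; apply: lS; rewrite inE eqxx.
Qed.

Hypothesis colour_proper : forall i, colour i != [set: 'I_m.+1]%SET.

Definition weight (k : 'I_m.+1) (x : 'rV[R]_n) : R := \prod_(i | k \in colour i) fht i x.

Definition barycentric (x : 'rV[R]_n) : 'rV[R]_m.+1 :=
  \row_k (weight k x / \sum_l weight l x).

(** The colours of a clique form a chain, so their union is the largest of them, which is proper.
    This keeps the normalising sum of the weights positive. *)
Lemma free_colour (S : {set F}) : clique S -> exists k, forall i, i \in S -> k \notin colour i.
Proof.
move=> cS; have [->|[i0 i0S]] := set_0Vmem S; first by exists ord0 => i; rewrite inE.
have [i iS imax] := arg_maxnP (fun i => #|colour i|) i0S.
have [k ki] : exists k, k \notin colour i.
  apply/existsP; apply: contraNT (colour_proper i) => /existsPn H.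
  by apply/eqP/finset.setP => k; rewrite finset.in_setT; exact/negPn/H.
exists k => j jS; apply: contra ki; apply: (fintype.subsetP _).
have [->//|ij] := eqVneq j i.
have /orP[//|h] := colour_comparable (cS _ _ jS iS ij).
have := imax j jS => le; have /eqP <- // : colour i == colour j.
by rewrite eqEcard h.
Qed.

Lemma weight_ge0 k x : body P x -> 0 <= weight k x.
Proof. by move=> Bx; apply: prodr_ge0 => i _; exact: Bx. Qed.

Lemma sum_weight_gt0 x : body P x -> 0 < \sum_k weight k x.
Proof.
move=> Bx; have [k kf] := free_colour (body_clique Bx).
rewrite (bigD1 k) //=; apply: ltr_pwDl; last by apply: sumr_ge0 => l _; exact: weight_ge0.
apply: prodr_gt0 => i ki; rewrite lt_neqAle eq_sym Bx andbT.
by apply: contraL ki => /eqP xi; apply: kf; rewrite inE xi.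
Qed.

Lemma barycentric_simplex x : body P x -> std_simplex R m (barycentric x).
Proof.
move=> Bx; have s0 := sum_weight_gt0 Bx; split=> [k|].
  by rewrite mxE divr_ge0 ?weight_ge0 // ltW.
under eq_bigr do rewrite mxE.
by rewrite -mulr_suml divff // gt_eqF.
Qed.

Lemma barycentric0 x i k : fht i x = 0 -> k \in colour i -> barycentric x 0 k = 0.
Proof. by move=> xi ki; rewrite mxE /weight (bigD1 i) //= xi !mul0r. Qed.

Lemma barycentric_continuous x : body P x -> {for x, continuous barycentric}.
Proof.
move=> Bx; apply: (@cvg_mx _ _ (nbhs x)) => a k; rewrite mxE; under eq_fun do rewrite mxE.
have H l : weight l y @[y --> x] --> weight l x.
  by apply: (@cvg_big_prod _ _ (nbhs x)) => i; exact: fht_continuous.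
apply: cvgM => //; apply: cvgV; first by rewrite gt_eqF // sum_weight_gt0.
exact: (@cvg_big_sum _ _ (nbhs x)).
Qed.

Local Notation V := coloured_mirrors.

Definition realization (p : glued V) : N :=
  simplex_ext (cmap (chamber_of (lbl p))) (barycentric (pos p)).

Lemma realization_glue x v : body P x ->
  realization (glue x v) = simplex_ext (cmap (chamber_of v)) (barycentric x).
Proof.
move=> Bx; rewrite /realization pos_glue //; apply/esym.
apply: near_cmap (near_lbl v Bx) (barycentric_simplex Bx) _ => i.
by rewrite inE => /eqP xi k; exact: barycentric0.
Qed.

Lemma realization_continuous : continuous realization.
Proof.
move=> p; apply: (@cvg_paste _ _ (cell V) (@layer _ _ _ V)) => [v||].
- exact: layer_closed.
- near=> q; have [x [v [Bx ->]]] := gluedP q; exists v.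
  by exists x.
move=> v [x Bx pE] B; rewrite -pE realization_glue // => nB.
have /subspace_continuousP gc := @simplex_ext_continuous _ _ _ (cmap (chamber_of v)).
have H : \forall y \near barycentric x, std_simplex R m y ->
    B (simplex_ext (cmap (chamber_of v)) y) := gc _ (barycentric_simplex Bx) _ nB.
have px : pos q @[q --> glue x v] --> x 
  by have := @pos_continuous _ _ _ V (glue x v); rewrite /continuous_at pos_glue.
have bx : barycentric y @[y --> x] --> barycentric x := barycentric_continuous Bx.
have H' : \forall q \near glue x v, std_simplex R m (barycentric (pos q)) ->
    B (simplex_ext (cmap (chamber_of v)) (barycentric (pos q))).
  exact: (cvg_comp _ _ px bx) H.
apply: filterS H' => q Hq [y By qE]; rewrite -qE realization_glue //.
by move: Hq; rewrite -qE pos_glue //; apply; exact: barycentric_simplex.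
Unshelve. all: by end_near. Qed.

Definition realization_map : continuousType (glued V) N :=
  HB.pack realization (isContinuous.Build _ _ realization realization_continuous).

End ColouredCells.

Local Arguments boundary : simpl never.

Lemma freeg_torsion_free (K : choiceType) (D : {freeg K}) k : D *+ k.+1 = 0 -> D = 0.
Proof.
move=> D0; apply/eqP/freeg_eqP => x; have := congr1 (coeff x) D0.
by rewrite raddfMn /= coeff0 => /eqP; rewrite mulrn_eq0 /= => /eqP.
Qed.

(** Reindexing a sum by a sign-reversing involution shows that it equals its opposite; the absence
    of 2-torsion then makes it vanish. *)
Lemma freeg_opp_eq0 (K : choiceType) (D : {freeg K}) : D = - D -> D = 0.
Proof. by move=> D0; apply: (@freeg_torsion_free K D 1); rewrite mulr2n {1}D0 addNr. Qed.

(** * Flags of facets *)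

Section Flags.
Context {F : finType} {m : nat}.
Local Notation T := {ffun 'I_m.+1 -> F}.
Implicit Types (t : T) (x : F).

Definition swap (i : 'I_m) t : T :=
  [ffun j => t (tperm (widen_ord (leqnSn m) i) (lift ord0 i) j)].

Definition set_last x t : T := [ffun j => if j == ord_max then x else t j].

Lemma swapK i : involutive (swap i).
Proof. by move=> t; apply/ffunP => j; rewrite !ffunE tpermK. Qed.

(** The first [j] facets of a flag cut out its face of codimension [j]. Vertices of the simplex of a
    flag depend only on these sets, which is why forgetting one vertex identifies different
    flags. *)
Definition prefix t (j : nat) : {set F} := [set t i | i : 'I_m.+1 & (i < j)%N]%SET.

Lemma mem_prefix t j (i : 'I_m.+1) : (i < j)%N -> t i \in prefix t j.
Proof. by move=> ij; apply: imset_f; rewrite inE. Qed.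

Lemma prefix_le t j k : (j <= k)%N -> prefix t j \subset prefix t k.
Proof.
move=> jk; apply/fintype.subsetP => _ /imsetP[i + ->]; rewrite inE => ij.
exact: mem_prefix (leq_trans ij jk).
Qed.

Lemma prefix_swap (i : 'I_m) t j : j != i.+1 -> prefix (swap i t) j = prefix t j.
Proof.
move=> ji; have sub t' : prefix (swap i t') j \subset prefix t' j.
  apply/fintype.subsetP => _ /imsetP[k + ->]; rewrite inE => kj; rewrite ffunE.
  by apply: mem_prefix; case: tpermP kj => [->|->|//]; rewrite /= /bump /=; lia.
by apply/eqP; rewrite finset.eqEsubset sub -{1}[t](swapK i) sub.
Qed.

Lemma prefix_last x t j : (j <= m)%N -> prefix (set_last x t) j = prefix t j.
Proof.
move=> jm; apply: eq_in_imset => k; rewrite inE => kj; rewrite ffunE.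
by case: eqP => // ke; move: kj; rewrite ke /=; lia.
Qed.

Section FlagSums.
Context {V : finType} {K : choiceType}.
Variables (flip : F -> V -> V) (sgn : V -> bool) (s : T -> int).
Hypothesis flipK : forall x, involutive (flip x).
Hypothesis sgn_flip : forall x v, sgn (flip x v) = ~~ sgn v.
Hypothesis s_swap : forall i t, s (swap i t) = - s t.
Hypothesis s_last : forall t, \sum_x s (set_last x t) = 0.

Lemma flag_sum_flip (Z : V -> T -> {freeg K}) :
  (forall v t, s t != 0 -> Z (flip (t ord0) v) t = Z v t) ->
  \sum_v \sum_t Z v t *~ ((-1) ^+ sgn v * s t) = 0.
Proof.
move=> ZE; rewrite exchange_big big1 //= => t _; apply: freeg_opp_eq0.
rewrite {1}(reindex_inj (inv_inj (flipK (t ord0)))) /= -sumrN; apply: eq_bigr => v _.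
have [->|t0] := eqVneq (s t) 0; first by rewrite !mulr0 mulr0z oppr0.
by rewrite ZE // sgn_flip signrN mulNr mulrNz.
Qed.

Lemma flag_sum_swap i (Z : V -> T -> {freeg K}) :
  (forall v t, Z v (swap i t) = Z v t) ->
  \sum_v \sum_t Z v t *~ ((-1) ^+ sgn v * s t) = 0.
Proof.
move=> ZE; rewrite big1 // => v _; apply: freeg_opp_eq0.
rewrite {1}(reindex_inj (inv_inj (swapK i))) /= -sumrN; apply: eq_bigr => t _.
by rewrite ZE s_swap mulrN mulrNz.
Qed.

(** Replacing the last facet in all possible ways counts every flag [#|F|] times; the multiplied sum
    vanishes by [s_last], and the chain group has no torsion. *)
Lemma flag_sum_last (Z : V -> T -> {freeg K}) :
  (forall v t x, Z v (set_last x t) = Z v t) ->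
  \sum_v \sum_t Z v t *~ ((-1) ^+ sgn v * s t) = 0.
Proof.
move=> ZE; rewrite big1 // => v _.
have [F0|] := posnP #|F|.
  by rewrite big1 // => t _; have := card0_eq F0 (t ord0); rewrite inE.
case E : #|F| => [//|k] _; apply: (@freeg_torsion_free K _ k); rewrite -E.
pose G t : {freeg K} := Z v t *~ ((-1) ^+ sgn v * s t).
rewrite -[LHS](_ : \sum_t \sum_x G (set_last x t) = _).
  rewrite big1 // => t _; rewrite /G; under eq_bigr do rewrite ZE.
  by rewrite -mulrz_sumr -mulr_sumr s_last mulr0.
pose tau (p : T * F) := (set_last p.2 p.1, p.1 ord_max).
have tauK : involutive tau.
  move=> [t x]; congr pair => /=; last by rewrite ffunE eqxx.
  by apply/ffunP => j; rewrite !ffunE; case: eqP => [->|].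
rewrite pair_big /= (reindex_inj (inv_inj tauK)) /= -(pair_big xpredT xpredT (fun t x => G (set_last (t ord_max) (set_last x t)))) /=.
under eq_bigr => t _.
  under eq_bigr => x _.
    rewrite (_ : set_last _ _ = t); last first.
      by apply/ffunP => j; rewrite !ffunE; case: eqP => [->|].
    over.
  rewrite sumr_const; over.
by rewrite /= sumrMnl.
Qed.

(** The single cancellation principle behind the cycle and the deformation to vertices. Without
    vertex 0 the terms pair up across the first facet, without an inner vertex under a swap of two
    facets, and without the last vertex they vanish by summation over the last facet. *)
Lemma flag_sum (k : 'I_m.+2) (Z : V -> T -> {freeg K}) :
  (k = ord0 -> forall v t, s t != 0 -> Z (flip (t ord0) v) t = Z v t) ->
  (forall t t', (forall j, j != k :> nat -> (j <= m.+1)%N -> prefix t j = prefix t' j) ->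
    forall v, Z v t = Z v t') ->
  \sum_v \sum_t Z v t *~ ((-1) ^+ sgn v * s t) = 0.
Proof.
move=> Z0 Z1; have [k0|k0] := eqVneq k ord0; first by apply: flag_sum_flip; exact: Z0.
have [km|km] := eqVneq (k : nat) m.+1.
  apply: flag_sum_last => v t x; apply: Z1 => j jk jm; apply: prefix_last; move: jk; lia.
have im : (k.-1 < m)%N by have := ltn_ord k; have : k != 0%N :> nat := k0; lia.
apply: (flag_sum_swap (i := Ordinal im)) => v t; apply: Z1 => j jk jm.
by apply: prefix_swap => /=; have : k != 0%N :> nat := k0; move: jk; lia.
Qed.

End FlagSums.

Section FlagMatrix.
Context {R : realType} {d : nat}.
Variable r : {set F} -> 'rV[R]_d.

Definition flag_mx t : 'M[R]_(m.+2, d) := \matrix_(j < m.+2) r (prefix t j).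

Lemma row_flag_mx t j : row j (flag_mx t) = r (prefix t j).
Proof. exact: rowK. Qed.

Lemma eq_flag_face (k : 'I_m.+2) t t' :
  (forall j, j != k :> nat -> (j <= m.+1)%N -> prefix t j = prefix t' j) ->
  rowsub (lift k) (flag_mx t) = rowsub (lift k) (flag_mx t').
Proof.
move=> tt'; apply/row_matrixP => j; rewrite !row_rowsub !row_flag_mx tt' //.
  by rewrite eq_sym; exact: (neq_lift k j).
by rewrite -ltnS; exact: ltn_ord.
Qed.

End FlagMatrix.
End Flags.

Section HomotopySum.
Context {R : realType} {n : nat} {X : topologicalType} {I : finType}.

Lemma boundary_prism_sum (eps : I -> int) (H : I -> 'rV[R]_n.+2 -> R -> X) :
  (forall i, eps i != 0 -> prism_continuous (H i)) ->
  boundary (\sum_i prism_chain (H i) *~ eps i : chain R n.+2 X) =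
    \sum_i (<< level_simplex (H i) 1 >> - << level_simplex (H i) 0 >>) *~ eps i -
    \sum_(k < n.+2) (\sum_i prism_chain (fun x t => H i (x *m face_mx k) t) *~ eps i) *~ (-1) ^+ k.
Proof.
move=> Hc; rewrite raddf_sum /=.
under [X in _ - X]eq_bigr do rewrite mulrz_suml.
rewrite [X in _ - X]exchange_big -sumrB; apply: eq_bigr => i _.
have [->|e0] := eqVneq (eps i) 0.
  by rewrite !mulr0z raddf0 big1 ?subr0 // => k _; rewrite mulr0z mul0rz.
rewrite raddfMz /= boundary_prism_chainS; last exact: Hc.
rewrite mulrzBl; congr (_ - _); rewrite mulrz_suml; apply: eq_bigr => k _.
by rewrite -!mulrzA mulrC.
Qed.

(** The homotopies belong to single simplices and need not fit together to a homotopy of maps; it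
    suffices that for each [k] the total of the prisms over the faces [k] lies in [A]. *)
Lemma homotopy_sum_null (A : set X) (eps : I -> int) (H : I -> 'rV[R]_n.+2 -> R -> X) :
  (forall i, eps i != 0 -> prism_continuous (H i)) ->
  (forall k, chain_in A (\sum_i prism_chain (fun x t => H i (x *m face_mx k) t) *~ eps i)) ->
  null A (\sum_i << level_simplex (H i) 1 >> *~ eps i -
          \sum_i << level_simplex (H i) 0 >> *~ eps i).
Proof.
move=> Hc HA; exists (\sum_i prism_chain (H i) *~ eps i).
rewrite boundary_prism_sum // -sumrB.
under [X in _ - (X - _)]eq_bigr do rewrite mulrzBl.
rewrite opprB addrCA subrr addr0; apply: supported_sum => k _.
by apply: chain_inMz; exact: HA.
Qed.

End HomotopySum.

(** * The fundamental cycle of the glued manifold *)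

Section FlagCycle.
Context {R : realType} {m : nat} {P : polytope R m.+1}.
Variable V : mirrors P.
Local Notation F := (facet P).
Local Notation h := (height P).
Local Notation T := {ffun 'I_m.+1 -> F}.
Implicit Types (t : T) (S : {set F}) (i : F) (v : cell V).

(* The multiple of the sum of the normals that lies on all the facets of the
   clique [S]. *)
Definition center S : 'rV[R]_m.+1 :=
  (h / (1 + (#|S|%:R - 1) * h ^+ 2)) *: \sum_(i in S) normal i.

Lemma center_denominator_gt0 S : 0 < 1 + (#|S|%:R - 1) * h ^+ 2.
Proof.
have := height_lt1 P; have : 0 <= #|S|%:R * h ^+ 2 by rewrite mulr_ge0 ?sqr_ge0.
lra.
Qed.

Lemma fht_center S i : fht i (center S) =
  h * (1 - (\sum_(j in S) dot (normal i) (normal j)) / (1 + (#|S|%:R - 1) * h ^+ 2)).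
Proof.
rewrite /fht /center dotZr dot_sumr; ring.
Qed.

Lemma fht_center_in S i : clique S -> i \in S -> fht i (center S) = 0.
Proof.
move=> cS iS; rewrite fht_center (bigD1 i) //= normal_unit.
rewrite (eq_bigr (fun=> h ^+ 2)) => [|j /andP[jS ji]]; last first.
  by rewrite normal_adjacent //; apply: cS => //; rewrite eq_sym.
rewrite sumr_const (_ : #|_| = #|S|.-1); last by rewrite (cardD1 i S) iS; apply: eq_card => j; rewrite !inE andbC.
have S0 : (0 < #|S|)%N by apply/card_gt0P; exists i.
rewrite (_ : h ^+ 2 *+ #|S|.-1 = (#|S|%:R - 1) * h ^+ 2); last first.
  by rewrite -[in RHS](prednK S0) -natr1 addrK mulr_natl.
by rewrite divff ?subrr ?mulr0 // gt_eqF // center_denominator_gt0.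
Qed.

(** Distinct normals have product at most [h ^+ 2]: equality holds for adjacent facets, and
    otherwise the product is below [2 h^2 - 1], which is smaller since [h < 1]. *)
Lemma fht_center_out S i : i \notin S -> 0 < fht i (center S).
Proof.
move=> iS; rewrite fht_center mulr_gt0 ?height_gt0 // subr_gt0.
rewrite ltr_pdivrMr ?center_denominator_gt0 // mul1r.
apply: (@le_lt_trans _ _ (\sum_(j in S) h ^+ 2)); last first.
  by rewrite sumr_const -mulr_natl; have := height_lt1 P; lra.
apply: ler_sum => j jS; have ij : i != j by apply: contraNneq iS => ->.
have [a|a] := boolP (adjacent i j); first by rewrite normal_adjacent.
by have := normal_apart ij a; have := height_lt1 P; lra.
Qed.

Lemma body_center S : clique S -> body P (center S).
Proof.
move=> cS i; have [iS|iS] := boolP (i \in S); first by rewrite fht_center_in.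
by apply: ltW; exact: fht_center_out.
Qed.

Variable s : T -> int.
Hypothesis s_adjacent : forall t, s t != 0 ->
  forall a b, a != b -> adjacent (t a) (t b).
Hypothesis s_swap : forall (a : 'I_m) t, s (swap a t) = - s t.
Hypothesis s_last : forall t, \sum_x s (set_last x t) = 0.

Lemma clique_prefix t j : s t != 0 -> clique (prefix t j).
Proof.
move=> st _ _ /imsetP[a _ ->] /imsetP[b _ ->] ab; apply: s_adjacent => //.
by apply: contraNneq ab => ->.
Qed.

Definition flag_chain v t : chain R m.+1 (glued V) := realize (fun x => glue x v) << flag_mx center t >>.

Definition flag_cycle : chain R m.+1 (glued V) :=
  \sum_v \sum_t flag_chain v t *~ ((-1) ^+ sgn v * s t).

Lemma flag_mx_body t : s t != 0 -> rows_in (body P) (flag_mx center t).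
Proof. by move=> st j; rewrite row_flag_mx; apply: body_center; exact: clique_prefix st. Qed.

Definition wall i : set 'rV[R]_m.+1 := [set x | body P x /\ fht i x = 0].

Lemma convex_wall i : convex_hull_closed (wall i).
Proof.
move=> k x w xs wQ; split; first by apply: body_convex => // j; have [] := wQ j.
rewrite fht_convex // big1 // => j _.
by have [_ ->] := wQ j; rewrite mulr0.
Qed.

Lemma glue_flip i v x : wall i x -> glue x (flip i v) = glue x v.
Proof.
move=> [Bx xi]; apply/(glue_eq _ _ Bx)/near_sym; first exact: body_clique.
apply/nearP; exists [set i]%SET; first by rewrite finset.sub1set inE xi.
by rewrite /flips enum_set1.
Qed.

Lemma flag_mx_wall t (j : 'I_m.+2) : s t != 0 -> j != ord0 ->
  wall (t ord0) (center (prefix t j)).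
Proof.
move=> st j0; split; first by apply: body_center; exact: clique_prefix.
apply: fht_center_in; first exact: clique_prefix st.
by apply: mem_prefix; rewrite lt0n.
Qed.

Lemma boundary_flag_cycle : boundary flag_cycle = 0.
Proof.
have E : boundary flag_cycle = \sum_(k < m.+2)
   (\sum_v \sum_t (realize (fun x => glue x v) << rowsub (lift k) (flag_mx center t) >> : chain R m (glued V))
     *~ ((-1) ^+ sgn v * s t)) *~ (-1) ^+ k.
  rewrite /flag_cycle raddf_sum /=.
  under [RHS]eq_bigr do rewrite mulrz_suml.
  rewrite [RHS]exchange_big; apply: eq_bigr => v _ /=; rewrite raddf_sum /=.
  under [RHS]eq_bigr do rewrite mulrz_suml.
  rewrite [RHS]exchange_big; apply: eq_bigr => t _ /=; rewrite raddfMz /=.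
  have [->|st] := eqVneq (s t) 0.
    by rewrite mulr0 mulr0z big1 // => k _; rewrite mul0rz.
  rewrite /flag_chain (@boundary_realize _ m.+1 _ _ (body P)); last first.
  - by apply: supportedU; exact: flag_mx_body.
  - exact: glue_continuous.
  - exact: body_convex.
  rewrite /abnd liftU1 /afaces raddf_sum mulrz_suml; apply: eq_bigr => k _.
  by rewrite raddfMz /= -!mulrzA mulrC.
rewrite E big1 // => k _.
rewrite (flag_sum (flip := @flip _ _ _ V) (@flipK _ _ _ V) (@sgn_flip _ _ _ V) s_swap s_last (k := k)) ?mul0rz //.
(* Without the centre of the whole polytope the simplex lies on the wall of the first facet, along
   which the two neighbouring copies are glued. *)
- move=> k0 v t st; apply: (@eq_realize _ _ _ _ (wall (t ord0))).
  + exact: convex_wall.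
  + by move=> x; exact: glue_flip.
  apply: supportedU => j; rewrite row_rowsub row_flag_mx; apply: flag_mx_wall => //.
  by rewrite k0.
by move=> t t' tt' v; rewrite (eq_flag_face _ tt').
Qed.

End FlagCycle.

Lemma within_comp (S T X : topologicalType) (D : set S) (Q : set T) (g : T -> X) (u : S -> T) :
  {within Q, continuous g} -> (forall y, D y -> Q (u y)) ->
  (forall y, D y -> {for y, continuous u}) -> {within D, continuous (g \o u)}.
Proof.
move=> /subspace_continuousP gc DQ uc; apply/subspace_continuousP => y Dy B /= nB.
have H : \forall z \near u y, Q z -> B (g z) := gc _ (DQ _ Dy) _ nB.
have H' : \forall z \near y, Q (u z) -> B (g (u z)) := uc _ Dy _ H.
by apply: (filterS _ H') => z Hz Dz; apply: Hz; exact: DQ.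
Qed.

Section LeastFree.
Context {m : nat}.
Implicit Types (U : {set 'I_m.+2}) (k : 'I_m.+2).

Definition least_free U : 'I_m.+2 :=
  odflt ord0 [pick k | (k \notin U) && [forall l, (l \notin U) ==> (k <= l)%N]].

Lemma least_freeP U k0 : k0 \notin U ->
  least_free U \notin U /\ forall l, l \notin U -> (least_free U <= l)%N.
Proof.
move=> k0U; rewrite /least_free; case: pickP => [k /andP[kU /forallP H]|H] /=.
  by split=> // l lU; have := H l; rewrite lU.
have [k kU kmin] := arg_minnP (fun k : 'I_m.+2 => k : nat) (P := [pred k | k \notin U]) k0U.
have := H k; rewrite [k \notin U]kU /= => /forallP[] l.
by apply/implyP => lU; exact: kmin.
Qed.

Variable U : 'I_m.+2 -> {set 'I_m.+2}.
Hypothesis U_free : forall j, least_free (U j) \notin U j.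
Hypothesis U_mono : forall j k : 'I_m.+2, (j <= k)%N -> U j \subset U k.

(** [least_free] is monotone along the increasing sets [U j]; being surjective it is a bijection,
    and a monotone bijection of an initial segment is the identity. *)
Lemma least_free_id : (forall k, exists j, least_free (U j) = k) ->
  forall j, least_free (U j) = j.
Proof.
pose f j := least_free (U j); move=> /fin_all_exists[g fg].
have fK : cancel g f by [].
have gi : injective g by exact: can_inj fK.
have fi : injective f by apply: (can_inj (g := g)); apply/(bij_can_sym (injF_bij gi)).
have fm (j k : 'I_m.+2) : (j <= k)%N -> (f j <= f k)%N.
  move=> jk; have [_] := least_freeP (U_free j); apply.
  by apply: contra (U_free k); apply: (fintype.subsetP (U_mono jk)).
suff H n (j : 'I_m.+2) : (j < n)%N -> f j = j by move=> j; exact: (H j.+1 j).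
elim: n j => [//|n IH] j; rewrite ltnS leq_eqVlt => /orP[/eqP jn|]; last exact: IH.
have le : (f j <= j)%N.
  rewrite -[leqRHS](congr1 val (fg j)); apply: fm; rewrite leqNgt; apply/negP => gj.
  by have := IH (g j); rewrite -jn gj => /(_ isT) e; move: gj; rewrite -e /f fg ltnn.
apply: val_inj => /=; apply/eqP; move: le; rewrite leq_eqVlt => /orP[//|lt].
have := IH (f j); rewrite -jn lt => /(_ isT) /fi e.
by move: lt; rewrite e ltnn.
Qed.

Lemma least_free_mem : (forall k, exists j, least_free (U j) = k) ->
  forall j k, (k \in U j) = (k < j)%N.
Proof.
move=> H j k; have fE := least_free_id H; have := U_free j; rewrite fE => Uj.
rewrite ltnNge; have [jk|kj] /= := leqP j k.
  apply: contraTF (U_mono jk) => kU; apply/fintype.subsetPn; exists k => //.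
  by have := U_free k; rewrite fE.
apply: contraTT kj => kU; rewrite -leqNgt -[j in leqLHS]fE.
by have [_] := least_freeP kU; apply.
Qed.

End LeastFree.

Lemma push_realize {R : realType} k d (X Y : topologicalType) (f : X -> Y) (g : 'rV[R]_d -> X)
    (w : 'M[R]_(k.+1, d)) (h : 'rV[R]_k.+1 -> R -> Y) a :
  continuous (fun x : std_simplex R k => g (set_val x *m w)) ->
  (forall x : std_simplex R k, f (g (set_val x *m w)) = h (set_val x) a) ->
  push f (realize g << w >>) = << level_simplex h a >>.
Proof.
move=> gc fgh; rewrite realizeU pushU; congr << _ >>; apply: eq_mksimplex => x.
by rewrite /= mksimplexE.
Qed.

(** * The image of the fundamental cycle *)

Section Degree.
Context {R : realType} {m : nat} {P : polytope R m.+1} {N : topologicalType}.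
Variable X : chambers R m.+1 N.
Variable colour : facet P -> {set 'I_m.+2}.
Hypothesis colour_neq0 : forall i, colour i != finset.set0.
Hypothesis colour_comparable : forall i j, adjacent i j ->
  (colour i \subset colour j) || (colour j \subset colour i).
Hypothesis colour_proper : forall i, colour i != [set: 'I_m.+2]%SET.

Local Notation F := (facet P).
Local Notation T := {ffun 'I_m.+1 -> F}.
Variable s : T -> int.
Hypothesis s_adjacent : forall t, s t != 0 -> forall a b, a != b -> adjacent (t a) (t b).
Hypothesis s_swap : forall (a : 'I_m) t, s (swap a t) = - s t.
Hypothesis s_last : forall t, \sum_x s (set_last x t) = 0.

Local Notation V := (coloured_mirrors X colour_neq0 colour_comparable).
Implicit Types (t : T) (S : {set F}) (i : F) (v : cell V) (c : chamber X).

Definition colour_union S : {set 'I_m.+2} := (\bigcup_(i in S) colour i)%SET.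

Lemma colour_union_sub S S' : S \subset S' -> colour_union S \subset colour_union S'.
Proof.
move=> SS; apply/finset.bigcupsP => i iS; apply: finset.bigcup_sup.
exact: (fintype.subsetP SS).
Qed.

Lemma least_free_clique S : clique S ->
  least_free (colour_union S) \notin colour_union S /\
  forall l, l \notin colour_union S -> (least_free (colour_union S) <= l)%N.
Proof.
move=> cS; have [k kf] := free_colour colour_comparable colour_proper cS.
apply: (@least_freeP _ _ k); apply/negP => /finset.bigcupP[i iS]; exact/negP/kf.
Qed.

(** The chosen vertex lies in the same face of the chamber as the image of the centre of [S], so the
    segment between them stays there. Taking the least admissible index makes the choice monotone
    along a flag. *)
Definition vertex S : 'rV[R]_m.+2 := delta_mx 0 (least_free (colour_union S)).

Definition is_flag t : bool := [forall j : 'I_m.+1, colour (t j) == [set k : 'I_m.+2 | (k <= j)%N]%SET].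

(** If all vertices occur, monotonicity forces the union of the first [j] colours to consist of the
    indices below [j]; comparability of adjacent colours then determines each colour. *)
Lemma flag_or_missing t : s t != 0 ->
  is_flag t \/ exists k, forall j, flag_mx vertex t j k = 0.
Proof.
move=> st; pose U (j : 'I_m.+2) := colour_union (prefix t j).
have Uf j := least_free_clique (@clique_prefix _ _ _ _ s_adjacent t (j : 'I_m.+2) st).
have Um (j k : 'I_m.+2) : (j <= k)%N -> U j \subset U k.
  by move=> jk; apply: colour_union_sub; exact: prefix_le.
case: (pselect (forall k, exists j, least_free (U j) = k)) => [H|nH]; last first.
  right; apply: contrapT => H; apply: nH => k; apply: contrapT => nk; apply: H; exists k => j.
  rewrite /flag_mx /vertex !mxE eqxx /=; case: eqP => // e; case: nk; exists j.
  exact: esym.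
left; have UE := least_free_mem (U := U) (fun j => (Uf j).1) Um H.
have sub (j : 'I_m.+1) k : k \in colour (t j) -> (k <= j)%N.
  move=> kj; have := UE (lift ord0 j) k; rewrite /= /bump /= add1n ltnS => <-.
  apply/finset.bigcupP; exists (t j) => //.
  by apply: mem_prefix.
have diag (j : 'I_m.+1) : widen_ord (leqnSn _) j \in colour (t j).
  have : widen_ord (leqnSn _) j \in U (lift ord0 j) by rewrite UE /= /bump.
  case/finset.bigcupP => _ /imsetP[i + ->]; rewrite inE ltnS => ij ki.
  have := sub _ _ ki => /= ji; suff ie : i = j by rewrite -{2}ie.
  by apply: val_inj; apply/eqP; rewrite eqn_leq ij ji.
apply/forallP => j; apply/eqP/finset.setP => k; rewrite inE; apply/idP/idP; first exact: sub.
rewrite leq_eqVlt => /orP[/eqP kj|kj]; first by rewrite (_ : k = widen_ord (leqnSn _) j) //; exact: val_inj.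
have km : (k < m.+1)%N by rewrite (leq_trans kj) // ltnW.
pose k' := Ordinal km; have -> : k = widen_ord (leqnSn _) k' by exact: val_inj.
have k'j : k' != j by apply: contraTneq kj => <-; rewrite ltnn.
have /orP[/fintype.subsetP -> //|/fintype.subsetP jk] := colour_comparable (s_adjacent st k'j).
by have := sub _ _ (jk _ (diag j)); rewrite /= leqNgt kj.
Qed.

Lemma flag_mx_vertex t : s t != 0 -> is_flag t -> flag_mx vertex t = 1%:M.
Proof.
move=> st /forallP tf; apply/row_matrixP => j; rewrite row_flag_mx row1 /vertex.
congr delta_mx; have UE k : (k \in colour_union (prefix t j)) = (k < j)%N.
  apply/finset.bigcupP/idP => [[_ /imsetP[i + ->]]|kj].
    by rewrite inE (eqP (tf i)) inE => ij ki; exact: leq_ltn_trans ki ij.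
  have km : (k < m.+1)%N by have := ltn_ord j; lia.
  exists (t (Ordinal km)); first exact: mem_prefix.
  by rewrite (eqP (tf _)) inE.
have [] := least_free_clique (@clique_prefix _ _ _ _ s_adjacent t j st).
rewrite UE -leqNgt => le /(_ j); rewrite UE ltnn => /(_ isT) ge.
by apply: val_inj => /=; apply/eqP; rewrite eqn_leq le ge.
Qed.

Definition mix t (x : 'rV[R]_m.+2) (a : R) : 'rV[R]_m.+2 :=
  (1 - a) *: barycentric colour (x *m flag_mx center t) + a *: (x *m flag_mx vertex t).

Lemma mixE t x a k : mix t x a 0 k =
  (1 - a) * barycentric colour (x *m flag_mx center t) 0 k + a * (x *m flag_mx vertex t) 0 k.
Proof. by rewrite /mix; set b := barycentric _ _; set c := x *m _; rewrite !mxE. Qed.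

Lemma vertex_simplex S : std_simplex R m.+1 (vertex S).
Proof. exact: std_simplex_delta. Qed.

Lemma mix_simplex t x a : s t != 0 -> std_simplex R m.+1 x -> 0 <= a <= 1 ->
  std_simplex R m.+1 (mix t x a).
Proof.
move=> st xs /andP[a0 a1].
have [b0 b1] : std_simplex R m.+1 (barycentric colour (x *m flag_mx center t)).
  apply: barycentric_simplex => //; apply: body_convex => //.
  exact: flag_mx_body st.
have [c0 c1] : std_simplex R m.+1 (x *m flag_mx vertex t).
  by apply: convex_std_simplex => // j; rewrite row_flag_mx; exact: vertex_simplex.
split=> [k|].
  by rewrite mixE; apply: addr_ge0; apply: mulr_ge0; rewrite ?subr_ge0.
under eq_bigr do rewrite mixE.
by rewrite big_split /= -!mulr_sumr b1 c1 !mulr1 subrK.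
Qed.

Lemma cmap_ext_flip i v (y : 'rV[R]_m.+2) : std_simplex R m.+1 y ->
  (forall k, k \in colour i -> y 0 k = 0) ->
  simplex_ext (cmap (chamber_of (flip i v))) y = simplex_ext (cmap (chamber_of v)) y.
Proof.
by move=> ys y0; apply: cmap_flip => k ki; rewrite simplex_val_insubd //; exact: y0.
Qed.

Definition deform v t (x : 'rV[R]_m.+2) (a : R) : N := simplex_ext (cmap (chamber_of v)) (mix t x a).

Lemma deform_continuous v t : s t != 0 -> prism_continuous (deform v t).
Proof.
move=> st; apply: (@within_comp _ _ _ _ (std_simplex R m.+1) _
  (fun y : 'rV[R]_(m.+2 + 1) => mix t (lsubmx y) (rsubmx y 0 0))).
- exact: simplex_ext_continuous.
- by move=> y [ys y01]; exact: mix_simplex.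
move=> y [ys y01].
have l1 : lsubmx z @[z --> y] --> lsubmx y by exact: lsubmx_continuous.
have r1 : rsubmx z 0 0 @[z --> y] --> rsubmx y 0 0 by exact: (@last_continuous R m.+2).
have By : body P (lsubmx y *m flag_mx center t).
  by apply: body_convex => //; exact: flag_mx_body st.
have b1 : lsubmx z *m flag_mx center t @[z --> y] --> lsubmx y *m flag_mx center t.
  exact: (@cvg_mulmxr _ _ (nbhs y)).
have b2 : lsubmx z *m flag_mx vertex t @[z --> y] --> lsubmx y *m flag_mx vertex t.
  exact: (@cvg_mulmxr _ _ (nbhs y)).
have b3 : barycentric colour x @[x --> lsubmx y *m flag_mx center t] -->
    barycentric colour (lsubmx y *m flag_mx center t) by exact: barycentric_continuous.
have b4 := cvg_comp _ _ b1 b3.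
apply: (@cvgD _ _ _ (nbhs y)); apply: cvgZ => //.
by apply: cvgB => //; exact: cvg_cst.
Qed.

Lemma level_deform0 v t : s t != 0 ->
  push (@realization _ _ _ _ _ X colour colour_neq0 colour_comparable) (flag_chain v t) =
  << level_simplex (deform v t) 0 >>.
Proof.
move=> st; apply: push_realize => [|x].
  have := affine_simplex_continuous (@body_convex _ _ P) (@glue_continuous _ _ _ V v)
    (flag_mx_body s_adjacent st).
  exact.
have Bx : body P (set_val x *m flag_mx center t).
  by apply: body_convex; [exact: set_valP|exact: flag_mx_body st].
by rewrite realization_glue // /deform /mix subr0 scale1r scale0r addr0.
Qed.

Lemma level_deform1 v t : << level_simplex (deform v t) 1 >> =
  realize (simplex_ext (cmap (chamber_of v))) << flag_mx vertex t >>.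
Proof.
rewrite realizeU; congr << _ >>; apply: eq_mksimplex => x.
by rewrite /deform /mix subrr scale0r add0r scale1r.
Qed.

(** The segments towards the vertices are followed flag by flag. On the sides of the prisms
    [flag_sum] applies: over face 0 both ends of every segment lie where the coordinates of the
    first colour vanish, so neighbouring cells agree. *)
Lemma flag_cycle_deform : null set0
  (\sum_(v : cell V) \sum_t realize (simplex_ext (cmap (chamber_of v))) << flag_mx vertex t >>
     *~ ((-1) ^+ sgn v * s t) -
   push (@realization _ _ _ _ _ X colour colour_neq0 colour_comparable) (flag_cycle V s)).
Proof.
pose eps (p : cell V * T) := (-1) ^+ sgn p.1 * s p.2.
have st p : eps p != 0 -> s p.2 != 0 by rewrite mulf_eq0 negb_or => /andP[].
have E1 : \sum_(v : cell V) \sum_t realize (simplex_ext (cmap (chamber_of v))) << flag_mx vertex t >>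
    *~ ((-1) ^+ sgn v * s t) = \sum_p << level_simplex (deform p.1 p.2) 1 >> *~ eps p.
  rewrite -(pair_big xpredT xpredT (fun v t => << level_simplex (deform v t) 1 >> *~ eps (v, t))).
  by apply: eq_bigr => v _; apply: eq_bigr => t _; rewrite level_deform1.
have E0 : push (@realization _ _ _ _ _ X colour colour_neq0 colour_comparable) (flag_cycle V s) =
    \sum_p << level_simplex (deform p.1 p.2) 0 >> *~ eps p.
  rewrite /flag_cycle raddf_sum -(pair_big xpredT xpredT (fun v t =>
    << level_simplex (deform v t) 0 >> *~ eps (v, t))).
  apply: eq_bigr => v _; rewrite raddf_sum; apply: eq_bigr => t _; rewrite /eps.
  have [->|st'] := eqVneq (s t) 0; first by rewrite mulr0 !mulr0z raddf0.
  by rewrite raddfMz -level_deform0.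
rewrite E1 E0; apply: homotopy_sum_null => [p ep|k]; first exact: deform_continuous (st p ep).
rewrite -(pair_big xpredT xpredT (fun v t => prism_chain (fun x a =>
  deform v t (x *m face_mx k) a) *~ ((-1) ^+ sgn v * s t))) /=.
rewrite (flag_sum (flip := @flip _ _ _ V) (@flipK _ _ _ V) (@sgn_flip _ _ _ V) s_swap s_last (k := k)
  (Z := fun v t => prism_chain (fun x a => deform v t (x *m face_mx k) a))).
- exact: supported0.
- move=> k0 v t st'; apply: eq_prism_chain => x a xs a01.
  have [Wx _] : wall (t ord0) (x *m face_mx k *m flag_mx center t) /\ True.
    split=> //; rewrite -mulmxA mul_face_mx; apply: convex_wall => // j.
    rewrite row_rowsub row_flag_mx; apply: flag_mx_wall st' _ => //.
    by rewrite k0.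
  apply: cmap_ext_flip; first by apply: mix_simplex => //; exact: face_mx_simplex.
  move=> l lc; rewrite mixE.
  rewrite (barycentric0 Wx.2 lc) mulr0 add0r -mulmxA mul_face_mx mxE big1 ?mulr0 // => j _.
  rewrite !mxE eqxx /=; case: eqP => [e|_]; last by rewrite mulr0.
  have [+ _] := least_free_clique (@clique_prefix _ _ _ _ s_adjacent t (lift k j) st').
  rewrite -e => /finset.bigcupP[]; exists (t ord0) => //; apply: mem_prefix.
  by rewrite k0.
move=> t t' tt' v; apply: eq_prism_chain => x a xs a01; rewrite /deform /mix.
by rewrite -!mulmxA !mul_face_mx !(eq_flag_face _ tt').
Qed.

(** If vertex [k] is missing, the simplex lies in face [k] of its chamber, and [cadj k] cancels it
    against another chamber. A complete flag gives the chamber itself, once for each cell over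
    it. *)
Lemma vertex_sum : \sum_(v : cell V) \sum_t realize (simplex_ext (cmap (chamber_of v))) << flag_mx vertex t >>
    *~ ((-1) ^+ sgn v * s t) =
  (\sum_(c : chamber X) (<< cmap c >> : chain R m.+1 N) *~ (-1) ^+ csgn c) *~
    ((multiplicity (P := P) X)%:Z * \sum_(t | is_flag t) s t).
Proof.
rewrite exchange_big mulr_sumr mulrz_sumr [RHS]big_mkcond; apply: eq_bigr => t _ /=.
pose G c : chain R m.+1 N := realize (simplex_ext (cmap c)) << flag_mx vertex t >> *~ ((-1) ^+ csgn c * s t).
apply: etrans (sum_chamber_of colour_neq0 colour_comparable G) _; rewrite /G.
have [->|st] := eqVneq (s t) 0.
  by rewrite big1 ?mul0rn ?mulr0 ?mulr0z ?if_same // => c _; rewrite mulr0.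
have [tf|[k kt]] := flag_or_missing st.
  rewrite tf flag_mx_vertex // [_ * s t]mulrC mulrzA -pmulrn mulrz_suml; congr (_ *+ _).
  by apply: eq_bigr => c _; rewrite realize_ext_id mulrzA.
have -> : is_flag t = false.
  apply/negP => tf; have := kt k; rewrite flag_mx_vertex // mxE eqxx => /eqP.
  by rewrite oner_eq0.
rewrite (@sum_sign_cancel _ _ (@csgn _ _ _ X) (cadj k)) ?mul0rn //.
- exact: cadjK.
- exact: csgn_cadj.
move=> c; rewrite csgn_cadj signrN mulNr mulrNz; congr (- (_ *~ _)).
rewrite !realizeU; congr << _ >>; apply: eq_mksimplex => x; apply: cmap_cadj.
rewrite simplex_val_insubd.
  by rewrite mxE big1 // => j _; rewrite kt mulr0.
apply: convex_std_simplex; first exact: set_valP.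
by move=> j; rewrite row_flag_mx; exact: vertex_simplex.
Qed.

Lemma push_flag_cycle : null set0
  (push (@realization _ _ _ _ _ X colour colour_neq0 colour_comparable) (flag_cycle V s) -
   (\sum_(c : chamber X) (<< cmap c >> : chain R m.+1 N) *~ (-1) ^+ csgn c) *~
    ((multiplicity (P := P) X)%:Z * \sum_(t | is_flag t) s t)).
Proof. by have := nullN flag_cycle_deform; rewrite vertex_sum opprB. Qed.

End Degree.

(** * The local degree at a vertex *)

Section SignedRows.
Context {R : realType} {m : nat}.

Definition signed_mx k (p : nat) (y : 'rV[R]_m) (b : seq bool) : 'M[R]_(k.+1, m) :=
  \matrix_(i < k.+1) (if (i < k)%N then (-1) ^+ nth false b i *: unit_row (p + i) else y).

Lemma conem_signed_mx k p y (a : bool) b :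
  conem ((-1) ^+ a *: unit_row p) (signed_mx k p.+1 y b) = signed_mx k.+1 p y (a :: b).
Proof.
apply/row_matrixP => i; rewrite rowK; case: (unliftP ord0 i) => [j|] ->.
  by rewrite conem_rowS rowK lift0 /= ltnS addSnnS.
by rewrite conem_row0 /= addn0.
Qed.

Lemma cross_sum k p (y : 'rV[R]_m) : cross k p y =
  \sum_(b : k.-tuple bool) << signed_mx k p y b >> *~ (-1) ^+ count id b.
Proof.
elim: k p => [|k IH] p.
  rewrite (big_pred1 [tuple]) => [|b]; last by apply/esym/eqP; exact: tuple0.
  rewrite expr0 mulr1z /=; congr << _ >>.
  by apply/row_matrixP => i; rewrite rowK /= ord1; apply/rowP => j; rewrite mxE.
have E (a : bool) : acone ((-1) ^+ a *: unit_row p) (cross k p.+1 y) =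
    \sum_(b : k.-tuple bool) << signed_mx k.+1 p y (a :: b) >> *~ (-1) ^+ count id b.
  rewrite IH raddf_sum; apply: eq_bigr => b _.
  by rewrite raddfMz /= aconeU conem_signed_mx.
rewrite crossS -{1}[unit_row p]scale1r -[1]/((-1) ^+ false) E.
rewrite -[X in acone X]scaleN1r -[-1 in X in _ - X]/((-1) ^+ true) E.
pose f (p : bool * k.-tuple bool) : k.+1.-tuple bool := cons_tuple p.1 p.2.
pose g (b : k.+1.-tuple bool) : bool * k.-tuple bool := (thead b, behead_tuple b).
rewrite (reindex f) /=; last first.
  exists g => [[a b]|b] _; rewrite /f /g /=; last by rewrite [RHS]tuple_eta; exact: val_inj.
  by congr pair; exact: val_inj.
rewrite -(pair_big xpredT xpredT (fun a (b : k.-tuple bool) => << signed_mx k.+1 p y (a :: b) >> *~ (-1) ^+ (a + count id b))) /=.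
rewrite big_bool addrC -sumrN; congr (_ + _); apply: eq_bigr => b _.
by rewrite exprD mulN1r mulrNz.
Qed.

End SignedRows.

Lemma level_realize {R : realType} k d (X : topologicalType) (f : 'rV[R]_k.+1 -> R -> X)
    (g : 'rV[R]_d -> X) (w : 'M[R]_(k.+1, d)) a :
  (forall x, f x a = g (x *m w)) -> << level_simplex f a >> = realize g << w >>.
Proof. by move=> fg; rewrite realizeU; congr << _ >>; apply: eq_mksimplex => x; exact: fg. Qed.

Section Corner.
Context {R : realType} {m : nat} {P : polytope R m.+1}.
Variable V : mirrors P.
Local Notation F := (facet P).
Local Notation h := (height P).
Local Notation T := {ffun 'I_m.+1 -> F}.
Local Notation E := 'rV[R]_m.+1.
Implicit Types (t : T) (S : {set F}) (i : F) (v : cell V).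

Variable s : T -> int.
Hypothesis s_adjacent : forall t, s t != 0 -> forall a b, a != b -> adjacent (t a) (t b).
Hypothesis s_swap : forall (a : 'I_m) t, s (swap a t) = - s t.
Variables (t0 : T) (v0 : cell V).
Hypothesis s_t0 : s t0 != 0.

Definition corner_facets : {set F} := prefix t0 m.+1.
Local Notation T0 := corner_facets.

Lemma corner_clique : clique T0.
Proof. exact: clique_prefix s_t0. Qed.

Lemma mem_corner k : t0 k \in T0.
Proof. exact: mem_prefix. Qed.

Lemma inj_of_weight t : s t != 0 -> injective t.
Proof.
move=> st a b ab; apply/eqP; apply: contraT => ne.
by have := s_adjacent st ne; rewrite ab adjacent_irr.
Qed.

Lemma card_prefix t : s t != 0 -> #|prefix t m.+1| = m.+1.
Proof.
move=> st; rewrite card_imset; last exact: inj_of_weight.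
by rewrite -[RHS]card_ord; apply: eq_card => j; rewrite !inE ltn_ord.
Qed.

Lemma near_flip i v : i \in T0 -> near T0 v0 (flip i v) = near T0 v0 v.
Proof.
move=> iT; have H w : near T0 v0 w -> near T0 v0 (flip i w).
  move=> vw; apply: near_trans vw _; first exact: corner_clique.
  apply/nearP; exists [set i]%SET; first by rewrite finset.sub1set.
  by rewrite /flips enum_set1.
by apply/idP/idP => [/H|/H//]; rewrite flipK.
Qed.

Lemma diff_flip i j v : (j \in diff v0 (flip i v)) = (j \in diff v0 v) (+) (i == j).
Proof. by rewrite !inE side_flip; case: (side j v0); case: (side j v); case: (i == j). Qed.

(** The axis towards which the centre of the face [S] is straightened: the first corner facet that
    does not contain this face. The value [ord_max] means that there is none and the image is the
    origin. *)
Definition missing S : 'I_m.+2 := least_free (widen_ord (leqnSn _) @: [set k | t0 k \in S])%SET.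

Lemma missing_free S : missing S \notin (widen_ord (leqnSn _) @: [set k | t0 k \in S])%SET.
Proof.
have [] // := @least_freeP _ (widen_ord (leqnSn _) @: [set k | t0 k \in S])%SET ord_max.
by apply/negP => /imsetP[k _ /(congr1 val)] /= e; have := ltn_ord k; rewrite -e ltnn.
Qed.

Lemma missing_out S (k : 'I_m.+1) : missing S = k :> nat -> t0 k \notin S.
Proof.
move=> e; apply: contra (missing_free S) => kS; apply/imsetP; exists k; first by rewrite inE.
exact: val_inj.
Qed.

Lemma missing_full S : T0 \subset S -> missing S = ord_max.
Proof.
move=> /fintype.subsetP TS; apply/eqP; apply: contraT => ne.
have lt : (missing S < m.+1)%N.
  by have := ltn_ord (missing S); rewrite ltnS leq_eqVlt => /orP[/eqP e|//]; case/eqP: ne; exact: val_inj.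
have := @missing_out S (Ordinal lt) erefl.
by rewrite TS // mem_corner.
Qed.

Definition corner_row v S : E :=
  \row_k (if k == missing S :> nat then (-1) ^+ (t0 k \in diff v0 v) else 0).

Definition full t := prefix t m.+1 == T0.

(** If every axis occurs, the monotonicity argument of [least_free_mem] makes [t] list the corner
    facets in the order of [t0]. *)
Lemma full_other t : s t != 0 -> full t -> t != t0 ->
  exists k : 'I_m.+1, forall j : 'I_m.+2, missing (prefix t j) != k :> nat.
Proof.
move=> st /eqP tT; apply: contra_neqP => H.
pose U (j : 'I_m.+2) := (widen_ord (leqnSn m.+1) @: [set k | t0 k \in prefix t j])%SET.
have Um (j k : 'I_m.+2) : (j <= k)%N -> U j \subset U k.
  move=> jk; apply/imsetS/fintype.subsetP => l; rewrite !inE.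
  exact: (fintype.subsetP (prefix_le t jk)).
have hit k : exists j, least_free (U j) = k.
  have [km|km] := ltnP k m.+1; last first.
    exists ord_max; apply: etrans (missing_full _) _; first by rewrite /= tT.
    by apply: val_inj => /=; apply/eqP; rewrite eqn_leq km -ltnS ltn_ord.
  apply: contrapT => nk; apply: H; exists (Ordinal km) => j; apply/eqP => e.
  by apply: nk; exists j; exact: val_inj.
have UE := least_free_mem (fun j => missing_free (prefix t j)) Um hit.
apply/ffunP => j; have : t j \in T0 by rewrite -tT mem_prefix.
case/imsetP => k _ tk; rewrite tk; congr (t0 _); apply: val_inj => /=; apply/eqP.
have mem (l : 'I_m.+2) : (t j \in prefix t l) = (k < l)%N.
  rewrite tk -[RHS](UE l (widen_ord (leqnSn _) k)) mem_imset ?inE // => a b /(congr1 val) e.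
  exact: val_inj.
have := mem (lift ord0 j); rewrite mem_prefix ?lift0 // ltnS => /esym kj.
rewrite eqn_leq kj /= leqNgt -(mem (widen_ord (leqnSn _) j)); apply/negP => /imsetP[l].
by rewrite inE => lj /(inj_of_weight st) e; move: lj; rewrite /= e ltnn.
Qed.

Lemma corner_row_t0 v (j : 'I_m.+2) :
  corner_row v (prefix t0 j) =
  if (j < m.+1)%N then (-1) ^+ nth false [seq t0 k \in diff v0 v | k <- enum 'I_m.+1] j *: unit_row j else 0.
Proof.
have mE : missing (prefix t0 j) = j :> nat.
  have lt k : (widen_ord (leqnSn m.+1) k \in (widen_ord (leqnSn _) @: [set k | t0 k \in prefix t0 j])%SET) = (k < j)%N.
    rewrite mem_imset; last by move=> a b /(congr1 val) e; exact: val_inj.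
    rewrite inE; apply/imsetP/idP => [[l]|kj]; last by exists k; rewrite ?inE.
    by rewrite inE => lj /(inj_of_weight s_t0) ->.
  have jf : j \notin (widen_ord (leqnSn _) @: [set k | t0 k \in prefix t0 j])%SET.
    have [jm|jm] := ltnP j m.+1.
      by rewrite (_ : j = widen_ord (leqnSn _) (Ordinal jm)) ?lt ?ltnn //; exact: val_inj.
    apply/negP => /imsetP[k _ e]; have := ltn_ord k; move: jm; rewrite e /=; lia.
  have [mf mmin] := least_freeP jf.
  apply/eqP; rewrite eqn_leq mmin //= leqNgt; apply/negP => mj.
  have mm : (missing (prefix t0 j) < m.+1)%N by have := ltn_ord j; move: mj; rewrite /missing; lia.
  have := lt (Ordinal mm); rewrite mj (_ : widen_ord _ _ = missing (prefix t0 j)); last exact: val_inj.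
  by rewrite (negPf (missing_free _)).
apply/rowP => k; rewrite mxE mE; have [jm|jm] := ltnP j m.+1; rewrite !mxE; case: eqP => [e|_] //.
- by rewrite mulr1 -e (nth_map ord0) ?size_enum_ord // nth_ord_enum.
- by rewrite mulr0.
by move: (ltn_ord k); rewrite e ltnNge jm.
Qed.

Definition corner_weight t : int := if full t then s t else 0.

Lemma corner_weight_swap (a : 'I_m) t : corner_weight (swap a t) = - corner_weight t.
Proof.
rewrite /corner_weight /full prefix_swap; last by rewrite eqSS gtn_eqF.
by case: ifP => _; rewrite ?s_swap ?oppr0.
Qed.

(** Signed distances to the walls at the corner, measured after unfolding; they turn the copies
    around the corner into orthants. *)
Definition corner_chart_fun v (y : E) : E :=
  \row_k fht (t0 k) (proj (reflect_in (diff v0 v) (hom y))).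

Lemma corner_chart_funE v y k : near T0 v0 v -> body P y ->
  corner_chart_fun v y 0 k = (last (reflect_in (diff v0 v) (hom y)))^-1 *
    ((-1) ^+ (t0 k \in diff v0 v) * fht (t0 k) y).
Proof.
move=> /andP[dT _] By; rewrite mxE fht_proj; last by rewrite gt_eqF // last_reflect_body.
congr (_ * _); rewrite ht_reflect; last first.
  by apply: cliqueS corner_clique; rewrite finset.subUset finset.sub1set mem_corner.
by rewrite ht_hom; case: (_ \in _); rewrite ?mulN1r ?mul1r.
Qed.

Lemma corner_chart_fun_cvg v y : body P y -> {for y, continuous (corner_chart_fun v)}.
Proof.
move=> By; apply: (@cvg_mx _ _ (nbhs y)) => a k; rewrite mxE; under eq_fun do rewrite mxE.
have c1 : hom z @[z --> y] --> hom y by exact: hom_continuous.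
have c2 : reflect_in (diff v0 v) X @[X --> hom y] --> reflect_in (diff v0 v) (hom y) by exact: reflect_continuous.
have c3 := cvg_comp _ _ c1 c2.
have c4 : proj (reflect_in (diff v0 v) (hom z)) @[z --> y] --> proj (reflect_in (diff v0 v) (hom y)).
  by apply: (@proj_cvg _ _ _ (nbhs y)) => //; rewrite gt_eqF // last_reflect_body.
have c5 : fht (t0 k) x @[x --> proj (reflect_in (diff v0 v) (hom y))] --> fht (t0 k) (proj (reflect_in (diff v0 v) (hom y))) by exact: fht_continuous.
exact: (cvg_comp _ _ c4 c5).
Qed.

Definition straighten v t (x : 'rV[R]_m.+2) (a : R) : E :=
  (1 - a) *: corner_chart_fun v (x *m flag_mx center t) + a *: (x *m flag_mx (corner_row v) t).

Lemma straightenE v t x a k : straighten v t x a 0 k =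
  (1 - a) * corner_chart_fun v (x *m flag_mx center t) 0 k + a * (x *m flag_mx (corner_row v) t) 0 k.
Proof. by rewrite /straighten; set b := corner_chart_fun _ _; set c := x *m _; rewrite !mxE. Qed.

Lemma straighten_continuous v t : s t != 0 -> prism_continuous (straighten v t).
Proof.
move=> st; apply: continuous_in_subspaceT => y /set_mem[ys y01].
have l1 : lsubmx z @[z --> y] --> lsubmx y by exact: lsubmx_continuous.
have r1 : rsubmx z 0 0 @[z --> y] --> rsubmx y 0 0 by exact: (@last_continuous R m.+2).
have By : body P (lsubmx y *m flag_mx center t).
  by apply: body_convex => //; exact: flag_mx_body st.
have b1 : lsubmx z *m flag_mx center t @[z --> y] --> lsubmx y *m flag_mx center t.
  exact: (@cvg_mulmxr _ _ (nbhs y)).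
have b2 : lsubmx z *m flag_mx (corner_row v) t @[z --> y] --> lsubmx y *m flag_mx (corner_row v) t.
  exact: (@cvg_mulmxr _ _ (nbhs y)).
have b3 : corner_chart_fun v x @[x --> lsubmx y *m flag_mx center t] -->
    corner_chart_fun v (lsubmx y *m flag_mx center t) by exact: corner_chart_fun_cvg.
have b4 := cvg_comp _ _ b1 b3.
apply: (@cvgD _ _ _ (nbhs y)); apply: cvgZ => //.
by apply: cvgB => //; exact: cvg_cst.
Qed.

(** In the coordinate [missing (prefix t j)] both ends of the segment have the sign prescribed by
    the cell, strictly because [x] has positive weight at vertex [j]; so the segment avoids the
    origin. *)
Lemma straighten_neq0 v t x a (j : 'I_m.+2) : near T0 v0 v -> s t != 0 ->
  std_simplex R m.+1 x -> 0 <= a <= 1 -> 0 < x 0 j -> (missing (prefix t j) < m.+1)%N ->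
  straighten v t x a <> 0.
Proof.
move=> nv st xs /andP[a0 a1] xj km /rowP /(_ (Ordinal km)); rewrite straightenE [RHS]mxE.
set k := Ordinal km; have kS : t0 k \notin prefix t j by exact: missing_out.
have [x0 x1] := xs.
have By : body P (x *m flag_mx center t) by apply: body_convex => //; exact: flag_mx_body st.
rewrite corner_chart_funE // => /(congr1 ( *%R ((-1) ^+ (t0 k \in diff v0 v)))).
rewrite mulr0 mulrDr; apply/eqP; rewrite gt_eqF //.
set e := (-1) ^+ _; have ee : e * e = 1 by rewrite /e -expr2 sqrr_sign.
set l := (last _)^-1; have l0 : 0 < l by rewrite invr_gt0 last_reflect_body.
set f := fht _ _; set g := (x *m _) 0 k.
have f0 : 0 < f.
  rewrite /f fht_convex // (bigD1 j) //= row_flag_mx; apply: ltr_pwDl.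
    by rewrite mulr_gt0 // fht_center_out.
  apply: sumr_ge0 => i _; rewrite mulr_ge0 // row_flag_mx.
  exact: (body_center (clique_prefix s_adjacent st)).
have g0 : 0 < e * g.
  rewrite /g mxE mulr_sumr (bigD1 j) //= !mxE eqxx mulrCA ee mulr1; apply: ltr_pwDl => //.
  apply: sumr_ge0 => i _; rewrite !mxE; case: ifP => _; last by rewrite !mulr0.
  by rewrite mulrCA ee mulr1.
have -> : e * ((1 - a) * (l * (e * f))) + e * (a * g) = (1 - a) * (l * f) * (e * e) + a * (e * g) by ring.
rewrite ee mulr1; have lf := mulr_gt0 l0 f0.
by have [->|ne] := eqVneq a 1; [lra|nra].
Qed.

Lemma missing_lt S k : t0 k \notin S -> (missing S < m.+1)%N.
Proof.
move=> kS; apply: leq_ltn_trans (ltn_ord k).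
have kU : widen_ord (leqnSn _) k \notin (widen_ord (leqnSn _) @: [set k | t0 k \in S])%SET.
  by rewrite mem_imset ?inE // => a b /(congr1 val) e; exact: val_inj.
by have [_ /(_ _ kU)] := least_freeP kU.
Qed.

Lemma prefix_missing t (j : 'I_m.+2) : s t != 0 -> full t -> (j < m.+1)%N ->
  (missing (prefix t j) < m.+1)%N.
Proof.
move=> st /eqP tT jm; have : t (Ordinal jm) \in T0 by rewrite -tT mem_prefix.
case/imsetP => k _ tk; apply: (@missing_lt _ k); rewrite -tk.
by apply/negP => /imsetP[l]; rewrite inE => lj /(inj_of_weight st) e; move: lj; rewrite -e ltnn.
Qed.

Lemma corner_row_flip v i S : i \in S -> near T0 v0 v ->
  corner_row (flip i v) S = corner_row v S.
Proof.
move=> iS _; apply/rowP => k; rewrite !mxE diff_flip.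
case: eqP => // /esym e; case: eqP => [ik|]; last by rewrite addbF.
by have := missing_out e; rewrite -ik iS.
Qed.

Definition corner_eps (p : cell V * T) : int :=
  if near T0 v0 p.1 then (-1) ^+ sgn p.1 * corner_weight p.2 else 0.

Lemma corner_eps_neq0 p : corner_eps p != 0 -> [/\ near T0 v0 p.1, full p.2 & s p.2 != 0].
Proof.
rewrite /corner_eps /corner_weight; case: ifP => // _; rewrite mulf_eq0 negb_or => /andP[_].
by case: ifP.
Qed.

Lemma simplex_pos k (x : 'rV[R]_k.+1) : std_simplex R k x -> exists j, 0 < x 0 j.
Proof.
move=> [x0 x1]; apply: contrapT => H; have : \sum_i x 0 i = 0.
  apply: big1 => i _; apply/eqP; rewrite eq_le x0 andbT leNgt; apply/negP => xi.
  by apply: H; exists i.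
by rewrite x1 => /eqP; rewrite oner_eq0.
Qed.

Lemma sum_corner_eps (K : choiceType) (Z : cell V -> T -> {freeg K}) :
  \sum_p Z p.1 p.2 *~ corner_eps p =
  \sum_v \sum_t (if near T0 v0 v then Z v t else 0) *~ ((-1) ^+ sgn v * corner_weight t).
Proof.
rewrite -(pair_big xpredT xpredT (fun v t => Z v t *~ corner_eps (v, t))) /=.
apply: eq_bigr => v _; apply: eq_bigr => t _; rewrite /corner_eps /=.
by case: ifP => _; rewrite ?mul0rz ?mulr0z.
Qed.

Lemma corner_sum_flip (K : choiceType) (Z : cell V -> T -> {freeg K}) :
  (forall v t, t ord0 \in T0 -> s t != 0 -> near T0 v0 v -> Z (flip (t ord0) v) t = Z v t) ->
  \sum_p Z p.1 p.2 *~ corner_eps p = 0.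
Proof.
move=> ZE; rewrite sum_corner_eps.
apply: (flag_sum_flip (flip := @flip _ _ _ V) (@flipK _ _ _ V) (@sgn_flip _ _ _ V)) => v t.
rewrite /corner_weight; case: ifP => [/eqP tT st|_]; last by rewrite eqxx.
have tT0 : t ord0 \in T0 by rewrite -tT mem_prefix.
by rewrite near_flip //; case: ifP => // nv; exact: ZE.
Qed.

Lemma corner_sum_swap (i : 'I_m) (K : choiceType) (Z : cell V -> T -> {freeg K}) :
  (forall v t, Z v (swap i t) = Z v t) -> \sum_p Z p.1 p.2 *~ corner_eps p = 0.
Proof.
move=> ZE; rewrite sum_corner_eps.
by apply: (flag_sum_swap (i := i) _ corner_weight_swap) => v t; rewrite ZE.
Qed.

Lemma supported_eq0 (K : choiceType) (Q : K -> Prop) (D : {freeg K}) : D = 0 -> supported Q D.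
Proof. by move=> ->; exact: supported0. Qed.

(** Restriction to flags through the corner destroys the cancellation at the last vertex, but the
    prisms over the face opposite the corner avoid the origin. The other faces cancel by flips and
    swaps as before. *)
Lemma straighten_face (k : 'I_m.+2) : chain_in [set~ 0 : E]
  (\sum_p prism_chain (fun x a => straighten p.1 p.2 (x *m face_mx k) a) *~ corner_eps p).
Proof.
have [kmax|kmax] := eqVneq k ord_max.
  apply: supported_sum => p _; have [->|ep] := eqVneq (corner_eps p) 0.
    by rewrite mulr0z; exact: supported0.
  apply: chain_inMz; apply: chain_in_prism_chain => x a xs a01; have [np fp sp] := corner_eps_neq0 ep.
  have xs' : std_simplex R m.+1 (x *m face_mx k) by exact: face_mx_simplex.
  have [j xj] := simplex_pos xs'; apply: (@straighten_neq0 _ _ _ _ j) => //.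
  apply: prefix_missing => //; rewrite ltn_neqAle -ltnS ltn_ord andbT.
  apply: contraTneq xj => e; rewrite -leNgt mxE big1 // => i _.
  rewrite !mxE; case: eqP => [ij|]; last by rewrite mulr0.
  have := ltn_ord i; rewrite -[X in (_ < X)%N]e -ij kmax /= /bump.
  by have := ltn_ord i; lia.
have [k0|k0] := eqVneq k ord0.
  apply: supported_eq0; apply: (corner_sum_flip (Z := fun v t =>
    prism_chain (fun x a => straighten v t (x *m face_mx k) a))) => v t tT0 st nv.
  apply: eq_prism_chain => x a xs a01.
  have Wx : wall (t ord0) (x *m face_mx k *m flag_mx center t).
    rewrite -mulmxA mul_face_mx; apply: convex_wall => // j.
    have j0 : lift k j != ord0 by rewrite k0.
    by rewrite row_rowsub row_flag_mx; exact: (flag_mx_wall s_adjacent st j0).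
  have E1 : corner_chart_fun (flip (t ord0) v) (x *m face_mx k *m flag_mx center t) =
      corner_chart_fun v (x *m face_mx k *m flag_mx center t).
    apply/rowP => i; rewrite !mxE; congr (fht _ (proj _)); apply: eq_reflect => j.
    rewrite ht_hom diff_flip; case: (t ord0 =P j) => [<-|_ _]; last by rewrite addbF.
    by rewrite Wx.2 eqxx.
  have E2 : x *m face_mx k *m flag_mx (corner_row (flip (t ord0) v)) t =
      x *m face_mx k *m flag_mx (corner_row v) t.
    rewrite -!mulmxA !mul_face_mx; congr (_ *m _); apply/row_matrixP => j.
    rewrite !row_rowsub !row_flag_mx; apply: corner_row_flip => //.
    by apply: mem_prefix; rewrite k0.
  by rewrite /straighten E1 E2.
have km : (k.-1 < m)%N.
  have := ltn_ord k; have : k != m.+1 :> nat by apply: contraNneq kmax => e; apply/eqP/val_inj.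
  have : k != 0%N :> nat := k0; lia.
apply: supported_eq0; apply: (corner_sum_swap (i := Ordinal km) (Z := fun v t =>
  prism_chain (fun x a => straighten v t (x *m face_mx k) a))) => v t.
apply: eq_prism_chain => x a xs a01.
have E r : rowsub (lift k) (flag_mx r (swap (Ordinal km) t)) = rowsub (lift k) (flag_mx r t) :> 'M[R]_(_, m.+1).
  apply: eq_flag_face => j jk _; apply: prefix_swap => /=; have : k != 0%N :> nat := k0.
  by move: jk; lia.
by rewrite /straighten -!mulmxA !mul_face_mx !E.
Qed.

Lemma sgn_flips S v : sgn (flips S v) = sgn v (+) odd #|S|.
Proof.
rewrite /flips cardE; elim: (enum S) => [|i l IH] /=; first by rewrite addbF.
by rewrite sgn_flip IH addbN.
Qed.

(** Crossing the walls in [T0] reaches one cell for each pattern of signs of the coordinates, that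
    is for each orthant. *)
Lemma sum_corner_cells (W : zmodType) (G : bool -> seq bool -> W) :
  \sum_(v | near T0 v0 v) G (sgn v) [seq t0 k \in diff v0 v | k <- enum 'I_m.+1] =
  \sum_(b : m.+1.-tuple bool) G (sgn v0 (+) odd (count id b)) b.
Proof.
pose g (b : m.+1.-tuple bool) : cell V := flips (t0 @: [set k | tnth b k])%SET v0.
pose g' v : m.+1.-tuple bool := [tuple t0 k \in diff v0 v | k < m.+1].
have t0i := inj_of_weight s_t0.
have gd b k : (t0 k \in diff v0 (g b)) = tnth b k by rewrite diff_flips mem_imset // inE.
have gn b : near T0 v0 (g b).
  apply/nearP; exists (t0 @: [set k | tnth b k])%SET => //.
  by apply/fintype.subsetP => _ /imsetP[k _ ->]; exact: mem_corner.
rewrite (reindex_onto g g') /= => [|v /andP[dT /eqP vE]]; last first.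
  rewrite /g [RHS]vE; congr flips; apply/finset.setP => i; apply/imsetP/idP => [[k]|id].
    by rewrite inE tnth_mktuple => + ->.
  have /imsetP[k _ ik] := fintype.subsetP dT _ id.
  by exists k => //; rewrite inE tnth_mktuple -ik.
apply: eq_big => [b|b _].
  rewrite gn /=; apply/eqP/eq_from_tnth => k; rewrite tnth_mktuple; exact: gd.
congr G; last by rewrite (eq_map (gd b)) map_tnth_enum.
rewrite sgn_flips card_imset // cardsE cardE /enum_mem size_filter -enumT.
by rewrite -{2}(map_tnth_enum b) count_map.
Qed.

Lemma sum_flip_corner k (c : int) (K : choiceType) (Z : cell V -> {freeg K}) :
  (forall v, near T0 v0 v -> Z (flip (t0 k) v) = Z v) ->
  \sum_v (if near T0 v0 v then Z v else 0) *~ ((-1) ^+ sgn v * c) = 0.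
Proof.
move=> ZE; apply: freeg_opp_eq0; rewrite {1}(reindex_inj (inv_inj (flipK (t0 k)))) /= -sumrN.
apply: eq_bigr => v _; rewrite near_flip ?mem_corner // sgn_flip signrN mulNr mulrNz.
by case: ifP => [/ZE ->|].
Qed.

Lemma straighten1 v t : << level_simplex (straighten v t) 1 >> =
  realize id << flag_mx (corner_row v) t >> :> chain R m.+1 E.
Proof.
apply: level_realize => x.
by rewrite /straighten subrr scale0r add0r scale1r.
Qed.

(** The straightened flag misses some axis [k], so crossing the facet [t0 k] leaves the simplex
    unchanged while it reverses the sign of the cell. *)
Lemma straighten_other t : corner_weight t != 0 -> t != t0 ->
  \sum_v (if near T0 v0 v then << level_simplex (straighten v t) 1 >> else 0)
    *~ ((-1) ^+ sgn v * corner_weight t) = 0 :> chain R m.+1 E.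
Proof.
rewrite /corner_weight; case: ifP => [ft st tt0|_]; last by rewrite eqxx.
have [k kt] := full_other st ft tt0.
apply: (@sum_flip_corner k (s t) _ (fun v => << level_simplex (straighten v t) 1 >>)) => v nv.
apply: etrans (straighten1 _ _) (etrans _ (esym (straighten1 _ _))).
suff -> : flag_mx (corner_row (flip (t0 k) v)) t = flag_mx (corner_row v) t by [].
apply/row_matrixP => j; rewrite !row_flag_mx; apply/rowP => i; rewrite !mxE diff_flip.
case: (i =P missing (prefix t j) :> nat) => [e|//].
case: (t0 k =P t0 i) => [/(inj_of_weight s_t0) ki|]; last by rewrite addbF.
by have := kt j; rewrite -e ki eqxx.
Qed.

Lemma flag_mx_corner_row v : flag_mx (corner_row v) t0 =
  signed_mx m.+1 0 0 [seq t0 k \in diff v0 v | k <- enum 'I_m.+1].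
Proof.
apply/row_matrixP => j.
by rewrite row_flag_mx rowK corner_row_t0 add0n.
Qed.

Lemma straighten_end : \sum_p << level_simplex (straighten p.1 p.2) 1 >> *~ corner_eps p =
  realize id (cross m.+1 0 0) *~ ((-1) ^+ sgn v0 * s t0) :> chain R m.+1 E.
Proof.
rewrite (sum_corner_eps (fun v t => << level_simplex (straighten v t) 1 >>)).
set C := (X in _ = X); rewrite exchange_big (bigD1 t0) //= [X in _ + X]big1 ?addr0 => [|t tt0]; last first.
  have [->|ct] := eqVneq (corner_weight t) 0; first by rewrite big1 // => v _; rewrite mulr0 mulr0z.
  exact: straighten_other ct tt0.
have ct0 : corner_weight t0 = s t0 by rewrite /corner_weight /full eqxx.
rewrite /C; pose G (a : bool) (b : seq bool) : chain R m.+1 E :=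
  realize id << signed_mx m.+1 0 0 b >> *~ ((-1) ^+ a * s t0).
transitivity (\sum_(v | near T0 v0 v) G (sgn v) [seq t0 k \in diff v0 v | k <- enum 'I_m.+1]).
  rewrite [RHS]big_mkcond; apply: eq_bigr => v _; rewrite ct0.
  case: ifP => _; last by rewrite mul0rz.
  by rewrite straighten1 flag_mx_corner_row.
rewrite sum_corner_cells (cross_sum m.+1 0 0) (raddf_sum (@realize R m.+1 m.+1 E id)) [RHS]mulrz_suml.
apply: eq_bigr => b _; rewrite (raddfMz (@realize R m.+1 m.+1 E id)) -[RHS]mulrzA /G.
congr (_ *~ _).
by rewrite signr_addb signr_odd mulrAC mulrC mulrA.
Qed.

Lemma straighten_null : null [set~ 0 : E] (realize id (cross m.+1 0 0) *~ ((-1) ^+ sgn v0 * s t0) -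
  \sum_p << level_simplex (straighten p.1 p.2) 0 >> *~ corner_eps p).
Proof.
rewrite -straighten_end; apply: homotopy_sum_null => [p ep|k]; last exact: straighten_face.
by apply: straighten_continuous; have [] := corner_eps_neq0 ep.
Qed.

End Corner.

Section AffineChart.
Context {R : realType} {n : nat} {M : topologicalType}.
Variables (c : chart R n M) (A : 'M[R]_n) (b : 'rV[R]_n).
Hypothesis A_unit : A \in unitmx.
Local Notation E := 'rV[R]_n.

(** The form [b - x A] is that of the distances [h - dot (normal i) x], with the normals as columns
    of [A]. *)
Definition affine_chart_fun (p : M) : E := b - chart_fun c p *m A.

Definition affine_chart_inv (y : E) : M := chart_inv c ((b - y) *m invmx A).

Lemma affine_chart_back_continuous : continuous (fun y : E => (b - y) *m invmx A).
Proof.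
move=> y; apply: (@cvg_mulmxr _ _ (nbhs y)); apply: (@cvgB _ _ _ (nbhs y)); first exact: cvg_cst.
exact: cvg_id.
Qed.

Definition affine_chart : chart R n M.
Proof.
refine (@Chart R n M (chart_dom c) [set y | chart_cod c ((b - y) *m invmx A)]
  affine_chart_fun affine_chart_inv _ _ _ _ _ _ _ _).
- exact: chart_dom_open.
- by apply: (open_comp _ (@chart_cod_open _ _ _ c)) => y _; exact: affine_chart_back_continuous.
- by move=> p dp /=; rewrite /affine_chart_fun opprB addrC subrK mulmxK //; exact: chart_funS.
- by move=> y cy; exact: chart_invS.
- move=> p dp; rewrite /affine_chart_inv /affine_chart_fun opprB addrC subrK mulmxK //.
  exact: chart_funK.
- move=> y cy; rewrite /affine_chart_inv /affine_chart_fun chart_invK // mulmxKV //.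
  by rewrite opprB addrC subrK.
- move=> p dp; apply: (@cvgB _ _ _ (nbhs p)); first exact: cvg_cst.
  by apply: (@cvg_mulmxr _ _ (nbhs p)); exact: chart_fun_cts.
move=> y cy; apply: (cvg_comp _ _ (@affine_chart_back_continuous y)).
exact: chart_inv_cts.
Defined.

End AffineChart.

(** * The flag cycle as a generator at a corner *)

Section CornerGenerator.
Context {R : realType} {m : nat} {P : polytope R m.+1}.
Variable V : mirrors P.
Local Notation F := (facet P).
Local Notation h := (height P).
Local Notation T := {ffun 'I_m.+1 -> F}.
Local Notation E := 'rV[R]_m.+1.
Implicit Types (t : T) (S : {set F}) (i : F) (v : cell V).

Variable s : T -> int.
Hypothesis s_adjacent : forall t, s t != 0 -> forall a b, a != b -> adjacent (t a) (t b).
Hypothesis s_swap : forall (a : 'I_m) t, s (swap a t) = - s t.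
Hypothesis s_last : forall t, \sum_x s (set_last x t) = 0.
Variables (t0 : T) (v0 : cell V).
Hypothesis s_t0 : s t0 * s t0 = 1.

Local Notation T0 := (corner_facets t0).
Local Notation eps := (@corner_eps R m P V s t0 v0).

Let s_t0_neq0 : s t0 != 0.
Proof. by apply: contra_eq_neq s_t0 => ->; rewrite mul0r. Qed.

Let T0_clique : clique T0.
Proof. exact: (@corner_clique _ _ _ _ s_adjacent _ s_t0_neq0). Qed.

Definition corner_normals : 'M[R]_m.+1 := \matrix_k normal (t0 k).

(** The Gram matrix of the corner normals is [(1 - h^2)] times the identity plus [h^2] times the
    matrix of ones. On a vector of its kernel the rows first give coordinate sum 0, and then 0. *)
Lemma corner_normals_unit : corner_normals^T \in unitmx.
Proof.
rewrite unitmx_tr -row_free_unit; apply: inj_row_free => u uN.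
have t0i := inj_of_weight s_adjacent s_t0_neq0.
have D (i : 'I_m.+1) : dot (normal (t0 i)) (u *m corner_normals) =
    (1 - h ^+ 2) * u 0 i + h ^+ 2 * \sum_k u 0 k.
  rewrite dot_mulmx (bigD1 i) //= rowK normal_unit.
  rewrite (eq_bigr (fun k => h ^+ 2 * u 0 k)) => [|k ki]; last first.
    by rewrite rowK normal_adjacent 1?mulrC //; apply: s_adjacent => //; rewrite eq_sym.
  by rewrite -mulr_sumr [in RHS](bigD1 i) //=; ring.
have H1 : h ^+ 2 < 1 := height_lt1 P.
have H0 : 0 < h ^+ 2 by rewrite exprn_gt0 ?height_gt0.
have D0 (i : 'I_m.+1) : (1 - h ^+ 2) * u 0 i + h ^+ 2 * \sum_k u 0 k = 0.
  by rewrite -D uN /dot trmx0 mulmx0 mxE.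
have S0 : \sum_k u 0 k = 0.
  have : \sum_(i < m.+1) ((1 - h ^+ 2) * u 0 i + h ^+ 2 * \sum_k u 0 k) = 0 by rewrite big1.
  rewrite big_split /= -mulr_sumr sumr_const card_ord -mulr_natr.
  set S := \sum_k _ => H; have : S * (1 - h ^+ 2 + h ^+ 2 * m.+1%:R) = 0 by rewrite -[RHS]H; ring.
  move=> /eqP; rewrite mulf_eq0 => /orP[/eqP //|]; rewrite gt_eqF //.
  by apply: addr_gt0; rewrite ?subr_gt0 // mulr_gt0 ?ltr0n.
apply/rowP => i; have := D0 i; rewrite S0 mulr0 addr0 mxE => /eqP.
by rewrite mulf_eq0 gt_eqF ?subr_gt0 //= => /eqP.
Qed.

Definition corner_chart : chart R m.+1 (glued V) :=
  affine_chart (star_chart v0 T0_clique) (const_mx h) corner_normals_unit.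

Definition corner_point : glued V := glue (center T0) v0.

Lemma corner_chart_glue v y : body P y -> star T0 v0 (glue y v) ->
  chart_fun corner_chart (glue y v) = corner_chart_fun t0 v0 v y.
Proof.
move=> By sy; rewrite /= /affine_chart_fun /= (unfold_glue By sy); apply/rowP => k.
rewrite !mxE /fht dotE; congr (_ - _); apply: eq_bigr => i _.
by rewrite !mxE mulrC.
Qed.

Lemma star_corner : star T0 v0 corner_point.
Proof.
apply/star_glue => //; first exact: body_center.
by split=> [|i iT]; [exact: near_refl|exact: fht_center_out].
Qed.

Lemma corner_chart_point : chart_fun corner_chart corner_point = 0.
Proof.
have Bc := body_center T0_clique.
rewrite corner_chart_glue //; last exact: star_corner.
apply/rowP => k; rewrite (corner_chart_funE s_adjacent s_t0_neq0) ?near_refl // mxE.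
by rewrite fht_center_in ?mulr0 //; exact: mem_corner.
Qed.

Lemma corner_chart_inv0 : chart_inv corner_chart 0 = corner_point.
Proof. by rewrite -corner_chart_point chart_funK //; exact: star_corner. Qed.

Definition corner_region : set E := [set x | body P x /\ forall i, i \notin T0 -> 0 < fht i x].

Lemma convex_corner_region : convex_hull_closed corner_region.
Proof.
move=> k x w xs wQ; have B : body P (x *m w) by apply: body_convex => // j; have [] := wQ j.
split=> // i iT; rewrite fht_convex //; have [j xj] := simplex_pos xs; have [x0 _] := xs.
rewrite (bigD1 j) //=; apply: ltr_pwDl; first by rewrite mulr_gt0 //; have [_ ->] := wQ j.
by apply: sumr_ge0 => l _; rewrite mulr_ge0 //; have [Bw _] := wQ l; exact: Bw.
Qed.

Lemma flag_mx_corner_region t : s t != 0 -> full t0 t -> rows_in corner_region (flag_mx center t).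
Proof.
move=> st /eqP tT j; rewrite row_flag_mx; split.
  exact: (body_center (clique_prefix s_adjacent st)).
move=> i iT; apply: fht_center_out; apply: contra iT; rewrite -tT.
by apply: (fintype.subsetP (prefix_le _ _)); rewrite -ltnS ltn_ord.
Qed.

Lemma flag_chain_star v t : near T0 v0 v -> s t != 0 -> full t0 t ->
  chain_in (star T0 v0) (flag_chain v t).
Proof.
move=> nv st ft; apply: (chain_in_realize (Q := corner_region)).
- exact: convex_corner_region.
- by move=> x [Bx xT]; apply/star_glue.
by apply: supportedU; exact: flag_mx_corner_region.
Qed.

(** A point with positive weight at vertex [j] is off every facet outside [prefix t j]. A simplex
    through the corner point must therefore contain all corner facets in its flag, and its cell must
    be near [v0]. *)
Lemma flag_chain_avoids v t : s t != 0 -> eps (v, t) = 0 ->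
  chain_in [set~ corner_point] (flag_chain v t).
Proof.
move=> st e0; have ns : ~ (near T0 v0 v /\ full t0 t).
  move=> [nv ft]; move: e0; rewrite /corner_eps /corner_weight /= nv ft => /eqP.
  by rewrite mulf_eq0 signr_eq0 (negPf st).
rewrite /flag_chain realizeU; apply: supportedU => _ [x _ <-]; rewrite mksimplexE; last first.
  exact: (affine_simplex_continuous (@body_convex _ _ P) (@glue_continuous _ _ _ V v)
    (flag_mx_body s_adjacent st)).
rewrite /=; set y := set_val x *m _ => e; apply: ns.
have xs := set_valP x.
have By : body P y by apply: body_convex => //; exact: (flag_mx_body s_adjacent st).
have yc : y = center T0 by rewrite -(pos_glue v By) e pos_glue //; exact: body_center.
have FE i : i \in T0 -> fht i y = 0 by move=> iT; rewrite yc fht_center_in.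
split.
  have : near (facets_at P y) v v0 by apply/(glue_eq _ _ By); rewrite e yc.
  move=> /(near_sym (body_clique By)); apply: near_sub; apply/fintype.subsetP => i.
  rewrite inE yc; apply: contraTT => iT.
  by rewrite gt_eqF // fht_center_out.
have [j xj] := simplex_pos xs; have [x0 _] := xs.
have sub : T0 \subset prefix t m.+1.
  apply/fintype.subsetP => i /FE; apply: contra_eqT => it; rewrite gt_eqF //.
  rewrite /y fht_convex // (bigD1 j) //=; apply: ltr_pwDl.
    rewrite mulr_gt0 // row_flag_mx fht_center_out //; apply: contra it.
    by apply: (fintype.subsetP (prefix_le _ _)); rewrite -ltnS ltn_ord.
  apply: sumr_ge0 => l _; rewrite mulr_ge0 // row_flag_mx.
  exact: (body_center (clique_prefix s_adjacent st)).
rewrite /full eq_sym eqEcard sub.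
by rewrite /corner_facets (card_prefix s_adjacent st) (card_prefix s_adjacent s_t0_neq0) leqnn.
Qed.

Definition corner_cycle : chain R m.+1 (glued V) := \sum_p flag_chain p.1 p.2 *~ eps p.

Lemma flag_cycle_corner : chain_in [set~ corner_point] (corner_cycle - flag_cycle V s).
Proof.
rewrite /flag_cycle (pair_big xpredT xpredT (fun v t => flag_chain v t *~ ((-1) ^+ sgn v * s t))) /=.
rewrite -sumrB; apply: supported_sum => -[v t] _; rewrite -mulrzBr /=.
have [s0|st] := eqVneq (s t) 0.
  have [->|/corner_eps_neq0[_ _]] := eqVneq (eps (v, t)) 0; last by rewrite /= s0 eqxx.
  by rewrite s0 mulr0 subrr mulr0z; exact: supported0.
have [e0|e0] := eqVneq (eps (v, t)) 0.
  by apply: chain_inMz; exact: flag_chain_avoids.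
have [/= nv ft _] := corner_eps_neq0 e0.
rewrite /corner_eps /corner_weight /= nv ft subrr mulr0z.
exact: supported0.
Qed.

Lemma corner_cycle_star : chain_in (star T0 v0) corner_cycle.
Proof.
apply: supported_sum => -[v t] _; have [->|e0] := eqVneq (eps (v, t)) 0.
  by rewrite mulr0z; exact: supported0.
by apply: chain_inMz; have [nv ft st] := corner_eps_neq0 e0; exact: flag_chain_star.
Qed.

Lemma push_flag_chain v t : near T0 v0 v -> s t != 0 -> full t0 t ->
  push (chart_fun corner_chart) (flag_chain v t) =
  << level_simplex (straighten t0 v0 v t) 0 >> :> chain R m.+1 E.
Proof.
move=> nv st ft; apply: push_realize => [|x].
  exact: (affine_simplex_continuous (@body_convex _ _ P) (@glue_continuous _ _ _ V v)
    (flag_mx_body s_adjacent st)).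
have [Bx xT] : corner_region (set_val x *m flag_mx center t).
  by apply: convex_corner_region; [exact: set_valP|exact: flag_mx_corner_region].
have sx : star T0 v0 (glue (set_val x *m flag_mx center t) v) by apply/star_glue.
apply: etrans (corner_chart_glue Bx sx) _.
by rewrite /straighten subr0 scale1r scale0r addr0.
Qed.

Lemma push_corner_cycle : push (chart_fun corner_chart) corner_cycle =
  \sum_p << level_simplex (straighten t0 v0 p.1 p.2) 0 >> *~ eps p :> chain R m.+1 E.
Proof.
rewrite /corner_cycle raddf_sum; apply: eq_bigr => -[v t] _.
have [->|e0] := eqVneq (eps (v, t)) 0; first by rewrite !mulr0z raddf0.
have [nv ft st] := corner_eps_neq0 e0.
by rewrite raddfMz -push_flag_chain.
Qed.

Let u : int := (-1) ^+ sgn v0 * s t0.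

Let uu : u * u = 1.
Proof. by rewrite /u mulrACA s_t0 mulr1 -expr2 sqrr_sign. Qed.

(** Modulo the complement of the corner point only [corner_cycle] remains of the flag cycle. In the
    chart it is homologous to the fan over the cross-polytope up to sign, and excision carries the
    generation statement back. *)
Lemma corner_generator : homology_generator [set~ corner_point] (flag_cycle V s).
Proof.
split; first by rewrite /rel_cycle boundary_flag_cycle //; exact: supported0.
have K_compact : compact [set corner_point] by exact: compact_set1.
have K_dom : [set corner_point] `<=` chart_dom corner_chart by move=> _ ->; exact: star_corner.
move=> c cc; have [a [ad ac ca]] := chart_excise (@glued_hausdorff _ _ _ V) K_compact K_dom cc.
set phi := chart_fun corner_chart.
have pad : chain_in (chart_cod corner_chart) (push phi a) by exact: chart_push_in.
have pac : rel_cycle (~` plane 0 m.+1) (push phi a).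
  rewrite /rel_cycle (boundary_push (U := chart_dom corner_chart) (@chart_fun_cts _ _ _ corner_chart) ad).
  apply: (chain_in_push (U := chart_dom corner_chart `&` [set~ corner_point])).
    move=> x [xd xp]; rewrite plane_full => e; apply: xp.
    have := chart_funK (c := corner_chart) xd.
    by rewrite -/phi (e : phi x = 0) corner_chart_inv0 => <-.
  by apply: chain_in_setI; [exact: chain_in_boundaryS|exact: ac].
have [j] := cross_generates (leqnn _) 0 pac; rewrite plane_full => jc.
(* [u] is the sign relating the flag cycle to the fan; since it is its own inverse, multiplying the
   multiplicity found for the fan by [u] converts it. *)
exists (j * u); rewrite /homologous.
have N1 : null [set~ 0 : E] (push phi (a - corner_cycle *~ (j * u))).
  have := nullD jc (nullMz (j * u) (straighten_null s_adjacent s_swap v0 s_t0_neq0)).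
  rewrite -push_corner_cycle mulrzBl -[_ *~ _ *~ (j * u)]mulrzA -/u mulrCA mulrA -mulrA uu mulr1.
  rewrite (raddfB (push phi)) (raddfMz (push phi)).
  by rewrite addrA subrK.
have N2 : null [set~ corner_point] (a - corner_cycle *~ (j * u)).
  have K0 : [set (0 : E)] `<=` chart_cod corner_chart.
    by move=> _ ->; rewrite -corner_chart_point; apply: chart_funS; exact: star_corner.
  have ain : chain_in (chart_dom corner_chart) (a - corner_cycle *~ (j * u)).
    by apply: chain_inB => //; apply: chain_inMz; exact: corner_cycle_star.
  have := chart_pull_null (@compact_set1 _ (0 : E)) K0 (chart_push_in ain) N1.
  by rewrite chart_pushK // image_set1 corner_chart_inv0.
have N3 := nullMz (j * u) (null_in flag_cycle_corner).
have := nullD (nullD ca N2) N3.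
by rewrite addrA subrK mulrzBl addrA subrK.
Qed.

End CornerGenerator.

(** * From one corner to all points *)

Section Transport.
Context {R : realType} {m : nat} {P : polytope R m.+1}.
Variable V : mirrors P.
Local Notation F := (facet P).
Local Notation E := 'rV[R]_m.+1.
Implicit Types (x y : E) (v : cell V) (i : F) (a : R).

Lemma unfold_self T v y : body P y -> star T v (glue y v) -> unfold_pt v (glue y v) = y.
Proof.
move=> By sy; rewrite (unfold_glue By sy).
have -> : diff v v = finset.set0 by apply/finset.setP => i; rewrite !inE eqxx.
rewrite /reflect_in /push_poles big1 ?scaler0 ?addr0 => [|i _]; last by rewrite inE mulr0n scale0r.
by rewrite proj_hom.
Qed.

Lemma fht_scale a x i : fht i (a *: x) = (1 - a) * height P + a * fht i x.
Proof. by rewrite /fht dotZr; ring. Qed.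

Definition radius x : set E := [set a *: x | a in `[0, 1]].

Lemma radius_compact x : compact (radius x).
Proof.
apply: continuous_compact; last exact: segment_compact.
apply: continuous_subspaceT => a; apply: (@cvgZ _ _ _ (nbhs a)); first exact: cvg_id.
exact: cvg_cst.
Qed.

Lemma radius_convex x : convex_set2 (radius x).
Proof.
move=> _ [a /= + <-] _ t [b /= + <-] /andP[t0 t1]; rewrite !in_itv /= => /andP[a0 a1] /andP[b0 b1].
exists (a + t * (b - a)); last by apply/rowP => k; rewrite !mxE; ring.
by rewrite /= in_itv /=; nra.
Qed.

(** Along the segment from the centre to [x] the distances to the facets interpolate between the
    positive height and those at [x], so only facets through [x] are ever met. The whole segment
    lies in one star chart, where it is compact and convex. *)
Lemma local_generator_radial (Z : chain R m.+1 (glued V)) x y v : body P x ->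
  radius x y -> boundary Z = 0 -> forall y', radius x y' ->
  local_generator Z (glue y v) -> local_generator Z (glue y' v).
Proof.
move=> Bx yK Z0 y' y'K; have cT := body_clique Bx.
pose T := facets_at P x; pose c := star_chart v cT.
have rB z : radius x z -> body P z /\ forall i, i \notin T -> 0 < fht i z.
  move=> [a /= + <-]; rewrite in_itv /= => /andP[a0 a1]; have h0 := height_gt0 P.
  split=> i; first by rewrite fht_scale; have := Bx i; nra.
  rewrite inE => xi; have xi0 : 0 < fht i x by rewrite lt_neqAle eq_sym xi Bx.
  by rewrite fht_scale; have [->|ne] := eqVneq a 1; [lra|nra].
have rS z : radius x z -> star T v (glue z v).
  by move=> /rB[Bz zT]; apply/star_glue => //; split=> //; exact: near_refl.
have inv z : radius x z -> chart_inv c z = glue z v.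
  move=> zK; have [Bz _] := rB _ zK.
  rewrite -{1}(unfold_self Bz (rS _ zK)).
  exact: (chart_funK (c := c) (rS _ zK)).
have cod : radius x `<=` chart_cod c.
  move=> z zK; have [Bz _] := rB _ zK; rewrite -(unfold_self Bz (rS _ zK)).
  exact: (chart_funS (c := c) (rS _ zK)).
rewrite -(inv _ yK) -(inv _ y'K).
exact: (local_generator_transport (@glued_hausdorff _ _ _ V) (@radius_compact x) cod
  (@radius_convex x) yK y'K Z0).
Qed.

Variable s : {ffun 'I_m.+1 -> F} -> int.
Hypothesis s_adjacent : forall t, s t != 0 ->
  forall a b : 'I_m.+1, a != b -> adjacent (t a) (t b).
Hypothesis s_swap : forall (a : 'I_m) t, s (swap a t) = - s t.
Hypothesis s_last : forall t, \sum_x s (set_last x t) = 0.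
Variable t0 : {ffun 'I_m.+1 -> F}.
Hypothesis s_t0 : s t0 * s t0 = 1.

(** Every cell has its own copy of the corner [t0]. Two segments, from this corner to the centre and
    from the centre to the point, stay in that cell, so no transport across walls is required. *)
Lemma flag_cycle_generator p : homology_generator [set~ p] (flag_cycle V s).
Proof.
have Z0 := boundary_flag_cycle V s_adjacent s_swap s_last.
have r0 y : radius y 0 by exists 0; rewrite ?scale0r //= in_itv /= lexx ler01.
have r1 y : radius y y by exists 1; rewrite ?scale1r //= in_itv /= lexx ler01.
have [x [v [Bx ->]]] := gluedP p.
have s0 : s t0 != 0 by apply: contra_eq_neq s_t0 => ->; rewrite mul0r.
have Bc : body P (center (corner_facets t0)) by exact/body_center/(corner_clique s_adjacent s0).
have G := corner_generator s_adjacent s_swap s_last v s_t0.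
have G0 := local_generator_radial Bc (r1 _) Z0 (r0 _) G.
exact: (local_generator_radial Bx (r0 _) Z0 (r1 _) G0).
Qed.

Definition flag_orientation : orientation R m.+1 (glued V).
Proof.
refine (@Orientation R m.+1 (glued V) (fun=> flag_cycle V s) flag_cycle_generator _) => p.
exists setT, (flag_cycle V s); split=> [||q _].
- exact: filterT.
- by rewrite /rel_cycle boundary_flag_cycle //; exact: supported0.
by apply: null_in; rewrite subrr; exact: supported0.
Defined.

Lemma flag_cycle_fundamental : fundamental_cycle flag_orientation (flag_cycle V s).
Proof.
split=> [|p]; first exact: boundary_flag_cycle.
by apply: null_in; rewrite subrr; exact: supported0.
Qed.

End Transport.

(** * The coloured 120-cell *)

Lemma neighbours_check : all (fun i => neighbours i == [seq j <- facets | gadj i j]) facets.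
Proof. by vm_cast_no_check (erefl true). Qed.

(** The only flag of adjacent facets with the colours of a complete flag; the uniqueness is a
    property for which the colouring was searched. *)
Definition base_flag : seq nat := [:: 45; 38; 1; 44]%N.

Definition flag_colours (i j : nat) : bool :=
  all (fun k => (k \in colours i) == (k <= j)%N) (iota 0 5).

(** Uniqueness makes the sum over the coloured flags a single orientation sign, hence nonzero.
    Filtering by colour first leaves few quadruples to test. *)
Lemma flag_unique : all (fun i => all (fun j => all (fun k => all (fun l =>
    (gorient i j k l == 0) || ([:: i; j; k; l] == base_flag))
    [seq l <- facets | flag_colours l 3%N]) [seq k <- facets | flag_colours k 2%N])
    [seq j <- facets | flag_colours j 1%N]) [seq i <- facets | flag_colours i 0%N].
Proof. by vm_cast_no_check (erefl true). Qed.

Lemma base_flag_colours : all (fun j => flag_colours (nth 0%N base_flag j) j) (iota 0 4).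
Proof. by vm_cast_no_check (erefl true). Qed.

Lemma base_flag_orient : gorient 45 38 1 44 = -1.
Proof. by vm_cast_no_check (erefl (-1 : int)). Qed.

Lemma foldr_addE (V : nmodType) (f : nat -> V) (l : seq nat) :
  foldr (fun x a => f x + a) 0 l = \sum_(x <- l) f x.
Proof. by elim: l => [|x l IH]; rewrite ?big_nil // big_cons /= IH. Qed.

Section Coloured120.
Local Notation F := 'I_120.
Implicit Types i j k l : F.

Lemma gorient_non_clique (i j k l : nat) :
  ~~ [&& gadj i j, gadj i k, gadj i l, gadj j k, gadj j l & gadj k l] -> gorient i j k l = 0.
Proof. by rewrite /gorient => /negbTE ->. Qed.

Lemma gorient_clique i j k l : gadj i j -> gadj i k -> gadj i l -> gadj j k -> gadj j l -> gadj k l ->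
  [/\ gorient j i k l = - gorient i j k l, gorient i k j l = - gorient i j k l &
      gorient i j l k = - gorient i j k l].
Proof.
move=> ij ik il jk jl kl; have /allP /(_ (i : nat) (facet_mem i)) /allP := gorient_check.
have kJ : (k : nat) \in [seq x <- neighbours i | gadj j x] by rewrite mem_filter jk; exact: ik.
have lK : (l : nat) \in [seq y <- [seq x <- neighbours i | gadj j x] | gadj k y].
  by rewrite !mem_filter kl jl; exact: il.
move=> /(_ (j : nat) ij) /allP /(_ _ kJ) /andP[_] /allP /(_ _ lK) /and3P[/eqP h1 /eqP h2 /eqP h3].
have sym (a b : F) : gadj a b -> gadj b a by move=> ab; apply: etrans (gadj_symmetric b a) ab.
by rewrite /gorient ij ik il jk jl kl !(sym i j, sym j k, sym k l) // h1 h2 h3.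
Qed.

Lemma gorient_swap i j k l :
  [/\ gorient j i k l = - gorient i j k l, gorient i k j l = - gorient i j k l &
      gorient i j l k = - gorient i j k l].
Proof.
have [/and4P[ij ik il /and3P[jk jl kl]]|nc] :=
  boolP [&& gadj i j, gadj i k, gadj i l, gadj j k, gadj j l & gadj k l]; first exact: gorient_clique.
rewrite (gorient_non_clique nc) oppr0; split; apply: gorient_non_clique; apply: contra nc;
  rewrite ?(gadj_symmetric j i) ?(gadj_symmetric k j) ?(gadj_symmetric l k);
  by move=> /and4P[-> -> -> /and3P[-> -> ->]].
Qed.

Lemma sum_gorient i j k : \sum_(l < 120) gorient i j k l = 0.
Proof.
have [/and3P[ij ik jk]|nc] := boolP [&& gadj i j, gadj i k & gadj j k]; last first.
  apply: big1 => l _; apply: gorient_non_clique; apply: contra nc.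
  by move=> /and4P[-> -> _ /and3P[-> _ _]].
have /allP /(_ (i : nat) (facet_mem i)) /allP := gorient_check.
have kJ : (k : nat) \in [seq x <- neighbours i | gadj j x] by rewrite mem_filter jk; exact: ik.
move=> /(_ (j : nat) ij) /allP /(_ _ kJ) /andP[/eqP + _].
have /allP /(_ (i : nat) (facet_mem i)) /eqP -> := neighbours_check.
rewrite foldr_addE !(big_filter, big_filter_cond) => H; rewrite -[RHS]H [RHS]big_mkcond /=.
rewrite -(big_mkord xpredT (fun l : nat => gorient i j k l)) /index_iota subn0 -/facets.
apply: eq_bigr => l _; case: ifP => [/and3P[il jl kl]|nc].
  by rewrite /gorient ij ik jk il jl kl.
apply: gorient_non_clique.
apply: contraFN nc.
by move=> /and4P[_ _ -> /and3P[_ -> ->]].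
Qed.

Definition weight120 (t : {ffun 'I_4 -> F}) : int :=
  gorient (t (inord 0)) (t (inord 1)) (t (inord 2)) (t (inord 3)).

Lemma weight120_adjacent t : weight120 t != 0 -> forall a b : 'I_4, a != b -> gadj (t a) (t b).
Proof.
move=> tn a b; rewrite -{2}[a]inord_val -{2}[b]inord_val -(inj_eq val_inj) /=.
have : [&& gadj (t (inord 0)) (t (inord 1)), gadj (t (inord 0)) (t (inord 2)),
    gadj (t (inord 0)) (t (inord 3)), gadj (t (inord 1)) (t (inord 2)),
    gadj (t (inord 1)) (t (inord 3)) & gadj (t (inord 2)) (t (inord 3))].
  by apply: contraNT tn => /gorient_non_clique E; apply/eqP.
move=> /and4P[h01 h02 h03 /and3P[h12 h13 h23]].
have sym i j : gadj i j -> gadj j i by move=> ij; apply: etrans (gadj_symmetric j i) ij.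
by case: a b => [[|[|[|[|//]]]] pa] [[|[|[|[|//]]]] pb] //= _; apply: sym.
Qed.

Lemma weight120_swap (a : 'I_3) t : weight120 (swap a t) = - weight120 t.
Proof.
rewrite /weight120 /swap !ffunE.
have [h1 h2 h3] := gorient_swap (t (inord 0)) (t (inord 1)) (t (inord 2)) (t (inord 3)).
have E (b : 'I_4) : tperm (widen_ord (leqnSn 3) a) (lift ord0 a) b =
    inord (if b == a :> nat then a.+1 else if b == a.+1 :> nat then a : nat else b : nat).
  apply: val_inj; rewrite /= inordK; last by case: (b) (a) => [[|[|[|[|//]]]] ?] [[|[|[|//]]] ?].
  by case: tpermP => [->|->|/eqP + /eqP]; rewrite -?(inj_eq val_inj) /= /bump /= ?eqxx //;
    [case: eqP => //; lia|move=> /negbTE -> /negbTE ->].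
rewrite !E !inordK //.
by case: a {E} => [[|[|[|//]]] pa] /=.
Qed.

Lemma weight120_last t : \sum_x weight120 (set_last x t) = 0.
Proof.
rewrite -[RHS](sum_gorient (t (inord 0)) (t (inord 1)) (t (inord 2))); apply: eq_bigr => x _.
by rewrite /weight120 !ffunE -!(inj_eq val_inj) /= !inordK.
Qed.

Definition flag120 : {ffun 'I_4 -> F} := [ffun a : 'I_4 => inord (nth 0%N base_flag a)].

Lemma val_flag120 (a : 'I_4) : flag120 a = nth 0%N base_flag a :> nat.
Proof. by rewrite ffunE inordK //; case: a => [[|[|[|[|//]]]] pa]. Qed.

Lemma weight_flag120 : weight120 flag120 = -1.
Proof. by rewrite /weight120 !val_flag120 !inordK //=; exact: base_flag_orient. Qed.

Definition colour120 i : {set 'I_5} := [set k : 'I_5 | (k : nat) \in colours i]%SET.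

Lemma colour120_neq0 i : colour120 i != finset.set0.
Proof.
have /allP /(_ _ (facet_mem i)) /andP[/hasP[k ki k5] _] := colours_proper.
have {}k5 : k \in iota 0 5 := k5; have k5' : (k < 5)%N by move: k5; rewrite mem_iota.
by apply/set0Pn; exists (Ordinal k5'); rewrite inE.
Qed.

Lemma colour120_proper i : colour120 i != [set: 'I_5]%SET.
Proof.
have /allP /(_ _ (facet_mem i)) /andP[_] := colours_proper.
apply: contra => /eqP E; apply/allP => k; rewrite mem_iota /= => k5.
by have : Ordinal k5 \in colour120 i by [rewrite E inE]; rewrite /colour120 inE.
Qed.

Lemma colour120_comparable i j : gadj i j ->
  (colour120 i \subset colour120 j) || (colour120 j \subset colour120 i).
Proof.
move=> ij; have /allP /(_ _ (facet_mem i)) /allP /(_ _ (facet_mem j)) := colours_comparable.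
rewrite ij /= => /orP[/allP h|/allP h]; apply/orP; [left|right];
  by apply/fintype.subsetP => k; rewrite !inE; exact: h.
Qed.

Lemma flag_coloursP i (a : nat) :
  reflect (colour120 i = [set k : 'I_5 | (k <= a)%N]%SET) (flag_colours i a).
Proof.
apply: (iffP allP) => [H|/finset.setP H k].
  by apply/finset.setP => k; have := H k; rewrite mem_iota /= ltn_ord => /(_ isT) /eqP; rewrite !inE.
by rewrite mem_iota /= => k5; have := H (Ordinal k5); rewrite !inE => ->.
Qed.

Lemma sum_flags120 (t1 : {ffun 'I_4 -> F} -> bool) :
  (forall t, t1 t = [forall a : 'I_4, colour120 (t a) == [set k : 'I_5 | (k <= a)%N]%SET]) ->
  \sum_(t | t1 t) weight120 t = -1.
Proof.
move=> t1E; rewrite (bigD1 flag120) /=; last first.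
  rewrite t1E; apply/forallP => a; apply/eqP/flag_coloursP; rewrite val_flag120.
  by have /allP := base_flag_colours; apply; rewrite mem_iota /= ltn_ord.
rewrite weight_flag120 big1 ?addr0 // => t /andP[]; rewrite t1E => /forallP tf; apply: contra_neqP => tn.
have fl (a : nat) : (a < 4)%N -> (t (inord a) : nat) \in [seq i <- facets | flag_colours i a].
  move=> a4; rewrite mem_filter facet_mem andbT; apply/flag_coloursP.
  by have /eqP -> := tf (inord a); rewrite inordK.
have /allP /(_ _ (fl 0%N isT)) /allP /(_ _ (fl 1%N isT)) /allP /(_ _ (fl 2%N isT)) /allP
  /(_ _ (fl 3%N isT)) := flag_unique.
rewrite -/(weight120 t) => /orP[/eqP //|/eqP [e0 e1 e2 e3]].
apply/ffunP => a; apply: val_inj; apply: etrans (esym (val_flag120 a)); rewrite -[a in LHS]inord_val.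
by case: a => [[|[|[|[|//]]]] pa].
Qed.

End Coloured120.

Theorem corollary5p8 (R : realType) (N : topologicalType)
    (N_closed : closed_manifold R 4 N) (N_nonempty : [set: N] !=set0)
    (N_connected : connected [set: N]) (oN : orientation R 4 N) :
  exists (M : topologicalType) (oM : orientation R 4 M)
         (f : continuousType M N) (d : int),
    [/\ closed_manifold R 4 M, hyperbolic R 4 M, has_degree oM oN f d & d != 0].
Proof.
have [cN [cN0 cNp]] := fundamental_cycle_exists oN N_closed.
have [X XN] := cycle_chambers cN0.
pose P := polytope120 (R := R).
pose V : mirrors P := coloured_mirrors X (P := P) colour120_neq0 colour120_comparable.
have base_sq : weight120 flag120 * weight120 flag120 = 1 by rewrite weight_flag120.
(* The factor -1 is the orientation of the unique coloured flag; the other factor counts the cells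
   over each chamber. *)
pose d : int := (multiplicity (P := P) X)%:Z * (-1).
exists (glued V), (flag_orientation V weight120_adjacent weight120_swap weight120_last base_sq),
  (realization_map X (P := P) colour120_neq0 colour120_comparable colour120_proper), d; split.
(* [glued_manifold] takes a cell to have a base point; if there were no chambers, the glued space
   would be empty and the manifold axioms hold vacuously. *)
- have [[v]|V0] := pselect (inhabited (cell V)); first exact: glued_manifold v.
  have M0 (p : glued V) : False by have [_ [v _]] := gluedP p; apply: V0.
  split; last exact: glued_compact.
  split; [exact: glued_hausdorff| |by move=> p; case: (M0 p)].
  by exists set0; [exact: countable0|split=> [//|p]; case: (M0 p)].
- exact: glued_hyperbolic.
- exists (flag_cycle V weight120), cN; split=> //; first exact: flag_cycle_fundamental.
  have := push_flag_cycle X (P := P) colour120_neq0 colour120_comparable colour120_proper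
    weight120_adjacent weight120_swap weight120_last.
  rewrite (sum_flags120 (t1 := is_flag (P := P) colour120)) // => H.
  rewrite /homologous pushforwardE.
  have := nullD H (nullMz d XN).
  by rewrite mulrzBl addrA subrK.
rewrite /d mulrN1 oppr_eq0; have := multiplicity_gt0 (P := P) X.
by rewrite lt0n.
Qed.
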